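(* Assume the setting described in the context and let $p\in(0,\infty)$. Then there exist a real number $\eta\in[0,\infty)$ and stochastic processes $O\colon[0,T]\times\Omega\to H_\varrho$ and $\tilde{\mathcal O}^n,\mathbb O^n\colon[0,T]\times\Omega\to P_n(H)$, $n\in\mathbb N$, with continuous sample paths such that (i) for all $t\in[0,T]$ it holds that $[O_t]_{\mathbb P,\mathcal B(H)}=\int_0^te^{(t-s)A}\,dW_s$, (ii) for all $n\in\mathbb N$, $t\in[0,T]$ it holds that $[\tilde{\mathcal O}^n_t]_{\mathbb P,\mathcal B(H)}=\int_0^tP_ne^{(t-s)A}\,dW_s$, (iii) for all $n\in\mathbb N$, $t\in[0,T]$ it holds that $\mathbb O^n_t=\tilde{\mathcal O}^n_t+P_ne^{tA}\xi-\int_0^te^{(t-s)(A-\eta)}\,\eta\,(\tilde{\mathcal O}^n_s+P_ne^{sA}\xi)\,ds$, (iv) $\mathbb P\big(\limsup_{n\to\infty}\sup_{s\in[0,T]}\|(O_s+e^{sA}\xi)-(\tilde{\mathcal O}^n_s+P_ne^{sA}\xi)\|_{H_\varrho}=0\big)=1$, (v) for all $n\in\mathbb N$, $t\in[0,T]$ it holds that $$\mathbb P\Big(\mathcal X^n_t=P_ne^{tA}\xi+\int_0^tP_ne^{(t-s)A}\,\mathbf 1_{\{\|\mathcal X^n_{\lfloor s\rfloor_{h_n}}\|_{H_\varrho}+\|\tilde{\mathcal O}^n_{\lfloor s\rfloor_{h_n}}+P_ne^{\lfloor s\rfloor_{h_n}A}\xi\|_{H_\varrho}\le|h_n|^{-\chi}\}}F(\mathcal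 X^n_{\lfloor s\rfloor_{h_n}})\,ds+\tilde{\mathcal O}^n_t\Big)=1,$$ and (vi) $$\sup_{n\in\mathbb N}\mathbb E\bigg[\int_0^Te^{\int_s^Tp\,\phi(\mathbb O^n_{\lfloor u\rfloor_{h_n}})\,du}\max\Big\{1,|\Phi(\mathbb O^n_{\lfloor s\rfloor_{h_n}})|^{p/2},\|\mathbb O^n_s\|_H^p,\int_0^T\|\tilde{\mathcal O}^n_u+P_ne^{uA}\xi\|_{H_\varrho}^{2p+2p\vartheta}\,du\Big\}\,ds\bigg]+\sup_{n\in\mathbb N}\sup_{s\in[0,T]}\mathbb E[\|\mathbb O^n_s\|_H^p]<\infty.$$
   Context: Setting. Let $T,c_0,\gamma,\theta,\vartheta\in(0,\infty)$, $\alpha\in[0,\frac12]$, $\varphi\in[0,1)$, $\rho\in[0,\frac14)$, $\varrho\in(\rho,\frac14)$, $\chi\in(0,\frac{\varrho-\rho}{1+\vartheta}]$, $H=L^2((0,1);\mathbb R)$ (with Lebesgue measure), $e_n=(\sqrt2\sin(n\pi x))_{x\in(0,1)}\in H$ and $\lambda_n=c_0\pi^2n^2$ for $n\in\mathbb N$, let $A\colon D(A)\subseteq H\to H$ be the linear operator with $D(A)=\{v\in H\colon\sum_{k=1}^\infty|\lambda_k\langle e_k,v\rangle_H|^2<\infty\}$ and $Av=\sum_{k=1}^\infty-\lambda_k\langle e_k,v\rangle_He_k$, let $(H_r,\langle\cdot,\cdot\rangle_{H_r},\|\cdot\|_{H_r})$, $r\in\mathbb R$, be a family of interpolation spaces associated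 to $-A$, let $\xi\in H_{1/2}$, let $F\in\mathcal C(H_\varrho,H_{-\alpha})$, $(P_n)_{n\in\mathbb N}\colon\mathbb N\to L(H_{-1})$, $(h_n)_{n\in\mathbb N}\colon\mathbb N\to(0,T]$, and $\phi,\Phi\colon H_1\to[0,\infty)$ satisfy for all $u\in H_1$, $n\in\mathbb N$, $v,w\in P_n(H)$ that $\phi(u)=\gamma+\gamma\sup_{x\in(0,1)}|\underline u(x)|^2$, $\Phi(u)=\gamma+\gamma\sup_{x\in(0,1)}|\underline u(x)|^\gamma$, $P_n(u)=\sum_{k=1}^n\langle e_k,u\rangle_He_k$, $\limsup_{m\to\infty}h_m=0$, $\langle v,P_nF(v+w)\rangle_H\le\phi(w)\|v\|_H^2+\varphi\|v\|_{H_{1/2}}^2+\Phi(w)$, and $\|F(v)-F(w)\|_{H_{-\alpha}}\le\theta(1+\|v\|_{H_\rho}^\vartheta+\|w\|_{H_\rho}^\vartheta)\|v-w\|_{H_\rho}$. Let $(\Omega,\mathcal F,\mathbb P)$ be a probability space, let $(W_t)_{t\in[0,T]}$ be an $\mathrm{Id}_H$-cylindrical $(\Omega,\mathcal F,\mathbb P)$-Wiener process, and let $\mathcal X^n,\mathcal O^n\colon[0,T]\times\Omega\to P_n(H)$, $n\in\mathbb N$, be stochastic processes which satisfy for all $n\in\mathbb N$, $t\in[0,T]$ that $[\mathcal O^n_t]_{\mathbb P,\mathcal B(H)}=\int_0^tP_ne^{(t-s)A}\,dW_s$ and $$\mathbb P\Big(\mathcal X^n_t=P_ne^{tA}\xi+\int_0^tP_ne^{(t-s)A}\,\mathbf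 1_{\{\|\mathcal X^n_{\lfloor s\rfloor_{h_n}}\|_{H_\varrho}+\|\mathcal O^n_{\lfloor s\rfloor_{h_n}}+P_ne^{\lfloor s\rfloor_{h_n}A}\xi\|_{H_\varrho}\le|h_n|^{-\chi}\}}F(\mathcal X^n_{\lfloor s\rfloor_{h_n}})\,ds+\mathcal O^n_t\Big)=1.$$ Notation. $\underline u$ is the continuous representative on $(0,1)$ of an equivalence class $u$ that possesses one. $\lfloor t\rfloor_h=\max((-\infty,t]\cap\{0,h,-h,2h,-2h,\dots\})$ for $h>0$. $[f]_{\mathbb P,\mathcal B(H)}$ is the class of all $\mathcal F/\mathcal B(H)$-measurable functions agreeing with $f$ outside a $\mathbb P$-null set; stochastic integrals are such classes. $H_r$ for $r\ge0$ is $D((-A)^r)$ with $\|v\|_{H_r}=\|(-A)^rv\|_H$, and for $r<0$ is the completion of $H$ with respect to $\|(-A)^r\cdot\|_H$; $P_n$ and $e^{tA}$ act on these spaces by continuous extension. *)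

(* Defs.v *)
From HB Require Import structures.
From mathcomp Require Import all_boot all_order all_algebra.
From mathcomp Require Import generic_quotient.
From mathcomp Require Import all_classical all_reals all_analysis.
From mathcomp Require Import measurable_realfun.

Set Implicit Arguments.
Unset Strict Implicit.
Unset Printing Implicit Defensive.
Import Order.TTheory GRing.Theory Num.Theory.
Import numFieldNormedType.Exports.
Local Open Scope classical_set_scope.
Local Open Scope ring_scope.

(* L^2(mu): square-integrable functions modulo mu-a.e. equality, as a normed
   space. *)
Section L2.
Context {d} {T : measurableType d} {R : realType}.
Variable mu : {measure set T -> \bar R}.

Local Notation Lf := (LfunType mu (lee1n 2)).

Definition L2_eq (f g : Lf) : bool := `[< (f : T -> R) = g %[ae mu] >].

Lemma L2_eqP (f g : Lf) : reflect ((f : T -> R) = g %[ae mu]) (L2_eq f g).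
Proof. exact: asboolP. Qed.

Lemma L2_eq_refl : reflexive L2_eq.
Proof. by move=> f; apply/L2_eqP; apply: nearW. Qed.

Lemma L2_eq_sym : symmetric L2_eq.
Proof. by move=> f g; apply/idP/idP => /L2_eqP fg; apply/L2_eqP/ae_eq_sym. Qed.

Lemma L2_eq_trans : transitive L2_eq.
Proof.
by move=> g f h /L2_eqP fg /L2_eqP gh; apply/L2_eqP/(ae_eq_trans fg gh).
Qed.

Canonical L2_equiv := EquivRel L2_eq L2_eq_refl L2_eq_sym L2_eq_trans.

Definition L2 : Type := {eq_quot L2_eq}%qT.
HB.instance Definition _ := Choice.on L2.
HB.instance Definition _ := EqQuotient.on L2.

Definition toL2 (f : Lf) : L2 := (\pi_L2 f)%qT.
Definition L2_fun (u : L2) : Lf := repr u.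

Lemma L2_funK (u : L2) : toL2 (L2_fun u) = u.
Proof. exact: reprK. Qed.

Lemma toL2P (f g : Lf) : toL2 f = toL2 g <-> (f : T -> R) = g %[ae mu].
Proof.
split=> [fg|fg]; first by apply/L2_eqP; apply/eqmodP.
by apply/eqmodP/L2_eqP.
Qed.

Lemma toL2K (f : Lf) : (L2_fun (toL2 f) : T -> R) = f %[ae mu].
Proof. by apply/toL2P; rewrite L2_funK. Qed.

Definition L2_zero : L2 := toL2 0.
Definition L2_opp (u : L2) : L2 := toL2 (- L2_fun u).
Definition L2_add (u v : L2) : L2 := toL2 (L2_fun u + L2_fun v).
Definition L2_scale (a : R) (u : L2) : L2 := toL2 (a *: L2_fun u).

Lemma toL2D f g : L2_add (toL2 f) (toL2 g) = toL2 (f + g).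
Proof.
apply/toL2P; have := toL2K f; have := toL2K g.
by apply: filterS2 => x gx fx Tx /=; rewrite !fctE gx// fx.
Qed.

Lemma toL2N f : L2_opp (toL2 f) = toL2 (- f).
Proof.
by apply/toL2P; apply: filterS (toL2K f) => x fx Tx /=; rewrite !fctE fx.
Qed.

Lemma toL2Z a f : L2_scale a (toL2 f) = toL2 (a *: f).
Proof.
by apply/toL2P; apply: filterS (toL2K f) => x fx Tx /=; rewrite !fctE fx.
Qed.

Lemma L2_ind (Q : L2 -> Prop) : (forall f, Q (toL2 f)) -> forall u, Q u.
Proof. by move=> Qf u; rewrite -(L2_funK u). Qed.

Lemma L2_addA : associative L2_add.
Proof.
by elim/L2_ind=> f; elim/L2_ind=> g; elim/L2_ind=> h; rewrite !toL2D addrA.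
Qed.

Lemma L2_addC : commutative L2_add.
Proof. by elim/L2_ind=> f; elim/L2_ind=> g; rewrite !toL2D addrC. Qed.

Lemma L2_add0 : left_id L2_zero L2_add.
Proof. by elim/L2_ind=> f; rewrite toL2D add0r. Qed.

Lemma L2_addN : left_inverse L2_zero L2_opp L2_add.
Proof. by elim/L2_ind=> f; rewrite toL2N toL2D addNr. Qed.

HB.instance Definition _ :=
  GRing.isZmodule.Build L2 L2_addA L2_addC L2_add0 L2_addN.

Lemma L2_scaleA a b u : L2_scale a (L2_scale b u) = L2_scale (a * b) u.
Proof. by elim/L2_ind: u => f; rewrite !toL2Z scalerA. Qed.

Lemma L2_scale1 : left_id 1 L2_scale.
Proof. by elim/L2_ind=> f; rewrite toL2Z scale1r. Qed.

Lemma L2_scaleDr : right_distributive L2_scale +%R.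
Proof.
move=> a; elim/L2_ind=> f; elim/L2_ind=> g.
by rewrite [_ + _]toL2D !toL2Z scalerDr -toL2D.
Qed.

Lemma L2_scaleDl u : {morph L2_scale^~ u : a b / a + b}.
Proof. by move=> a b; elim/L2_ind: u => f; rewrite !toL2Z scalerDl -toL2D. Qed.

HB.instance Definition _ := GRing.Zmodule_isLmodule.Build R L2
  L2_scaleA L2_scale1 L2_scaleDr L2_scaleDl.

Definition L2_norm (u : L2) : R := fine 'N[mu]_2%:E[EFin \o L2_fun u].

Lemma ae_eq_Lnorm (f g : T -> R) (p : R) :
  measurable_fun setT f -> measurable_fun setT g -> f = g %[ae mu] ->
  'N[mu]_p%:E[EFin \o f]%E = 'N[mu]_p%:E[EFin \o g]%E.
Proof.
move=> mf mg fg; rewrite unlock; congr (_ `^ _)%E.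
have mp (h : T -> R) : measurable_fun setT h ->
    measurable_fun setT (EFin \o (fun x => `|h x| `^ p)).
  move=> mh; apply/measurable_EFinP.
  apply: (measurableT_comp (measurable_powR _)) => //.
  exact: measurableT_comp.
apply: ge0_ae_eq_integral => //; [exact: (mp f)|exact: (mp g)|..].
- by move=> x _; exact: poweR_ge0.
- by move=> x _; exact: poweR_ge0.
- by apply: filterS fg => x fgx xT /=; rewrite fgx.
Qed.

Lemma L2_norm_toL2 f : L2_norm (toL2 f) = fine 'N[mu]_2%:E[EFin \o f].
Proof. by congr fine; apply: ae_eq_Lnorm => //; exact: toL2K. Qed.

Lemma L2_ler_normD u v : L2_norm (u + v) <= L2_norm u + L2_norm v.
Proof.
elim/L2_ind: u => f; elim/L2_ind: v => g.
by rewrite [_ + _]toL2D !L2_norm_toL2 ler_LnormD.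
Qed.

Lemma L2_normZ a u : L2_norm (a *: u) = `|a| * L2_norm u.
Proof.
elim/L2_ind: u => f; rewrite [_ *: _]toL2Z !L2_norm_toL2.
by apply: EFin_inj; rewrite EFinM !finite_norm_fine LnormZ.
Qed.

Lemma L2_normr0_eq0 u : L2_norm u = 0 -> u = 0.
Proof.
elim/L2_ind: u => f; rewrite L2_norm_toL2 => /fine_Lnormr_eq0 f0.
exact/toL2P.
Qed.

HB.instance Definition _ := @Lmodule_isNormed.Build R L2
  L2_norm L2_ler_normD L2_normZ L2_normr0_eq0.

(* The class of f if f is square integrable, 0 otherwise. *)
Definition L2_class (f : T -> R) : L2 :=
  if pselect (f \in Lfun mu 2%:E) is left fL
  then toL2 (Lfun_Sub (lee1n 2) fL) else 0.

Definition L2_inner (u v : L2) : R := \int[mu]_x (L2_fun u x * L2_fun v x).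

End L2.

Section SpectralSetting.
Context {R : realType}.

Definition mu01 : set (measurableTypeR R) -> \bar R :=
  mrestr lebesgue_measure (measurable_itv `]0%R, 1%R[).
HB.instance Definition _ := Measure.on mu01.

Definition H01 : Type := L2 mu01.

Definition inner (u v : H01) : R := L2_inner u v.

(* Sequences indexed by {1, 2, ...} are functions on nat whose value at 0 is
   never used. *)
Definition eigf (k : nat) : H01 :=
  L2_class mu01 (fun x => Num.sqrt 2 * sin (k%:R * pi * x)).

Lemma eigfE (k : nat) : {ae mu01, forall x,
  L2_fun (eigf k) x = Num.sqrt 2 * sin (k%:R * pi * x)}.
Proof.
pose f : R -> R := fun x => Num.sqrt 2 * sin (k%:R * pi * x).
have mf : measurable_fun [set: measurableTypeR R] f.
  apply: continuous_measurable_fun => x.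
  apply: cvgM; first exact: cvg_cst.
  apply: continuous_comp; last exact: continuous_sin.
  by apply: cvgM; [exact: cvg_cst|exact: cvg_id].
have fL : (f : measurableTypeR R -> R) \in Lfun mu01 2%:E.
  apply/andP; split; first exact: mem_set.
  rewrite inE /= /finite_norm unlock poweR_lty//.
  apply: (@le_lt_trans _ _ (\int[mu01]_x (2%:E))%E).
    apply: ge0_le_integral => //.
    - by move=> x _; exact: poweR_ge0.
    - apply: (@measurableT_comp _ _ _ _ _ _ (EFin)) => //.
      apply: (measurableT_comp (measurable_powR _)) => //.
      exact: measurableT_comp.
    - move=> x _; rewrite [leLHS]poweR_EFin lee_fin powR_mulrn//.
      rewrite -normrX ger0_norm ?sqr_ge0//.
      rewrite /f exprMn sqr_sqrtr// ler_piMr//.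
  rewrite integral_cst//= /mu01 /mrestr setTI lebesgue_measure_itv/=.
  by rewrite lte_fin ltr01 oppr0 adde0 mule1 ltry.
rewrite /eigf /L2_class; case: pselect => // fL'.
by apply: filterS (toL2K (Lfun_Sub _ fL')) => x; apply.
Qed.

Definition lam (c0 : R) (k : nat) : R := c0 * pi ^+ 2 * k%:R ^+ 2.

Definition Pn (n : nat) (u : H01) : H01 :=
  \sum_(1 <= k < n.+1) inner (eigf k) u *: eigf k.

(* sum_(k >= 1) m_k <e_k, v> e_k, convergence in H; meaningful only for v in
   the domain of the diagonal operator with multipliers m. *)
Definition diagop (m : nat -> R) (v : H01) : H01 :=
  limn (fun n => \sum_(1 <= k < n.+1) (m k * inner (eigf k) v) *: eigf k).

(* H_r for r >= 0, as a subspace of H: the domain of (-A)^r. *)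
Definition Hr (c0 r : R) : set H01 :=
  [set v | (\sum_(1 <= k <oo)
     (`|lam c0 k `^ r * inner (eigf k) v| ^+ 2)%:E < +oo)%E].

(* (-A)^r *)
Definition powA (c0 r : R) (v : H01) : H01 := diagop (fun k => lam c0 k `^ r) v.

Definition Hnorm (c0 r : R) (v : H01) : R := `|powA c0 r v|.

(* The semigroup e^(t (A - eta)), diagonal since A e_k = - lam_k e_k. *)
Definition expAsub (c0 eta t : R) (v : H01) : H01 :=
  diagop (fun k => expR (t * (- lam c0 k - eta))) v.

(* e^(tA) *)
Definition expA (c0 t : R) : H01 -> H01 := expAsub c0 0 t.

(* The continuous representative of u on the open interval (0,1); arbitrary
   if there is none. *)
Definition crep (u : H01) : R -> R :=
  xget (cst 0) [set f : R -> R | {within `]0%R, 1%R[, continuous f} /\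
    {ae mu01, forall x, L2_fun u x = f x}].

(* Hneg is a realization of H_(-alpha): a completion of H with respect to
   the norm |(-A)^(-alpha) v|. *)
Definition is_completion (c0 alpha : R) (Hneg : completeNormedModType R)
    (iota : {linear H01 -> Hneg}) : Prop :=
  (forall v, `|iota v| = Hnorm c0 (- alpha) v) /\ dense (range iota).

(* The continuous extension to Hneg of an operator S on H, where it exists (it
   is then unique by density); 0 otherwise. *)
Definition cext (Hneg : completeNormedModType R) (iota : {linear H01 -> Hneg})
    (S : H01 -> H01) : Hneg -> H01 :=
  xget (cst 0) [set q : Hneg -> H01 |
    continuous q /\ forall v, q (iota v) = S v].

Definition continuous_Hr (c0 r : R) (V : normedModType R) (F : H01 -> V) :=
  forall u, Hr c0 r u -> forall eps, 0 < eps -> exists2 delta, 0 < delta &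
    forall v, Hr c0 r v -> Hnorm c0 r (v - u) < delta -> `|F v - F u| < eps.

Definition gridfloor (h t : R) : R := (Num.floor (t / h))%:~R * h.

(* For h > 0, gridfloor h t is max (]-oo, t] `&` {0, h, -h, 2h, -2h, ...}). *)
Lemma gridfloorP (h t : R) : 0 < h ->
  gridfloor h t <= t /\
  forall k : int, k%:~R * h <= t -> k%:~R * h <= gridfloor h t.
Proof.
move=> h0; split=> [|k kt]; first by rewrite -ler_pdivlMr// ge_floor.
by rewrite ler_pM2r// ler_int floor_ge_int ler_pdivlMr.
Qed.

(* The integral over [0, t] of a function with values in the
   finite-dimensional space P_n(H), computed in the orthonormal basis
   e_1, ..., e_n. *)
Definition Pint (n : nat) (t : R) (f : R -> H01) : H01 :=
  \sum_(1 <= k < n.+1)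
    (\int[lebesgue_measure]_(s in `[0%R, t]) inner (eigf k) (f s)) *: eigf k.

(* The right-hand side at time t of the truncated scheme of dimension n and
   step h, for a path X of the scheme and a path O of the noise. *)
Definition scheme (c0 varrho chi : R) (Hneg : completeNormedModType R)
    (iota : {linear H01 -> Hneg}) (F : H01 -> Hneg) (xi : H01)
    (n : nat) (h : R) (X O : R -> H01) (t : R) : H01 :=
  Pn n (expA c0 t xi)
  + Pint n t (fun s =>
      if Hnorm c0 varrho (X (gridfloor h s))
         + Hnorm c0 varrho
             (O (gridfloor h s) + Pn n (expA c0 (gridfloor h s) xi))
         <= `|h| `^ (- chi)
      then cext iota (fun v => Pn n (expA c0 (t - s) v))
             (F (X (gridfloor h s)))
      else 0)
  + O t.

End SpectralSetting.
Arguments H01 R : clear implicits.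
Arguments mu01 R : clear implicits.

Section Stochastic.
Context {R : realType} {d : measure_display} {Omega : measurableType d}.
Variable P : probability Omega R.
Local Notation H := (H01 R).

Definition prob_one (E : set Omega) : Prop := measurable E /\ P E = 1%E.

Definition borel_H (Z : Omega -> H) : Prop :=
  forall U, open U -> measurable (Z @^-1` U).

Definition open_Hr (c0 r : R) (U : set H) : Prop :=
  U `<=` Hr c0 r /\
  forall u, U u -> exists2 eps, 0 < eps &
    forall v, Hr c0 r v -> Hnorm c0 r (v - u) < eps -> U v.

(* Z is a random variable with values in H_r, with its Borel sigma-algebra. *)
Definition rv_Hr (c0 r : R) (Z : Omega -> H) : Prop :=
  (forall w, Hr c0 r (Z w)) /\
  forall U, open_Hr c0 r U -> measurable (Z @^-1` U).

(* Z is a random variable with values in P_n(H). *)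
Definition rv_Pn (n : nat) (Z : Omega -> H) : Prop :=
  (forall w, range (Pn n) (Z w)) /\ borel_H Z.

Definition continuous_path (N : H -> R) (T : R) (Y : R -> H) : Prop :=
  forall t, 0 <= t <= T -> N (Y s - Y t) @[s --> within `[0, T] (nbhs t)] --> 0.

Section CylindricalWiener.
Variables (T : R) (W : R -> H -> Omega -> R).

(* The sigma-algebra of the process up to time s. *)
Definition past (s : R) : set (set Omega) :=
  <<s [set E | exists u g (Y : set R),
    [/\ 0 <= u <= s, measurable Y & E = W u g @^-1` Y]] >>.

(* The sigma-algebra of the increment from s to t. *)
Definition incr (s t : R) : set (set Omega) :=
  <<s [set E | exists g (Y : set R),
    measurable Y /\ E = (fun w => W t g w - W s g w) @^-1` Y] >>.

(* W t g stands for <g, W_t>. *)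
Record cylindrical_wiener : Prop := CylindricalWiener {
  cw_meas : forall t g, 0 <= t <= T -> measurable_fun setT (W t g);
  cw_zero : forall g, {ae P, forall w, W 0 g w = 0};
  cw_linear : forall t (a : R) g h, 0 <= t <= T ->
    {ae P, forall w, W t (a *: g + h) w = a * W t g w + W t h w};
  cw_normal : forall s t g (Y : set R), 0 <= s -> s < t -> t <= T ->
    g != 0 -> measurable Y ->
    P ((fun w => W t g w - W s g w) @^-1` Y) =
    normal_prob 0 (Num.sqrt (t - s) * `|g|) Y;
  cw_indep : forall s t A B, 0 <= s -> s < t -> t <= T ->
    past s A -> incr s t B -> P (A `&` B) = (P A * P B)%E;
  cw_cont : forall g,
    {ae P, forall w, {within `[0, T], continuous (fun t => W t g w)}}
}.

(* The deterministic elementary integrands are the finite sums of terms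
   1_(]lo, hi]](s) <left, .> right. *)
Record elem_term := ElemTerm
  { et_lo : R; et_hi : R; et_left : H; et_right : H }.

Definition elem_val (E : seq elem_term) (s : R) (v : H) : H :=
  \sum_(i <- E)
    (\1_(`]et_lo i, et_hi i]) s * inner (et_left i) v) *: et_right i.

Definition elem_int (E : seq elem_term) (w : Omega) : H :=
  \sum_(i <- E)
    (W (et_hi i) (et_left i) w - W (et_lo i) (et_left i) w) *: et_right i.

(* The squared Hilbert-Schmidt norm. *)
Definition HS2 (S : H -> H) : \bar R :=
  (\sum_(1 <= k <oo) (`|S (eigf k)| ^+ 2)%:E)%E.

(* The class of Z is the Ito integral over [0, t] of the deterministic
   operator-valued integrand Psi, i.e. the L^2(P; H)-limit of the integrals of
   elementary integrands which approximate Psi in L^2([0, t]; HS(H, H)). *)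
Definition is_stoch_integral (t : R) (Psi : R -> H -> H) (Z : Omega -> H) :=
  borel_H Z /\
  exists E : nat -> seq elem_term,
  [/\ forall m,
        all (fun i => [&& 0 <= et_lo i, et_lo i <= et_hi i & et_hi i <= t]) (E m),
      (\int[lebesgue_measure]_(s in `[0%R, t])
         HS2 (fun v => (Psi s v - elem_val (E m) s v)%R))%E
        @[m --> \oo] --> 0%E &
      (\int[P]_w (`|(Z w - elem_int (E m) w)%R| ^+ 2)%:E)%E
        @[m --> \oo] --> 0%E].

End CylindricalWiener.
End Stochastic.

(* Main.v *)
From HB Require Import structures.
Require Import Defs.
From mathcomp Require Import all_boot all_order all_algebra.
From mathcomp Require Import all_classical all_reals all_analysis.
From mathcomp Require Import measurable_realfun.
From mathcomp Require Import ring lra.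
Set Implicit Arguments.
Unset Strict Implicit.
Unset Printing Implicit Defensive.
Import Order.TTheory GRing.Theory Num.Theory.
Import numFieldNormedType.Exports.
Local Open Scope classical_set_scope.
Local Open Scope ring_scope.

(* Mode by mode, the stochastic convolution is an Ornstein-Uhlenbeck functional of
   the coordinate paths t |-> <e_k, W_t>.  Integration by parts turns it into a
   pathwise integral, so that modifying W off one set of full measure yields
   versions of all convolutions, with every rate, whose paths are continuous
   everywhere.  Increments of these modes are sub-Gaussian; chaining in time gives
   a random constant q with all moments such that k^(1 + gap) lam_k^(2 varrho) y_k(t)^2
   <= q for all k and t, whence O lives in H_varrho and the Galerkin convolutions
   converge to it uniformly.  The convolution of rate lam_k + eta solves the
   equation of (iii).  Chaining in space bounds the moments of the sup norm of its
   Galerkin sums uniformly in n with a sub-Gaussian constant which tends to 0 as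
   eta grows, so that some eta makes exp (c sup^2) integrable; Jensen's inequality
   on the time grid then gives (vi).  Finally (v) holds because a stochastic
   convolution is unique up to null sets and the right-hand side of the scheme at
   time t depends on finitely many of its values. *)

(** * Integrals and completeness of L2 *)

(** Gaussianity enters through upper bounds on moment generating functions only. Such bounds survive
    almost sure limits by Fatou and sums of dependent variables at the price of a constant, and they
    give moments of growth j! C^j, which the power series of exp (c y^2) tolerates as long as c C is
    small. In (vi) the exponent c = 4 T p gamma is prescribed: one factor 2 separates the
    exponential weight from the maximum, T comes from Jensen, the other 2 separates the noise from
    the initial value. Smallness therefore has to come from the variance, and this is what [eta]
    provides. Two chaining arguments occur because the two demands differ. The weight in (vi) asks
    for exponential moments of the sup norm in space, but after Jensen only at single times.
    Continuity in [H_varrho] and (iv) ask for uniformity in time, but polynomial moments are enough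
    there. The order of choices matters: [eta] depends on the data alone, the set of full measure is
    then shrunk for the rates lam_k and lam_k + eta, and the exponential bound has one constant for
    all such sets. *)

Section integral_tools.
Context {d} {T : measurableType d} {R : realType}.
Variable mu : {measure set T -> \bar R}.
Local Open Scope ereal_scope.

(** The integral is a supremum over simple functions below the integrand, so the comparison also
    covers integrands of unknown measurability, such as [HS2] of an operator family or the nested
    integral in (vi). *)
Lemma ge0_le_integralW (D : set T) (f g : T -> \bar R) :
  (forall x, D x -> 0 <= f x) -> (forall x, D x -> f x <= g x) ->
  \int[mu]_(x in D) f x <= \int[mu]_(x in D) g x.
Proof.
move=> f0 fg; rewrite !ge0_integralE//; last first.
  by move=> x Dx; exact: le_trans (f0 _ Dx) (fg _ Dx).
apply: le_ereal_sup => _ [h hf <-]; exists h => // x.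
apply: (le_trans (hf x)); rewrite /patch; case: ifPn => // /[!inE].
exact: fg.
Qed.

(** Through this form of Fatou the integral bounds pass to limits: in the completeness of L^2, for
    sub-Gaussian constants and for series of squares. *)
Lemma fatou_le (D : set T) (f_ : nat -> T -> \bar R) (f : T -> \bar R) c :
  measurable D -> (forall n, measurable_fun D (f_ n)) -> measurable_fun D f ->
  (forall n x, D x -> 0 <= f_ n x) ->
  {ae mu, forall x, D x -> f_ n x @[n --> \oo] --> f x} ->
  (\forall n \near \oo, \int[mu]_(x in D) f_ n x <= c) ->
  \int[mu]_(x in D) f x <= c.
Proof.
move=> mD mf_ mf f0 cvf lec.
have mlim : measurable_fun D (fun x => limn_einf (f_^~ x)).
  apply: measurableT_comp => //.
  by apply: measurable_fun_limn_esup => n; exact: measurableT_comp.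
have -> : \int[mu]_(x in D) f x = \int[mu]_(x in D) limn_einf (f_^~ x).
  apply: ae_eq_integral => //.
  by apply: filterS cvf => x cvx Dx; rewrite (cvg_limn_einf_sup (cvx Dx)).
apply: (le_trans (fatou mu mD mf_ f0)).
rewrite limn_einf_lim; apply: lime_le; first exact: is_cvg_einfs.
case: lec => N _ lec; apply: nearW => n.
apply: (@le_trans _ _ (\int[mu]_(x in D) f_ (maxn n N) x)).
  by apply: ereal_inf_lbound; exists (maxn n N) => //=; rewrite leq_maxl.
by apply: lec => /=; rewrite leq_maxr.
Qed.
Lemma integral_realD (D : set T) (f g : T -> R) : measurable D ->
  measurable_fun D f -> measurable_fun D g ->
  (forall x, 0 <= f x)%R -> (forall x, 0 <= g x)%R ->
  \int[mu]_(x in D) (f x + g x)%:E =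
    \int[mu]_(x in D) (f x)%:E + \int[mu]_(x in D) (g x)%:E.
Proof.
move=> mD mf mg f0 g0; under eq_integral do rewrite EFinD.
by apply: ge0_integralD => //; try (by apply/measurable_EFinP);
  move=> x _; rewrite lee_fin.
Qed.

Lemma integral_realZ (D : set T) (f : T -> R) (c : R) : measurable D ->
  measurable_fun D f -> (forall x, 0 <= f x)%R -> (0 <= c)%R ->
  \int[mu]_(x in D) (c * f x)%:E = c%:E * \int[mu]_(x in D) (f x)%:E.
Proof.
move=> mD mf f0 c0; under eq_integral do rewrite EFinM.
by apply: ge0_integralZl => //; try (by apply/measurable_EFinP);
  try (by move=> x _; rewrite lee_fin); rewrite lee_fin.
Qed.

End integral_tools.

Lemma measurable_bigsum {d} {T : measurableType d} {R : realType} (D : set T)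
    (I : eqType) (r : seq I) (f : I -> T -> R) :
  (forall i, i \in r -> measurable_fun D (f i)) ->
  measurable_fun D (fun x => \sum_(i <- r) f i x).
Proof.
move=> mf; rewrite (_ : (fun x => _) = (fun x => \sum_(i <- r) (if i \in r then f i x else 0))).
  by apply: measurable_sum => i; case: (boolP (i \in r)) => // ir; exact: mf.
by apply/funext => x; apply: eq_big_seq => i ->.
Qed.

Lemma cvg_bigsum {R : realType} (I : eqType) (r : seq I) (S : Type) (F : set_system S)
    {FF : Filter F} (f : I -> S -> R) (l : I -> R) :
  (forall i, i \in r -> f i x @[x --> F] --> l i) ->
  \sum_(i <- r) f i x @[x --> F] --> \sum_(i <- r) l i.
Proof.
elim: r => [_|i r IH fl]; first by under eq_fun do rewrite big_nil; rewrite big_nil; exact: cvg_cst.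
under eq_fun do rewrite big_cons; rewrite big_cons.
apply: (@cvgD _ R^o); first by apply: fl; rewrite mem_head.
by apply: IH => j jr; apply: fl; rewrite inE jr orbT.
Qed.

Section L2_facts.
Context {d} {T : measurableType d} {R : realType}.
Variable mu : {measure set T -> \bar R}.
Local Notation Lf := (LfunType mu (lee1n 2)).

Lemma Lf_integrableM (f g : Lf) :
  mu.-integrable setT (EFin \o (fun x => f x * g x)).
Proof. by apply/Lfun1_integrable/Lfun2_mul_Lfun1; exact: LfunP. Qed.

Lemma L2_inner_toL2 (f g : Lf) :
  L2_inner (toL2 f) (toL2 g) = \int[mu]_x (f x * g x).
Proof.
rewrite /L2_inner /Rintegral; congr fine; apply: ae_eq_integral => //.
- by apply/measurable_EFinP; exact: measurable_funM.
- by apply/measurable_EFinP; exact: measurable_funM.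
- have := toL2K g; apply: filterS2 (toL2K f) => x fx gx Tx /=.
  by rewrite fx// gx.
Qed.

Lemma L2_innerC (u v : L2 mu) : L2_inner u v = L2_inner v u.
Proof. by rewrite /L2_inner; under eq_Rintegral do rewrite mulrC. Qed.

Lemma L2_innerDl (u v w : L2 mu) :
  L2_inner (u + v) w = L2_inner u w + L2_inner v w.
Proof.
rewrite -(L2_funK u) -(L2_funK v) -(L2_funK w).
move: (L2_fun u) (L2_fun v) (L2_fun w) => f g h.
rewrite [_ + _]toL2D !L2_inner_toL2 -RintegralD//; try exact: Lf_integrableM.
by apply: eq_Rintegral => x _; rewrite mulrDl.
Qed.

Lemma L2_innerZl a (u v : L2 mu) : L2_inner (a *: u) v = a * L2_inner u v.
Proof.
rewrite -(L2_funK u) -(L2_funK v); move: (L2_fun u) (L2_fun v) => f g.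
rewrite [_ *: _]toL2Z !L2_inner_toL2 -RintegralZl//; last exact: Lf_integrableM.
by apply: eq_Rintegral => x _; rewrite mulrA.
Qed.

Lemma L2_inner_norm (u : L2 mu) : L2_inner u u = `|u| ^+ 2.
Proof.
rewrite -(L2_funK u); move: (L2_fun u) => f; rewrite L2_inner_toL2.
have -> : `|toL2 f| = fine 'N[mu]_2%:E[EFin \o f] := L2_norm_toL2 f.
apply: EFin_inj; rewrite -powR_mulrn//; last by rewrite fine_ge0// Lnorm_ge0.
rewrite -poweR_EFin finite_norm_fine powR_Lnorm// /Rintegral fineK; last first.
  exact: integrable_fin_num (Lf_integrableM f f).
apply: eq_integral => x _ /=; rewrite powR_mulrn//.
by rewrite real_normK ?num_real// expr2.
Qed.

Lemma L2_ae_norm (u : L2 mu) (f : T -> R) : measurable_fun setT f ->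
  L2_fun u = f %[ae mu] -> ((`|u| ^+ 2)%:E = \int[mu]_x ((f x) ^+ 2)%:E)%E.
Proof.
move=> mf uf; rewrite -L2_inner_norm /L2_inner /Rintegral fineK; last first.
  exact: integrable_fin_num (Lf_integrableM _ _).
apply: ae_eq_integral => //.
- by apply/measurable_EFinP; exact: measurable_funM.
- by apply/measurable_EFinP; exact: measurable_funX.
- by apply: filterS uf => x fx Tx; rewrite fx// expr2.
Qed.

End L2_facts.

Section L2_hilbert.
Context {d} {T : measurableType d} {R : realType}.
Variable mu : {measure set T -> \bar R}.
Implicit Types u v w : L2 mu.
Local Notation "<< u , v >>" := (L2_inner u v) (format "<< u ,  v >>").

Lemma L2_innerDr u v w : <<u, v + w>> = <<u, v>> + <<u, w>>.
Proof. by rewrite L2_innerC L2_innerDl !(L2_innerC _ u). Qed.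

Lemma L2_innerZr a u v : <<u, a *: v>> = a * <<u, v>>.
Proof. by rewrite L2_innerC L2_innerZl L2_innerC. Qed.

Lemma L2_inner0l u : <<0, u>> = 0.
Proof. by rewrite -(scale0r 0) L2_innerZl mul0r. Qed.

Lemma L2_inner0r u : <<u, 0>> = 0.
Proof. by rewrite L2_innerC L2_inner0l. Qed.

Lemma L2_innerNl u v : <<- u, v>> = - <<u, v>>.
Proof. by rewrite -scaleN1r L2_innerZl mulN1r. Qed.

Lemma L2_innerNr u v : <<u, - v>> = - <<u, v>>.
Proof. by rewrite L2_innerC L2_innerNl L2_innerC. Qed.

Lemma L2_innerBl u v w : <<u - v, w>> = <<u, w>> - <<v, w>>.
Proof. by rewrite L2_innerDl L2_innerNl. Qed.

Lemma L2_innerBr u v w : <<u, v - w>> = <<u, v>> - <<u, w>>.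
Proof. by rewrite L2_innerDr L2_innerNr. Qed.

Lemma L2_inner_suml I (r : seq I) (Q : pred I) (f : I -> L2 mu) v :
  <<\sum_(i <- r | Q i) f i, v>> = \sum_(i <- r | Q i) <<f i, v>>.
Proof.
apply: (big_morph (fun u => <<u, v>>)) => [a b|]; first exact: L2_innerDl.
exact: L2_inner0l.
Qed.

Lemma L2_inner_sumr I (r : seq I) (Q : pred I) (f : I -> L2 mu) v :
  <<v, \sum_(i <- r | Q i) f i>> = \sum_(i <- r | Q i) <<v, f i>>.
Proof. by rewrite L2_innerC L2_inner_suml; under eq_bigr do rewrite L2_innerC. Qed.

Lemma L2_normD_sqr u v : `|u + v| ^+ 2 = `|u| ^+ 2 + 2 * <<u, v>> + `|v| ^+ 2.
Proof.
rewrite -!L2_inner_norm L2_innerDl !L2_innerDr (L2_innerC v u); ring.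
Qed.

Lemma L2_cauchy_schwarz u v : `|<<u, v>>| <= `|u| * `|v|.
Proof.
have [->|v0] := eqVneq v 0; first by rewrite L2_inner0r !normr0 mulr0.
have nv : 0 < `|v| by rewrite normr_gt0.
rewrite -(@ler_pXn2r _ 2)// ?nnegrE ?mulr_ge0// real_normK ?num_real// exprMn.
(* The squared norm of the component of [u] orthogonal to [v]. *)
have := sqr_ge0 (`|u - (<<u, v>> / `|v| ^+ 2) *: v|).
rewrite L2_normD_sqr normrN L2_innerNr L2_innerZr normrZ exprMn.
rewrite real_normK ?num_real//.
have v20 : `|v| ^+ 2 != 0 by rewrite expf_neq0// gt_eqF.
rewrite expr_div_n -subr_ge0 => h0.
have -> : `|u| ^+ 2 * `|v| ^+ 2 - <<u, v>> ^+ 2 = `|v| ^+ 2 * (`|u| ^+ 2 +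
  2 * (- (<<u, v>> / `|v| ^+ 2 * <<u, v>>)) + <<u, v>> ^+ 2 / (`|v| ^+ 2) ^+ 2 * `|v| ^+ 2).
  by field; rewrite gt_eqF.
apply: mulr_ge0; first exact: sqr_ge0.
exact: h0.
Qed.

Lemma cvg_L2_inner (F : set_system nat) {FF : Filter F} (f g : nat -> L2 mu) u v :
  f n @[n --> F] --> u -> g n @[n --> F] --> v ->
  <<f n, g n>> @[n --> F] --> <<u, v>>.
Proof.
move=> fu gv.
have nf : `|f n - u| @[n --> F] --> 0.
  by rewrite -(normr0 (L2 mu)) -(subrr u); apply: cvg_norm; apply: cvgB => //; exact: cvg_cst.
have ng : `|g n - v| @[n --> F] --> 0.
  by rewrite -(normr0 (L2 mu)) -(subrr v); apply: cvg_norm; apply: cvgB => //; exact: cvg_cst.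
apply/cvgrPdist_le => e e0.
pose a := `|u| + `|v| + 1.
have a0 : 0 < a by rewrite /a; have := normr_ge0 u; have := normr_ge0 v; lra.
(* The cap at 1 bounds the quadratic error term [e' * e'] by [e']. *)
pose e' := Num.min 1 (e / (2 * a)).
have e'0 : 0 < e' by rewrite /e' lt_min ltr01 divr_gt0// mulr_gt0.
near=> n.
have fn : `|f n - u| <= e'.
  by near: n; move/cvgr0_norm_le : nf => /(_ _ e'0); apply: filterS => n; rewrite normr_id.
have gn : `|g n - v| <= e'.
  by near: n; move/cvgr0_norm_le : ng => /(_ _ e'0); apply: filterS => n; rewrite normr_id.
have -> : <<u, v>> - <<f n, g n>> = - (<<f n - u, v>> + <<u, g n - v>> + <<f n - u, g n - v>>).
  by rewrite !L2_innerBl !L2_innerBr; ring.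
rewrite normrN.
apply: (le_trans (ler_normD _ _)); apply: (le_trans (lerD (ler_normD _ _) (lexx _))).
have h1 := le_trans (L2_cauchy_schwarz (f n - u) v) (ler_wpM2r (normr_ge0 v) fn).
have h2 := le_trans (L2_cauchy_schwarz u (g n - v)) (ler_wpM2l (normr_ge0 u) gn).
have h3 := le_trans (L2_cauchy_schwarz (f n - u) (g n - v)) (ler_pM (normr_ge0 _) (normr_ge0 _)
  fn gn).
apply: (le_trans (lerD (lerD h1 h2) h3)).
have e'1 : e' <= 1 by rewrite /e' ge_min lexx.
have e'2 : e' * (2 * a) <= e.
  by rewrite -ler_pdivlMr ?mulr_gt0// /e' ge_min lexx orbT.
have : e' * e' <= e' by rewrite ler_piMr// ltW.
have : 0 <= e' * a by rewrite mulr_ge0 ?ltW.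
rewrite /a in e'2 *; have := normr_ge0 u; have := normr_ge0 v.
nra.
Unshelve. all: by end_near. Qed.

End L2_hilbert.

Section L2_complete.
Context {d} {T : measurableType d} {R : realType}.
Variable mu : {measure set T -> \bar R}.

Lemma L2_fun_sub (u v : L2 mu) :
  L2_fun (u - v) = (fun x => L2_fun u x - L2_fun v x) %[ae mu].
Proof.
have -> : u - v = toL2 (L2_fun u - L2_fun v).
  by rewrite -[in LHS](L2_funK u) -[in LHS](L2_funK v) [- _]toL2N [_ + _]toL2D.
by apply: filterS (toL2K (L2_fun u - L2_fun v)) => x ->.
Qed.

Lemma L2_dist_sqr (u v : L2 mu) :
  ((`|u - v| ^+ 2)%:E = \int[mu]_x ((L2_fun u x - L2_fun v x) ^+ 2)%:E)%E.
Proof. by apply: L2_ae_norm; [exact: measurable_funB|exact: L2_fun_sub]. Qed.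

Lemma Lfun2_sqr_lty (f : T -> R) : measurable_fun setT f ->
  (\int[mu]_x ((f x) ^+ 2)%:E < +oo)%E -> f \in Lfun mu 2%:E.
Proof.
move=> mf fy; rewrite inE; apply/andP; split; first by rewrite inE.
rewrite inE /= /finite_norm unlock poweR_lty//.
rewrite (eq_integral (fun x => ((f x) ^+ 2)%:E))//= => x _.
by rewrite powR_mulrn// real_normK ?num_real.
Qed.

(** Weighting the [j]-th squared increment by [4 ^+ j] leaves a sum whose integral is at most a
    geometric series of ratio 1/4. Where that sum is finite, the increments are at most
    [C * 2^-1 ^+ j]. *)
Lemma ae_geometric_cvg (f : nat -> T -> R) : (forall n, measurable_fun setT (f n)) ->
  (forall j, (\int[mu]_x ((f j.+1 x - f j x) ^+ 2)%:E <= (16^-1 ^+ j)%:E)%E) ->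
  {ae mu, forall x, cvgn (fun n => f n x)}.
Proof.
move=> mf fj.
pose D j x : \bar R := (4 ^+ j * (f j.+1 x - f j x) ^+ 2)%:E.
have mD j : measurable_fun setT (D j).
  apply/measurable_EFinP; apply: measurable_funM => //; apply: measurable_funX.
  exact: measurable_funB.
have D0 j x : (0 <= D j x)%E.
  by rewrite /D lee_fin; apply: mulr_ge0; [exact: exprn_ge0|exact: sqr_ge0].
pose G x := (\sum_(j <oo) D j x)%E.
have mG : measurable_fun setT G by apply: ge0_emeasurable_sum.
have G0 x : (0 <= G x)%E by apply: nneseries_ge0.
have iG : (\int[mu]_x G x < +oo)%E.
  rewrite integral_nneseries//.
  apply: (@le_lt_trans _ _ (\sum_(j <oo) ((geometric 1 4^-1 j)%:E))%E).
    apply: lee_nneseries => [j _ _|j _]; first exact: integral_ge0.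
    rewrite /D; under eq_integral do rewrite EFinM.
    have mq : measurable_fun setT (fun x => ((f j.+1 x - f j x) ^+ 2)%:E).
      by apply/measurable_EFinP; apply: measurable_funX; exact: measurable_funB.
    rewrite (ge0_integralZl mu measurableT mq)//=; last by move=> x _; rewrite lee_fin sqr_ge0.
    apply: (le_trans (lee_wpmul2l _ (fj j))); first by rewrite lee_fin exprn_ge0.
    rewrite mul1r -EFinM lee_fin -exprMn; suff -> : 4 * 16^-1 = 4^-1 :> R by [].
    by field.
  apply: (@le_lt_trans _ _ (1 / (1 - 4^-1) : R)%:E); last exact: ltry.
  have cg : series (geometric (1 : R) 4^-1) @ \oo --> (1 / (1 - 4^-1) : R).
    by apply: cvg_geometric_series; rewrite ger0_norm//; lra.
  apply: lime_le.
    by apply: is_cvg_nneseries => j _ _; rewrite lee_fin /= mul1r exprn_ge0.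
  apply: nearW => n; rewrite sumEFin lee_fin.
  rewrite -(cvg_lim _ cg)//; apply: nondecreasing_cvgn_le.
    by apply: nondecreasing_series => j _ _; rewrite /= mul1r exprn_ge0.
  by apply/cvg_ex; eexists; exact: cg.
have iGi : mu.-integrable setT G.
  apply/integrableP; split => //.
  by under eq_integral do rewrite gee0_abs//.
apply: filterS (integrable_ae measurableT iGi) => x /(_ Logic.I) Gx.
pose C := Num.sqrt (fine (G x)).
have DC j : `|f j.+1 x - f j x| <= C * 2^-1 ^+ j.
  have : (D j x <= G x)%E.
    have := @nneseries_lim_ge R (fun k => D k x) xpredT 0%N j.+1.
    rewrite big_mkord big_ord_recr/= => /(_ (fun k _ _ => D0 k x)).
    by apply: le_trans; rewrite leeDr// sume_ge0.
  rewrite -(fineK Gx) lee_fin => DG.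
  rewrite -(@ler_pXn2r _ 2)// ?nnegrE ?mulr_ge0 ?sqrtr_ge0 ?exprn_ge0//.
  rewrite real_normK ?num_real// exprMn sqr_sqrtr ?fine_ge0//.
  rewrite -exprM mulnC exprM (_ : 2^-1 ^+ 2 = 4^-1 :> R); last by field.
  by rewrite exprVn ler_pdivlMr ?exprn_gt0// mulrC.
have cs : cvgn (series (fun j => f j.+1 x - f j x)).
  apply: normed_cvg.
  apply: (@series_le_cvg _ _ (geometric C 2^-1)) => //.
  - by move=> n; exact: normr_ge0.
  - by move=> n; rewrite /= mulr_ge0 ?sqrtr_ge0 ?exprn_ge0.
  - by apply: is_cvg_geometric_series; rewrite ger0_norm//; lra.
have -> : (fun n => f n x) = (fun n => f 0%N x + series (fun j => f j.+1 x - f j x) n).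
  apply/funext => n; rewrite /series/= telescope_sumr//.
  by rewrite addrC subrK.
by apply: is_cvgD => //; exact: is_cvg_cst.
Qed.

Lemma L2_complete (u : nat -> L2 mu) :
  (forall e, 0 < e -> exists N, forall m n, (N <= m)%N -> (N <= n)%N ->
    `|u m - u n| <= e) -> cvgn u.
Proof.
move=> cu.
have /choice[N HN] : forall j : nat, exists N, forall m n, (N <= m)%N -> (N <= n)%N ->
    `|u m - u n| <= 4^-1 ^+ j by move=> j; apply: cu; rewrite exprn_gt0.
(* Summing the moduli makes [k] nondecreasing while still [N j <= k j]. *)
pose k j := (\sum_(i < j.+1) N i)%N.
have kN j : (N j <= k j)%N by rewrite /k big_ord_recr/= leq_addl.
have kS j : (k j <= k j.+1)%N by rewrite {2}/k big_ord_recr/= leq_addr.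
have kle i j : (i <= j)%N -> (k i <= k j)%N.
  by move=> /subnKC <-; elim: (j - i)%N => [|m IH]; rewrite ?addn0// addnS (leq_trans IH).
pose f j := (L2_fun (u (k j)) : T -> R).
have mf j : measurable_fun setT (f j) by [].
have fij i j : (i <= j)%N -> (\int[mu]_x ((f j x - f i x) ^+ 2)%:E <= (16^-1 ^+ i)%:E)%E.
  move=> ij; rewrite -L2_dist_sqr lee_fin.
  have -> : 16^-1 ^+ i = (4^-1 ^+ i) ^+ 2 :> R.
    by rewrite -exprM mulnC exprM; congr (_ ^+ _); field.
  rewrite ler_pXn2r ?nnegrE//; apply: HN => //.
  exact: leq_trans (kN i) (kle _ _ ij).
have [Z [mZ Z0 ZP]] := ae_geometric_cvg mf (fun j => fij j j.+1 (leqnSn j)).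
(* Setting the functions to zero on the null set makes them converge everywhere, so that the limit
   is measurable. *)
pose g_ n x := f n x * \1_(~` Z) x.
have g_f n x : ~ Z x -> g_ n x = f n x.
  by move=> Zx; rewrite /g_ indicE mem_set// mulr1.
have mg_ n : measurable_fun setT (g_ n).
  apply: measurable_funM => //; apply: measurable_indic; exact: measurableC.
have cg x : g_ n x @[n --> \oo] --> limn (g_ ^~ x).
  have [Zx|Zx] := pselect (Z x).
    rewrite (_ : g_ ^~ x = cst 0); last first.
      by apply/funext => n; rewrite /g_ indicE memNset ?mulr0//; exact.
    by rewrite lim_cst//; exact: cvg_cst.
  rewrite (_ : g_ ^~ x = f ^~ x); last by apply/funext => n; rewrite g_f.
  by apply: contrapT => nc; apply: Zx; apply: ZP => /= c; apply: nc.
pose g x := limn (g_ ^~ x).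
have mg : measurable_fun setT g by apply: (@measurable_fun_cvg _ _ _ _ g_) => // x _; exact: cg.
have gf i : (\int[mu]_x ((g x - f i x) ^+ 2)%:E <= (16^-1 ^+ i)%:E)%E.
  apply: (@fatou_le _ _ _ mu setT (fun n x => ((f n x - f i x) ^+ 2)%:E)) => //.
  - by move=> n; apply/measurable_EFinP; apply: measurable_funX; exact: measurable_funB.
  - by apply/measurable_EFinP; apply: measurable_funX; exact: measurable_funB.
  - by move=> n x _; rewrite lee_fin sqr_ge0.
  - exists Z; split => // x /= xP; apply: contrapT => Zx; apply: xP => _.
    apply: cvg_EFin; first exact: nearW.
    apply: (cvg_comp (fun n => f n x - f i x) (fun y => y ^+ 2)); last exact: sqr_continuous.
    apply: (@cvgB _ R^o); last exact: cvg_cst.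
    rewrite (_ : (fun n => f n x) = g_ ^~ x); first exact: cg.
    by apply/funext => n; rewrite g_f.
  - by exists i => // n /= ni; exact: fij.
(* What is square integrable so far is the difference from [f 0]; the limit is this difference plus
   an element of L^2. *)
have gL : (fun x => g x - f 0%N x) \in Lfun mu 2%:E.
  apply: Lfun2_sqr_lty; first exact: measurable_funB.
  by apply: le_lt_trans (gf 0%N) _; rewrite ltry.
pose v := toL2 (Lfun_Sub (lee1n 2) gL + L2_fun (u (k 0%N))).
have vg : L2_fun v = g %[ae mu].
  apply: filterS (toL2K (Lfun_Sub (lee1n 2) gL + L2_fun (u (k 0%N)))) => x -> // _.
  by rewrite /= subrK.
have vu j : `|v - u (k j)| <= 4^-1 ^+ j.
  rewrite -(@ler_pXn2r _ 2)// ?nnegrE// -exprM mulnC exprM.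
  have -> : 4^-1 ^+ 2 = 16^-1 :> R by field.
  rewrite -lee_fin; apply: le_trans (gf j).
  rewrite (L2_ae_norm (f := fun x => g x - f j x))//; first exact: measurable_funB.
  by apply: filterS2 (L2_fun_sub v (u (k j))) vg => x -> // ->.
apply/cvg_ex; exists v; apply/cvgrPdist_le => e e0.
have [j Hj] : exists j, 4^-1 ^+ j <= e / 2.
  have : geometric (1 : R) 4^-1 @ \oo --> 0 by apply: cvg_geometric; rewrite ger0_norm//; lra.
  move/cvgrPdist_le => /(_ (e / 2)); case; first by rewrite divr_gt0.
  move=> j _ /(_ j (leqnn j)); rewrite sub0r normrN /= mul1r ger0_norm ?exprn_ge0// => ?.
  by exists j.
exists (k j) => // n /= kn.
have -> : v - u n = (v - u (k j)) + (u (k j) - u n) by rewrite addrA subrK.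
apply: (le_trans (ler_normD _ _)); rewrite (splitr e); apply: lerD.
  exact: le_trans (vu j) Hj.
apply: le_trans Hj; apply: HN => //; exact: leq_trans (kN j) kn.
Qed.

End L2_complete.

Section mrestr_integral.
Context {d} {T : measurableType d} {R : realType}.
Variable mu : {measure set T -> \bar R}.
Local Open Scope ereal_scope.
Import HBNNSimple.

Lemma sintegral_mrestr (D : set T) (mD : measurable D) (h : {nnsfun T >-> R}) :
  sintegral (mrestr mu mD) h = sintegral mu (h \_ D).
Proof.
rewrite !sintegralET; apply: eq_fsbigr => x _.
have [->|x0] := eqVneq x 0%R; first by rewrite !mul0e.
congr (_ * _); rewrite /mrestr; congr (mu _); apply/seteqP; split => [y [/= hy Dy]|y /=].
  by rewrite patchE mem_set.
rewrite patchE; case: ifPn => [/[!inE] Dy hy|_ /esym/eqP]; first by split.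
by rewrite (negbTE x0).
Qed.

(** Transfers integrals against [mu01], a measure on the whole line, to Lebesgue integrals over the
    interval. Cutting a simple function off outside [D] turns a competitor for one supremum into one
    for the other. *)
Lemma ge0_integral_mrestr (D : set T) (mD : measurable D) (f : T -> \bar R) :
  (forall x, 0 <= f x) ->
  \int[mrestr mu mD]_x f x = \int[mu]_(x in D) f x.
Proof.
move=> f0; rewrite ge0_integralTE// ge0_integralE//.
apply/eqP; rewrite eq_le; apply/andP; split.
  apply: ge_ereal_sup => _ [h /= hf <-]; rewrite sintegral_mrestr mrestrict.
  apply: ereal_sup_ubound; exists (proj_nnsfun h mD) => //= x.
  rewrite mindicE patchE; case: ifPn => _; first by rewrite mulr1.
  by rewrite mulr0.
apply: ge_ereal_sup => _ [h /= hf <-].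
apply: ereal_sup_ubound; exists h => [x /=|].
  apply: (le_trans (hf x)); rewrite patchE; case: ifPn => // _.
rewrite sintegral_mrestr; congr (sintegral _ _); apply/funext => x.
rewrite patchE; case: ifPn => // /negP xD.
apply/eqP; rewrite eq_sym eq_le; apply/andP; split; last by exact: fun_ge0.
by have := hf x; rewrite patchE; case: ifPn => // _; rewrite lee_fin.
Qed.

End mrestr_integral.

Lemma ae_imply {d} {T : measurableType d} {R : realType} (mu : {measure set T -> \bar R})
    (P Q : T -> Prop) : (forall x, P x -> Q x) ->
  {ae mu, forall x, P x} -> {ae mu, forall x, Q x}.
Proof.
move=> PQ [A [mA A0 PA]]; exists A; split => // x /= nQ; apply: PA => /= Px.
exact/nQ/PQ.
Qed.

Section real_integral.
Context {R : realType}.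
Local Notation leb := (@lebesgue_measure R).
Implicit Types (f F : R -> R) (a b : R).

Lemma continuous_itv_integrable f a b : continuous f ->
  leb.-integrable `[a, b] (EFin \o f).
Proof.
move=> cf; apply: continuous_compact_integrable; first exact: segment_compact.
exact: continuous_subspaceT.
Qed.

Lemma Rintegral_FTC2 f F a b : a <= b -> continuous f ->
  (forall x, is_derive x (1 : R) F (f x)) ->
  \int[leb]_(x in `[a, b]) f x = F b - F a.
Proof.
rewrite le_eqVlt => /predU1P[-> _ _|ab cf dF].
  by rewrite set_itv1 Rintegral_set1 subrr.
have cF : continuous F.
  move=> x; apply: differentiable_continuous.
  by apply/derivable1_diffP; apply: ex_derive; exact: dF.
rewrite /Rintegral (@continuous_FTC2 _ f F)//.
- exact: continuous_subspaceT.
- split; first by move=> x _; apply: ex_derive; exact: dF.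
  + exact/cvg_at_right_filter/cF.
  + exact/cvg_at_left_filter/cF.
- by move=> x _; rewrite derive1E; apply: derive_val; exact: dF.
Qed.

End real_integral.

(** * The sine basis *)

Section sine_basis.
Context {R : realType}.
Local Notation leb := (@lebesgue_measure R).
Local Notation mu := (mu01 R).

Definition sinek (k : nat) (x : R) : R := Num.sqrt 2 * sin (k%:R * pi * x).

Lemma sin_natpi (k : nat) : sin (k%:R * pi) = 0 :> R.
Proof.
elim: k => [|k IH]; first by rewrite mul0r sin0.
by rewrite -natr1 mulrDl mul1r sinDpi IH oppr0.
Qed.

Lemma continuous_sinek k : continuous (sinek k).
Proof.
move=> x; apply: cvgM; first exact: cvg_cst.
apply: continuous_comp; last exact: continuous_sin.
by apply: cvgM; [exact: cvg_cst|exact: cvg_id].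
Qed.

Lemma measurable_sinek k : measurable_fun setT (sinek k).
Proof. by apply: continuous_measurable_fun; exact: continuous_sinek. Qed.

Lemma ge0_integral_mu01 (f : R -> \bar R) : (forall x, 0 <= f x)%E ->
  (\int[mu]_x f x = \int[leb]_(x in `]0%R, 1%R[) f x)%E.
Proof. exact: (@ge0_integral_mrestr _ _ _ leb _ (measurable_itv `]0%R, 1%R[)). Qed.

Lemma integral_mu01 (f : R -> \bar R) :
  (\int[mu]_x f x = \int[leb]_(x in `]0%R, 1%R[) f x)%E.
Proof. by rewrite integralE [RHS]integralE !ge0_integral_mu01. Qed.

Lemma Rintegral_mu01 (f : R -> R) : continuous f ->
  \int[mu]_x f x = \int[leb]_(x in `[0%R, 1%R]) f x.
Proof.
move=> cf; rewrite /Rintegral integral_mu01; congr fine.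
rewrite integral_itv_bndo_bndc; last first.
  by apply/measurable_EFinP; apply: measurable_funTS; exact: continuous_measurable_fun.
rewrite integral_itv_obnd_cbnd//.
by apply/measurable_EFinP; apply: measurable_funTS; exact: continuous_measurable_fun.
Qed.

Lemma inner_eigf_int k (u : H01 R) :
  inner (eigf k) u = \int[mu]_x (sinek k x * L2_fun u x).
Proof.
rewrite /inner /L2_inner /Rintegral; congr fine; apply: ae_eq_integral => //.
- by apply/measurable_EFinP; exact: measurable_funM.
- apply/measurable_EFinP; apply: measurable_funM => //; exact: measurable_sinek.
- by apply: filterS (eigfE (R := R) k) => x -> _.
Qed.

Lemma Rint_cos_natpi (c : R) : c != 0 -> sin (c * pi) = 0 ->
  \int[leb]_(x in `[0%R, 1%R]) cos (c * pi * x) = 0.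
Proof.
move=> c0 sc.
have ccos : continuous (fun x : R => cos (c * pi * x)).
  move=> x; apply: continuous_comp; last exact: continuous_cos.
  by apply: cvgM; [exact: cvg_cst|exact: cvg_id].
have dF (x : R) : is_derive x (1 : R) (fun x => (c * pi)^-1 * sin (c * pi * x)) (cos (c * pi * x)).
  apply: is_derive_eq; rewrite /GRing.scale/= mulr1.
  by rewrite mulrCA mulVf ?mulr1// mulf_neq0// gt_eqF// pi_gt0.
rewrite (@Rintegral_FTC2 _ _ _ 0 1 ler01 ccos dF).
by rewrite mulr1 sc !mulr0 sin0 mulr0 subrr.
Qed.

Lemma inner_eigf (j k : nat) : (0 < j)%N -> (0 < k)%N ->
  inner (eigf j) (eigf k : H01 R) = (j == k)%:R.
Proof.
move=> j0 k0; rewrite inner_eigf_int.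
have -> : \int[mu]_x (sinek j x * L2_fun (eigf k) x) =
          \int[mu]_x (sinek j x * sinek k x).
  rewrite /Rintegral; congr fine; apply: ae_eq_integral => //.
  - apply/measurable_EFinP; apply: measurable_funM => //; exact: measurable_sinek.
  - by apply/measurable_EFinP; apply: measurable_funM => //; exact: measurable_sinek.
  - by apply: filterS (eigfE (R := R) k) => x -> _.
rewrite Rintegral_mu01; last first.
  by move=> x; apply: cvgM; exact: continuous_sinek.
have ccos (c : R) : continuous (fun x => cos (c * pi * x)).
  move=> x; apply: continuous_comp; last exact: continuous_cos.
  by apply: cvgM; [exact: cvg_cst|exact: cvg_id].
have -> : \int[leb]_(x in `[0%R, 1%R]) (sinek j x * sinek k x) =
    \int[leb]_(x in `[0%R, 1%R]) (cos ((j%:R - k%:R) * pi * x) - cos ((j%:R + k%:R) * pi * x)).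
  apply: eq_Rintegral => x _; rewrite /sinek mulrBl mulrBl mulrDl mulrDl cosB cosD.
  rewrite mulrACA -expr2 sqr_sqrtr//; ring.
rewrite RintegralB//; [|exact: continuous_itv_integrable..].
rewrite (@Rint_cos_natpi (j%:R + k%:R)); last 2 first.
- by rewrite -natrD pnatr_eq0 addn_eq0 negb_and -lt0n j0.
- by rewrite -natrD sin_natpi.
rewrite subr0; have [->|jk] := eqVneq j k.
  rewrite subrr; under eq_Rintegral do rewrite !mul0r cos0.
  rewrite Rintegral_cst//= lebesgue_measure_itv/= lte_fin ltr01 oppr0 adde0.
  by rewrite mul1r.
rewrite Rint_cos_natpi//; first by rewrite subr_eq0 eqr_nat.
by rewrite mulrBl sinB !sin_natpi mul0r mulr0 subrr.
Qed.

Lemma bounded_sin_cos_poly (k : nat) (q : {poly R}) :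
  [bounded sin (k%:R * pi * x) * q.[cos (pi * x)] | x in [set: R]].
Proof.
exists (\sum_(i < size q) `|q`_i|); split; first exact: num_real.
move=> M /ltW qM x _ /=; apply: le_trans qM.
rewrite normrM horner_coef; apply: (@le_trans _ _ (1 * `|\sum_(i < size q) q`_i * cos (pi * x) ^+
  i|)).
  by apply: ler_wpM2r => //; rewrite ler_norml sin_le1 sin_geN1.
rewrite mul1r; apply: (le_trans (ler_norm_sum _ _ _)); apply: ler_sum => i _.
rewrite normrM ler_piMr// normrX exprn_ile1//.
by rewrite ler_norml cos_le1 cos_geN1.
Qed.

Lemma measurable_sin_cos_poly (k : nat) (q : {poly R}) :
  measurable_fun setT (fun x : R => sin (k%:R * pi * x) * q.[cos (pi * x)]).
Proof.
apply: continuous_measurable_fun => x; apply: cvgM.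
  apply: continuous_comp; last exact: continuous_sin.
  by apply: cvgM; [exact: cvg_cst|exact: cvg_id].
apply: (@continuous_comp _ _ _ (fun x => cos (pi * x)) (fun y => q.[y])).
  apply: continuous_comp; last exact: continuous_cos.
  by apply: cvgM; [exact: cvg_cst|exact: cvg_id].
exact: continuous_horner.
Qed.

Lemma mu01_fin : mu setT \is a fin_num.
Proof.
by rewrite /mu01 /mrestr setTI lebesgue_measure_itv/= lte_fin ltr01 oppr0 adde0.
Qed.

Lemma L2_fun_integrable (u : H01 R) : mu.-integrable setT (EFin \o L2_fun u).
Proof. by apply/Lfun1_integrable; apply: Lfun_subset12; [exact: mu01_fin|exact: LfunP]. Qed.

Lemma integrable_sin_cos_poly (u : H01 R) (k : nat) (q : {poly R}) :
  mu.-integrable setT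
    (EFin \o (fun x => (sin (k%:R * pi * x) * q.[cos (pi * x)]) * L2_fun u x)).
Proof.
have := integrableMr (mu := mu) measurableT (measurable_sin_cos_poly k q)
  (bounded_sin_cos_poly k q) (L2_fun_integrable u).
by apply: eq_integrable.
Qed.

(** Multiplication by cos (pi x) turns sin (k pi x) into the mean of its neighbours of index k - 1
    and k + 1, so orthogonality to all sines propagates by induction on the polynomial. *)
Lemma Rint_sin_cos_poly (u : H01 R) :
  (forall k, (0 < k)%N -> inner (eigf k) u = 0) ->
  forall (q : {poly R}) (k : nat),
  \int[mu]_x ((sin (k%:R * pi * x) * q.[cos (pi * x)]) * L2_fun u x) = 0.
Proof.
move=> u0; elim/poly_ind => [|q c IH] k.
  under eq_Rintegral do rewrite horner0 mulr0 mul0r.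
  by rewrite /Rintegral integral0.
have I0 j : \int[mu]_x (sin (j%:R * pi * x) * L2_fun u x) = 0.
  case: j => [|j].
    under eq_Rintegral do rewrite !mul0r sin0 mul0r.
    by rewrite /Rintegral integral0.
  have := u0 j.+1 isT; rewrite inner_eigf_int /sinek.
  rewrite (_ : \int[mu]_x _ = \int[mu]_x (Num.sqrt 2 * (sin (j.+1%:R * pi * x) * L2_fun u x)));
    last first.
    by apply: eq_Rintegral => x _; rewrite mulrA.
  rewrite RintegralZl//; last first.
    have := integrable_sin_cos_poly u j.+1 1%:P.
    by apply: eq_integrable => // x _; rewrite /= hornerC mulr1.
  by move/eqP; rewrite mulf_eq0 sqrtr_eq0 leNgt ltr0n/= => /eqP.
case: k => [|k].
  under eq_Rintegral do rewrite !mul0r sin0 !mul0r.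
  by rewrite /Rintegral integral0.
pose g j x := (sin (j%:R * pi * x) * q.[cos (pi * x)]) * L2_fun u x.
have ig j : mu.-integrable setT (EFin \o g j) by exact: integrable_sin_cos_poly.
have is0 j : mu.-integrable setT (EFin \o (fun x => sin (j%:R * pi * x) * L2_fun u x)).
  have := integrable_sin_cos_poly u j 1%:P.
  by apply: eq_integrable => // x _; rewrite /= hornerC mulr1.
transitivity (\int[mu]_x ((2^-1 * g k.+2 x + 2^-1 * g k x) + c * (sin (k.+1%:R * pi * x) * L2_fun
  u x))).
  apply: eq_Rintegral => x _; rewrite /g hornerMXaddC.
  have -> : k.+2%:R * pi * x = k.+1%:R * pi * x + pi * x by rewrite -[k.+2%:R]natr1; ring.
  have -> : k%:R * pi * x = k.+1%:R * pi * x - pi * x by rewrite -[k.+1%:R]natr1; ring.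
  by rewrite sinD sinB; field.
have iZ (a : R) f : mu.-integrable setT (EFin \o f) ->
  mu.-integrable setT (EFin \o (fun x => a * f x)).
  by move=> fi; have := integrableZl measurableT a fi; apply: eq_integrable.
have iD f1 f2 : mu.-integrable setT (EFin \o f1) -> mu.-integrable setT (EFin \o f2) ->
    mu.-integrable setT (EFin \o (fun x => f1 x + f2 x)).
  by move=> f1i f2i; have := integrableD measurableT f1i f2i; apply: eq_integrable.
rewrite RintegralD//; [|by apply: iD; exact: iZ|exact: iZ].
rewrite RintegralD//; [|exact: iZ..].
by rewrite !RintegralZl// /g !IH I0 !mulr0 !addr0.
Qed.

Lemma ae_mu01 (Q : R -> Prop) :
  {ae leb, forall x, 0 < x < 1 -> Q x} -> {ae mu, forall x, Q x}.
Proof.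
case=> A [mA A0 QA]; exists (A `|` ~` `]0, 1[%classic); split.
- by apply: measurableU => //; apply: measurableC; exact: measurable_itv.
- apply/eqP; rewrite eq_le measure_ge0 andbT /mu01 /mrestr -A0.
  apply: le_measure; rewrite ?inE//.
    apply: measurableI; last exact: measurable_itv.
    by apply: measurableU => //; apply: measurableC; exact: measurable_itv.
  by move=> x [[//|nx] xx]; case: nx.
- move=> x /= nQ; have [x01|x01] := pselect (0 < x < 1).
    by left; apply: QA => /=; move/(_ x01).
  by right; rewrite /= in_itv/=.
Qed.

Lemma bernoulli_ineq (x : R) (n : nat) : -1 <= x -> 1 + n%:R * x <= (1 + x) ^+ n.
Proof.
move=> x1; elim: n => [|n IH]; first by rewrite mul0r addr0 expr0.
rewrite exprS; apply: le_trans (ler_wpM2l _ IH); last by lra.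
rewrite -natr1; have := sqr_ge0 x; have : 0 <= n%:R * x ^+ 2 by rewrite mulr_ge0// sqr_ge0.
lra.
Qed.

(** The powers [(1 - t ^+ n) ^+ (2 ^ n)] are polynomials in [t] approaching a step at [t = 2^-1], a
    building block of elementary proofs of the Weierstrass theorem. Below the jump, Bernoulli bounds
    the defect by [(2 * t) ^+ n]. *)
Lemma cvg_pow_step_lt (t : R) : 0 <= t < 2^-1 ->
  (1 - t ^+ n) ^+ (2 ^ n) @[n --> \oo] --> (1 : R).
Proof.
move=> /andP[t0 t2].
apply: (@squeeze_cvgr _ _ _ _ (fun n => 1 - (2 * t) ^+ n) (cst 1)).
- apply: nearW => n; have tn1 : 0 <= t ^+ n <= 1.
    by rewrite exprn_ge0//= exprn_ile1//; lra.
  apply/andP; split; last by rewrite exprn_ile1//; lra.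
  have := @bernoulli_ineq (- t ^+ n) (2 ^ n); rewrite mulrN natrX -exprMn; apply.
  lra.
- rewrite -[X in _ --> X]subr0; apply: (@cvgB _ R^o); first exact: cvg_cst.
  by apply: cvg_expr; rewrite ger0_norm; lra.
- exact: cvg_cst.
Qed.

Lemma cvg_pow_step_gt (t : R) : 2^-1 < t <= 1 ->
  (1 - t ^+ n) ^+ (2 ^ n) @[n --> \oo] --> (0 : R).
Proof.
move=> /andP[t2 t1].
apply: (@squeeze_cvgr _ _ _ _ (cst 0) (fun n => ((2 * t)^-1) ^+ n)).
- apply: nearW => n; have tn1 : 0 <= t ^+ n <= 1.
    by rewrite exprn_ge0//= ?exprn_ile1//; lra.
  apply/andP; split; first by rewrite exprn_ge0//; lra.
  have t2n : 0 < (2 * t) ^+ n by rewrite exprn_gt0//; lra.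
  rewrite exprVn -[leRHS]mul1r ler_pdivlMr//.
  (* Bernoulli for the conjugate factor; its product with the power to be estimated is a power of 1
     - t^(2n), hence at most 1. *)
  have h : (2 * t) ^+ n <= (1 + t ^+ n) ^+ (2 ^ n).
    have := @bernoulli_ineq (t ^+ n) (2 ^ n); rewrite natrX -exprMn => hh.
    by apply: le_trans (hh _); lra.
  apply: le_trans (ler_wpM2l _ h) _; first by rewrite exprn_ge0//; lra.
  rewrite -exprMn exprn_ile1//; first by rewrite mulr_ge0; lra.
  have := sqr_ge0 (t ^+ n); lra.
- exact: cvg_cst.
- by apply: cvg_expr; rewrite ger0_norm ?invr_ge0 ?invf_lt1//; lra.
Qed.

(** Polynomials in cos (pi x) approximate the indicator of x <= b: the cosine decreases on [0, pi],
    so an affine function of it crosses [2^-1] exactly at [b]. The polynomials stay between 0 and 1,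
    so dominated convergence applies. *)
Lemma Rint_sin_le (u : H01 R) (b : R) :
  (forall k, (0 < k)%N -> inner (eigf k) u = 0) -> 0 < b < 1 ->
  (\int[mu]_x (sin (pi * x) * L2_fun u x * \1_(`]-oo, b]%classic) x)%:E = 0)%E.
Proof.
move=> u0 /andP[b0 b1].
pose a := cos (pi * b).
pose q n : {poly R} := (1 - ((a / 4 + 2^-1)%:P - 4^-1 *: 'X) ^+ n) ^+ (2 ^ n).
(* The division by 4 keeps [t] within [0, 1], and [t b = 2^-1]. *)
pose t x := (a - cos (pi * x)) / 4 + 2^-1.
have qE n x : (q n).[cos (pi * x)] = (1 - t x ^+ n) ^+ (2 ^ n).
  rewrite /q !(hornerE, horner_exp) /t; congr ((1 - _ ^+ _) ^+ _); ring.
have t01 x : 0 <= t x <= 1.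
  have := cos_le1 (pi * x); have := cos_geN1 (pi * x).
  by rewrite /t /a; have := cos_le1 (pi * b); have := cos_geN1 (pi * b); lra.
pose f n x := sin (1%:R * pi * x) * (q n).[cos (pi * x)] * L2_fun u x.
have fi n : mu.-integrable setT (EFin \o f n) by exact: integrable_sin_cos_poly.
pose g x := (sin (pi * x) * L2_fun u x * \1_(`]-oo, b]%classic) x)%:E.
have mg : measurable_fun setT g.
  apply/measurable_EFinP; apply: measurable_funM; last exact: measurable_indic.
  apply: measurable_funM; last first.
    by apply/measurable_EFinP; exact: measurable_int (L2_fun_integrable u).
  apply: continuous_measurable_fun => x; apply: continuous_comp; last exact: continuous_sin.
  by apply: cvgM; [exact: cvg_cst|exact: cvg_id].
have fg : {ae mu, forall x, setT x -> (EFin \o f n) x @[n --> \oo] --> g x}.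
  have nb : {ae leb, forall x, x != b}.
    exists [set b]; split => //; first exact: lebesgue_measure_set1.
    by move=> x /= /negP; rewrite negbK => /eqP.
  apply: ae_mu01; apply: ae_imply nb => x xb /andP[x0 x1] _.
  have pi0 := pi_gt0 R.
  apply: cvg_EFin; first exact: nearW.
  rewrite (_ : _ \o _ = (fun n => (sin (pi * x) * L2_fun u x) * (1 - t x ^+ n) ^+ (2 ^ n)));
    last first.
    by apply/funext => n; rewrite /f /= qE mul1r; ring.
  apply: cvgM; first exact: cvg_cst.
  have ltc (y z : R) : 0 < y < 1 -> 0 < z < 1 -> y < z -> cos (pi * z) < cos (pi * y).
    move=> /andP[y0 y1] /andP[z0 z1] yz.
    by rewrite ltr_cos ?ltr_pM2l// in_itv/= ?mulr_ge0 ?ler_piMr ?ltW.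
  rewrite indicE; case: (ltgtP x b) xb => // xb _.
    rewrite mem_set/=; last by rewrite in_itv/= ltW.
    apply: cvg_pow_step_lt; have := t01 x; rewrite /t /a.
    have := ltc x b; rewrite b0 b1 x0 x1 => /(_ isT isT xb); lra.
  rewrite memNset/=; last by rewrite in_itv/= leNgt xb.
  apply: cvg_pow_step_gt; have := t01 x; rewrite /t /a.
  have := ltc b x; rewrite b0 b1 x0 x1 => /(_ isT isT xb); lra.
have fb : {ae mu, forall x n, setT x -> (`|(EFin \o f n) x| <= `|(L2_fun u x)%:E|)%E}.
  apply: nearW => x n _; rewrite /= lee_fin /f normrM ler_piMl// normrM.
  rewrite mulr_ile1// ?ler_norml ?sin_le1 ?sin_geN1//.
  rewrite qE; have := t01 x => /andP[tx0 tx1].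
  have tn : 0 <= t x ^+ n <= 1 by rewrite exprn_ge0//= exprn_ile1.
  have : 0 <= (1 - t x ^+ n) ^+ (2 ^ n) <= 1 by rewrite exprn_ge0 ?exprn_ile1//; lra.
  lra.
have [_ _] := dominated_convergence measurableT (fun n => measurable_int _ (fi n)) mg fg
  (integrable_abse (L2_fun_integrable u)) fb.
rewrite (_ : (fun n => _) = cst 0%E).
  by move=> h; apply: (cvg_unique _ h) => //; exact: cvg_cst.
apply/funext => n; have := Rint_sin_cos_poly u0 (q n) 1%N.
  rewrite /Rintegral => h; rewrite -(fineK (integrable_fin_num measurableT (fi n)))//=.
  by rewrite h.
Qed.

(** The function sin (pi x) u(x), extended by zero, has vanishing integral over every half-line
    []-oo, y]]. Lebesgue differentiation makes it vanish almost everywhere, and the sine is positive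
    inside the interval. *)
Lemma eigf_total (u : H01 R) :
  (forall k, (0 < k)%N -> inner (eigf k) u = 0) -> u = 0.
Proof.
move=> u0; pose g x := sin (pi * x) * L2_fun u x.
have gi : mu.-integrable setT (EFin \o g).
  have := integrable_sin_cos_poly u 1 1%:P.
  by apply: eq_integrable => // x _; rewrite /= hornerC mulr1 mul1r.
have mg : measurable_fun setT (EFin \o g) by exact: measurable_int gi.
have gi01 : leb.-integrable `]0, 1[ (EFin \o g).
  apply/integrableP; split; first exact: measurable_funTS.
  by rewrite -ge0_integral_mu01//; case/integrableP : gi.
pose h : R -> R := g \_ `]0, 1[.
have hE : EFin \o h = (EFin \o g) \_ `]0, 1[.
  by apply/funext => x; rewrite /h /= !patchE; case: ifP.
have hi : leb.-integrable setT (EFin \o h) by rewrite hE -integrable_mkcond.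
have F0 y : \int[leb]_(x in `]-oo, y]) h x = 0.
  rewrite /Rintegral (_ : \int[leb]_(x in `]-oo, y]) (h x)%:E = 0)%E//.
  transitivity (\int[leb]_(x in `]-oo, y]) ((EFin \o g) \_ `]0%R, 1%R[) x)%E; first by rewrite -hE.
  rewrite -integral_mkcondr.
  have [y0|y0] := leP y 0.
    rewrite (_ : _ `&` _ = set0) ?integral_set0//.
    apply/seteqP; split => x //= []; rewrite !in_itv/= => xy /andP[x0 _].
    by have := le_lt_trans (le_trans xy y0) x0; rewrite ltxx.
  have [y1|y1] := ltP y 1.
    have := @Rint_sin_le u y u0; rewrite y0 y1 => /(_ isT).
    rewrite integral_mu01 => <-.
    rewrite setIC integral_mkcondr; apply: eq_integral => x _.
    by rewrite patchE indicE; case: ifPn => _ /=; rewrite ?mulr1 ?mulr0.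
  rewrite (_ : _ `&` _ = `]0, 1[%classic); last first.
    apply/seteqP; split => x //=; first by case.
    move=> x01; split => //; move: x01; rewrite !in_itv/= => /andP[_ /ltW x1].
    exact: le_trans x1 y1.
  rewrite -integral_mu01.
  have := Rint_sin_cos_poly u0 1%:P 1; rewrite /Rintegral => h1.
  rewrite -(fineK (integrable_fin_num measurableT gi)) -[RHS]/(0%:E) -[in RHS]h1; congr (fine _)%:E.
  by apply: eq_integral => x _; rewrite hornerC mulr1 mul1r.
have h0 : {ae leb, forall x, h x = 0}.
  have := @FTC1Ny R h.
  case.
  - by move=> y; apply: integrableS hi => //; exact: measurable_itv.
  - by apply: open_integrable_locally => //; exact: openT.
  move=> A [mA A0 hA]; exists A; split => // x hx; apply: hA => /= -[_ Fh].
  apply: hx; rewrite /= -Fh (_ : (fun x => _) = cst 0); last exact/funext.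
  by rewrite derive1E derive_cst.
apply/normr0_eq0/eqP; rewrite -sqrf_eq0; apply/eqP/EFin_inj.
rewrite (L2_ae_norm (f := cst 0))//; first by under eq_integral do rewrite /= expr0n/=;
  rewrite integral0.
have f0 : {ae mu, forall x, L2_fun u x = 0}.
  apply: ae_mu01; apply: ae_imply h0 => x; rewrite /h patchE => hx x01.
  move: hx; rewrite mem_set/= ?in_itv//= => /eqP; rewrite mulf_eq0 => /orP[|/eqP//].
  case/andP : x01 => x0 x1; rewrite gt_eqF// sin_gt0_pi// mulr_gt0 ?pi_gt0//=.
  by rewrite -[ltRHS]mulr1 ltr_pM2l// pi_gt0.
by apply: filterS f0.
Qed.

End sine_basis.

Section hsum.
Context {R : realType}.
Local Notation H := (H01 R).
Implicit Types (a b : nat -> R) (u v : H).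

Definition hsum a : H := limn (fun n => \sum_(1 <= k < n.+1) a k *: eigf k).
Definition ssq a : \bar R := (\sum_(1 <= k <oo) (a k ^+ 2)%:E)%E.
Definition coef (k : nat) u : R := inner (eigf k) u.

Lemma inner_eigf_sum a (m n j : nat) : (0 < m)%N -> (0 < j)%N ->
  coef j (\sum_(m <= k < n) a k *: eigf k : H) = if (m <= j < n)%N then a j else 0.
Proof.
move=> m0 j0; rewrite /coef /inner L2_inner_sumr.
rewrite (eq_big_nat _ _ (F2 := fun k => (if k == j then a k else 0))); last first.
  move=> k /andP[mk kn]; rewrite L2_innerZr [L2_inner _ _]inner_eigf//; last exact: leq_trans mk.
  by rewrite eq_sym; case: eqP; rewrite ?mulr1 ?mulr0.
case: ifPn => [jmn|jmn].
  rewrite (bigD1_seq j)/= ?mem_index_iota ?iota_uniq// eqxx.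
  by rewrite big1 ?addr0// => k /negbTE ->.
rewrite big_nat big1// => k kmn; case: eqP => // kj; move: jmn.
by rewrite -kj kmn.
Qed.

Lemma norm_eigf_sum a (m n : nat) : (0 < m)%N ->
  `|\sum_(m <= k < n) a k *: eigf k : H| ^+ 2 = \sum_(m <= k < n) a k ^+ 2.
Proof.
move=> m0; rewrite -L2_inner_norm L2_inner_suml; apply: eq_big_nat => k /andP[mk kn].
rewrite L2_innerZl -[L2_inner _ _]/(coef k _) inner_eigf_sum//; last exact: leq_trans mk.
by rewrite mk kn -expr2.
Qed.

Lemma ssq_ge0 a : (0 <= ssq a)%E.
Proof. by apply: nneseries_ge0 => k _ _; rewrite lee_fin sqr_ge0. Qed.

Lemma cvg_ssq a : ((\sum_(1 <= k < n.+1) a k ^+ 2)%:E) @[n --> \oo] --> ssq a.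
Proof.
have : (\sum_(1 <= k < n) (a k ^+ 2)%:E)%E @[n --> \oo] --> ssq a.
  by apply: is_cvg_nneseries => k _ _; rewrite lee_fin sqr_ge0.
move=> h A /h [N _ HN]; exists N => // n Nn.
by have := HN n.+1 (leqW Nn); rewrite /= sumEFin.
Qed.

Lemma ssq_lim a (l : R) :
  (\sum_(1 <= k < n.+1) a k ^+ 2) @[n --> \oo] --> l -> ssq a = l%:E.
Proof.
move=> al; apply: (cvg_unique _ (@cvg_ssq a)) => //.
by apply: cvg_EFin => //; exact: nearW.
Qed.

Lemma ssq_le a b : (forall k, (0 < k)%N -> `|a k| <= `|b k|) -> (ssq a <= ssq b)%E.
Proof.
move=> ab; apply: lee_lim.
- by apply: is_cvg_nneseries => k _ _; rewrite lee_fin sqr_ge0.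
- by apply: is_cvg_nneseries => k _ _; rewrite lee_fin sqr_ge0.
apply: nearW => n; rewrite !sumEFin lee_fin; apply: ler_sum_nat => k /andP[k0 _].
by rewrite -(real_normK (num_real (a k))) -(real_normK (num_real (b k))) ler_pXn2r ?nnegrE// ab.
Qed.

(** The squared norm of a block of the series is the same block of [ssq a], so the partial sums are
    Cauchy. *)
Lemma cvg_hsum a : (ssq a < +oo)%E ->
  \sum_(1 <= k < n.+1) a k *: eigf k @[n --> \oo] --> hsum a.
Proof.
move=> afin; apply: L2_complete => e e0.
have af : ssq a \is a fin_num by rewrite ge0_fin_numE// ssq_ge0.
have := @cvg_ssq a; rewrite -(fineK af) => /fine_cvgP[_] /cvgrPdist_le.
move=> /(_ (e ^+ 2 / 2)); case; first by rewrite divr_gt0// exprn_gt0.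
move=> N _ HN; exists N.
suff key m n : (N <= m)%N -> (m <= n)%N ->
    `|\sum_(1 <= k < m.+1) a k *: eigf k - \sum_(1 <= k < n.+1) a k *: eigf k : H| <= e.
  move=> m n Nm Nn; case: (leqP m n) => mn; first exact: key.
  by rewrite distrC; apply: key => //; exact: ltnW.
move=> Nm mn; rewrite distrC (@big_cat_nat _ _ _ m.+1 1 n.+1)//= addrAC subrr add0r.
rewrite -(@ler_pXn2r _ 2) ?nnegrE ?(ltW e0)// norm_eigf_sum//.
have := HN _ Nm; have := HN _ (leq_trans Nm mn); rewrite /= (@big_cat_nat _ _ _ m.+1 1 n.+1)//=.
by rewrite !ler_norml; lra.
Qed.

Lemma coef_hsum a j : (ssq a < +oo)%E -> (0 < j)%N -> coef j (hsum a) = a j.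
Proof.
move=> afin j0; have h := @cvg_L2_inner _ _ _ _ \oo _ _ _ _ _ (cvg_cst (eigf j :
  H)) (cvg_hsum afin).
rewrite /coef /inner -(cvg_lim _ (h _ _))//; apply/cvg_lim => //; apply: cvg_near_cst.
exists j => // n /= jn; rewrite -[L2_inner _ _]/(coef j _) inner_eigf_sum//.
by rewrite j0 ltnS jn.
Qed.

Lemma norm_hsum a : (ssq a < +oo)%E -> (`|hsum a| ^+ 2)%:E = ssq a.
Proof.
move=> afin; apply/esym/ssq_lim.
under eq_fun do rewrite -norm_eigf_sum//.
apply: (cvg_comp (fun n => `|\sum_(1 <= k < n.+1) a k *: eigf k : H|) (fun y => y ^+ 2));
  last exact: sqr_continuous.
by apply: cvg_norm; exact: cvg_hsum.
Qed.

Lemma ssq_fin a n : (forall k, (n < k)%N -> a k = 0) ->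
  ssq a = (\sum_(1 <= k < n.+1) a k ^+ 2)%:E.
Proof.
move=> a0; apply: ssq_lim; apply: cvg_near_cst; exists n => // m /= nm.
rewrite (@big_cat_nat _ _ _ n.+1)//= [X in _ + X = _](_ : _ = 0) ?addr0//.
by rewrite big_nat big1// => k /andP[nk _]; rewrite a0// expr0n.
Qed.

(** Totality of the sines reduces an equality in [H] to its coordinates; most identities between
    elements of [H] below are proved this way. *)
Lemma coef_inj u v : (forall k, (0 < k)%N -> coef k u = coef k v) -> u = v.
Proof.
move=> uv; apply/subr0_eq/eigf_total => k k0.
by rewrite /inner L2_innerBr; apply/eqP; rewrite subr_eq0; apply/eqP; exact: uv.
Qed.

Lemma coefD k u v : coef k (u + v) = coef k u + coef k v.
Proof. exact: L2_innerDr. Qed.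
Lemma coefB k u v : coef k (u - v) = coef k u - coef k v.
Proof. exact: L2_innerBr. Qed.
Lemma coefZ k c u : coef k (c *: u) = c * coef k u.
Proof. exact: L2_innerZr. Qed.
Lemma coef0 k : coef k (0 : H) = 0.
Proof. exact: L2_inner0r. Qed.

Lemma bessel u n : \sum_(1 <= k < n.+1) coef k u ^+ 2 <= `|u| ^+ 2.
Proof.
set v := \sum_(1 <= k < n.+1) coef k u *: eigf k : H.
have vv : `|v| ^+ 2 = \sum_(1 <= k < n.+1) coef k u ^+ 2 by rewrite norm_eigf_sum.
have uv : L2_inner u v = \sum_(1 <= k < n.+1) coef k u ^+ 2.
  rewrite L2_inner_sumr; apply: eq_big_nat => k /andP[k0 kn].
  by rewrite L2_innerZr L2_innerC -expr2.
have := sqr_ge0 (`|u - v|); rewrite L2_normD_sqr normrN L2_innerNr vv uv; lra.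
Qed.

Lemma coef_ssq_lty u : (ssq (coef^~ u) < +oo)%E.
Proof.
apply: (@le_lt_trans _ _ (`|u| ^+ 2)%:E); last exact: ltry.
rewrite -(cvg_lim _ (@cvg_ssq (coef^~ u)))//; apply: lime_le.
  by apply/cvg_ex; eexists; exact: cvg_ssq.
by apply: nearW => n; rewrite lee_fin bessel.
Qed.

Lemma hsum_coef u : hsum (coef^~ u) = u.
Proof. by apply: coef_inj => k k0; rewrite coef_hsum// coef_ssq_lty. Qed.

Lemma parseval u : (`|u| ^+ 2)%:E = ssq (coef^~ u).
Proof. by rewrite -norm_hsum ?hsum_coef// coef_ssq_lty. Qed.

Lemma sqr_coef_le k u : (0 < k)%N -> `|coef k u| <= `|u|.
Proof.
move=> k0; apply: (le_trans (L2_cauchy_schwarz _ _)).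
have -> : `|eigf k : H| = 1; last by rewrite mul1r.
by apply/eqP; rewrite -(@pexpr_eq1 _ _ 2)// -L2_inner_norm [L2_inner _ _]inner_eigf// eqxx.
Qed.

Lemma PnE n u : Pn n u = \sum_(1 <= k < n.+1) coef k u *: eigf k.
Proof. by []. Qed.

Lemma coef_Pn n u k : (0 < k)%N -> coef k (Pn n u) = if (k <= n)%N then coef k u else 0.
Proof. by move=> k0; rewrite PnE inner_eigf_sum// k0 ltnS. Qed.

Lemma range_PnP n u : range (Pn n) u <-> forall k, (n < k)%N -> coef k u = 0.
Proof.
split=> [[v _ <-] k nk|u0].
  by rewrite coef_Pn ?(leq_ltn_trans _ nk)// leqNgt nk.
exists u => //; apply: coef_inj => k k0; rewrite coef_Pn//.
by case: leqP => // nk; rewrite u0.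
Qed.

Lemma Pn_id n u : range (Pn n) u -> Pn n u = u.
Proof.
move=> /range_PnP u0; apply: coef_inj => k k0; rewrite coef_Pn//.
by case: leqP => // nk; rewrite u0.
Qed.

Lemma range_eigf_sum a n : range (Pn n) (\sum_(1 <= k < n.+1) a k *: eigf k : H).
Proof.
apply/range_PnP => k nk; rewrite inner_eigf_sum ?(leq_ltn_trans _ nk)//.
by rewrite ltnS leqNgt nk andbF.
Qed.

Lemma diagopE (m : nat -> R) u : diagop m u = hsum (fun k => m k * coef k u).
Proof. by []. Qed.

Lemma HrE c0 r u : Hr c0 r u = (ssq (fun k => (lam c0 k `^ r * coef k u)%R) < +oo)%E.
Proof.
rewrite /Hr /=; congr (_ < _)%E; rewrite /ssq; apply: eq_eseriesr => k _.
by rewrite real_normK ?num_real.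
Qed.

Lemma Hnorm_sqr c0 r u : Hr c0 r u ->
  ((Hnorm c0 r u) ^+ 2)%:E = ssq (fun k => lam c0 k `^ r * coef k u).
Proof. by rewrite HrE => ur; rewrite -norm_hsum. Qed.

Lemma lam_gt0 (c0 : R) k : 0 < c0 -> (0 < k)%N -> 0 < lam c0 k.
Proof. by move=> c00 k0; rewrite /lam !mulr_gt0 ?exprn_gt0 ?pi_gt0// ltr0n. Qed.

Lemma coef_expA c0 eta t u k : (0 < k)%N -> 0 < c0 -> 0 <= eta -> 0 <= t ->
  coef k (expAsub c0 eta t u) = expR (t * (- lam c0 k - eta)) * coef k u.
Proof.
move=> k0 c00 e0 t0; rewrite /expAsub diagopE coef_hsum//.
apply: le_lt_trans (coef_ssq_lty u); apply: ssq_le => j j0.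
rewrite normrM ler_piMl// ger0_norm ?expR_ge0// -expR0 ler_expR.
by rewrite mulr_ge0_le0// -opprD oppr_le0 addr_ge0// ltW// lam_gt0.
Qed.

End hsum.

(** * Sub-Gaussian Wiener increments *)

Section normal_mgf.
Context {R : realType}.
Local Notation leb := (@lebesgue_measure R).
Variable s : R.
Hypothesis s0 : s != 0.

(** The bound [M] makes [f] integrable, as the change of variables by the Radon-Nikodym derivative
    requires. The derivative is [normal_pdf] because both have the same integral over every
    measurable set. *)
Lemma ge0_integral_normal_prob (f : R -> R) M : measurable_fun setT f ->
  (forall x, 0 <= f x <= M) ->
  (\int[normal_prob 0 s]_x (f x)%:E = \int[leb]_x (f x * normal_pdf 0 s x)%:E)%E.
Proof.
move=> mf fM.
have fi : (normal_prob 0 s).-integrable setT (EFin \o f).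
  apply/integrableP; split; first exact/measurable_EFinP.
  apply: (@le_lt_trans _ _ (\int[normal_prob 0 s]_x (cst M%:E x))%E).
    apply: ge0_le_integralW => x _; first exact: abse_ge0.
    by rewrite /= lee_fin ger0_norm; case/andP : (fM x).
  rewrite integral_cst//= (_ : normal_prob 0 s setT = 1%E) ?mule1 ?ltry//.
  exact: integral_normal_pdf.
rewrite -(Radon_Nikodym_change_of_variables (normal_prob_dominates 0 s) measurableT fi).
apply: ae_eq_integral => //.
- apply: emeasurable_funM => //; first exact/measurable_EFinP.
  by apply: measurable_int; apply: Radon_Nikodym_integrable; exact: normal_prob_dominates.
- apply/measurable_EFinP; apply: measurable_funM => //; exact: measurable_normal_pdf.
- suff : ae_eq leb setT (Radon_Nikodym (charge_of_finite_measure (normal_prob 0 s)) leb)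
      (fun x => (normal_pdf 0 s x)%:E).
    by apply: ae_imply => x fx Tx; rewrite /= fx.
  rewrite Radon_NikodymE//=; first exact: normal_prob_dominates.
  move=> dom; case: cid => /= h [h1 h2 h3].
  apply: integral_ae_eq => //=.
  + by apply/measurable_EFinP; exact: measurable_normal_pdf.
  + by move=> E E01 mE; rewrite -h3.
Qed.

(** Completing the square: the exponential times the centred density is [expR (s ^+ 2 / 2)] times
    the density centred at [s ^+ 2]. Truncation at [n] gives bounded functions, and Fatou removes
    it. *)
Lemma normal_mgf_le :
  (\int[normal_prob 0 s]_x (expR x)%:E <= (expR (s ^+ 2 / 2))%:E)%E.
Proof.
pose f (n : nat) (x : R) := Num.min (expR x) n%:R.
have mf n : measurable_fun setT (f n) by apply: measurable_minr.
have fge n x : 0 <= f n x <= n%:R.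
  by rewrite /f le_min expR_ge0 ler0n/= ge_min lexx orbT.
apply: (@fatou_le _ (measurableTypeR R) R (normal_prob 0 s) setT (fun n x => (f n x)%:E)) => //.
- by move=> n; apply/measurable_EFinP; exact: mf.
- by apply/measurable_EFinP; exact: measurable_expR.
- by move=> n x _; rewrite lee_fin; case/andP : (fge n x).
- apply: nearW => x _; apply: cvg_near_cst.
  exists (Num.truncn (expR x)).+1 => // n /= xn.
  congr EFin; rewrite /f min_l// ltW// (lt_le_trans (truncnS_gt _))//.
  by rewrite ler_nat.
- apply: nearW => n; rewrite (ge0_integral_normal_prob (mf n) (fge n)).
  apply: (@le_trans _ _ (\int[leb]_x ((expR (s ^+ 2 / 2))%:E * (normal_pdf (s ^+ 2) s x)%:E))%E).
    apply: ge0_le_integralW => x _; first by rewrite lee_fin mulr_ge0 ?normal_pdf_ge0//;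
      case/andP : (fge n x).
    rewrite -EFinM lee_fin; apply: (@le_trans _ _ (expR x * normal_pdf 0 s x)).
      by rewrite ler_wpM2r ?normal_pdf_ge0// /f ge_min lexx.
    rewrite !normal_pdfE// mulrCA [leRHS]mulrCA ler_wpM2l ?normal_peak_ge0//.
    rewrite /normal_fun -!expRD ler_expR le_eqVlt; apply/orP; left; apply/eqP.
    by rewrite -mulr_natr; field.
  rewrite ge0_integralZl//=.
  - by rewrite integral_normal_pdf mule1.
  - by apply/measurable_EFinP; exact: measurable_normal_pdf.
  - by move=> x _; rewrite lee_fin normal_pdf_ge0.
Qed.

End normal_mgf.

Section independent_product.
Context {d} {T : measurableType d} {R : realType} (P : probability T R).

(** Independence says that the joint law agrees with the product of the laws on rectangles, hence
    everywhere; Tonelli then splits the integral. *)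
Lemma indep_integralM (X Y : T -> R) (f g : R -> R) :
  measurable_fun setT X -> measurable_fun setT Y ->
  measurable_fun setT f -> measurable_fun setT g ->
  (forall x, 0 <= f x) -> (forall x, 0 <= g x) ->
  (forall A B : set R, measurable A -> measurable B ->
    P (X @^-1` A `&` Y @^-1` B) = (P (X @^-1` A) * P (Y @^-1` B))%E) ->
  (\int[P]_w (f (X w) * g (Y w))%:E =
   \int[P]_w (f (X w))%:E * \int[P]_w (g (Y w))%:E)%E.
Proof.
move=> mX mY mf mg f0 g0 XY.
pose X' : {mfun T >-> R} := HB.pack X (isMeasurableFun.Build _ _ _ _ X mX).
pose Y' : {mfun T >-> R} := HB.pack Y (isMeasurableFun.Build _ _ _ _ Y mY).
pose mXY := measurable_fun_pair mX mY.
pose Z' : {mfun T >-> (R * R)%type} := HB.pack (fun w => (X w, Y w))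
  (isMeasurableFun.Build _ _ _ _ (fun w => (X w, Y w)) mXY).
pose PX := distribution P X'; pose PY := distribution P Y'.
pose PZ := distribution P Z'.
have PE A : measurable A -> (PX \x PY)%E A = PZ A.
  by apply: product_measure_unique => B C mB mC; rewrite -XY.
have mfg : measurable_fun setT (fun z : R * R => (f z.1 * g z.2)%:E).
  apply/measurable_EFinP; apply: measurable_funM.
    exact: measurableT_comp mf measurable_fst.
  exact: measurableT_comp mg measurable_snd.
have fg0 z : (0 <= (f z.1 * g z.2)%:E)%E by rewrite lee_fin mulr_ge0.
transitivity (\int[PZ]_z (f z.1 * g z.2)%:E)%E.
  by rewrite /PZ /distribution ge0_integral_pushforward.
rewrite -(eq_measure_integral _ (fun A mA _ => PE A mA)).
rewrite (fubini_tonelli1 (m1 := PX) (m2 := PY) _ mfg)// /fubini_F.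
have mfE : measurable_fun setT (fun x => (f x)%:E) by exact/measurable_EFinP.
have mgE : measurable_fun setT (fun x => (g x)%:E) by exact/measurable_EFinP.
have fX : (\int[P]_w (f (X w))%:E = \int[PX]_x (f x)%:E)%E.
  by rewrite /PX /distribution (ge0_integral_pushforward mX P measurableT mfE)// => x _;
    rewrite lee_fin.
have gY : (\int[P]_w (g (Y w))%:E = \int[PY]_x (g x)%:E)%E.
  by rewrite /PY /distribution (ge0_integral_pushforward mY P measurableT mgE)// => x _;
    rewrite lee_fin.
have gi0 : (0 <= \int[PY]_y (g y)%:E)%E by apply: integral_ge0 => y _; rewrite lee_fin.
rewrite fX gY -(ge0_integralZr PX measurableT mfE _ gi0); last by move=> x _; rewrite lee_fin.
apply: eq_integral => x _; rewrite -(ge0_integralZl PY measurableT mgE) ?lee_fin//.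
by move=> y _; rewrite lee_fin.
Qed.

End independent_product.

Section wiener_mgf.
Context {R : realType} {d : measure_display} {Omega : measurableType d}.
Variable P : probability Omega R.
Variables (T : R) (W : R -> H01 R -> Omega -> R).
Hypothesis Ww : cylindrical_wiener P T W.
Local Notation H := (H01 R).
Implicit Types L : seq (R * H).

Definition sumW L (w : Omega) : R := \sum_(x <- L) W x.1 x.2 w.
(** The covariance of [W x.1 x.2] and [W y.1 y.2]; thus [qW L] is the variance of [sumW L]. *)
Definition covW (x y : R * H) : R := Num.min x.1 y.1 * inner x.2 y.2.
Definition qW L : R := \sum_(x <- L) \sum_(y <- L) covW x y.

Lemma sumW_cons x L w : sumW (x :: L) w = W x.1 x.2 w + sumW L w.
Proof. by rewrite /sumW big_cons. Qed.

Lemma covWC x y : covW x y = covW y x.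
Proof. by rewrite /covW minC /inner L2_innerC. Qed.

Lemma qW_cons x L : qW (x :: L) = covW x x + 2 * (\sum_(y <- L) covW x y) + qW L.
Proof.
rewrite /qW big_cons big_cons.
under [X in _ + X]eq_bigr do rewrite big_cons.
rewrite big_split/=; under [X in _ + (X + _)]eq_bigr do rewrite covWC.
ring.
Qed.

Lemma W_scale t a g : 0 <= t <= T -> {ae P, forall w, W t (a *: g) w = a * W t g w}.
Proof.
move=> t0; have W0 : {ae P, forall w, W t 0 w = 0}.
  have := cw_linear Ww (1 : R) 0 0 t0; apply: filterS => w.
  by rewrite scaler0 addr0 mul1r => /eqP; rewrite -subr_eq0 opprD addrA subrr sub0r oppr_eq0 =>
    /eqP.
have := cw_linear Ww a g 0 t0; apply: filterS2 W0 => w W0 .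
by rewrite addr0 W0 addr0.
Qed.

Lemma W_add t f g : 0 <= t <= T -> {ae P, forall w, W t (f + g) w = W t f w + W t g w}.
Proof.
by move=> t0; have := cw_linear Ww (1 : R) f g t0; apply: filterS => w; rewrite scale1r mul1r.
Qed.

Lemma W_zero t : 0 <= t <= T -> {ae P, forall w, W t 0 w = 0}.
Proof. by move=> t0; have := W_scale 0 0 t0; apply: filterS => w; rewrite scale0r mul0r. Qed.

Lemma measurable_sumW L : all (fun x => 0 <= x.1 <= T) L -> measurable_fun setT (sumW L).
Proof.
elim: L => [_|x L IH /= /andP[x0 /IH mL]].
  by rewrite (_ : sumW [::] = cst 0)//; apply/funext => w; rewrite /sumW big_nil.
rewrite (_ : sumW (x :: L) = (fun w => W x.1 x.2 w + sumW L w)); last first.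
  by apply/funext => w; exact: sumW_cons.
by apply: measurable_funD => //; exact: (cw_meas Ww).
Qed.

Lemma past_sumW (s : R) L (A : set R) : all (fun x => 0 <= x.1 <= s) L ->
  measurable A -> past W s (sumW L @^-1` A).
Proof.
move=> Ls mA; pose G := [set E | exists u g (Y : set R),
    [/\ 0 <= u <= s, measurable Y & E = W u g @^-1` Y]].
have mW u g : 0 <= u <= s -> measurable_fun (setT : set (g_sigma_algebraType G)) (W u g : _ -> R).
  move=> us _ Y mY; rewrite setTI; apply: sub_sigma_algebra; by exists u, g, Y.
suff mL : measurable_fun (setT : set (g_sigma_algebraType G)) (sumW L : _ -> R).
  by have := mL measurableT A mA; rewrite setTI.
elim: L Ls => [_|x L IH /= /andP[x0 /IH mL]].
  by rewrite (_ : sumW [::] = cst 0)//; apply/funext => w; rewrite /sumW big_nil.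
rewrite (_ : sumW (x :: L) = (fun w => W x.1 x.2 w + sumW L w)); last first.
  by apply/funext => w; exact: sumW_cons.
by apply: measurable_funD => //; exact: mW.
Qed.

Lemma incr_W_mgf a b m : 0 <= a -> a < b -> b <= T -> m != 0 ->
  (\int[P]_w (expR (W b m w - W a m w))%:E <= (expR ((b - a) * `|m| ^+ 2 / 2))%:E)%E.
Proof.
move=> a0 ab bT m0; set s := Num.sqrt (b - a) * `|m|.
have s0 : s != 0 by rewrite mulf_neq0 ?normr_eq0// gt_eqF// sqrtr_gt0 subr_gt0.
have ba0 : 0 <= b - a by rewrite subr_ge0 ltW.
have -> : (b - a) * `|m| ^+ 2 = s ^+ 2 by rewrite exprMn sqr_sqrtr.
apply: le_trans (normal_mgf_le s0).
have mX : measurable_fun setT (fun w => W b m w - W a m w : measurableTypeR R).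
  apply: (@measurable_funB _ Omega R); apply: (cw_meas Ww); rewrite ?a0 ?bT ?andbT/=.
    exact: le_trans a0 (ltW ab).
  exact: le_trans (ltW ab) bT.
have mE : measurable_fun setT (fun x : measurableTypeR R => (expR x)%:E).
  by apply/measurable_EFinP; exact: measurable_expR.
rewrite -(ge0_integral_pushforward mX P measurableT mE); last by move=> x _;
  rewrite lee_fin expR_ge0.
rewrite le_eqVlt; apply/orP; left; apply/eqP; apply: eq_measure_integral => A mA _.
exact: (cw_normal Ww a0 ab bT m0 mA).
Qed.

(** The later increment is independent of [sumW L], so exponential moments multiply. The cases
    [a = b] and [m = 0] are treated apart because [cw_normal] describes nondegenerate increments. *)
Lemma mgf_step a b m L q : 0 <= a -> a <= b -> b <= T -> all (fun x => 0 <= x.1 <= a) L ->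
  (\int[P]_w (expR (sumW L w))%:E <= (expR (q / 2))%:E)%E ->
  (\int[P]_w (expR (sumW L w + (W b m w - W a m w)))%:E <=
    (expR ((q + (b - a) * `|m| ^+ 2) / 2))%:E)%E.
Proof.
move=> a0 ab bT La Lq.
have aT : a <= T by exact: le_trans bT.
have b0 : 0 <= b by exact: le_trans ab.
have mL : measurable_fun setT (sumW L).
  apply: measurable_sumW; apply: sub_all La => x /andP[-> /= xa]; exact: le_trans aT.
move: ab; rewrite le_eqVlt => /predU1P[<-|ab].
  by rewrite subrr mul0r addr0; under eq_integral do rewrite subrr addr0.
have [->|m0] := eqVneq m 0.
  rewrite normr0 expr0n/= mulr0 addr0; apply: le_trans Lq.
  rewrite le_eqVlt; apply/orP; left; apply/eqP.
  apply: ae_eq_integral => //.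
  - apply/measurable_EFinP; apply: measurableT_comp => //; apply: measurable_funD => //.
    by apply: measurable_funB; apply: (cw_meas Ww); rewrite ?a0 ?b0.
  - by apply/measurable_EFinP; exact: measurableT_comp.
  - have := W_zero (t := a); rewrite a0 aT => /(_ isT).
    have := W_zero (t := b); rewrite b0 bT => /(_ isT).
    by apply: filterS2 => w -> -> _; rewrite subrr addr0.
under eq_integral do rewrite expRD.
rewrite (indep_integralM (X := sumW L) (Y := fun w => W b m w - W a m w) (f := expR) (g := expR))//.
- rewrite mulrDl expRD EFinM; apply: lee_pmul => //.
  + by apply: integral_ge0 => w _; rewrite lee_fin expR_ge0.
  + by apply: integral_ge0 => w _; rewrite lee_fin expR_ge0.
  + exact: incr_W_mgf.
- by apply: measurable_funB; apply: (cw_meas Ww); rewrite ?a0 ?b0.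
- move=> A B mA mB; apply: (cw_indep Ww a0 ab bT).
    exact: past_sumW.
  by apply: sub_sigma_algebra; exists m, B.
Qed.

(** Induction on the number of terms, latest time first. The value at the latest time [b] is an
    increment over [a, b], independent of the rest, plus the value at the next time [a] in the same
    direction, which linearity merges with the term already there. *)
Lemma mgf_sorted n L : (size L <= n)%N -> all (fun x => 0 <= x.1 <= T) L ->
  sorted (fun x y => y.1 <= x.1) L ->
  (\int[P]_w (expR (sumW L w))%:E <= (expR (qW L / 2))%:E)%E.
Proof.
have int0 : (\int[P]_w (expR (sumW [::] w))%:E <= (expR (qW [::] / 2))%:E)%E.
  rewrite /qW big_nil mul0r; under eq_integral do rewrite /sumW big_nil.
  by rewrite integral_cst//= probability_setT mule1.
elim: n L => [|n IH] [|[b m1] L] //= nL /andP[/= /andP[b0 bT] LT] sL.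
case: L nL LT sL => [_ _ _|[a m2] L nL /= /andP[/= /andP[a0 aT] LT] /andP[/= ab sL]].
  have T0 : 0 <= (0 : R) <= T by rewrite lexx (le_trans b0 bT).
  have := @mgf_step 0 b m1 [::] 0 (lexx 0) b0 bT isT.
  rewrite {1}(_ : 0 / 2 = qW [::] / 2 :> R); last by rewrite /qW big_nil.
  move=> /(_ int0); rewrite add0r subr0.
  rewrite (_ : b * `|m1| ^+ 2 = qW [:: (b, m1)]); last first.
    by rewrite /qW !big_cons !big_nil !addr0 /covW/= minxx -L2_inner_norm.
  apply: le_trans; rewrite le_eqVlt; apply/orP; left; apply/eqP.
  apply: ae_eq_integral => //.
  - apply/measurable_EFinP; apply: measurableT_comp => //.
    by apply: measurable_sumW; rewrite /= b0 bT.
  - apply/measurable_EFinP; apply: measurableT_comp => //; apply: measurable_funD.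
      exact: measurable_sumW.
    by apply: measurable_funB; apply: (cw_meas Ww); rewrite ?b0 ?T0.
  - have := cw_zero Ww m1; apply: filterS => w W0 _.
    by rewrite /sumW big_cons !big_nil W0 subr0 addr0 add0r.
pose M := (a, m1 + m2) :: L.
have La : all (fun x => 0 <= x.1 <= a) L.
  apply/allP => x xL; have /andP[-> _] /= := allP LT x xL.
  have tr : transitive (fun x y : R * H => y.1 <= x.1).
    by move=> y x' z /= h1 h2; exact: le_trans h2 h1.
  by move: sL; rewrite (path_sortedE tr) => /andP[/allP/(_ x xL)].
have Ma : all (fun x => 0 <= x.1 <= a) M by rewrite /= a0 lexx.
have := @mgf_step a b m1 M (qW M) a0 ab bT Ma.
have -> : (\int[P]_w (expR (sumW M w))%:E <= (expR (qW M / 2))%:E)%E.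
  apply: IH => //=; first by rewrite a0 aT.
  by case: (L) sL.
move=> /(_ isT).
have -> : qW M + (b - a) * `|m1| ^+ 2 = qW ((b, m1) :: (a, m2) :: L).
  rewrite /M !qW_cons big_cons.
  have -> : \sum_(y <- L) covW (a, m1 + m2) y = \sum_(y <- L) covW (b,
    m1) y + \sum_(y <- L) covW (a, m2) y.
    rewrite -big_split/=; apply: eq_big_seq => y /(allP La) /andP[_ ya].
    by rewrite /covW/= !min_r ?(le_trans ya ab)// /inner L2_innerDl mulrDr.
  rewrite /covW/= !minxx (min_r ab) /inner !L2_inner_norm L2_normD_sqr; ring.
apply: le_trans; rewrite le_eqVlt; apply/orP; left; apply/eqP.
apply: ae_eq_integral => //.
- apply/measurable_EFinP; apply: measurableT_comp => //.
  by apply: measurable_sumW; rewrite /= b0 bT a0 aT.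
- apply/measurable_EFinP; apply: measurableT_comp => //; apply: measurable_funD.
    by apply: measurable_sumW; rewrite /= a0 aT.
  by apply: measurable_funB; apply: (cw_meas Ww); rewrite ?b0 ?a0.
- have := @W_add a m1 m2; rewrite a0 aT => /(_ isT); apply: filterS => w Wa _.
  by rewrite /M !sumW_cons/= Wa; congr (expR _)%:E; ring.
Qed.

Lemma mgf_sumW L : all (fun x => 0 <= x.1 <= T) L ->
  (\int[P]_w (expR (sumW L w))%:E <= (expR (qW L / 2))%:E)%E.
Proof.
move=> LT; pose r (x y : R * H) := y.1 <= x.1; pose L' := sort r L.
have pL : perm_eq L' L by rewrite perm_sort.
have sE : sumW L = sumW L' by apply/funext => w; rewrite /sumW (perm_big _ pL).
have -> : qW L = qW L'.
  rewrite /qW (perm_big _ pL)/=; apply: eq_bigr => x _.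
  by rewrite (perm_big _ pL).
rewrite sE; apply: (@mgf_sorted (size L')) => //.
  by rewrite (perm_all _ pL).
by apply: sort_sorted => x y; rewrite /r le_total.
Qed.

End wiener_mgf.

Section subgaussian.
Context {R : realType} {d : measure_display} {Omega : measurableType d}.
Variable P : probability Omega R.
Implicit Types (X Y : Omega -> R) (v : R).

(** A bound on the moment generating function is recorded rather than normality: it passes to almost
    sure limits by Fatou and yields all moments. *)
Definition subgaussian X v : Prop := measurable_fun setT X /\
  forall a, (\int[P]_w (expR (a * X w))%:E <= (expR (a ^+ 2 * v / 2))%:E)%E.

Lemma measurable_expRM X a : measurable_fun setT X ->
  measurable_fun setT (fun w => (expR (a * X w))%:E).
Proof.
by move=> mX; apply/measurable_EFinP; apply: measurableT_comp => //; exact: measurable_funM.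
Qed.

Lemma subgaussian_le X v v' : v <= v' -> subgaussian X v -> subgaussian X v'.
Proof.
move=> vv' [mX sX]; split => // a; apply: (le_trans (sX a)).
by rewrite lee_fin ler_expR ler_pM2r// ler_wpM2l// sqr_ge0.
Qed.

Lemma subgaussian_ae X Y v : measurable_fun setT Y -> X = Y %[ae P] -> subgaussian X v ->
  subgaussian Y v.
Proof.
move=> mY XY [mX sX]; split => // a; apply: le_trans (sX a).
rewrite le_eqVlt; apply/orP; left; apply/eqP; apply: ae_eq_integral => //.
- exact: measurable_expRM.
- exact: measurable_expRM.
- by apply: filterS XY => w -> .
Qed.

Lemma subgaussian_lim (X_ : nat -> Omega -> R) X v : measurable_fun setT X ->
  {ae P, forall w, X_ n w @[n --> \oo] --> X w} ->
  (forall n, subgaussian (X_ n) v) -> subgaussian X v.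
Proof.
move=> mX cX sX; split => // a.
apply: (@fatou_le _ _ _ P setT (fun n w => (expR (a * X_ n w))%:E)) => //.
- by move=> n; apply: measurable_expRM; case: (sX n).
- exact: measurable_expRM.
- apply: filterS cX => w cw _; apply: cvg_EFin; first exact: nearW.
  apply: (cvg_comp (fun n => a * X_ n w) expR); last exact: continuous_expR.
  by apply: cvgM => //; exact: cvg_cst.
- by apply: nearW => n; case: (sX n).
Qed.

Lemma subgaussianZ X v c : subgaussian X v -> subgaussian (fun w => c * X w) (c ^+ 2 * v).
Proof.
move=> [mX sX]; split; first exact: measurable_funM.
move=> a; under eq_integral do rewrite mulrA.
by apply: (le_trans (sX _)); rewrite exprMn mulrA.
Qed.

(** Dependent [X] and [Y] are allowed: the product of the exponentials is at most half the sum of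
    their squares, which doubles [a] and so quadruples [v]. *)
Lemma subgaussianD X Y v : subgaussian X v -> subgaussian Y v ->
  subgaussian (fun w => X w + Y w) (4 * v).
Proof.
move=> [mX sX] [mY sY]; split; first exact: measurable_funD.
move=> a; apply: (@le_trans _ _ (\int[P]_w (2^-1 * expR (2 * a * X w) + 2^-1 * expR (2 * a * Y
  w))%:E)%E).
  apply: ge0_le_integralW => w _; first by rewrite lee_fin expR_ge0.
  rewrite lee_fin mulrDr expRD.
  have -> : 2 * a * X w = a * X w + a * X w by ring.
  have -> : 2 * a * Y w = a * Y w + a * Y w by ring.
  rewrite !expRD; have := sqr_ge0 (expR (a * X w) - expR (a * Y w)).
  rewrite sqrrB !expr2 -mulr_natr; lra.
have mR (c : R) (Z : Omega -> R) : measurable_fun setT Z ->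
  measurable_fun setT (fun w => expR (c * Z w)).
  by move=> mZ; apply: measurableT_comp => //; exact: measurable_funM.
have R0 (c : R) (Z : Omega -> R) w : 0 <= expR (c * Z w) by exact: expR_ge0.
have h0 : 0 <= 2^-1 :> R by [].
rewrite (integral_realD P measurableT
  (measurable_funM (measurable_cst _) (mR (2 * a) X mX))
  (measurable_funM (measurable_cst _) (mR (2 * a) Y mY))
  (fun w => mulr_ge0 h0 (R0 (2 * a) X w)) (fun w => mulr_ge0 h0 (R0 (2 * a) Y w))).
rewrite (integral_realZ P measurableT (mR (2 * a) X mX) (R0 (2 * a) X) h0).
rewrite (integral_realZ P measurableT (mR (2 * a) Y mY) (R0 (2 * a) Y) h0).
apply: (@le_trans _ _ (2^-1%:E * (expR ((2 * a) ^+ 2 * v / 2))%:E + 2^-1%:E * (expR ((2 * a) ^+ 2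
  * v / 2))%:E)%E).
  by apply: leeD; apply: lee_wpmul2l.
rewrite -EFinM -EFinD lee_fin (_ : (2 * a) ^+ 2 * v / 2 = a ^+ 2 * (4 * v) / 2); last by field.
by set E := expR _; lra.
Qed.

Lemma exp_ge_pow (y : R) n : 0 <= y -> y ^+ n / n`!%:R <= expR y.
Proof.
move=> y0; case: n => [|n].
  by rewrite expr0 fact0 divr1; have := expR_ge1Dx y; lra.
by have := expR_ge1Dxn n y0; lra.
Qed.

Lemma fact_le_expn n : (n`! <= n ^ n)%N.
Proof.
elim: n => // n IH; rewrite factS expnS leq_mul2l/=.
by apply: leq_trans IH _; case: n => // n; rewrite leq_exp2r.
Qed.

(** The growth is the Gaussian one, of order j! rather than (2 j)!, and this is what later makes the
    power series of exp (c y^2) summable when c v is small. The power is bounded by the exponentials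
    of [a * X w] and [- a * X w] for a suitable [a]. *)
Lemma subgaussian_moment X v j : 0 < v -> subgaussian X v ->
  (\int[P]_w ((X w) ^+ (2 * j))%:E <= (2 * j`!%:R * (2 * expR 2 * v) ^+ j)%:E)%E.
Proof.
move=> v0 [mX sX]; case: j => [|j].
  rewrite muln0; under eq_integral do rewrite expr0.
  by rewrite integral_cst//= probability_setT mule1 lee_fin fact0 expr0 !mulr1 ler1n.
set n := (2 * j.+1)%N.
(* With this [a] the exponential bound [expR (a ^+ 2 * v / 2)] becomes [expR j.+1%:R]. *)
pose a := Num.sqrt (n%:R / v).
have a2 : a ^+ 2 = n%:R / v by rewrite sqr_sqrtr// divr_ge0// ltW.
have n0 : 0 < n%:R :> R by rewrite ltr0n.
have a0 : a != 0 by rewrite gt_eqF// sqrtr_gt0 divr_gt0.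
have an : a ^+ n = (n%:R / v) ^+ j.+1 by rewrite /n exprM a2.
have an0 : 0 < a ^+ n by rewrite an exprn_gt0// divr_gt0.
pose C := n`!%:R / a ^+ n.
have C0 : 0 <= C by rewrite divr_ge0// ltW.
have pw w : (X w) ^+ n <= C * (expR (a * X w) + expR (- a * X w)).
  have := @exp_ge_pow (`|a * X w|) n (normr_ge0 _).
  have -> : `|a * X w| ^+ n = a ^+ n * X w ^+ n.
    by rewrite /n exprM real_normK ?num_real// -exprM exprMn.
  have : expR `|a * X w| <= expR (a * X w) + expR (- a * X w).
    case: (lerP 0 (a * X w)) => h; rewrite ?(ger0_norm h) ?(ltr0_norm h) ?mulNr.
      by rewrite lerDl expR_ge0.
    by rewrite lerDr expR_ge0.
  move=> h1 h2; have h3 := le_trans h2 h1.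
  rewrite /C mulrAC ler_pdivlMr//; move: h3; rewrite ler_pdivrMr ?ltr0n ?fact_gt0//.
  by rewrite (mulrC (X w ^+ n)) (mulrC n`!%:R).
apply: (@le_trans _ _ (\int[P]_w (C * (expR (a * X w) + expR (- a * X w)))%:E)%E).
  apply: ge0_le_integralW => w _; last by rewrite lee_fin pw.
  by rewrite lee_fin /n exprM exprn_ge0// sqr_ge0.
have mR c : measurable_fun setT (fun w => expR (c * X w)).
  by apply: measurableT_comp => //; exact: measurable_funM.
have R0 c w : 0 <= expR (c * X w) by exact: expR_ge0.
rewrite (integral_realZ P measurableT (measurable_funD (mR a) (mR (- a)))
  (fun w => addr_ge0 (R0 a w) (R0 (- a) w)) C0).
rewrite (integral_realD P measurableT (mR a) (mR (- a)) (R0 a) (R0 (- a))).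
apply: (@le_trans _ _ (C%:E * ((expR (a ^+ 2 * v / 2))%:E + (expR ((- a) ^+ 2 * v / 2))%:E))%E).
  by apply: lee_wpmul2l; [rewrite lee_fin|apply: leeD].
rewrite -EFinD -EFinM lee_fin sqrrN a2 divfK ?gt_eqF//.
have -> : n%:R / 2 = j.+1%:R :> R by rewrite /n natrM mulrC mulKf.
have E (x : R) m : expR (x * m%:R) = expR x ^+ m by rewrite expRM_natr.
(* The crude half of Stirling trades the power [j.+1%:R ^+ j.+1] for a factorial. *)
have ej : j.+1%:R ^+ j.+1 <= expR 1 ^+ j.+1 * (j.+1)`!%:R :> R.
  have := @exp_ge_pow j.+1%:R j.+1 (ler0n _ _).
  by rewrite ler_pdivrMr ?ltr0n ?fact_gt0// -[X in expR X]mul1r E.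
rewrite /C an expr_div_n invf_div -mulr2n.
have f1 : n`!%:R <= n%:R ^+ j.+1 * n%:R ^+ j.+1 :> R.
  by rewrite -exprD addnn -mul2n -natrX ler_nat fact_le_expn.
have nj0 : 0 < n%:R ^+ j.+1 :> R by rewrite exprn_gt0.
have f2 : n`!%:R * (v ^+ j.+1 / n%:R ^+ j.+1) <= n%:R ^+ j.+1 * v ^+ j.+1.
  rewrite mulrA ler_pdivrMr// mulrAC ler_wpM2r// exprn_ge0// ltW//.
apply: (le_trans (ler_wpM2r _ f2)); first by rewrite mulrn_wge0// expR_ge0.
rewrite -[X in expR X]mul1r E [n%:R]natrM exprMn.
have h : 0 <= 2 * 2 ^+ j.+1 * v ^+ j.+1 * expR 1 ^+ j.+1.
  by rewrite !mulr_ge0// ?exprn_ge0 ?expR_ge0// ltW.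
have e2 : expR 2 = expR 1 * expR 1 :> R by rewrite -expRD.
have := ler_wpM2l h ej; rewrite e2 !exprMn; lra.
Qed.

End subgaussian.

Section rintegral_sum.
Context {d} {T : measurableType d} {R : realType}.
Variable mu : {measure set T -> \bar R}.

Lemma integrable_rsum (D : set T) (mD : measurable D) (I : Type) (r : seq I) (f : I -> T -> R) :
  (forall i, mu.-integrable D (EFin \o f i)) ->
  mu.-integrable D (EFin \o (fun x => \sum_(i <- r) f i x)).
Proof.
move=> fi; rewrite (_ : _ \o _ = fun x => (\sum_(i <- r) (EFin \o f i) x)%E); last first.
  by apply/funext => x /=; rewrite sumEFin.
exact: integrable_sum.
Qed.

Lemma Rintegral_sum (D : set T) (mD : measurable D) (I : Type) (r : seq I) (f : I -> T -> R) :
  (forall i, mu.-integrable D (EFin \o f i)) ->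
  \int[mu]_(x in D) \sum_(i <- r) f i x = \sum_(i <- r) \int[mu]_(x in D) f i x.
Proof.
move=> fi; elim: r => [|i r IH].
  by under eq_Rintegral do rewrite big_nil; rewrite Rintegral_cst// mul0r big_nil.
under eq_Rintegral do rewrite big_cons.
rewrite RintegralD//; first by rewrite IH big_cons.
exact: integrable_rsum.
Qed.

End rintegral_sum.

Section lincomb.
Context {R : realType} {d : measure_display} {Omega : measurableType d}.
Variable P : probability Omega R.
Variables (T : R) (W : R -> H01 R -> Omega -> R).
Hypothesis Ww : cylindrical_wiener P T W.
Local Notation H := (H01 R).
Local Notation leb := (@lebesgue_measure R).
Variable I : eqType.
Implicit Types (r : seq I) (c t : I -> R) (g : I -> H).

Definition lincomb r c t g (w : Omega) : R := \sum_(i <- r) c i * W (t i) (g i) w.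

(** The step function whose Wiener integral over [0, T] is [lincomb]; its squared L^2 norm [energy]
    is the variance, by the Ito isometry. *)
Definition kerW r c t g (s : R) : H := \sum_(i <- r) (c i * \1_(`[0, t i]%classic) s) *: g i.

Definition energy r c t g : R := \int[leb]_(s in `[0%R, T]) `|kerW r c t g s| ^+ 2.

Lemma Rint_indic_itv0 (a b : R) : 0 <= a -> a <= b ->
  \int[leb]_(s in `[0%R, b]) \1_(`[0, a]%classic) s = a.
Proof.
move=> a0 ab; rewrite /Rintegral integral_indic//= setIidl; last first.
  by apply: subset_itvl; rewrite bnd_simp.
rewrite lebesgue_measure_itv/= lte_fin; case: ltP => [_|].
  by rewrite oppr0 adde0.
by move=> a1; apply/eqP; rewrite eq_le a0 a1.
Qed.

Lemma integrable_indicZ (a b c : R) :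
  leb.-integrable `[0%R, c] (EFin \o (fun s => b * \1_(`[0, a]%classic) s)).
Proof.
have i1 : leb.-integrable `[0%R, c] (EFin \o \1_(`[0, a]%classic)).
  by apply: integrableS (integrable_indic_itv (0 : R) a true false) => //; exact: measurable_itv.
by have := integrableZl (mu := leb) (measurable_itv `[0%R, c]) b i1; exact: eq_integrable.
Qed.

Lemma normkerW r c t g s : `|kerW r c t g s| ^+ 2 =
  \sum_(i <- r) \sum_(j <- r) (c i * c j * inner (g i) (g j)) *
    \1_(`[0, Num.min (t i) (t j)]%classic) s.
Proof.
rewrite -L2_inner_norm /kerW L2_inner_suml; apply: eq_bigr => i _.
rewrite L2_inner_sumr; apply: eq_bigr => j _.
rewrite L2_innerZl L2_innerZr /inner !indicE.
have -> : (s \in `[0, Num.min (t i) (t j)]%classic) =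
    (s \in `[0, t i]%classic) && (s \in `[0, t j]%classic).
  by rewrite !mem_setE !in_itv/= le_min; case: (0 <= s); rewrite ?andbF.
by case: (s \in `[0, t i]%classic); case: (s \in `[0, t j]%classic) => /=; ring.
Qed.

Lemma integrable_normkerW r c t g :
  leb.-integrable `[0%R, T] (EFin \o (fun s => `|kerW r c t g s| ^+ 2)).
Proof.
rewrite (_ : (fun s => `|_| ^+ 2) = (fun s => \sum_(i <- r) \sum_(j <- r) (c i * c j * inner (g
  i) (g j)) *
    \1_(`[0, Num.min (t i) (t j)]%classic) s)); last by apply/funext => s; rewrite normkerW.
apply: integrable_rsum => // i; apply: integrable_rsum => // j; exact: integrable_indicZ.
Qed.

Lemma energyE r c t g : (forall i, i \in r -> 0 <= t i <= T) ->
  energy r c t g =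
  \sum_(i <- r) \sum_(j <- r) c i * c j * inner (g i) (g j) * Num.min (t i) (t j).
Proof.
move=> tT; rewrite /energy; under eq_Rintegral do rewrite normkerW.
have mT : measurable `[0%R, T] by exact: measurable_itv.
rewrite Rintegral_sum//; last first.
  by move=> i; apply: integrable_rsum => // j; exact: integrable_indicZ.
apply: eq_big_seq => i ir; rewrite Rintegral_sum//; last by move=> j; exact: integrable_indicZ.
apply: eq_big_seq => j jr; have /andP[i0 iT] := tT _ ir; have /andP[j0 jT] := tT _ jr.
rewrite RintegralZl//; last first.
  have := integrable_indicZ (Num.min (t i) (t j)) 1 T.
  by apply: eq_integrable => // s _; rewrite /= mul1r.
by rewrite Rint_indic_itv0// ?le_min ?i0 ?j0// ge_min iT.
Qed.

Lemma measurable_lincomb r c t g : (forall i, i \in r -> 0 <= t i <= T) ->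
  measurable_fun setT (lincomb r c t g).
Proof.
move=> tT; rewrite (_ : lincomb r c t g = (fun w => \sum_(i <- r)
  (if i \in r then c i * W (t i) (g i) w else 0))); last first.
  by apply/funext => w; apply: eq_big_seq => i ->.
apply: measurable_sum => i; case: (boolP (i \in r)) => ir //; apply: measurable_funM => //.
exact: (cw_meas Ww) (tT _ ir).
Qed.

Lemma subgaussian_lincomb r c t g : (forall i, i \in r -> 0 <= t i <= T) ->
  subgaussian P (lincomb r c t g) (energy r c t g).
Proof.
move=> tT; split; first exact: measurable_lincomb.
move=> a; pose L := [seq (t i, (a * c i) *: g i) | i <- r].
have LT : all (fun x : R * H => 0 <= x.1 <= T) L.
  by apply/allP => x /mapP[i ir ->] /=; exact: tT.
have qE : qW L = a ^+ 2 * energy r c t g.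
  rewrite energyE// /qW /L big_map mulr_sumr; apply: eq_bigr => i _.
  rewrite big_map mulr_sumr; apply: eq_bigr => j _.
  by rewrite /covW/= /inner L2_innerZl L2_innerZr; ring.
rewrite -qE; apply: le_trans (mgf_sumW Ww LT).
rewrite le_eqVlt; apply/orP; left; apply/eqP; apply: ae_eq_integral => //.
- exact/measurable_expRM/measurable_lincomb.
- by apply/measurable_EFinP; apply: measurableT_comp => //; exact: (measurable_sumW Ww).
- suff : {ae P, forall w, a * lincomb r c t g w = sumW W L w}.
    by apply: ae_imply => w ->.
  rewrite /L /lincomb /sumW; elim: (r) tT => [|i r' IH] tT.
    by apply: nearW => w; rewrite !big_nil mulr0.
  have /IH{}IH : forall i, i \in r' -> 0 <= t i <= T by move=> j jr; apply: tT; rewrite inE jr orbT.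
  have := W_scale Ww (a * c i) (g i) (tT _ (mem_head _ _)).
  apply: filterS2 IH => w IH Wi.
  by rewrite big_cons mulrDr IH /= big_cons/= Wi mulrA.
Qed.

End lincomb.

Section increments.
Context {R : realType} {d : measure_display} {Omega : measurableType d}.
Variable P : probability Omega R.
Variables (T : R) (W : R -> H01 R -> Omega -> R).
Hypothesis Ww : cylindrical_wiener P T W.
Local Notation H := (H01 R).
Local Notation leb := (@lebesgue_measure R).
Variable I : eqType.
Implicit Types (r : seq I) (c lo hi : I -> R) (g : I -> H).

Definition incW r c lo hi g (w : Omega) : R :=
  \sum_(i <- r) c i * (W (hi i) (g i) w - W (lo i) (g i) w).

Definition inc_ker r c lo hi g (s : R) : H :=
  \sum_(i <- r) (c i * \1_(`]lo i, hi i]%classic) s) *: g i.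

(** Each increment is a difference of two values, tagged by a Boolean, which makes it a [lincomb].
    The bound [v] is a parameter because the energies of the kernels below are estimated, not
    computed. *)
Lemma subgaussian_incW r c lo hi g (v : R) :
  (forall i, i \in r -> [/\ 0 <= lo i, lo i <= hi i & hi i <= T]) ->
  (\int[leb]_(s in `[0%R, T]) (`|inc_ker r c lo hi g s| ^+ 2)%:E <= v%:E)%E ->
  subgaussian P (incW r c lo hi g) v.
Proof.
move=> rT.
pose r2 := [seq (i, true) | i <- r] ++ [seq (i, false) | i <- r].
pose c2 (x : I * bool) := if x.2 then c x.1 else - c x.1.
pose t2 (x : I * bool) := if x.2 then hi x.1 else lo x.1.
pose g2 (x : I * bool) := g x.1.
have r2T x : x \in r2 -> 0 <= t2 x <= T.
  rewrite mem_cat => /orP[] /mapP[i ir ->]; rewrite /t2/=; have [h1 h2 h3] := rT _ ir.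
    by rewrite h3 (le_trans h1 h2).
  by rewrite h1 (le_trans h2 h3).
have incE : incW r c lo hi g = lincomb W r2 c2 t2 g2.
  apply/funext => w; rewrite /lincomb /r2 big_cat/= !big_map -big_split/=.
  by apply: eq_bigr => i _; rewrite /c2/t2/g2/= mulNr mulrBr.
have kerE s : 0 <= s -> inc_ker r c lo hi g s = kerW r2 c2 t2 g2 s.
  move=> s0; rewrite /kerW /r2 big_cat/= !big_map -big_split/=.
  apply: eq_big_seq => i ir; rewrite /c2/t2/g2/= -scalerDl; congr (_ *: _).
  have [h1 h2 h3] := rT _ ir; rewrite !indicE !mem_setE !in_itv/= s0/=.
  case: (leP s (lo i)) => slo; rewrite ?(le_trans slo h2)/=; first by ring.
  by case: (s <= hi i) => /=; ring.
move=> ev; rewrite incE; apply: subgaussian_le (subgaussian_lincomb Ww c2 g2 r2T).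
rewrite -lee_fin; apply: le_trans ev; rewrite /energy /Rintegral fineK; last first.
  exact: (integrable_fin_num (mu := leb) (measurable_itv _) (integrable_normkerW T r2 c2 t2 g2)).
rewrite le_eqVlt; apply/orP; left; apply/eqP; apply: eq_integral => s.
by rewrite inE/= in_itv/= => /andP[s0 _]; rewrite kerE.
Qed.

End increments.

(** * Calculus of continuous paths *)

Section paths.
Context {R : realType}.
Local Notation leb := (@lebesgue_measure R).
Implicit Types (f B : R -> R).

Lemma derive_continuous (f df : R -> R) : (forall x, is_derive x (1 : R) f (df x)) -> continuous f.
Proof.
move=> fd x; apply: differentiable_continuous.
by apply/derivable1_diffP; apply: ex_derive; exact: fd.
Qed.

(** As [f] vanishes on the negative half-line, the lower limit 0 may be replaced by minus infinity,
    and the fundamental theorem applies at every point, with no exception at 0. *)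
Lemma Rint_primitive f : continuous f -> (forall x, x <= 0 -> f x = 0) ->
  forall x, is_derive x (1 : R) (fun y => \int[leb]_(r in `[0%R, y]) f r) (f x).
Proof.
move=> cf f0 x.
have f0E y : \int[leb]_(r in `[0%R, y]) f r = \int[leb]_(r in `]-oo, y]) f r.
  rewrite Rintegral_mkcond [RHS]Rintegral_mkcond; apply: eq_Rintegral => r _.
  rewrite !patchE !mem_setE !in_itv/=; case: (leP 0 r) => //= r0.
  by rewrite f0 ?if_same// ltW.
rewrite (funext f0E).
have fi y : leb.-integrable `]-oo, y] (EFin \o f).
  have fi0 : leb.-integrable `[0%R, y] (EFin \o f) by exact: continuous_itv_integrable.
  have := fi0; rewrite integrable_mkcond; last exact: measurable_itv.
  rewrite [in X in _ -> X]integrable_mkcond; last exact: measurable_itv.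
  congr (is_true (integrable _ _ _)); apply/funext => r.
  rewrite !patchE !mem_setE !in_itv/=; case: (leP 0 r) => //= r0.
  by rewrite f0 ?if_same// ltW.
have [F1 F2] := @continuous_FTC1 R f -oo%O x (x + 1) (ltac:(lra)) (fi (x + 1)) (ltNyr _) (cf x).
by apply: DeriveDef; [exact: F1|rewrite -derive1E; exact: F2].
Qed.

Lemma uniform_continuity f (a b e : R) : continuous f -> 0 < e ->
  exists2 dl, 0 < dl & forall x y, a <= x <= b -> a <= y <= b -> `|x - y| <= dl ->
    `|f x - f y| <= e.
Proof.
move=> cf e0; apply: contrapT => nex.
have /choice[xy Hxy] : forall n : nat, exists z : R * R, [/\ a <= z.1 <= b, a <= z.2 <= b,
    `|z.1 - z.2| <= n.+1%:R^-1 & ~ (`|f z.1 - f z.2| <= e)].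
  move=> n; apply: contrapT => nz; apply: nex; exists n.+1%:R^-1; first by rewrite invr_gt0.
  move=> x y xab yab xy; apply: contrapT => nf; apply: nz; by exists (x, y).
have bx : bounded_fun (fun n => (xy n).1).
  exists (`|a| + `|b|); split; first exact: num_real.
  move=> M /ltW abM n _ /=; apply: le_trans abM.
  have [/andP[h1 h2] _ _ _] := Hxy n.
  rewrite ler_norml; apply/andP; split.
    apply: le_trans h1; have := ler_norm (- a); rewrite normrN; have := normr_ge0 b; lra.
  apply: (le_trans h2); have := ler_norm b; have := normr_ge0 a; lra.
have [g gi /cvg_ex[l gl]] := bolzano_weierstrass bx.
have gn n : (n <= g n)%N.
  elim: n => // n IH; apply: leq_ltn_trans IH _.
  by have := gi n.+1 n; rewrite ltnn leEnat => /negbT; rewrite -ltnNge.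
have e20 : 0 < e / 2 by rewrite divr_gt0.
have := cf l => /cvgrPdist_le /(_ (e / 2) e20) [/= dl dl0 Hdl].
have dl20 : 0 < dl / 2 by rewrite divr_gt0.
move/cvgrPdist_lt : gl => /(_ _ dl20) [N _ HN].
pose M := maxn N (Num.truncn (dl / 2)^-1).+1.
have NM : (N <= g M)%N by rewrite (leq_trans _ (gn M))// leq_maxl.
have := HN M (leq_maxl _ _); rewrite /= => lx.
have [_ _ xy1 nf] := Hxy (g M); apply: nf.
have gM : (g M).+1%:R^-1 < dl / 2.
  rewrite -[ltRHS]invrK ltf_pV2 ?posrE ?invr_gt0// (lt_le_trans (truncnS_gt _))// ler_nat.
  by rewrite (leq_trans _ (leqW (gn M)))// leq_maxr.
have h1 : `|f l - f (xy (g M)).1| <= e / 2 by apply: Hdl => /=; apply: (lt_trans lx); lra.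
have h2 : `|f l - f (xy (g M)).2| <= e / 2.
  apply: Hdl => /=; rewrite (_ : l - _ = (l - (xy (g M)).1) + ((xy (g M)).1 - (xy (g M)).2));
    last by rewrite addrA subrK.
  by apply: le_lt_trans (ler_normD _ _) _; have := le_lt_trans xy1 gM; lra.
rewrite (_ : f _ - f _ = (f l - f (xy (g M)).2) - (f l - f (xy (g M)).1)); last by ring.
apply: le_trans (ler_normB _ _) _; lra.
Qed.

Lemma MVT_bound (f df : R -> R) (a b M : R) : a <= b -> (forall x, is_derive x (1 : R) f (df x)) ->
  (forall x, a <= x <= b -> `|df x| <= M) -> `|f b - f a| <= M * (b - a).
Proof.
move=> ab fd dM.
have cf : {within `[a, b], continuous f}.
  by apply: continuous_subspaceT; exact: (derive_continuous fd).
have [c cab ->] := @MVT_segment R f df a b ab (fun x _ => fd x) cf.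
rewrite normrM [`|b - a|]ger0_norm ?subr_ge0//.
by apply: ler_wpM2r; [rewrite subr_ge0|apply: dM; rewrite in_itv/= in cab].
Qed.

(* Integration by parts rewrites the Wiener integral of [exp (- mu (t - r))]
   against [B] as this pathwise Lebesgue integral. *)
Definition ou (mu : R) B (t : R) : R :=
  B t - mu * expR (- (mu * t)) * \int[leb]_(r in `[0%R, t]) (expR (mu * r) * B r).

(** * Pathwise Ornstein-Uhlenbeck functional *)

Section ou_path.
Variables (B : R -> R).
Hypotheses (cB : continuous B) (B0 : forall x, x <= 0 -> B x = 0).

Definition expint (mu t : R) := \int[leb]_(r in `[0%R, t]) (expR (mu * r) * B r).

Lemma continuous_expM (mu : R) : continuous (fun r => expR (mu * r)).
Proof.
move=> x; apply: continuous_comp; last exact: continuous_expR.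
by apply: cvgM; [exact: cvg_cst|exact: cvg_id].
Qed.

Lemma is_derive_expint mu t : is_derive t (1 : R) (expint mu) (expR (mu * t) * B t).
Proof.
apply: (@Rint_primitive (fun r => expR (mu * r) * B r)).
  by move=> x; apply: cvgM; [exact: continuous_expM|exact: cB].
by move=> x x0; rewrite B0// mulr0.
Qed.

Lemma is_derive_expM (mu t : R) : is_derive t (1 : R) (fun r => expR (mu * r)) (mu * expR (mu * t)).
Proof.
apply: is_derive_eq; rewrite /GRing.scale/= mulr1 mulrC.
by [].
Qed.

Lemma ouE mu t : ou mu B t = B t - mu * expR (- (mu * t)) * expint mu t.
Proof. by []. Qed.

Lemma continuous_ou mu : continuous (ou mu B).
Proof.
have ce : continuous (fun r => expR (- (mu * r))).
  have -> : (fun r => expR (- (mu * r))) = (fun r => expR (- mu * r)).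
    by apply/funext => r; rewrite mulNr.
  exact: continuous_expM.
move=> t; apply: (@cvgB _ R^o); first exact: cB.
apply: cvgM; last exact: (derive_continuous (is_derive_expint mu)).
by apply: cvgM; [exact: cvg_cst|exact: ce].
Qed.

Lemma ou_le0 mu t : t <= 0 -> ou mu B t = 0.
Proof.
move=> t0; rewrite ouE B0// sub0r; move: t0; rewrite le_eqVlt => /predU1P[->|t0].
  by rewrite /expint set_itv1 Rintegral_set1 mulr0 oppr0.
by rewrite /expint set_itv_ge ?bnd_simp -?ltNge// Rintegral_set0 mulr0 oppr0.
Qed.

Lemma exp_ou mu t : expR (mu * t) * ou mu B t = expR (mu * t) * B t - mu * expint mu t.
Proof.
rewrite ouE mulrBr; congr (_ - _).
by rewrite mulrA mulrCA -expRD subrr expR0 mulr1.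
Qed.

(** Equation (iii) in one mode, with [x0] the coordinate of the initial value. The integrand has the
    explicit primitive [expR (- (mu * t)) * D], found from the relation [exp_ou] between [ou] and
    [expint]. *)
Lemma ou_resolvent (lam eta x0 t : R) : 0 <= t ->
  (ou lam B t + expR (- (lam * t)) * x0)
  - \int[leb]_(s in `[0%R, t]) (expR (- ((lam + eta) * (t - s))) * (eta * (ou lam B s + expR (-
    (lam * s)) * x0)))
  = ou (lam + eta) B t + expR (- ((lam + eta) * t)) * x0.
Proof.
move=> t0; set mu := lam + eta.
pose D s := mu * expint mu s - lam * (expR (eta * s) * expint lam s) + x0 * expR (eta * s).
have emu s : expR (mu * s) = expR (eta * s) * expR (lam * s) by rewrite -expRD /mu; congr expR;
  ring.
have DD s : is_derive s (1 : R) D (eta * (expR (mu * s) * ou lam B s + expR (eta * s) * x0)).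
  have d1 := is_derive_expint mu s; have d2 := is_derive_expint lam s.
  have d3 := is_derive_expM eta s.
  apply: is_derive_eq.
  rewrite /GRing.scale/= emu -(mulrA (expR (eta * s)) _ (ou lam B s)) exp_ou /mu; ring.
pose g s := expR (- (mu * (t - s))) * (eta * (ou lam B s + expR (- (lam * s)) * x0)).
have gE s : g s = expR (- (mu * t)) * (eta * (expR (mu * s) * ou lam B s + expR (eta * s) * x0)).
  rewrite /g (_ : - (mu * (t - s)) = - (mu * t) + mu * s); last by ring.
  by rewrite expRD emu expRN (expRN (lam * s)); field; rewrite !gt_eqF ?expR_gt0.
have cg : continuous g.
  rewrite (funext gE) => s; apply: cvgM; first exact: cvg_cst.
  apply: cvgM; first exact: cvg_cst.
  apply: (@cvgD _ R^o); apply: cvgM; try exact: cvg_cst; try exact: continuous_expM.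
  exact: continuous_ou.
have Dg s : is_derive s (1 : R) (fun r => expR (- (mu * t)) * D r) (g s).
  have d1 := DD s; rewrite gE; apply: is_derive_eq; by rewrite /GRing.scale/=.
rewrite (Rintegral_FTC2 t0 cg Dg) /D !ouE.
have e0 m : expint m 0 = 0 by rewrite /expint set_itv1 Rintegral_set1.
rewrite !e0 !mulr0 expR0 mulr1 subr0 add0r -/mu.
have -> : - (lam * t) = eta * t - mu * t by rewrite /mu; ring.
by rewrite expRD; ring.
Qed.

(** What the increments of [B] after time [s] contribute at time [t], that is the integral of expR
    (- mu (t - r)) dB(r) over ]s, t]. Its Riemann sums with left endpoints are [ousum]. *)
Definition ouinc (mu s t : R) : R := ou mu B t - expR (- (mu * (t - s))) * ou mu B s.

Definition part (s t : R) (N i : nat) : R := s + (t - s) * (i%:R / N%:R).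

Definition ousum (mu s t : R) (N : nat) : R :=
  \sum_(i < N) expR (- (mu * (t - part s t N i))) *
    (B (part s t N i.+1) - B (part s t N i)).

Lemma part_in s t N i : s <= t -> (i <= N)%N -> s <= part s t N i <= t.
Proof.
move=> st; case: N => [|N] iN.
  by rewrite /part invr0 mulr0 mulr0 addr0 lexx.
rewrite /part; have h : 0 <= (i%:R / N.+1%:R : R) <= 1.
  by rewrite divr_ge0//= ler_pdivrMr ?ltr0n// mul1r ler_nat.
have ts : 0 <= t - s by rewrite subr_ge0.
by case/andP : h => h1 h2; rewrite lerDl mulr_ge0//= -lerBrDl ler_piMr.
Qed.

Lemma part_step s t N i : part s t N i.+1 = part s t N i + (t - s) / N%:R.
Proof. by rewrite /part -natr1; ring. Qed.

(** On a cell of the partition the error is the increment of a function with derivative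
    [mu * expR (mu * r) * (B (x i.+1) - B r)], small by uniform continuity of [B]; the cells add up
    to a factor [mu * (t - s)]. *)
Lemma ousum_cvg mu s t : 0 <= mu -> 0 <= s -> s <= t ->
  forall e, 0 < e -> exists N0, forall N, (N0 < N)%N -> `|ouinc mu s t - ousum mu s t N| <= e.
Proof.
move=> mu0 s0 st e e0.
(* Adding 1 keeps [C] positive when [mu * (t - s)] vanishes. *)
pose C := mu * (t - s) + 1.
have C0 : 0 < C by rewrite /C ltr_wpDl// mulr_ge0// subr_ge0.
have eC : 0 < e / C by rewrite divr_gt0.
have [dl dl0 Hdl] := @uniform_continuity B s t _ cB eC.
exists (Num.truncn ((t - s) / dl)) => N NN.
have N0 : 0 < N%:R :> R by rewrite ltr0n (leq_trans _ NN).
have Nd : (t - s) / N%:R <= dl.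
  rewrite ler_pdivrMr// mulrC -ler_pdivrMr//; apply/ltW/(lt_le_trans (truncnS_gt _)).
  by rewrite ler_nat.
pose x i := part s t N i.
pose G r := expR (mu * r) * ou mu B r.
have -> : ouinc mu s t = expR (- (mu * t)) * (G t - G s).
  rewrite /ouinc /G/= (_ : - (mu * (t - s)) = - (mu * t) + mu * s); last by ring.
  by rewrite expRD expRN; field; rewrite gt_eqF ?expR_gt0.
have -> : ousum mu s t N = expR (- (mu * t)) *
    \sum_(i < N) expR (mu * x i) * (B (x i.+1) - B (x i)).
  rewrite mulr_sumr; apply: eq_bigr => i _; rewrite mulrA -expRD.
  by congr (expR _ * _); rewrite /x; ring.
have xN : x N = t by rewrite /x /part divff ?gt_eqF//; ring.
have x0 : x 0%N = s by rewrite /x /part mul0r mulr0 addr0.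
have -> : G t - G s = \sum_(i < N) (G (x i.+1) - G (x i)).
  by rewrite -xN -x0 -[in LHS](telescope_sumr (fun i => G (x i)))// big_mkord.
rewrite -mulrBr -sumrB normrM ger0_norm ?expR_ge0//.
have bound i : (i < N)%N -> `|G (x i.+1) - G (x i) - expR (mu * x i) * (B (x i.+1) - B (x i))| <=
    expR (mu * t) * (mu * (e / C)) * ((t - s) / N%:R).
  move=> iN; pose f r := expR (mu * r) * B (x i.+1) - mu * expint mu r.
  have -> : G (x i.+1) - G (x i) - expR (mu * x i) * (B (x i.+1) - B (x i)) = f (x i.+1) - f (x i).
    by rewrite /G !exp_ou /f; ring.
  have xi : x i <= x i.+1.
    by rewrite /x part_step lerDl divr_ge0 ?subr_ge0// ltW.
  have -> : (t - s) / N%:R = x i.+1 - x i by rewrite /x part_step addrAC subrr add0r.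
  have fd r : is_derive r (1 : R) f (mu * expR (mu * r) * (B (x i.+1) - B r)).
    have d1 := is_derive_expint mu r; have d2 := is_derive_expM mu r.
    apply: is_derive_eq; rewrite /GRing.scale/=; ring.
  apply: (MVT_bound xi fd) => r /andP[r1 r2].
  have /andP[h1 h2] := part_in st (ltnW iN); have /andP[h3 h4] := part_in st iN.
  have r0 : s <= r <= t by rewrite (le_trans h1 r1) (le_trans r2 h4).
  rewrite mulrC normrM [`|mu * _|]ger0_norm; last by rewrite mulr_ge0// expR_ge0.
  have B1 : `|B (x i.+1) - B r| <= e / C.
    apply: Hdl => //; first by rewrite h3 h4.
    rewrite ger0_norm ?subr_ge0//; apply: le_trans Nd.
    by move: r1; rewrite /x part_step; lra.
  rewrite [leRHS](_ : _ = (e / C) * (mu * expR (mu * t))); last by ring.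
  apply: ler_pM => //.
    by rewrite mulr_ge0// expR_ge0.
  by apply: ler_wpM2l => //; rewrite ler_expR ler_wpM2l//; case/andP : r0.
apply: (@le_trans _ _ (expR (- (mu * t)) * \sum_(i < N) (expR (mu * t) * (mu * (e / C)) * ((t -
  s) / N%:R)))).
  apply: ler_wpM2l; first exact: expR_ge0.
  by apply: (le_trans (ler_norm_sum _ _ _)); apply: ler_sum => i _; exact: bound.
rewrite sumr_const card_ord -[X in _ * X]mulr_natr.
have -> : expR (- (mu * t)) * (expR (mu * t) * (mu * (e / C)) * ((t - s) / N%:R) * N%:R) =
    (expR (- (mu * t)) * expR (mu * t)) * (mu * (t - s) * (e / C)).
  by field; rewrite !gt_eqF.
rewrite -expRD addNr expR0 mul1r mulrA ler_pdivrMr//.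
by rewrite mulrC ler_wpM2l ?ltW// /C; lra.
Qed.

End ou_path.
End paths.

(** * Chaining *)

Section dyadic_chain.
Context {R : realType}.
Variables (L : R) (L0 : 0 < L).

Definition dyad (m i : nat) : R := L * (i%:R / 2 ^+ m).

(** For even [n] this dominates the [n]-th power of every increment of level [m] divided by
    [r ^+ m], so the sum over [m] controls a Hoelder constant on the dyadic points. *)
Definition chain_level (n m : nat) (r : R) (f : R -> R) : R :=
  r^-1 ^+ (m * n) * \sum_(i < 2 ^ m) (f (dyad m i.+1) - f (dyad m i)) ^+ n.

Definition dyad_below (m : nat) (x : R) : nat := Num.truncn (2 ^+ m * (x / L)).

Lemma dyad_double m i : dyad m.+1 i.*2 = dyad m i.
Proof.
rewrite /dyad exprS -muln2 natrM; congr (_ * _); field.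
by rewrite gt_eqF// exprn_gt0.
Qed.

Lemma dyad_below_le m x : 0 <= x <= L -> (dyad_below m x <= 2 ^ m)%N.
Proof.
move=> /andP[x0 xL]; rewrite /dyad_below -(ler_nat R) natrX.
have h : 2 ^+ m * (x / L) <= 2 ^+ m by rewrite ler_piMr ?exprn_ge0// ler_pdivrMr// mul1r.
by apply: le_trans h; rewrite truncn_le mulr_ge0 ?exprn_ge0// divr_ge0// ltW.
Qed.

Lemma dyad_below_dist m x : 0 <= x <= L -> `|x - dyad m (dyad_below m x)| <= L / 2 ^+ m.
Proof.
move=> /andP[x0 xL].
have y0 : 0 <= 2 ^+ m * (x / L) by rewrite mulr_ge0 ?exprn_ge0// divr_ge0// ltW.
have h1 : (Num.truncn (2 ^+ m * (x / L)))%:R <= 2 ^+ m * (x / L) by rewrite truncn_le.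
 have h2 := truncnS_gt (2 ^+ m * (x / L)).
have p2 : 0 < 2 ^+ m :> R by rewrite exprn_gt0.
set k := Num.truncn _ in h1 h2.
have -> : x - dyad m (dyad_below m x) = L / 2 ^+ m * (2 ^+ m * (x / L) - k%:R).
  by rewrite /dyad /dyad_below -/k; field; rewrite !gt_eqF.
have c0 : 0 <= L / 2 ^+ m by rewrite divr_ge0// ltW.
rewrite normrM ger0_norm// ler_piMr// ger0_norm ?subr_ge0//.
by move: h2; rewrite -natr1; lra.
Qed.

Lemma dyad_belowS m x : 0 <= x <= L ->
  dyad_below m.+1 x = (dyad_below m x).*2 \/ dyad_below m.+1 x = (dyad_below m x).*2.+1.
Proof.
move=> /andP[x0 xL].
have y0 : 0 <= 2 ^+ m * (x / L) by rewrite mulr_ge0 ?exprn_ge0// divr_ge0// ltW.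
rewrite /dyad_below exprS -mulrA.
have h1 : (Num.truncn (2 ^+ m * (x / L)))%:R <= 2 ^+ m * (x / L) by rewrite truncn_le.
 have h2 := truncnS_gt (2 ^+ m * (x / L)).
set y := 2 ^+ m * (x / L) in y0 h1 h2 *; set k := Num.truncn y in h1 h2 *.
have z0 : 0 <= 2 * y by rewrite mulr_ge0.
have h3 : (Num.truncn (2 * y))%:R <= 2 * y by rewrite truncn_le.
 have h4 := truncnS_gt (2 * y).
set l := Num.truncn (2 * y) in h3 h4 *.
have : (k.*2 <= l)%N.
  rewrite -ltnS -(ltr_nat R) -muln2 natrM; apply: le_lt_trans h4; lra.
have : (l <= k.*2.+1)%N.
  rewrite -ltnS -(ltr_nat R); apply: (le_lt_trans h3).
  by rewrite -doubleS -muln2 natrM; lra.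
rewrite leq_eqVlt => /predU1P[->|]; first by right.
by rewrite ltnS => h5 h6; left; apply/eqP; rewrite eqn_leq h5 h6.
Qed.

(** The dyadic points below [x] move by at most one step of the next level, so the increments, each
    at most [q * r ^+ m], sum to a geometric series; continuity carries the bound to [x] itself. *)
Lemma chain_bound (n : nat) (r : R) (f : R -> R) (x : R) :
  (0 < n)%N -> ~~ odd n -> 0 < r < 1 -> continuous f -> 0 <= x <= L ->
  (((f x - f 0) ^+ n)%:E <=
    ((1 - r)^-1 ^+ n)%:E * \sum_(m <oo) (chain_level n m r f)%:E)%E.
Proof.
move=> n0 en /andP[r0 r1] cf xL.
have lev0 m : 0 <= chain_level n m r f.
  rewrite /chain_level mulr_ge0 ?exprn_ge0 ?invr_ge0 ?(ltW r0)//.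
  by apply: sumr_ge0 => i _; rewrite exprn_even_ge0.
have S0 : (0 <= \sum_(m <oo) (chain_level n m r f)%:E)%E.
  by apply: nneseries_ge0 => m _ _; rewrite lee_fin.
have c0 : 0 < (1 - r)^-1 ^+ n by rewrite exprn_gt0// invr_gt0; lra.
have [Sy|Sfin] := eqVneq (\sum_(m <oo) (chain_level n m r f)%:E)%E +oo%E.
  by rewrite Sy gt0_muley ?leey// lte_fin.
have Sf : (\sum_(m <oo) (chain_level n m r f)%:E)%E \is a fin_num.
  by rewrite ge0_fin_numE// ltey.
rewrite -(fineK Sf) -EFinM lee_fin.
(* The [n]-th root of the whole sum serves all levels at once. *)
set S := fine _; pose q := S `^ (n%:R^-1).
have S0' : 0 <= S by rewrite /S fine_ge0.
have qn : q ^+ n = S.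
  by rewrite /q -powR_mulrn ?powR_ge0// -powRrM mulVf ?powRr1// pnatr_eq0 -lt0n.
have q0 : 0 <= q by exact: powR_ge0.
have inc m i : (i < 2 ^ m)%N -> `|f (dyad m i.+1) - f (dyad m i)| <= q * r ^+ m.
  move=> im; rewrite -(@ler_pXn2r _ n)// ?nnegrE ?mulr_ge0 ?exprn_ge0 ?(ltW r0)//.
  rewrite -normrX ger0_norm ?exprn_even_ge0// exprMn qn -exprM.
  rewrite -ler_pdivrMr ?exprn_gt0// mulrC.
  apply: (@le_trans _ _ (chain_level n m r f)).
    rewrite /chain_level exprVn; apply: ler_wpM2l; first by rewrite invr_ge0 exprn_ge0// ltW.
    rewrite (bigD1 (Ordinal im))//= lerDl; apply: sumr_ge0 => k _.
    by rewrite exprn_even_ge0.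
  rewrite -lee_fin fineK//.
  have := @nneseries_lim_ge R (fun k => (chain_level n k r f)%:E) xpredT 0%N m.+1.
  rewrite big_mkord big_ord_recr/= => /(_ (fun k _ _ => lev0 k)); apply: le_trans.
  by rewrite leeDr// sume_ge0// => k _; rewrite lee_fin.
have r1' : 0 < 1 - r by lra.
pose X m := dyad m (dyad_below m x).
have part m : `|f (X m) - f 0| <= q * \sum_(i < m.+1) r ^+ i.
  elim: m => [|m IH].
    rewrite big_ord1 expr0 mulr1 /X.
    (* At level 0 the point is an endpoint of [0, L]: index 0, or index 1 when [x = L]. *)
    have := dyad_below_le 0 xL; rewrite expn0; case: (dyad_below 0 x) => [_|[_|//]].
      by rewrite /dyad mul0r mulr0 subrr normr0.
    by have := inc 0%N 0%N isT; rewrite expr0 mulr1 {2}/dyad mul0r mulr0.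
  rewrite (_ : _ - _ = (f (X m.+1) - f (X m)) + (f (X m) - f 0)); last by rewrite addrA subrK.
  apply: (le_trans (ler_normD _ _)); rewrite big_ord_recr/= mulrDr addrC; apply: lerD => //.
  rewrite /X; have [e|e] := dyad_belowS m xL; rewrite e.
    by rewrite dyad_double subrr normr0 mulr_ge0// exprn_ge0// ltW.
  rewrite -(dyad_double m (dyad_below m x)); apply: inc.
  by have := dyad_below_le m.+1 xL; rewrite e.
have geo m : \sum_(i < m) r ^+ i <= (1 - r)^-1.
  rewrite -[leRHS]mul1r ler_pdivlMr// mulrC.
  have := exprn_ge0 m (ltW r0); have := subrX1 r m.
  by set S' := \sum_(i < m) _; nra.
have lim : `|f x - f 0| <= q * (1 - r)^-1.
  have cX : X m @[m --> \oo] --> x.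
    apply/cvgrPdist_le => e e0.
    have : (geometric L 2^-1) m @[m --> \oo] --> 0.
      by apply: cvg_geometric; rewrite ger0_norm; lra.
    move/cvgr0_norm_le => /(_ e e0); apply: filterS => m /= h.
    apply: (le_trans (dyad_below_dist m xL)); apply: le_trans h.
    by rewrite -exprVn ler_norm.
  have cfX : `|f (X m) - f 0| @[m --> \oo] --> `|f x - f 0|.
    apply: cvg_norm; apply: (@cvgB _ R^o); last exact: cvg_cst.
    by apply: cvg_comp; [exact: cX|exact: cf].
  rewrite -(cvg_lim _ cfX)//; apply: limr_le.
    by apply/cvg_ex; eexists; exact: cfX.
  by apply: nearW => m; apply: le_trans (part m) _; rewrite ler_wpM2l.
rewrite mulrC -qn -exprMn.
rewrite -[leLHS]ger0_norm ?exprn_even_ge0// normrX ler_pXn2r ?nnegrE//.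
by rewrite mulr_ge0// invr_ge0 ltW.
Qed.

End dyadic_chain.

Section chain_expectation.
Context {R : realType} {d : measure_display} {Omega : measurableType d}.
Variable P : probability Omega R.
Variables (L r : R) (n : nat) (Z : R -> Omega -> R).
Hypotheses (L0 : 0 < L) (r01 : 0 < r < 1) (n0 : (0 < n)%N) (en : ~~ odd n).
Hypothesis mZ : forall x, 0 <= x <= L -> measurable_fun setT (Z x).

(* Chaining along dyadic points, with Hoelder weights [r ^ m] on level [m]:
   [chainQ] dominates the [n]-th power of the oscillation of [Z]. *)
Definition chainQ (w : Omega) : \bar R :=
  (((1 - r)^-1 ^+ n)%:E * \sum_(m <oo) (chain_level L n m r (Z ^~ w))%:E)%E.

Lemma chain_level_ge0 m f : 0 <= chain_level L n m r f.
Proof.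
case/andP : r01 => r0 r1.
rewrite /chain_level mulr_ge0 ?exprn_ge0 ?invr_ge0 ?(ltW r0)//.
by apply: sumr_ge0 => i _; rewrite exprn_even_ge0.
Qed.

Lemma dyad_in m i : (i <= 2 ^ m)%N -> 0 <= dyad L m i <= L.
Proof.
move=> im; have p2 : 0 < 2 ^+ m :> R by rewrite exprn_gt0.
rewrite /dyad mulr_ge0 ?divr_ge0 ?(ltW L0) ?(ltW p2)//= ler_piMr ?(ltW L0)// ler_pdivrMr//.
by rewrite mul1r -natrX ler_nat.
Qed.

Lemma measurable_chain_level m : measurable_fun setT (fun w => chain_level L n m r (Z ^~ w)).
Proof.
apply: measurable_funM => //; apply: measurable_sum => i; apply: measurable_funX.
by apply: measurable_funB; apply: mZ; apply: dyad_in => //; exact: ltnW.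
Qed.

Lemma chainQ_ge0 w : (0 <= chainQ w)%E.
Proof.
case/andP : r01 => r0 r1.
apply: mule_ge0; first by rewrite lee_fin exprn_ge0// invr_ge0; lra.
by apply: nneseries_ge0 => m _ _; rewrite lee_fin chain_level_ge0.
Qed.

Lemma measurable_chainQ : measurable_fun setT chainQ.
Proof.
apply: measurable_funeM; apply: ge0_emeasurable_sum => [m w _ _|m _].
  by rewrite lee_fin chain_level_ge0.
by apply/measurable_EFinP; exact: measurable_chain_level.
Qed.

(** Level [m] has [2 ^ m] increments, weighted by [r^-1 ^+ (m * n)]; under the smallness condition
    its expectation is at most [M * 2^-1 ^+ m]. *)
Lemma chain_expectation (M A : R) : 0 <= M -> 0 <= A -> 2 * r^-1 ^+ n * A <= 2^-1 ->
  (forall m i, (i < 2 ^ m)%N ->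
    (\int[P]_w ((Z (dyad L m i.+1) w - Z (dyad L m i) w) ^+ n)%:E <= (M * A ^+ m)%:E)%E) ->
  (\int[P]_w chainQ w <= ((1 - r)^-1 ^+ n * (2 * M))%:E)%E.
Proof.
case/andP : (r01) => r0 r1 M0 A0 rA Zm.
have c0 : 0 <= (1 - r)^-1 ^+ n by rewrite exprn_ge0// invr_ge0; lra.
rewrite ge0_integralZl//; last 2 first.
- apply: ge0_emeasurable_sum => [m w _ _|m _]; first by rewrite lee_fin chain_level_ge0.
  by apply/measurable_EFinP; exact: measurable_chain_level.
- by move=> w _; apply: nneseries_ge0 => m _ _; rewrite lee_fin chain_level_ge0.
rewrite EFinM; apply: lee_wpmul2l; first by rewrite lee_fin.
rewrite integral_nneseries//; last 2 first.
- by move=> m; apply/measurable_EFinP; exact: measurable_chain_level.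
- by move=> m w _; rewrite lee_fin chain_level_ge0.
have lev m : (\int[P]_w (chain_level L n m r (Z ^~ w))%:E <= (geometric M 2^-1 m)%:E)%E.
  have mi i : (i < 2 ^ m)%N -> measurable_fun setT (fun w => (Z (dyad L m i.+1) w - Z (dyad L m
    i) w) ^+ n).
    move=> im; apply: measurable_funX; apply: measurable_funB; apply: mZ; apply: dyad_in => //.
    exact: ltnW.
  have rm0 : 0 <= r^-1 ^+ (m * n) by rewrite exprn_ge0// invr_ge0 ltW.
  rewrite /chain_level integral_realZ//; last 2 first.
  - by apply: measurable_sum => i; exact: mi.
  - by move=> w; apply: sumr_ge0 => i _; rewrite exprn_even_ge0.
  under eq_integral do rewrite -sumEFin.
  rewrite ge0_integral_sum//; last 2 first.
  - by move=> i; apply/measurable_EFinP; exact: mi.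
  - by move=> i w _; rewrite lee_fin exprn_even_ge0.
  apply: (@le_trans _ _ ((r^-1 ^+ (m * n))%:E * \sum_(i < 2 ^ m) (M * A ^+ m)%:E)%E).
    by apply: lee_wpmul2l; [rewrite lee_fin|apply: lee_sum => i _; exact: Zm].
  rewrite sumEFin -EFinM lee_fin sumr_const card_ord -[X in _ * X]mulr_natr natrX.
  have -> : r^-1 ^+ (m * n) * (M * A ^+ m * 2 ^+ m) = M * (2 * r^-1 ^+ n * A) ^+ m.
    by rewrite !exprMn -exprM [(n * m)%N]mulnC; ring.
  apply: ler_wpM2l => //; rewrite lerXn2r ?nnegrE ?mulr_ge0 ?exprn_ge0 ?invr_ge0 ?(ltW r0)//.
apply: (@le_trans _ _ (\sum_(m <oo) ((geometric M 2^-1 m : R)%:E))%E).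
  apply: lee_nneseries => m _ // _.
  by apply: integral_ge0 => w _; rewrite lee_fin chain_level_ge0.
have cg : series (geometric (M : R) 2^-1) @ \oo --> (M / (1 - 2^-1) : R).
  by apply: cvg_geometric_series; rewrite ger0_norm; lra.
have -> : 2 * M = M / (1 - 2^-1) by field; lra.
apply: lime_le.
  by apply: is_cvg_nneseries => j _ _; rewrite lee_fin mulr_ge0// exprn_ge0.
apply: nearW => N; rewrite sumEFin lee_fin -(cvg_lim _ cg)//; apply: nondecreasing_cvgn_le.
  by apply: nondecreasing_series => j _ _; rewrite /= mulr_ge0// exprn_ge0.
by apply/cvg_ex; eexists; exact: cg.
Qed.

End chain_expectation.

Section steps.
Context {R : realType}.
Variables (f : R -> R) (s t : R).
Hypotheses (st : s <= t) (f0 : forall r, 0 <= f r).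

Definition stepf (N : nat) (r : R) : R :=
  \sum_(i < N) f (part s t N i) * \1_(`]part s t N i, part s t N i.+1]%classic) r.

Lemma part_le N i : part s t N i <= part s t N i.+1.
Proof. by rewrite part_step lerDl divr_ge0 ?subr_ge0. Qed.

Lemma part0 N : part s t N 0 = s.
Proof. by rewrite /part mul0r mulr0 addr0. Qed.

Lemma partN N : (0 < N)%N -> part s t N N = t.
Proof. by move=> N0; rewrite /part divff ?pnatr_eq0 -?lt0n//; ring. Qed.

Lemma indic_part N i r : \1_(`]part s t N i, part s t N i.+1]%classic) r =
  (r <= part s t N i.+1)%R%:R - (r <= part s t N i)%R%:R :> R.
Proof.
rewrite indicE mem_setE in_itv/=; have h := part_le N i.
case: (leP r (part s t N i)) => h1; first by rewrite (le_trans h1 h) subrr.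
by case: (r <= part s t N i.+1); rewrite subr0.
Qed.

Lemma sum_indic_part N r : (0 < N)%N ->
  \sum_(i < N) (\1_(`]part s t N i, part s t N i.+1]%classic) r : R) = \1_(`]s, t]%classic) r.
Proof.
move=> N0; under eq_bigr do rewrite indic_part.
have := telescope_sumr (fun i => (r <= part s t N i)%R%:R : R) (leq0n N).
rewrite big_mkord => ->; rewrite part0 partN// indicE mem_setE in_itv/=.
by case: (leP r s) => h1; [rewrite (le_trans h1 st) subrr|case: (r <= t); rewrite subr0].
Qed.

(** Left-endpoint values of an increasing kernel lie below the kernel, which controls the L^2 norm
    of the step function uniformly in [N]. *)
Lemma stepf_le N r : (0 < N)%N -> (forall x y, x <= y -> f x <= f y) ->
  0 <= stepf N r <= f r * \1_(`]s, t]%classic) r.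
Proof.
move=> N0 fnd; apply/andP; split.
  by apply: sumr_ge0 => i _; rewrite mulr_ge0// indicE.
rewrite -(sum_indic_part r N0) mulr_sumr; apply: ler_sum => i _.
rewrite indicE mem_setE in_itv/=; case: ltP => h; rewrite ?andbF ?mulr0//=.
by apply: ler_wpM2r => //; apply: fnd; exact: ltW.
Qed.

Lemma stepf_dist N r C : (0 < N)%N -> 0 <= C ->
  (forall x y, x <= y -> y <= t -> `|f x - f y| <= C * (y - x)) ->
  `|f r * \1_(`]s, t]%classic) r - stepf N r| <= C * ((t - s) / N%:R) * \1_(`]s, t]%classic) r.
Proof.
move=> N0 C0 fC; rewrite -(sum_indic_part r N0) mulr_sumr -sumrB mulr_sumr.
apply: (le_trans (ler_norm_sum _ _ _)); apply: ler_sum => i _.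
rewrite -mulrBl normrM [`|\1__ _|]ger0_norm; last by rewrite indicE.
rewrite indicE mem_setE in_itv/=; case: ltP => h; rewrite ?mulr0//=.
case: (boolP (r <= part s t N i.+1)) => h2; rewrite /= ?mulr0// !mulr1.
have /andP[h3 h4] := part_in st (ltn_ord i).
rewrite distrC; apply: (le_trans (fC _ _ (ltW h) (le_trans h2 h4))).
by apply: ler_wpM2l => //; move: h2; rewrite part_step; lra.
Qed.

End steps.

Section exp_kernel.
Context {R : realType}.
Local Notation leb := (@lebesgue_measure R).
Variables (mu t : R).
Hypothesis mu0 : 0 < mu.

Definition expker (r : R) : R := expR (- (mu * (t - r))).

Lemma expker_ge0 r : 0 <= expker r. Proof. exact: expR_ge0. Qed.

Lemma expker_nd x y : x <= y -> expker x <= expker y.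
Proof. by move=> xy; rewrite ler_expR lerN2 ler_pM2l// lerB. Qed.

Lemma continuous_expker : continuous expker.
Proof.
have -> : expker = (fun r => expR (- (mu * t)) * expR (mu * r)).
  by apply/funext => r; rewrite /expker -expRD; congr expR; ring.
by move=> x; apply: cvgM; [exact: cvg_cst|exact: continuous_expM].
Qed.

Lemma is_derive_expker r : is_derive r (1 : R) expker (mu * expker r).
Proof.
have -> : expker = (fun r => expR (- (mu * t)) * expR (mu * r)).
  by apply/funext => x; rewrite /expker -expRD; congr expR; ring.
have d1 := is_derive_expM mu r.
by apply: is_derive_eq; rewrite /GRing.scale/=; ring.
Qed.

Lemma expker_lip x y : x <= y -> y <= t -> `|expker x - expker y| <= mu * (y - x).
Proof.
move=> xy yt; rewrite distrC; apply: (MVT_bound xy is_derive_expker) => r /andP[_ ry].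
rewrite ger0_norm ?mulr_ge0 ?expker_ge0 ?(ltW mu0)// ler_piMr ?(ltW mu0)//.
rewrite -expR0 ler_expR oppr_le0 mulr_ge0 ?(ltW mu0)// subr_ge0.
exact: le_trans ry yt.
Qed.

(** The variance of [ouinc] over a time step [tau]; [Rint_expker_sqr] identifies it with the energy
    of the kernel. *)
Definition ouvar (tau : R) : R := (1 - expR (- (2 * mu * tau))) / (2 * mu).

Lemma Rint_expker_sqr s : s <= t ->
  \int[leb]_(r in `[s, t]) (expker r ^+ 2) = ouvar (t - s).
Proof.
move=> st; have dF r : is_derive r (1 : R) (fun r => (2 * mu)^-1 * expker r ^+ 2) (expker r ^+ 2).
  have d1 := is_derive_expker r; apply: is_derive_eq.
  by rewrite /GRing.scale/=; field; rewrite gt_eqF.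
have c2 : continuous (fun r => expker r ^+ 2).
  move=> x; apply: (cvg_comp expker (fun y => y ^+ 2)); last exact: sqr_continuous.
  exact: continuous_expker.
rewrite (Rintegral_FTC2 st c2 dF) /ouvar /expker subrr mulr0 oppr0 expR0 expr1n.
have -> : expR (- (mu * (t - s))) ^+ 2 = expR (- (2 * mu * (t - s))).
  by rewrite -expRM_natl; congr expR; ring.
by field; rewrite gt_eqF.
Qed.

Lemma ouvar_ge0 tau : 0 <= tau -> 0 <= ouvar tau.
Proof.
move=> t0; rewrite /ouvar divr_ge0//; last by rewrite mulr_ge0// ltW.
by rewrite subr_ge0 -expR0 ler_expR oppr_le0 !mulr_ge0// ltW.
Qed.

Lemma ouvar_le tau : ouvar tau <= (2 * mu)^-1.
Proof.
by rewrite /ouvar -[leRHS]mul1r ler_pM2r ?invr_gt0 ?mulr_gt0// gerBl expR_ge0.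
Qed.

Lemma int_stepf_sqr N s T : (0 < N)%N -> 0 <= s -> s <= t -> t <= T ->
  (\int[leb]_(r in `[0%R, T]) ((stepf expker s t N r) ^+ 2)%:E <= (ouvar (t - s))%:E)%E.
Proof.
move=> N0 s0 st tT.
pose g : R -> \bar R := (fun r : R => (expker r ^+ 2)%:E) \_ `[s, t]%classic.
apply: (@le_trans _ _ (\int[leb]_(r in `[0%R, T]) g r)%E).
  apply: ge0_le_integralW => r _; first by rewrite lee_fin sqr_ge0.
  have /andP[h1 h2] := stepf_le st expker_ge0 r N0 expker_nd.
  rewrite /g patchE; case: ifPn => [_|]; rewrite /= lee_fin.
    rewrite ler_pXn2r ?nnegrE ?expker_ge0//; apply: (le_trans h2).
    by rewrite ler_piMr ?expker_ge0// indicE; case: (_ \in _).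
  rewrite mem_setE in_itv/= => h3; move: h2; rewrite indicE mem_setE in_itv/=.
  have -> : (s < r <= t) = false.
    by apply/negbTE; apply: contra h3 => /andP[/ltW -> ->].
  by rewrite mulr0 => h2; rewrite (_ : stepf _ _ _ _ _ = 0) ?expr0n//; apply/eqP; rewrite eq_le h2.
rewrite /g -integral_mkcondr setIidr; last first.
  by apply: subset_itv; rewrite bnd_simp.
rewrite -(Rint_expker_sqr st) /Rintegral fineK//.
apply: (integrable_fin_num (mu := leb)); first exact: measurable_itv.
apply: continuous_itv_integrable => x.
by apply: (cvg_comp expker (fun y => y ^+ 2)); [exact: continuous_expker|exact: sqr_continuous].
Qed.

End exp_kernel.

(** * Regularity of the modes in time *)

Section good_paths.
Context {R : realType} {d : measure_display} {Omega : measurableType d}.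
Variable P : probability Omega R.
Variables (T : R) (W : R -> H01 R -> Omega -> R).
Hypothesis (Ww : cylindrical_wiener P T W) (T0 : 0 <= T).
Local Notation H := (H01 R).

Definition good_path (w : Omega) : Prop := forall k,
  {within `[0, T], continuous (fun t => W t (eigf k) w)} /\ W 0 (eigf k) w = 0.

Lemma good_path_exists : exists G : set Omega,
  [/\ measurable G, P (~` G) = 0%E & G `<=` good_path].
Proof.
have : {ae P, forall w, good_path w}.
  apply/ae_foralln => k; have := cw_cont Ww (eigf k); apply: filterS2 (cw_zero Ww (eigf k)).
  by move=> w; split.
case=> N [mN N0 gN]; exists (~` N); split.
- exact: measurableC.
- by rewrite setCK.
- by move=> w Nw; apply: contrapT => gw; apply: Nw; exact: gN.
Qed.

Definition clampT (t : R) : R := Num.max 0 (Num.min t T).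

Lemma clampT_in t : 0 <= clampT t <= T.
Proof. by rewrite /clampT le_max lexx/= ge_max T0 ge_min lexx orbT. Qed.

Lemma clampT_id t : 0 <= t <= T -> clampT t = t.
Proof. by move=> /andP[t0 tT]; rewrite /clampT min_l// max_r. Qed.

Lemma clampT_le0 t : t <= 0 -> clampT t = 0.
Proof. by move=> t0; rewrite /clampT max_l// ge_min t0. Qed.

Lemma clampT_lip x y : `|clampT x - clampT y| <= `|x - y|.
Proof.
have n1 : x - y <= `|x - y| by exact: ler_norm.
have n2 : y - x <= `|x - y| by rewrite distrC ler_norm.
have n0 : 0 <= `|x - y| by [].
rewrite /clampT; have [h1|h1] := leP x T; have [h2|h2] := leP y T; rewrite ?(max_r T0);
  have [h3|h3] := leP 0 x; have [h4|h4] := leP 0 y; rewrite ler_norml;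
  have T0' := T0; lra.
Qed.

Lemma continuous_clampT : continuous clampT.
Proof.
move=> x; apply/cvgrPdist_le => e e0; exists e => //= y xy.
exact: le_trans (clampT_lip x y) (ltW xy).
Qed.

Variable G : set Omega.
Hypotheses (mG : measurable G) (PG : P (~` G) = 0%E) (Ggood : G `<=` good_path).

(* Vanishing off [G] makes every path continuous, not only almost every one;
   clamping the time makes it continuous on the whole line. *)
Definition coord_path (k : nat) (w : Omega) (t : R) : R := \1_G w * W (clampT t) (eigf k) w.

Lemma BpE k w t : G w -> 0 <= t <= T -> coord_path k w t = W t (eigf k) w.
Proof. by move=> Gw tT; rewrite /coord_path indicE mem_set// mul1r clampT_id. Qed.

Lemma coord_path_le0 k w t : t <= 0 -> coord_path k w t = 0.
Proof.
move=> t0; rewrite /coord_path indicE; case: (boolP (w \in G)) => [|_]; last by rewrite mul0r.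
by rewrite inE clampT_le0// => /Ggood /(_ k)[_ ->]; rewrite mulr0.
Qed.

Lemma coord_path_notin k w : ~ G w -> coord_path k w = cst 0.
Proof. by move=> Gw; apply/funext => t; rewrite /coord_path indicE memNset// mul0r. Qed.

Lemma continuous_coord_path k w : continuous (coord_path k w).
Proof.
have [Gw|Gw] := pselect (G w); last by rewrite coord_path_notin//; exact: cst_continuous.
have -> : coord_path k w = fun t => W (clampT t) (eigf k) w.
  by apply/funext => t; rewrite /coord_path indicE mem_set// mul1r.
have [cW _] := Ggood Gw k; move=> x.
have /subspace_continuousP := cW => /(_ (clampT x)).
have xT : (`[0, T]%classic : set R) (clampT x) by rewrite /= in_itv/= clampT_in.
move=> /(_ xT) cx; apply: (cvg_comp clampT (fun t => W t (eigf k) w)); last exact: cx.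
move=> A; rewrite /within/= => nA; have h : nbhs x (clampT @^-1` (fun t => t \in `[0,
  T] -> A t)) := @continuous_clampT x _ nA.
apply: (@filterS _ (nbhs x) _ _ _ _ h) => y hy; apply: hy; rewrite /= in_itv/=; exact: clampT_in.
Qed.

Lemma measurable_coord_path k t : measurable_fun setT (fun w => coord_path k w t).
Proof.
apply: measurable_funM; first exact: measurable_indic.
exact: (cw_meas Ww) (clampT_in t).
Qed.

Lemma ae_G : {ae P, forall w, G w}.
Proof. by exists (~` G); split => //; exact: measurableC. Qed.

Definition ou_mode (mu : R) (k : nat) (t : R) (w : Omega) : R := ou mu (coord_path k w) t.

Lemma continuous_ou_mode mu k w : continuous (fun t => ou_mode mu k t w).
Proof. by apply: continuous_ou; [exact: continuous_coord_path|exact: coord_path_le0]. Qed.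

Lemma Yp0 mu k w : ou_mode mu k 0 w = 0.
Proof. by rewrite /ou_mode (ou_le0 (@coord_path_le0 k w) mu (lexx 0)). Qed.

Lemma ouinc0 mu k w t : ouinc (coord_path k w) mu 0 t = ou_mode mu k t w.
Proof. by rewrite /ouinc (ou_le0 (@coord_path_le0 k w) mu (lexx 0)) mulr0 subr0. Qed.

Lemma cvg_ousum mu k w s t : 0 <= mu -> 0 <= s -> s <= t ->
  ousum (coord_path k w) mu s t n.+1 @[n --> \oo] --> ouinc (coord_path k w) mu s t.
Proof.
move=> mu0 s0 st; apply/cvgrPdist_le => e e0.
have [N0 HN] := ousum_cvg (@continuous_coord_path k w) (@coord_path_le0 k w) mu0 s0 st e0.
by exists N0 => // n /= Nn; apply: HN.
Qed.

Lemma measurable_ousum mu k s t N :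
  measurable_fun setT (fun w => ousum (coord_path k w) mu s t N).
Proof.
apply: measurable_sum => i; apply: measurable_funM => //.
by apply: measurable_funB; exact: measurable_coord_path.
Qed.

Lemma measurable_ouinc mu k s t : 0 <= mu -> 0 <= s -> s <= t ->
  measurable_fun setT (fun w => ouinc (coord_path k w) mu s t).
Proof.
move=> mu0 s0 st.
apply: (@measurable_fun_cvg _ _ _ _ (fun n w => ousum (coord_path k w) mu s t n.+1)).
  by move=> n; exact: measurable_ousum.
by move=> w _; exact: cvg_ousum.
Qed.

Lemma measurable_ou_mode mu k t : 0 <= mu -> 0 <= t -> measurable_fun setT (ou_mode mu k t).
Proof.
by move=> mu0 t0; rewrite -(funext (ouinc0 mu k ^~ t)); exact: measurable_ouinc.
Qed.

(** For a fixed mesh the sum over modes is a single [incW] with orthonormal directions. Therefore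
    the energies of the modes add up, each being at most [ouvar] whatever the mesh, and the mesh is
    sent to zero. *)
Lemma subgaussian_ouinc (n : nat) (a m : nat -> R) (s t : R) : 0 <= s -> s <= t -> t <= T ->
  (forall k, (0 < k)%N -> 0 < m k) ->
  subgaussian P (fun w => \sum_(1 <= k < n.+1) a k * ouinc (coord_path k w) (m k) s t)
    (\sum_(1 <= k < n.+1) a k ^+ 2 * ouvar (m k) (t - s)).
Proof.
move=> s0 st tT m0.
apply: (@subgaussian_lim _ _ _ P (fun N w => \sum_(1 <=
  k < n.+1) a k * ousum (coord_path k w) (m k) s t N.+1)).
- apply: measurable_bigsum => k; rewrite mem_index_iota => /andP[k0 _].
  by apply: measurable_funM => //; apply: measurable_ouinc => //; exact: ltW (m0 _ k0).
- apply: nearW => w; apply: cvg_bigsum => k; rewrite mem_index_iota => /andP[k0 _].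
  by apply: cvgM; [exact: cvg_cst|apply: cvg_ousum => //; exact: ltW (m0 _ k0)].
move=> N; pose r := [seq (k, i) | k <- index_iota 1 n.+1, i <- iota 0 N.+1].
pose c (x : nat * nat) := a x.1 * expker (m x.1) t (part s t N.+1 x.2).
pose lo (x : nat * nat) := part s t N.+1 x.2.
pose hi (x : nat * nat) := part s t N.+1 x.2.+1.
pose g (x : nat * nat) : H := eigf x.1.
have rin x : x \in r -> (0 < x.1)%N /\ (x.2 < N.+1)%N.
  move=> /allpairsP[[k i] [/= h1 h2 ->]] /=; move: h1 h2.
  rewrite mem_index_iota -[0%N :: _]/(iota 0 N.+1) mem_iota add0n.
  by move=> /andP[? _] /andP[_ ?].
have rT x : x \in r -> [/\ 0 <= lo x, lo x <= hi x & hi x <= T].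
  move=> /rin[x1 x2]; rewrite /lo /hi.
  have /andP[h1 h2] := part_in st (ltnW x2); have /andP[h3 h4] := part_in st x2.
  by split; [exact: le_trans h1|exact: part_le|exact: le_trans tT].
have sumE (F : nat * nat -> R) : \sum_(x <- r) F x =
    \sum_(1 <= k < n.+1) \sum_(i < N.+1) F (k, nat_of_ord i).
  by rewrite /r big_allpairs; apply: eq_bigr => k _; rewrite -[iota 0 N.+1]/(index_iota 0 N.+1)
    big_mkord.
apply: (@subgaussian_ae _ _ _ P (incW W r c lo hi g)).
- apply: measurable_bigsum => k; rewrite mem_index_iota => /andP[k0 _].
  by apply: measurable_funM => //; exact: measurable_ousum.
- apply: ae_imply ae_G => w Gw _; rewrite /incW sumE; apply: eq_bigr => k _.
  rewrite /ousum mulr_sumr; apply: eq_bigr => i _.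
  have /andP[h1 h2] := part_in st (ltnW (ltn_ord i)); have /andP[h3 h4] := part_in st (ltn_ord i).
  rewrite !BpE ?(le_trans s0)// ?(le_trans _ tT)//.
  by rewrite /c/= /expker mulrA.
apply: (subgaussian_incW Ww rT).
have kE x : `|inc_ker r c lo hi g x| ^+ 2 = \sum_(1 <=
  k < n.+1) (a k ^+ 2 * (stepf (expker (m k) t) s t N.+1 x) ^+ 2).
  rewrite /inc_ker /r big_allpairs.
  rewrite (eq_bigr (fun k => (a k * stepf (expker (m k) t) s t N.+1 x) *: (eigf k : H)));
    last first.
    move=> k _; rewrite /stepf mulr_sumr scaler_suml -[iota 0 N.+1]/(index_iota 0 N.+1) big_mkord.
    by apply: eq_bigr => i _; rewrite /c/= mulrA.
  by rewrite norm_eigf_sum//; apply: eq_bigr => k _; rewrite exprMn.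
under eq_integral do rewrite kE -sumEFin.
have mst k : measurable_fun `[0%R, T] (fun x => (a k ^+ 2 * stepf (expker (m k) t) s t N.+1 x ^+
  2)%:E).
  apply/measurable_EFinP; apply: measurable_funTS; apply: measurable_funM => //.
  apply: measurable_funX; apply: measurable_sum => i; apply: measurable_funM => //.
rewrite ge0_integral_sum//; last first.
  by move=> k x _; rewrite lee_fin mulr_ge0// sqr_ge0.
rewrite -sumEFin !big_nat; apply: lee_sum => k /andP[k0 _].
rewrite integral_realZ//; last 3 first.
- apply: measurable_funTS; apply: measurable_funX; apply: measurable_sum => i; exact:
  measurable_funM.
- by move=> x; exact: sqr_ge0.
- exact: sqr_ge0.
rewrite [leRHS]EFinM lee_wpmul2l ?lee_fin ?sqr_ge0//.
by apply: int_stepf_sqr => //; exact: m0.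
Qed.

End good_paths.

Section pseries.
Context {R : realType}.

(** Discrete form of the comparison of the series with the integral of x^(-1-e); it reduces to ln (1
    + y) <= y and 1 + y <= exp y. *)
Lemma inv_le_telescope (e x : R) : 0 < e -> 0 < x ->
  e * (x + 1) `^ (- (1 + e)) <= x `^ (- e) - (x + 1) `^ (- e).
Proof.
move=> e0 x0; have x1 : 0 < x + 1 by lra.
have -> : (x + 1) `^ (- (1 + e)) = (x + 1)^-1 * (x + 1) `^ (- e).
  have -> : - (1 + e) = -1 + - e by lra.
  by rewrite powRD ?powR_inv1 ?(ltW x1)//; apply/implyP => _; rewrite gt_eqF.
rewrite lerBrDr.
have -> : x `^ (- e) = expR (- (e * ln (x / (x + 1)))) * (x + 1) `^ (- e).
  rewrite /powR !gt_eqF// -expRD; congr expR.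
  rewrite ln_div ?posrE//; ring.
have -> : e * ((x + 1)^-1 * (x + 1) `^ (- e)) + (x + 1) `^ (- e) =
  (1 + e * (x + 1)^-1) * (x + 1) `^ (- e) by ring.
rewrite ler_wpM2r ?powR_ge0//; apply: le_trans (expR_ge1Dx _).
rewrite lerD2l -mulrN ler_pM2l// lerNr.
have -> : x / (x + 1) = 1 + (- (x + 1)^-1) by field; lra.
apply: le_ln1Dx; rewrite ltrNl opprK invf_lt1; lra.
Qed.

Lemma pseries_le (e : R) n : 0 < e -> \sum_(k < n) k.+1%:R `^ (- (1 + e)) <= 1 + e^-1.
Proof.
move=> e0.
suff H m : \sum_(k < m.+1) k.+1%:R `^ (- (1 + e)) <= 1 + e^-1 * (1 - m.+1%:R `^ (- e)).
  case: n => [|n]; first by rewrite big_ord0 addr_ge0// invr_ge0 ltW.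
  apply: le_trans (H n) _; rewrite lerD2l; apply: ler_piMr; first by rewrite invr_ge0 ltW.
  by rewrite lerBlDr lerDl powR_ge0.
elim: m => [|m IH].
  by rewrite big_ord_recr big_ord0 /= !powR1 subrr mulr0 addr0 add0r.
rewrite big_ord_recr/=; apply: le_trans (lerD IH (lexx _)) _.
rewrite -addrA lerD2l.
have := @inv_le_telescope e m.+1%:R e0 (ltr0Sn _ _); rewrite natr1.
set u := m.+1%:R `^ (- e); set v := m.+2%:R `^ (- e); set z := m.+2%:R `^ _ => h.
have -> : 1 - v = (1 - u) + (u - v) by ring.
by rewrite (mulrDr _ (1 - u)) lerD2l mulrC ler_pdivlMr// mulrC.
Qed.
End pseries.

Section subgaussian_chaining.
Context {R : realType} {d : measure_display} {Omega : measurableType d}.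
Variable P : probability Omega R.

(* Any ratio [r] with [th < r ^+ 2 < 1] would do. *)
Definition chain_ratio (th : R) : R := (1 + th) / 2.

Lemma chain_ratio_in (th : R) : 0 < th < 1 -> 0 < chain_ratio th < 1.
Proof. by rewrite /chain_ratio => /andP[? ?]; apply/andP; split; lra. Qed.

(** By the inequality of arithmetic and geometric means [th / chain_ratio th ^+ 2 < 1]; a high power
    of this quotient absorbs the factor 2 that counts the dyadic intervals of each level. *)
Lemma chain_power_exists (th : R) : 0 < th < 1 -> exists j0 : nat, forall j, (j0 <= j)%N ->
  2 * (chain_ratio th)^-1 ^+ (2 * j) * th ^+ j <= 2^-1.
Proof.
move=> /[dup] /chain_ratio_in /andP[r0 r1] /andP[t0 t1].
pose q := th / chain_ratio th ^+ 2.
have r20 : 0 < chain_ratio th ^+ 2 by rewrite exprn_gt0.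
have q0 : 0 < q by rewrite divr_gt0.
have q1 : q < 1.
  rewrite ltr_pdivrMr// mul1r /chain_ratio -subr_gt0.
  have -> : ((1 + th) / 2) ^+ 2 - th = ((1 - th) / 2) ^+ 2 by field.
  by rewrite exprn_gt0//; lra.
have : q ^+ n @[n --> \oo] --> (0 : R) by apply: cvg_expr; rewrite ger0_norm// ltW.
move/cvgrPdist_le => /(_ 4^-1 ltac:(lra)) [N _ HN]; exists N => j Nj.
have := HN j Nj; rewrite sub0r normrN ger0_norm ?exprn_ge0 ?(ltW q0)//.
rewrite /q expr_div_n exprVn -exprM; set X := chain_ratio th ^+ (2 * j).
by move=> h; rewrite -mulrA [X in 2 * X]mulrC; lra.
Qed.

Variables (L : R) (j : nat) (Z : R -> Omega -> R) (K th : R).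
Hypotheses (L0 : 0 < L) (K0 : 0 < K) (th01 : 0 < th < 1).
Hypothesis jth : 2 * (chain_ratio th)^-1 ^+ (2 * j) * th ^+ j <= 2^-1.
Hypothesis mZ : forall x, 0 <= x <= L -> measurable_fun setT (Z x).
Hypothesis sgZZ : forall m i, (i < 2 ^ m)%N ->
  subgaussian P (fun w => Z (dyad L m i.+1) w - Z (dyad L m i) w) (K * th ^+ m).

Lemma subgaussian_chain :
  (\int[P]_w chainQ L (chain_ratio th) (2 * j) Z w <=
    ((1 - chain_ratio th)^-1 ^+ (2 * j) * (4 * j`!%:R) * (2 * expR 2 * K) ^+ j)%:E)%E.
Proof.
have t0 : 0 < th by case/andP: th01.
have -> : (1 - chain_ratio th)^-1 ^+ (2 * j) * (4 * j`!%:R) * (2 * expR 2 * K) ^+ j =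
  (1 - chain_ratio th)^-1 ^+ (2 * j) * (2 * (2 * j`!%:R * (2 * expR 2 * K) ^+ j)) by ring.
have en : ~~ odd (2 * j) by rewrite oddM.
have M0 : 0 <= 2 * j`!%:R * (2 * expR 2 * K) ^+ j.
  by rewrite !mulr_ge0// exprn_ge0// !mulr_ge0 ?expR_ge0// ltW.
apply: (chain_expectation L0 (chain_ratio_in th01) en mZ M0 _ jth).
  by rewrite exprn_ge0// ltW.
move=> m i im.
apply: le_trans (subgaussian_moment j _ (sgZZ im)) _; first by rewrite mulr_gt0// exprn_gt0.
by rewrite lee_fin (mulrA _ K) (exprMn _ _ (th ^+ m)) -!exprM (mulnC j m) mulrA.
Qed.
End subgaussian_chaining.

Section ou_time.
Context {R : realType} {d : measure_display} {Omega : measurableType d}.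
Variable P : probability Omega R.
Variables (T : R) (W : R -> H01 R -> Omega -> R).
Hypothesis (Ww : cylindrical_wiener P T W) (T0 : 0 < T).
Variable G : set Omega.
Hypotheses (mG : measurable G) (PG : P (~` G) = 0%E) (Ggood : G `<=` good_path T W).
Local Notation coord_path := (coord_path T W G).
Local Notation ou_mode := (ou_mode T W G).

(** Interpolates between the bounds [x] and 1: a small exponent [a] gives up regularity in time and
    keeps more decay in [mu] for the variance [ouvar]. *)
Lemma one_sub_exp_le_powR (a x : R) : 0 < a <= 1 -> 0 <= x -> 1 - expR (- x) <= x `^ a.
Proof.
move=> /andP[a0 a1] x0; have [->|xn0] := eqVneq x 0.
  by rewrite oppr0 expR0 subrr powR_ge0.
have xp : 0 < x by rewrite lt_neqAle eq_sym xn0.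
have e0 := expR_ge0 (- x).
have [x1|x1] := leP x 1.
  have := expR_ge1Dx (- x); suff : x <= x `^ a by lra.
  by rewrite -{1}(powRr1 x0) ger_powR ?xp.
have : 1 <= x `^ a by rewrite -(powRr0 x) ler_powR// ltW.
lra.
Qed.

Lemma subgaussian_ou_mode k mu t : (0 < k)%N -> 0 < mu -> 0 <= t <= T ->
  subgaussian P (ou_mode mu k t) (2 * mu)^-1.
Proof.
move=> k0 mu0 /andP[t0 tT].
have := @subgaussian_ouinc _ _ _ P T W Ww (ltW T0) G mG PG Ggood k (fun i => (i == k)%:R) (fun=>
  mu) 0 t (lexx _) t0 tT (fun _ _ => mu0).
rewrite (_ : (fun w => _) = ou_mode mu k t); last first.
  apply/funext => w; rewrite big_nat_recr//= eqxx mul1r big_nat big1 ?add0r ?ouinc0//.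
  by move=> i /andP[_ ik]; rewrite lt_eqF// mul0r.
apply: subgaussian_le; rewrite big_nat_recr//= eqxx expr1n mul1r big_nat big1 ?add0r.
  exact: ouvar_le.
by move=> i /andP[_ ik]; rewrite lt_eqF// expr0n/= mul0r.
Qed.

Lemma subgaussian_ouinc1 k mu s t : (0 < k)%N -> 0 < mu -> 0 <= s -> s <= t -> t <= T ->
  subgaussian P (fun w => ouinc (coord_path k w) mu s t) (ouvar mu (t - s)).
Proof.
move=> k0 mu0 s0 st tT.
have := @subgaussian_ouinc _ _ _ P T W Ww (ltW T0) G mG PG Ggood k (fun i => (i == k)%:R) (fun=>
  mu) s t s0 st tT (fun _ _ => mu0).
rewrite (_ : (fun w => _) = (fun w => ouinc (coord_path k w) mu s t)); last first.
  apply/funext => w; rewrite big_nat_recr//= eqxx mul1r big_nat big1 ?add0r//.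
  by move=> i /andP[_ ik]; rewrite lt_eqF// mul0r.
apply: subgaussian_le; rewrite big_nat_recr//= eqxx expr1n mul1r big_nat big1 ?add0r//.
by move=> i /andP[_ ik]; rewrite lt_eqF// expr0n/= mul0r.
Qed.

(** The increment is the innovation over [s, t] minus the decay of the old value. Both have variance
    at most the [v] of the proof, and adding them without independence costs the factor 4. *)
Lemma subgaussian_ou_mode_incr k mu s t a : (0 < k)%N -> 0 < mu -> 0 <= s -> s <= t -> t <= T ->
  0 < a <= 1 ->
  subgaussian P (fun w => ou_mode mu k t w - ou_mode mu k s w) (2 * mu^-1 * (2 * mu * (t - s)) `^
    a).
Proof.
move=> k0 mu0 s0 st tT a01.
pose v := (2 * mu)^-1 * (2 * mu * (t - s)) `^ a.
have tau0 : 0 <= t - s by lra.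
have sT : 0 <= s <= T by rewrite s0 (le_trans st).
have -> : 2 * mu^-1 * (2 * mu * (t - s)) `^ a = 4 * v by rewrite /v; field; rewrite gt_eqF.
have -> : (fun w => ou_mode mu k t w - ou_mode mu k s w) =
  (fun w => (expR (- (mu * (t - s))) - 1) * ou_mode mu k s w + ouinc (coord_path k w) mu s t).
  by apply/funext => w; rewrite /ouinc /ou_mode; ring.
have pw : 1 - expR (- (2 * mu * (t - s))) <= (2 * mu * (t - s)) `^ a.
  by apply: one_sub_exp_le_powR => //; rewrite !mulr_ge0// ltW.
have e1 : expR (- (mu * (t - s))) <= 1.
  by rewrite -expR0 ler_expR oppr_le0 mulr_ge0// ltW.
have e2 : expR (- (2 * mu * (t - s))) <= expR (- (mu * (t - s))).
  by rewrite ler_expR lerN2 ler_wpM2r//; lra.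
have e0 := expR_ge0 (- (mu * (t - s))).
apply: subgaussianD.
  apply: subgaussian_le (subgaussianZ _ (subgaussian_ou_mode k0 mu0 sT)).
  rewrite mulrC ler_wpM2l ?invr_ge0 ?mulr_ge0 ?(ltW mu0)//; apply: le_trans pw.
  by rewrite expr2; set e := expR _ in e1 e2 e0 *; nra.
apply: subgaussian_le (subgaussian_ouinc1 k0 mu0 s0 st tT).
by rewrite /ouvar mulrC ler_wpM2l// invr_ge0 mulr_ge0// ltW.
Qed.

Lemma subgaussian_ou_mode_dyad k mu a m i : (0 < k)%N -> 0 < mu -> 0 < a <= 1 -> (i < 2 ^ m)%N ->
  subgaussian P (fun w => ou_mode mu k (dyad T m i.+1) w - ou_mode mu k (dyad T m i) w)
    (2 * mu^-1 * (2 * mu * T) `^ a * (2 `^ (- a)) ^+ m).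
Proof.
move=> k0 mu0 a01 im.
have /andP[h1 h2] := dyad_in T0 (ltnW im); have /andP[h3 h4] := dyad_in T0 im.
have dd : dyad T m i.+1 - dyad T m i = T * 2 `^ (- m%:R).
  by rewrite /dyad -mulrBr -mulrBl -natr1 addrAC subrr add0r powRN powR_mulrn// mul1r.
have le : dyad T m i <= dyad T m i.+1.
  by rewrite -subr_ge0 dd mulr_ge0 ?powR_ge0// ltW.
have := subgaussian_ou_mode_incr k0 mu0 h1 le h4 a01; rewrite dd mulrA powRM ?powR_ge0 ?mulr_ge0
  ?(ltW T0) ?(ltW mu0)//.
by rewrite -powRrM -(powR_mulrn m) ?powR_ge0// -powRrM mulrA (mulrC (- a)) mulrN mulNr.
Qed.

End ou_time.

Lemma nneseries_term_le {R : realType} (f : nat -> \bar R) k :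
  (forall i, 0 <= f i)%E -> (f k <= \sum_(i <oo) f i)%E.
Proof.
move=> f0; apply: le_trans (nneseries_lim_ge k.+1 _); last by move=> i _ _; exact: f0.
by rewrite big_nat_recr//= leeDr// sume_ge0.
Qed.

Section master.
Context {R : realType} {d : measure_display} {Omega : measurableType d}.
Variable P : probability Omega R.
Variables (T : R) (W : R -> H01 R -> Omega -> R).
Hypothesis (Ww : cylindrical_wiener P T W) (T0 : 0 < T).
Variable G : set Omega.
Hypotheses (mG : measurable G) (PG : P (~` G) = 0%E) (Ggood : G `<=` good_path T W).
Local Notation ou_mode := (ou_mode T W G).
Variables (c0 varrho : R).
Hypotheses (c00 : 0 < c0) (vr0 : 0 < varrho) (vr1 : varrho < 4^-1).

(* The weights [wexp] have summable inverses, and [wt k * y k ^+ 2 <= C] for all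
   [k] puts the sequence [y] in [H_varrho]; the remaining gap below [1/4] pays for
   the supremum over time. *)
Definition gap : R := (1 - 4 * varrho) / 4.
Definition wexp (k : nat) : R := k%:R `^ (1 + gap).
Definition wt (k : nat) : R := wexp k * lam c0 k `^ (2 * varrho).

Lemma gap_gt0 : 0 < gap. Proof. rewrite /gap; move: vr1; lra. Qed.
Lemma gap_lt1 : gap < 1. Proof. rewrite /gap; move: vr0; lra. Qed.

Lemma wexp_gt0 k : (0 < k)%N -> 0 < wexp k.
Proof. by move=> k0; rewrite powR_gt0// ltr0n. Qed.

Lemma lam_pos k : (0 < k)%N -> 0 < lam c0 k.
Proof. by move=> k0; rewrite /lam !mulr_gt0 ?exprn_gt0 ?pi_gt0 ?ltr0n. Qed.

Lemma wt_gt0 k : (0 < k)%N -> 0 < wt k.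
Proof. by move=> k0; apply: mulr_gt0; [exact: wexp_gt0|apply: powR_gt0; exact: lam_pos]. Qed.

Lemma wexp_inv_sum n : \sum_(k < n) (wexp k.+1)^-1 <= 1 + gap^-1.
Proof.
rewrite (eq_bigr (fun k : 'I_n => k.+1%:R `^ (- (1 + gap)))); last first.
  by move=> k _; rewrite powRN.
by apply: pseries_le; exact: gap_gt0.
Qed.

Variables (m : nat -> R).
Hypothesis m_ge : forall k, (0 < k)%N -> lam c0 k <= m k.

(** The Hoelder exponent in time. The sub-Gaussian constants [K k] then carry k^(2(a-1)) =
    k^(gap-2), the weights [wt k] carry k^(1+gap) k^(4 varrho) = k^(2 - 3 gap), and the products in
    [wtK] decay like k^(-2 gap). *)
Let a : R := gap / 2.
Let th : R := 2 `^ (- a).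

Let a01 : 0 < a <= 1.
Proof. rewrite /a; have := gap_gt0; have := gap_lt1 => *; apply/andP; split; lra. Qed.

Let th01 : 0 < th < 1.
Proof.
case/andP: a01 => a0 a1; rewrite /th powR_gt0//= powRN invf_lt1 ?powR_gt0//.
have := @gt0_ltr_powR R a a0 1 2; rewrite powR1; apply; rewrite ?inE ?nnegrE//.
by rewrite ltr1n.
Qed.

Let K (k : nat) : R := 2 * (m k)^-1 * (2 * m k * T) `^ a.

Lemma rate_gt0 k : (0 < k)%N -> 0 < m k.
Proof. by move=> k0; exact: lt_le_trans (lam_pos k0) (m_ge k0). Qed.

Let K0 k : (0 < k)%N -> 0 < K k.
Proof.
move=> k0; have m0 := rate_gt0 k0; apply: mulr_gt0; first by rewrite divr_gt0.
by rewrite powR_gt0// !mulr_gt0.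
Qed.

Let Cw : R := 2 * (2 * T) `^ a * (c0 * pi ^+ 2) `^ (2 * varrho + (a - 1)).

Let wtK k : (0 < k)%N -> wt k * K k <= Cw * k%:R `^ (- (2 * gap)).
Proof.
move=> k0; have kp : 0 < k%:R :> R by rewrite ltr0n.
have mk := rate_gt0 k0; have lk := lam_pos k0.
have c1 : 0 < c0 * pi ^+ 2 by rewrite mulr_gt0// exprn_gt0// pi_gt0.
have KE : K k = 2 * (2 * T) `^ a * m k `^ (a - 1).
  rewrite /K (_ : 2 * m k * T = 2 * T * m k); last by ring.
  rewrite (@powRM _ (2 * T) (m k))// ?ltW// ?mulr_gt0//.
  have -> : m k `^ (a - 1) = m k `^ a * (m k)^-1.
    by rewrite powRD ?powR_inv1 ?(ltW mk)//; apply/implyP => _; rewrite gt_eqF.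
  by ring.
have mle : m k `^ (a - 1) <= lam c0 k `^ (a - 1).
  rewrite -(opprB 1 a) !powRN lef_pV2 ?posrE ?powR_gt0//.
  by rewrite ge0_ler_powR ?nnegrE ?(ltW lk) ?(ltW mk) ?m_ge//; case/andP: a01; lra.
have p2 : 0 < 2 * (2 * T) `^ a by rewrite mulr_gt0// powR_gt0// mulr_gt0.
have -> : Cw * k%:R `^ (- (2 * gap)) = wt k * (2 * (2 * T) `^ a * lam c0 k `^ (a - 1)).
  rewrite /Cw /wt (_ : wexp k * _ * _ =
     2 * (2 * T) `^ a * (wexp k * (lam c0 k `^ (2 * varrho) * lam c0 k `^ (a - 1)))); last by ring.
  rewrite -[in RHS]powRD; last by apply/implyP => _; rewrite gt_eqF.
  rewrite /lam; set cc := c0 * pi ^+ 2 in c1 *.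
  rewrite -!(mulrA (2 * _)); congr (_ * _).
  rewrite (@powRM _ cc (k%:R ^+ 2)) ?exprn_ge0 ?(ltW c1)//.
  rewrite [RHS]mulrCA; congr (_ * _).
  rewrite -(powR_mulrn 2 (ler0n _ k)) -powRrM /wexp -powRD; last by apply/implyP => _;
    rewrite gt_eqF.
  by congr (_ `^ _); rewrite /a /gap; field.
rewrite KE ler_wpM2l ?(ltW (wt_gt0 k0))// ler_wpM2l ?(ltW p2)//.
Qed.

Let r0 : 0 < chain_ratio th < 1. Proof. exact: chain_ratio_in. Qed.

(** A sum over the modes in place of a supremum: it dominates the [j]-th power of the weighted
    square for all modes and times at once, and it can be integrated term by term. *)
Definition masterQ (j : nat) (w : Omega) : \bar R :=
  (\sum_(k <oo) (wt k.+1 ^+ j)%:E * chainQ T (chain_ratio th) (2 * j) (ou_mode (m k.+1) k.+1) w)%E.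

Let even2 j : ~~ odd (2 * j). Proof. by rewrite oddM. Qed.

Let mY k : forall x, 0 <= x <= T -> measurable_fun setT (ou_mode (m k.+1) k.+1 x).
Proof.
move=> x /andP[x0 _]; apply: (measurable_ou_mode Ww (ltW T0) mG Ggood) => //.
by apply: ltW; exact: rate_gt0.
Qed.

Lemma masterQ_ge0 j w : (0 <= masterQ j w)%E.
Proof.
apply: nneseries_ge0 => k _ _; apply: mule_ge0; last exact: chainQ_ge0.
by rewrite lee_fin exprn_ge0// ltW// wt_gt0.
Qed.

Lemma measurable_masterQ j : measurable_fun setT (masterQ j).
Proof.
apply: ge0_emeasurable_sum => [k w _ _|k _].
  by apply: mule_ge0; [rewrite lee_fin exprn_ge0// ltW// wt_gt0|exact: chainQ_ge0].
by apply: measurable_funeM; apply: measurable_chainQ => //; exact: mY.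
Qed.

Lemma masterQ_bound j k t w : (0 < j)%N -> (0 < k)%N -> 0 <= t <= T ->
  (((wt k * ou_mode (m k) k t w ^+ 2) ^+ j)%:E <= masterQ j w)%E.
Proof.
move=> j0; case: k => // k _ tT.
apply: (@le_trans _ _ ((wt k.+1 ^+ j)%:E * chainQ T (chain_ratio th) (2 * j) (ou_mode (m k.+1)
  k.+1) w)%E).
  rewrite exprMn EFinM; apply: lee_wpmul2l.
    by rewrite lee_fin exprn_ge0// ltW// wt_gt0.
  have n0 : (0 < 2 * j)%N by rewrite muln_gt0.
  have cY : continuous (fun t => ou_mode (m k.+1) k.+1 t w) by move=> x; apply:
    continuous_ou_mode => //; exact: ltW.
  have := chain_bound T0 n0 (even2 j) r0 cY tT.
  by rewrite (Yp0 Ggood) subr0 exprM.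
apply: (@nneseries_term_le _ (fun i => (wt i.+1 ^+ j)%:E * chainQ T (chain_ratio th) (2 * j)
  (ou_mode (m i.+1) i.+1) w)%E k) => i.
by apply: mule_ge0; [rewrite lee_fin exprn_ge0// ltW// wt_gt0|exact: chainQ_ge0].
Qed.

(** The [k]-th term is of order k^(-2 gap j), which for large [j] falls below k^(-1-gap): high
    moments buy summability over the modes. *)
Lemma masterQ_integral : exists j0 : nat, forall j, (j0 <= j)%N ->
  (\int[P]_w masterQ j w < +oo)%E.
Proof.
have [j0 Hj0] := chain_power_exists th01.
have [j1 Hj1] : exists j1 : nat, forall j, (j1 <= j)%N -> 1 + gap <= 2 * gap * j%:R.
  have g0 := gap_gt0.
  have [j1 _ H] := @nbhs_infty_ger R ((1 + gap) / (2 * gap)).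
  have g2 : 0 < 2 * gap by lra.
  exists j1 => j /H /=; rewrite (ler_pdivrMr _ _ g2) => h; apply: le_trans h _; by rewrite mulrC.
exists (maxn 1 (maxn j0 j1)) => j; rewrite !geq_max => /and3P[jp /Hj0 jth /Hj1 jg].
have /andP[ra rb] := r0.
pose D := (1 - chain_ratio th)^-1 ^+ (2 * j) * (4 * j`!%:R) * (2 * expR 2) ^+ j * Cw ^+ j.
have Cw0 : 0 <= Cw by rewrite !mulr_ge0// powR_ge0.
have D10 : 0 <= (1 - chain_ratio th)^-1 ^+ (2 * j) * (4 * j`!%:R) * (2 * expR 2) ^+ j.
  have h : 0 <= (1 - chain_ratio th)^-1 by rewrite invr_ge0 subr_ge0 ltW.
  by apply: mulr_ge0; [apply: mulr_ge0; [exact: exprn_ge0|exact: mulr_ge0]|apply: exprn_ge0;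
    rewrite mulr_ge0// expR_ge0].
have D0 : 0 <= D by rewrite /D mulr_ge0// exprn_ge0.
have cq0 k w : (0 <= (wt k.+1 ^+ j)%:E * chainQ T (chain_ratio th) (2 * j) (ou_mode (m k.+1)
  k.+1) w)%E.
  by apply: mule_ge0; [rewrite lee_fin exprn_ge0// ltW// wt_gt0|exact: chainQ_ge0].
rewrite /masterQ integral_nneseries//; last first.
  by move=> k; apply: measurable_funeM; apply: measurable_chainQ => //; exact: mY.
apply: (@le_lt_trans _ _ (D * (1 + gap^-1))%:E); last exact: ltry.
have each k : (\int[P]_w ((wt k.+1 ^+ j)%:E * chainQ T (chain_ratio th) (2 * j) (ou_mode (m k.+1)
  k.+1) w)
   <= (D * (wexp k.+1)^-1)%:E)%E.
  rewrite ge0_integralZl//; last 3 first.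
  - by apply: measurable_chainQ => //; exact: mY.
  - by move=> w _; exact: chainQ_ge0.
  - by rewrite lee_fin exprn_ge0// ltW// wt_gt0.
  have sgd mm i : (i < 2 ^ mm)%N -> subgaussian P (fun w => ou_mode (m k.+1) k.+1 (dyad T mm
    i.+1) w - ou_mode (m k.+1) k.+1 (dyad T mm i) w) (K k.+1 * th ^+ mm).
    by move=> im; apply: (subgaussian_ou_mode_dyad Ww T0 mG PG Ggood) => //; exact: rate_gt0.
  have h := subgaussian_chain T0 (K0 (ltn0Sn k)) th01 jth (@mY k) sgd.
  apply: le_trans (lee_wpmul2l _ h) _; first by rewrite lee_fin exprn_ge0// ltW// wt_gt0.
  rewrite -EFinM lee_fin.
  have -> : wt k.+1 ^+ j * ((1 - chain_ratio th)^-1 ^+ (2 * j) * (4 * j`!%:R) * (2 * expR 2 * K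
    k.+1) ^+ j)
    = (1 - chain_ratio th)^-1 ^+ (2 * j) * (4 * j`!%:R) * (2 * expR 2) ^+ j * (wt k.+1 * K k.+1)
      ^+ j.
    by rewrite [(2 * expR 2 * _) ^+ j]exprMn [(wt _ * _) ^+ j]exprMn; ring.
  rewrite /D -(mulrA _ (Cw ^+ j)) ler_wpM2l//.
  have wK0 : 0 <= wt k.+1 * K k.+1 by rewrite mulr_ge0// ltW ?wt_gt0 ?K0.
  have Ck : 0 <= Cw * k.+1%:R `^ (- (2 * gap)) by rewrite mulr_ge0// powR_ge0.
  apply: le_trans (lerXn2r _ wK0 Ck (wtK (ltn0Sn k))) _.
  rewrite exprMn ler_wpM2l ?exprn_ge0// -powR_mulrn ?powR_ge0// -powRrM /wexp -powRN.
  rewrite ler_powR ?ler1n//; lra.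
apply: le_trans (lee_nneseries _ (fun k _ => each k)) _.
  by move=> k _ _; apply: integral_ge0 => w _; exact: cq0.
apply: lime_le.
  by apply: is_cvg_nneseries => k _ _; rewrite lee_fin mulr_ge0// invr_ge0 ltW// wexp_gt0.
apply: nearW => N; rewrite sumEFin lee_fin -mulr_sumr big_mkord.
by rewrite ler_wpM2l// wexp_inv_sum.
Qed.

End master.

Section dominated_sums.
Context {R : realType}.

Lemma ssq_leB (a : nat -> R) B : (forall n, \sum_(1 <= k < n.+1) a k ^+ 2 <= B) ->
  (ssq a <= B%:E)%E.
Proof.
move=> aB; rewrite -(cvg_lim _ (@cvg_ssq R a))//; apply: lime_le.
  by apply/cvg_ex; eexists; exact: cvg_ssq.
by apply: nearW => n; rewrite lee_fin.
Qed.

Lemma tail_sum_le (M : nat -> R) B e : (forall k, (0 < k)%N -> 0 <= M k) ->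
  (forall n, \sum_(1 <= k < n.+1) M k <= B) -> 0 < e ->
  exists N, forall n, \sum_(N.+1 <= k < n.+1) M k <= e.
Proof.
move=> M0 MB e0; pose u n := \sum_(1 <= k < n.+1) M k.
have nd : nondecreasing_seq u.
  apply/nondecreasing_seqP => n; rewrite /u [leRHS]big_nat_recr//= lerDl; exact: M0.
have bu : has_ubound (range u) by exists B => _ [n _ <-]; exact: MB.
have cu := nondecreasing_cvgn nd bu; have ul n : u n <= sup (range u).
  by apply: ub_le_sup => //; exists n.
move/cvgrPdist_le : cu => /(_ _ e0) [N _ HN]; exists N => n.
have [nN|Nn] := leqP n N; first by rewrite big_geq ?ltnS// ltW.
have := HN N (leqnn N); rewrite ger0_norm ?subr_ge0 ?ul//; have := ul n.
rewrite /u (@big_cat_nat _ _ _ N.+1 1 n.+1)//=; last by rewrite ltnS ltnW.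
by rewrite /=; lra.
Qed.

(** Dominated convergence for series, along an arbitrary filter and uniformly in the number of
    terms, the form in which [ssq_leB] takes it up. *)
Lemma dominated_sum (S : Type) (F : set_system S) {FF : Filter F} (g : nat -> S -> R)
  (M : nat -> R) B e :
  (\forall s \near F, forall k, (0 < k)%N -> 0 <= g k s <= M k) ->
  (forall k, (0 < k)%N -> 0 <= M k) ->
  (forall n, \sum_(1 <= k < n.+1) M k <= B) ->
  (forall k, (0 < k)%N -> g k s @[s --> F] --> (0 : R)) -> 0 < e ->
  \forall s \near F, forall n, \sum_(1 <= k < n.+1) g k s <= e.
Proof.
move=> gM M0 MB g0 e0; have e20 : 0 < e / 2 by rewrite divr_gt0.
have [N HN] := tail_sum_le M0 MB e20.
have : \sum_(1 <= k < N.+1) g k s @[s --> F] --> \sum_(1 <= k < N.+1) (0 : R).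
  by apply: cvg_bigsum => k; rewrite mem_index_iota => /andP[k0 _]; exact: g0.
rewrite big1_eq => /cvgrPdist_le /(_ _ e20); apply: filterS2 gM => s gM hN n.
have head : \sum_(1 <= k < N.+1) g k s <= e / 2.
  by move: hN; rewrite sub0r normrN; apply: le_trans; exact: ler_norm.
have tail : \sum_(N.+1 <= k < n.+1) g k s <= e / 2.
  apply: le_trans (HN n); rewrite !big_nat; apply: ler_sum => k /andP[Nk _].
  by have /andP[] := gM k (leq_trans (ltn0Sn _) Nk).
have [nN|Nn] := leqP n N.
  have rest : 0 <= \sum_(n.+1 <= k < N.+1) g k s.
    rewrite big_nat; apply: sumr_ge0 => k /andP[nk _].
    by have /andP[] := gM k (leq_trans (ltn0Sn _) nk).
  by move: head; rewrite (@big_cat_nat _ _ _ n.+1 1 N.+1)//= => head; lra.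
rewrite (@big_cat_nat _ _ _ N.+1 1 n.+1)//=; last by rewrite ltnS ltnW.
lra.
Qed.
End dominated_sums.

Section regular.
Context {R : realType} {d : measure_display} {Omega : measurableType d}.
Variable P : probability Omega R.
Variables (T : R) (W : R -> H01 R -> Omega -> R).
Hypothesis (Ww : cylindrical_wiener P T W) (T0 : 0 < T).
Variables (c0 varrho : R).
Hypotheses (c00 : 0 < c0) (vr0 : 0 < varrho) (vr1 : varrho < 4^-1).
Local Notation wt := (wt c0 varrho).

Lemma ou_mode_sub (G G' : set Omega) m k t w : G' `<=` G -> G' w ->
  ou_mode T W G' m k t w = ou_mode T W G m k t w.
Proof.
move=> GG G'w; have -> // : ou_mode T W G' m k t w = ou_mode T W G m k t w.
rewrite /ou_mode (_ : coord_path T W G' k w = coord_path T W G k w)//; apply/funext => s.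
by rewrite /coord_path !indicE !mem_set//; exact: GG.
Qed.

Lemma ou_mode_out (G : set Omega) m k t w : ~ G w -> ou_mode T W G m k t w = 0.
Proof.
move=> Gw; rewrite /ou_mode coord_path_notin// ouE /expint; under eq_Rintegral do rewrite mulr0.
by rewrite Rintegral_cst//= mul0r mulr0 subr0.
Qed.

(* [G'] discards the null set on which the random constant [q] is infinite.  The
   bound holds for all smaller [G''], so that one set can serve two rates [m]. *)
Lemma regular_set (G : set Omega) (m : nat -> R) (J : nat) :
  measurable G -> P (~` G) = 0%E -> G `<=` good_path T W ->
  (forall k, (0 < k)%N -> lam c0 k <= m k) ->
  exists (j : nat) (G' : set Omega) (q : Omega -> R),
  [/\ (J <= j)%N, [/\ measurable G', P (~` G') = 0%E & G' `<=` G],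
      [/\ measurable_fun setT q, forall w, 0 <= q w & (\int[P]_w (q w ^+ j)%:E < +oo)%E] &
      forall G'' w k t, G'' `<=` G' -> (0 < k)%N -> 0 <= t <= T ->
        wt k * ou_mode T W G'' (m k) k t w ^+ 2 <= q w].
Proof.
move=> mG PG Gg mlam.
have [j0 Hj0] := masterQ_integral Ww T0 mG PG Gg c00 vr0 vr1 mlam.
pose j := maxn 1 (maxn J j0).
have j1 : (0 < j)%N by rewrite /j leq_maxl.
have Jj : (J <= j)%N by rewrite /j !leq_max leqnn/= orbT.
have /Hj0 Qfin : (j0 <= j)%N by rewrite /j !leq_max leqnn !orbT.
pose Q := masterQ T W G c0 varrho m j.
have mQ : measurable_fun setT Q := measurable_masterQ Ww T0 mG Gg c00 vr0 vr1 mlam j.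
have Q0 w : (0 <= Q w)%E := ltac:(by apply: masterQ_ge0).
pose S := [set w | (Q w < +oo)%E].
have mS : measurable S.
  have := emeasurable_fun_infty_o measurableT mQ +oo%E; rewrite setTI; exact.
have PS : P (~` S) = 0%E.
  have iQ : P.-integrable setT Q.
    by apply/integrableP; split => //; under eq_integral do rewrite gee0_abs//.
  have [N [mN N0 NS]] := integrable_ae measurableT iQ.
  apply: (subset_measure0 _ mN _ N0); first exact: measurableC.
  move=> w Sw; apply: NS => /= /(_ I); rewrite ge0_fin_numE// => h; exact: Sw.
pose G' := G `&` S.
(* The [j]-th root turns a bound on powers into one on the weighted squares themselves, while
   [q ^+ j] stays integrable; the indicator removes the infinite values. *)
pose q w : R := \1_G' w * (fine (Q w)) `^ (j%:R^-1).
have q0 w : 0 <= q w by rewrite mulr_ge0// powR_ge0.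
have jR : j%:R != 0 :> R by rewrite pnatr_eq0 -lt0n.
have f0 w : 0 <= fine (Q w) by rewrite fine_ge0.
exists j, G', q; split => //.
- split; [exact: measurableI| |by move=> w []].
  rewrite setCI; apply/eqP; rewrite -measure_le0.
  have h1 := measurableC mG; have h2 := measurableC mS.
  have e : (P (~` G) + P (~` S) = 0)%E by rewrite PG PS adde0.
  by rewrite -[leRHS]e; exact: measureU2.
- split => //.
    apply: measurable_funM; first by apply: measurable_indic; exact: measurableI.
    apply: (measurableT_comp (measurable_powR _)).
      exact: (measurableT_comp (fine_measurable measurableT)).
  apply: le_lt_trans Qfin; apply: ge0_le_integralW => w _; first by rewrite lee_fin exprn_ge0.
  rewrite /q indicE; case: (boolP (w \in G')) => [|_]; last by rewrite mul0r expr0n gtn_eqF//;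
    exact: Q0.
  rewrite inE => -[_ Sw]; rewrite mul1r -powR_mulrn ?powR_ge0// -powRrM mulVf// powRr1//.
  by rewrite fineK// ge0_fin_numE.
move=> G'' w k t G''G' k0 tT.
have [Gw|Gw] := pselect (G'' w); last by rewrite ou_mode_out// expr0n/= mulr0.
have G'w := G''G' _ Gw; rewrite (@ou_mode_sub G G'')//; last by move=> x /G''G' [].
rewrite /q indicE mem_set// mul1r.
have := masterQ_bound T0 Gg c00 vr0 vr1 m w j1 k0 tT.
have -> : masterQ T W G c0 varrho m j w = (fine (Q w))%:E.
  by rewrite fineK// ge0_fin_numE//; case: G'w.
rewrite lee_fin; set x := _ * _ => xj.
have x0 : 0 <= x by rewrite mulr_ge0 ?sqr_ge0// ltW// wt_gt0.
have -> : x = (x ^+ j) `^ (j%:R^-1) by rewrite -powR_mulrn// -powRrM mulfV// powRr1.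
by rewrite ge0_ler_powR ?nnegrE ?invr_ge0 ?exprn_ge0.
Qed.
End regular.

Lemma cvg_sqr {R : realType} (S : Type) (F : set_system S) {FF : Filter F} (f : S -> R) (l : R) :
  f x @[x --> F] --> l -> f x ^+ 2 @[x --> F] --> l ^+ 2.
Proof. by move=> h; under eq_fun do rewrite expr2; rewrite expr2; exact: cvgM. Qed.

(** * The convolutions as processes in H_varrho *)

Section weighted.
Context {R : realType}.
Local Notation H := (H01 R).
Variables (c0 varrho : R).
Hypotheses (c00 : 0 < c0) (vr0 : 0 < varrho) (vr1 : varrho < 4^-1).
Local Notation wt := (wt c0 varrho).
Local Notation wexp := (wexp varrho).
Local Notation gap := (gap varrho).
Local Notation Hnorm := (Hnorm c0 varrho).
Local Notation Hr := (Hr c0 varrho).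
Local Notation lamr k := (lam c0 k `^ varrho).

Lemma coef_eigf_sum (a : nat -> R) (n k : nat) : (0 < k)%N ->
  coef k (\sum_(1 <= i < n.+1) a i *: eigf i : H) = if (k <= n)%N then a k else 0.
Proof. by move=> k0; rewrite inner_eigf_sum// k0 ltnS. Qed.

Lemma hsumB (a b : nat -> R) : (ssq a < +oo)%E -> (ssq b < +oo)%E ->
  (ssq (fun k => (a k - b k)%R) < +oo)%E -> hsum a - hsum b = hsum (fun k => a k - b k).
Proof. by move=> ha hb hab; apply: coef_inj => k k0; rewrite coefB !coef_hsum. Qed.

Definition wbnd (C : R) (a : nat -> R) := forall k, (0 < k)%N -> wt k * a k ^+ 2 <= C.
Definition weight_mass : R := 1 + gap^-1.

Lemma weight_mass_gt0 : 0 < weight_mass.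
Proof. by rewrite /weight_mass addr_gt0// invr_gt0 gap_gt0. Qed.

Lemma wbnd_ge0 C a : wbnd C a -> 0 <= C.
Proof.
by move=> h; apply: le_trans (h 1%N isT); rewrite mulr_ge0 ?sqr_ge0// ltW// wt_gt0.
Qed.

Lemma wbnd_sqr C a k : (0 < k)%N -> wbnd C a -> (lamr k * a k) ^+ 2 <= C / wexp k.
Proof.
move=> k0 h; rewrite ler_pdivlMr ?wexp_gt0//; apply: le_trans (h k k0).
rewrite /wt [2 * varrho]mulrC powRrM powR_mulrn ?powR_ge0// le_eqVlt; apply/orP; left.
by apply/eqP; ring.
Qed.

Lemma wexp_sum n : \sum_(1 <= k < n.+1) (wexp k)^-1 <= weight_mass.
Proof.
by rewrite big_add1 big_mkord; apply: wexp_inv_sum.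
Qed.

Lemma wexp_sumM C n : 0 <= C -> \sum_(1 <= k < n.+1) C / wexp k <= C * weight_mass.
Proof. by move=> C0; rewrite -mulr_sumr ler_wpM2l// wexp_sum. Qed.

Lemma ssq_wbnd C a : wbnd C a -> (ssq (fun k => (lamr k * a k)%R) <= (C * weight_mass)%:E)%E.
Proof.
move=> h; apply: ssq_leB => n; apply: le_trans (wexp_sumM n (wbnd_ge0 h)).
by rewrite !big_nat; apply: ler_sum => k /andP[k0 _]; exact: wbnd_sqr.
Qed.

Lemma lam_nd k : (0 < k)%N -> lam c0 1 <= lam c0 k.
Proof.
move=> k0; rewrite /lam ler_wpM2l//; first by rewrite mulr_ge0 ?sqr_ge0// ltW.
by rewrite expr1n -natrX ler1n expn_gt0 k0.
Qed.

Lemma le_lamr r k (a : R) : 0 <= r -> (0 < k)%N -> lam c0 1 `^ r * `|a| <= lam c0 k `^ r * `|a|.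
Proof.
move=> r0 k0; rewrite ler_wpM2r// ge0_ler_powR ?nnegrE//; last exact: lam_nd.
- by rewrite ltW// lam_gt0.
- by rewrite ltW// lam_gt0.
Qed.

Lemma ssq_Z (c : R) a : (ssq (fun k => (c * a k)%R) = (c ^+ 2)%:E * ssq a)%E.
Proof.
rewrite /ssq -nneseriesZl; last by move=> k _; rewrite lee_fin sqr_ge0.
by apply: eq_eseriesr => k _; rewrite exprMn EFinM.
Qed.

Lemma ssq_lamr r a : 0 <= r ->
  (ssq a <= (lam c0 1 `^ r ^- 2)%:E * ssq (fun k => (lam c0 k `^ r * a k)%R))%E.
Proof.
move=> r0; have l1 : 0 < lam c0 1 `^ r by rewrite powR_gt0 ?lam_gt0.
have -> : ssq a = ((lam c0 1 `^ r ^- 2)%:E * ssq (fun k => (lam c0 1 `^ r * a k)%R))%E.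
  by rewrite ssq_Z muleA -EFinM mulVf ?mul1e// sqrf_eq0 gt_eqF.
apply: lee_wpmul2l; first by rewrite lee_fin invr_ge0 exprn_ge0// ltW.
apply: ssq_le => k k0; rewrite !normrM !(ger0_norm (powR_ge0 _ _)); exact: le_lamr.
Qed.

Lemma ssq_lamr_lty r a : 0 <= r -> (ssq (fun k => (lam c0 k `^ r * a k)%R) < +oo)%E ->
  (ssq a < +oo)%E.
Proof.
move=> r0 h; apply: le_lt_trans (ssq_lamr a r0) _.
have : ssq (fun k => (lam c0 k `^ r * a k)%R) \is a fin_num by rewrite ge0_fin_numE// ssq_ge0.
by move=> /fineK <-; rewrite -EFinM ltry.
Qed.

Lemma wbnd_lty C a : wbnd C a -> (ssq (fun k => (lamr k * a k)%R) < +oo)%E.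
Proof. by move=> /ssq_wbnd h; exact: le_lt_trans h (ltry _). Qed.

Lemma wbnd_lty0 C a : wbnd C a -> (ssq a < +oo)%E.
Proof. by move=> h; apply: (ssq_lamr_lty (ltW vr0) (wbnd_lty h)). Qed.

Lemma Hr_hsum a : (ssq (fun k => (lamr k * a k)%R) < +oo)%E -> Hr (hsum a).
Proof.
move=> h; have h0 := ssq_lamr_lty (ltW vr0) h.
rewrite HrE; apply: le_lt_trans h; apply: ssq_le => k k0; by rewrite coef_hsum.
Qed.

Lemma Hnorm_hsum a : (ssq (fun k => (lamr k * a k)%R) < +oo)%E ->
  ((Hnorm (hsum a)) ^+ 2)%:E = ssq (fun k => lamr k * a k).
Proof.
move=> h; have h0 := ssq_lamr_lty (ltW vr0) h; rewrite Hnorm_sqr; last exact: Hr_hsum.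
rewrite /ssq; apply: congr_lim; apply/funext => n; rewrite big_nat [RHS]big_nat; apply:
  eq_bigr => k /andP[k0 _].
by rewrite coef_hsum.
Qed.

Lemma Hnorm_ge0 u : 0 <= Hnorm u. Proof. exact: normr_ge0. Qed.

Lemma wbndB C a b : wbnd C a -> wbnd C b -> wbnd (4 * C) (fun k => a k - b k).
Proof.
move=> ha hb k k0; have h1 := ha k k0; have h2 := hb k k0; have w0 : 0 < wt k by exact: wt_gt0.
have : 0 <= wt k * (a k + b k) ^+ 2 by rewrite mulr_ge0 ?sqr_ge0// ltW.
have : wt k * (a k - b k) ^+ 2 + wt k * (a k + b k) ^+ 2 = 2 * (wt k * a k ^+ 2) + 2 * (wt k * b
  k ^+ 2) by ring.
lra.
Qed.

Section path.
Variables (T : R) (T0 : 0 < T) (y : nat -> R -> R) (C : R).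
Hypothesis cy : forall k, continuous (y k).
Hypothesis wy : forall t, 0 <= t <= T -> wbnd C (y ^~ t).

Let C0 : 0 <= C.
Proof. by apply: wbnd_ge0 (wy (t := 0) _); rewrite lexx ltW. Qed.

(** Each mode is continuous, and the squared weighted increments are dominated by the summable
    [4 * C / wexp k], so the increments tend to zero in the norm of [H_varrho]. *)
Lemma path_continuous : continuous_path Hnorm T (fun t => hsum (y ^~ t)).
Proof.
move=> t tT; apply/cvgrPdist_le => e e0.
pose g k s := (lamr k * (y k s - y k t)) ^+ 2.
have := @dominated_sum R R (within `[0, T]%classic (nbhs t)) (within_filter _ (nbhs_filter t)) g
  (fun k => 4 * C / wexp k) (4 * C * weight_mass) (e ^+ 2).
have h1 : \forall s \near within `[0, T]%classic (nbhs t), forall k,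
  (0 < k)%N -> 0 <= g k s <= 4 * C / wexp k.
  rewrite near_withinE; apply: nearW => s; rewrite /= in_itv/= => sT k k0.
  by rewrite sqr_ge0/=; exact: (wbnd_sqr k0 (wbndB (wy sT) (wy tT))).
have h2 k : (0 < k)%N -> 0 <= 4 * C / wexp k.
  by move=> k0; rewrite divr_ge0 ?mulr_ge0// ltW// wexp_gt0.
have h3 n : \sum_(1 <= k < n.+1) 4 * C / wexp k <= 4 * C * weight_mass by apply: wexp_sumM;
  rewrite mulr_ge0.
have h4 k : (0 < k)%N -> g k s @[s --> within `[0, T]%classic (nbhs t)] --> (0 : R).
  move=> k0; apply: cvg_within_filter.
  have h : lamr k * (y k s - y k t) @[s --> t] --> lamr k * (y k t - y k t).
    by apply: cvgM; [exact: cvg_cst|apply: (@cvgB _ R^o); [exact: cy|exact: cvg_cst]].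
  by have := @cvg_sqr _ _ _ (nbhs_filter t) _ _ h; rewrite subrr mulr0 expr0n.
move=> /(_ h1 h2 h3 h4 (exprn_gt0 _ e0)) h; move: h; rewrite !near_withinE; apply:
  filterS => s hs sT.
have {}hs := hs sT; have sT' : 0 <= s <= T by move: sT; rewrite /= in_itv.
have wB := wbndB (wy sT') (wy tT).
have hB := hsumB (wbnd_lty0 (wy sT')) (wbnd_lty0 (wy tT)) (wbnd_lty0 wB).
rewrite sub0r normrN ger0_norm ?Hnorm_ge0// hB -(@ler_pXn2r _ 2%N) ?nnegrE ?Hnorm_ge0 ?(ltW e0)//.
by rewrite -lee_fin Hnorm_hsum ?(wbnd_lty wB)//; exact: ssq_leB.
Qed.

Lemma fin_path_continuous n : continuous_path Num.norm T (fun t => \sum_(1 <= k < n.+1) y k t *: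
  eigf k : H).
Proof.
move=> t tT; apply/cvgrPdist_le => e e0.
have h : \sum_(1 <= k < n.+1) (y k s - y k t) ^+ 2 @[s --> t] --> \sum_(1 <=
  k < n.+1) (y k t - y k t) ^+ 2.
  apply: cvg_bigsum => k _.
  by apply: (@cvg_sqr R R (nbhs t) _ (fun s => y k s - y k t)); apply: (@cvgB _ R^o); [exact:
    cy|exact: cvg_cst].
rewrite near_withinE; have {h} := h; move/cvgrPdist_le => /(_ _ (exprn_gt0 2 e0)); apply:
  filterS => s hs _.
rewrite sub0r normrN normr_id -sumrB (eq_bigr (fun k => (y k s - y k t) *: (eigf k : H)));
  last first.
  by move=> k _; rewrite scalerBl.
rewrite -(@ler_pXn2r _ 2%N) ?nnegrE ?(ltW e0)// norm_eigf_sum//.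
move: hs; rewrite big1; last by move=> k _; rewrite subrr expr0n.
by rewrite sub0r normrN; apply: le_trans; exact: ler_norm.
Qed.

End path.
End weighted.

Section coordinate_measurability.
Context {R : realType} {d : measure_display} {Omega : measurableType d}.
Variables (n : nat) (z : nat -> Omega -> R).
Hypothesis mz : forall k, (0 < k <= n)%N -> measurable_fun setT (z k).

(** A set that is open in finitely many coordinates is a countable union of boxes with rational
    centre and radius. Coordinates run from 1 to [n]; the entry 0 of a centre is a placeholder. *)
Lemma measurable_coord_open (V : (nat -> R) -> Prop) :
  (forall a, V a -> exists2 e : R, 0 < e & forall b, (forall k,
    (0 < k <= n)%N -> `|b k - a k| < e) -> V b) ->
  measurable [set w | V (z ^~ w)].
Proof.
move=> Vop.
pose box (x : seq rat * rat) (b : nat -> R) :=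
  forall k, (0 < k <= n)%N -> `|b k - ratr (nth 0 x.1 k)| < ratr x.2.
pose F (x : seq rat * rat) : set Omega :=
  [set w | (forall b, box x b -> V b) /\ box x (z ^~ w)].
have -> : [set w | V (z ^~ w)] = \bigcup_x F x.
  apply/seteqP; split=> [w /= /[dup] Vw /Vop [e e0 He]|w [x _]]; last first.
    by case=> xV /xV.
  have [r] : exists r : rat, ratr r \in `]0, (e / 2)[%R.
    by apply: rat_in_itvoo; rewrite divr_gt0.
  rewrite in_itv/= => /andP[r0 re].
  have cex k : exists q : rat, `|z k w - ratr q| < ratr r.
    have [|q] := @rat_in_itvoo R (z k w - ratr r) (z k w + ratr r).
      by rewrite ltrBlDr -addrA ltrDl addr_gt0.
    by rewrite in_itv/= => /andP[h1 h2]; exists q; rewrite ltr_norml; apply/andP; split; lra.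
  pose c k := projT1 (cid (cex k)).
  have cP k : `|z k w - ratr (c k)| < ratr r by rewrite /c; case: cid.
  have nc k : (0 < k <= n)%N -> nth 0 (mkseq c n.+1) k = c k.
    by move=> /andP[_ kn]; rewrite nth_mkseq.
  exists (mkseq c n.+1, r) => //; split => [b bb|k kn /=]; last by rewrite nc.
  apply: He => k kn; have := bb k kn; rewrite /= nc// => h1.
  have h2 := cP k; have -> : b k - z k w = (b k - ratr (c k)) - (z k w - ratr (c k)) by ring.
  by apply: le_lt_trans (ler_normB _ _) _; lra.
apply: countable_bigcupT_measurable => // x.
have [xV|xV] := pselect (forall b, box x b -> V b); last first.
  by rewrite (_ : F x = set0)//; apply/seteqP; split => // w [].
rewrite (_ : F x = [set w | box x (z ^~ w)]); last first.
  by apply/seteqP; split => [w []//|w]; split.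
have -> : [set w | box x (z ^~ w)] = \bigcap_(k in [set k | (0 < k <= n)%N])
    [set w | `|z k w - ratr (nth 0 x.1 k)| < ratr x.2].
  by apply/seteqP; split => w /= h k kn; exact: h.
apply: bigcap_measurableType => k kn.
have mk : measurable_fun setT (fun w => `|z k w - ratr (nth 0 x.1 k)|).
  by apply: measurableT_comp => //; apply: measurable_funB => //; exact: mz.
have := mk measurableT `]-oo, ratr x.2[%classic (measurable_itv _).
by rewrite setTI; congr measurable; apply/seteqP; split => w /=; rewrite in_itv.
Qed.
End coordinate_measurability.

Section hilbert_measurability.
Context {R : realType} {d : measure_display} {Omega : measurableType d}.
Local Notation H := (H01 R).
Variables (c0 varrho : R).
Hypotheses (c00 : 0 < c0) (vr0 : 0 < varrho).
Local Notation Hnorm := (Hnorm c0 varrho).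
Local Notation Hr := (Hr c0 varrho).
Local Notation lamr k := (lam c0 k `^ varrho).

(** The weighted coefficients of [u + v] are the coordinates of the sum of two elements of [H],
    hence square summable by Bessel. *)
Lemma HrD u v : Hr u -> Hr v -> Hr (u + v).
Proof.
rewrite !HrE => hu hv.
pose a k := lamr k * coef k u; pose b k := lamr k * coef k v.
have : (ssq (coef^~ (hsum a + hsum b)%R) < +oo)%E by exact: coef_ssq_lty.
apply: le_lt_trans; apply: ssq_le => k k0.
by rewrite (coefD k (hsum a) (hsum b)) (coef_hsum hu k0) (coef_hsum hv k0) /a /b (coefD k u v)
  mulrDr.
Qed.

Lemma HrZ c u : Hr u -> Hr (c *: u).
Proof.
rewrite !HrE => hu; have -> : (fun k => lamr k * coef k (c *:
  u)) = (fun k => c * (lamr k * coef k u)).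
  by apply/funext => k; rewrite coefZ mulrCA.
rewrite ssq_Z; have : ssq (fun k => (lamr k * coef k u)%R) \is a fin_num by rewrite
  ge0_fin_numE// ssq_ge0.
by move=> /fineK <-; rewrite -EFinM ltry.
Qed.

Lemma HrB u v : Hr u -> Hr v -> Hr (u - v).
Proof. by move=> hu hv; rewrite -(scaleN1r v); exact: (HrD hu (HrZ (-1) hv)). Qed.

Lemma powA_hsum u : powA c0 varrho u = hsum (fun k => lamr k * coef k u).
Proof. by []. Qed.

Lemma powAD u v : Hr u -> Hr v -> powA c0 varrho (u + v) = powA c0 varrho u + powA c0 varrho v.
Proof.
move=> hu hv; have huv := HrD hu hv; move: hu hv huv; rewrite !HrE => hu hv huv.
by apply: coef_inj => k k0; rewrite !powA_hsum (coef_hsum huv k0)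
  (coefD k (hsum _) (hsum _)) (coef_hsum hu k0) (coef_hsum hv k0) (coefD k u v) mulrDr.
Qed.

Lemma HnormD u v : Hr u -> Hr v -> Hnorm (u + v) <= Hnorm u + Hnorm v.
Proof. by move=> hu hv; rewrite /Defs.Hnorm powAD//; exact: ler_normD. Qed.

Lemma powAN u : Hr u -> powA c0 varrho (- u) = - powA c0 varrho u.
Proof.
move=> hu; have hN : Hr (- u) by rewrite -scaleN1r; exact: HrZ.
apply: (addrI (powA c0 varrho u)); rewrite -powAD// !subrr.
by apply: coef_inj => k k0; rewrite powA_hsum coef0 coef_hsum// ?coef0 ?mulr0// -HrE -(subrr u);
  exact: HrB.
Qed.

Lemma HnormN u : Hr u -> Hnorm (- u) = Hnorm u.
Proof. by move=> hu; rewrite /Defs.Hnorm powAN// normrN. Qed.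

Lemma Hnorm_sub u v : Hr u -> Hr v -> Hnorm (u - v) = Hnorm (v - u).
Proof. by move=> hu hv; rewrite -(opprB v u) (HnormN (HrB hv hu)). Qed.

Lemma Hnorm_tri u v w : Hr u -> Hr v -> Hr w -> Hnorm (u - w) <= Hnorm (u - v) + Hnorm (v - w).
Proof.
move=> hu hv hw; have := HnormD (HrB hu hv) (HrB hv hw).
by rewrite (_ : (u - v) + (v - w) = u - w)// addrA subrK.
Qed.

Lemma Hr_fin n (a : nat -> R) : Hr (\sum_(1 <= k < n.+1) a k *: eigf k : H).
Proof.
rewrite HrE (@ssq_fin _ _ n) ?ltry// => k nk.
by rewrite coef_eigf_sum ?(leq_ltn_trans _ nk)// leqNgt nk mulr0.
Qed.

Lemma Hnorm_fin n (a : nat -> R) :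
  Hnorm (\sum_(1 <= k < n.+1) a k *: eigf k : H) ^+ 2 = \sum_(1 <= k < n.+1) (lamr k * a k) ^+ 2.
Proof.
apply: EFin_inj; rewrite Hnorm_sqr; last exact: Hr_fin.
rewrite (@ssq_fin _ _ n); last first.
  by move=> k nk; rewrite coef_eigf_sum ?(leq_ltn_trans _ nk)// leqNgt nk mulr0.
by congr EFin; apply: eq_big_nat => k /andP[k0 kn]; rewrite (coef_eigf_sum a n k0) -ltnS kn.
Qed.

Lemma small_weighted_sum n (l : nat -> R) (e : R) : 0 < e -> exists2 dl, 0 < dl &
  forall x : nat -> R, (forall k, (0 < k <= n)%N -> `|x k| < dl) ->
  \sum_(1 <= k < n.+1) (l k * x k) ^+ 2 < e ^+ 2.
Proof.
move=> e0; pose L := \sum_(1 <= k < n.+1) l k ^+ 2.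
have L0 : 0 <= L by apply: sumr_ge0 => k _; exact: sqr_ge0.
have L1 : 0 < 1 + L by lra.
exists (e / (1 + L)); first by rewrite divr_gt0.
move=> x hx; apply: (@le_lt_trans _ _ (L * (e / (1 + L)) ^+ 2)).
  rewrite /L mulr_suml; apply: ler_sum_nat => k k0.
  rewrite exprMn ler_wpM2l ?sqr_ge0// -(real_normK (num_real (x k))).
  by rewrite ler_pXn2r ?nnegrE ?divr_ge0 ?(ltW e0) ?(ltW L1)// ltW// hx.
rewrite expr_div_n mulrCA gtr_pMr ?exprn_gt0// ltr_pdivrMr ?exprn_gt0// mul1r.
by nra.
Qed.

Lemma rv_Pn_sum n (z : nat -> Omega -> R) : (forall k, (0 < k <= n)%N ->
  measurable_fun setT (z k)) ->
  rv_Pn n (fun w => \sum_(1 <= k < n.+1) z k w *: eigf k : H).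
Proof.
move=> mz; split=> [w|U oU]; first exact: range_eigf_sum.
apply: (measurable_coord_open mz (V := fun a => U (\sum_(1 <= k < n.+1) a k *: eigf k))).
move=> a Ua; have /nbhs_ballP[e /= e0 eU] := open_nbhs_nbhs (conj oU Ua).
have [dl dl0 HH] := @small_weighted_sum n (fun=> 1) e e0; exists dl => // b hb.
apply: eU; rewrite -ball_normE /= distrC -sumrB (eq_bigr (fun k => (b k - a k) *: (eigf k : H)));
  last first.
  by move=> k _; rewrite scalerBl.
rewrite -(@ltr_pXn2r _ 2%N) ?nnegrE ?(ltW e0)// norm_eigf_sum//.
by have := HH _ hb; under eq_bigr do rewrite mul1r.
Qed.

Lemma open_Hr_coord n (U : set H) (a : nat -> R) : open_Hr c0 varrho U ->
  U (\sum_(1 <= k < n.+1) a k *: eigf k : H) ->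
  exists2 e : R, 0 < e & forall b, (forall k, (0 < k <= n)%N -> `|b k - a k| < e) ->
    U (\sum_(1 <= k < n.+1) b k *: eigf k : H).
Proof.
move=> [_ oU] Ua; have [e e0 eU] := oU _ Ua.
have [dl dl0 HH] := @small_weighted_sum n (fun k => lamr k) e e0; exists dl => // b hb.
apply: eU; first exact: Hr_fin.
rewrite -sumrB (eq_bigr (fun k => (b k - a k) *: (eigf k : H))); last first.
  by move=> k _; rewrite scalerBl.
rewrite -(@ltr_pXn2r _ 2%N) ?nnegrE ?(ltW e0) ?normr_ge0// Hnorm_fin.
exact: HH hb.
Qed.

(** The value is a limit in [H_varrho] of finite sums [Z n]. It lies in an open [U] iff for some [m]
    eventually [Z n] lies in the set of points around which a ball of radius slightly above
    [m.+1%:R^-1] stays in [U]. These are countably many conditions, each on finitely many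
    coordinates. *)
Lemma rv_Hr_lim (z : nat -> Omega -> R) : (forall k, (0 < k)%N -> measurable_fun setT (z k)) ->
  (forall w, ssq (fun k => (lamr k * z k w)%R) < +oo)%E ->
  rv_Hr c0 varrho (fun w => hsum (z ^~ w)).
Proof.
move=> mz fz; split=> [w|U oU]; first exact: Hr_hsum.
pose Z n w : H := \sum_(1 <= k < n.+1) z k w *: eigf k.
have Zlim w e : 0 < e -> exists N, forall n, (N <= n)%N -> Hnorm (hsum (z ^~ w) - Z n w) < e.
  move=> e0; have f0 := ssq_lamr_lty c00 (ltW vr0) (fz w).
  have e20 : 0 < (e / 2) ^+ 2 by rewrite exprn_gt0// divr_gt0.
  pose s := fine (ssq (fun k => (lamr k * z k w)%R)).
  have sE : ssq (fun k => (lamr k * z k w)%R) = s%:E by rewrite fineK// ge0_fin_numE ?ssq_ge0.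
  have bs n : \sum_(1 <= k < n.+1) (lamr k * z k w) ^+ 2 <= s.
    rewrite -lee_fin -sE /ssq; have := @nneseries_lim_ge R (fun k => ((lamr k * z k w) ^+ 2)%:E)
      xpredT 1%N n.+1.
    by rewrite sumEFin; apply => i _ _; rewrite lee_fin sqr_ge0.
  have [N HN] := tail_sum_le (fun k _ => sqr_ge0 (lamr k * z k w)) bs e20.
  exists N => n Nn.
  pose a k := if (k <= n)%N then 0 else z k w.
  have ale k : `|a k| <= `|z k w| by rewrite /a; case: ifP => // _; rewrite normr0.
  have fa : (ssq (fun k => (lamr k * a k)%R) < +oo)%E.
    by apply: le_lt_trans (fz w); apply: ssq_le => k k0; rewrite !normrM ler_wpM2l.
  have -> : hsum (z ^~ w) - Z n w = hsum a.
    apply: coef_inj => k k0; rewrite coefB !coef_hsum// ?coef_eigf_sum//; last first.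
      by apply: le_lt_trans f0; apply: ssq_le => i _; exact: ale.
    by rewrite /a; case: ifP; rewrite ?subrr ?subr0.
  apply: (@le_lt_trans _ _ (e / 2)); last by lra.
  rewrite -(@ler_pXn2r _ 2%N) ?nnegrE ?normr_ge0 ?divr_ge0 ?(ltW e0)//.
  rewrite -lee_fin Hnorm_hsum//; apply: ssq_leB => M; apply: le_trans (HN M).
  have [MN|NM] := leqP M N.
    rewrite !big_nat big1 ?sumr_ge0// => k; first by rewrite sqr_ge0.
    by move=> /andP[_ kM]; rewrite /a (leq_trans _ (leq_trans MN Nn))// mulr0 expr0n.
  rewrite (@big_cat_nat _ _ _ N.+1 1 M.+1)//=; last by rewrite ltnS ltnW.
  rewrite [X in X + _]big_nat big1 ?add0r; last first.
    by move=> k /andP[_ kM]; rewrite /a (leq_trans _ Nn)// mulr0 expr0n.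
  rewrite !big_nat; apply: ler_sum => k _; rewrite !exprMn ler_wpM2l ?sqr_ge0//.
  by rewrite -(real_normK (num_real (a k))) -(real_normK (num_real (z k w))) ler_pXn2r ?nnegrE.
(* The slack [e] beyond the radius [m.+1%:R^-1] makes [V m] open. *)
pose V (m : nat) : set H := [set u | Hr u /\ exists2 e, 0 < e & forall v,
  Hr v -> Hnorm (v - u) < m.+1%:R^-1 + e -> U v].
have oV m : open_Hr c0 varrho (V m).
  split=> [u []//|u [hu [e e0 He]]]; exists (e / 2); first by rewrite divr_gt0.
  move=> v hv vu; split=> //; exists (e / 2); first by rewrite divr_gt0.
  move=> x hx xv; apply: (He _ hx).
  have h := Hnorm_tri hx hv hu; apply: (le_lt_trans h).
  have -> : m.+1%:R^-1 + e = (m.+1%:R^-1 + e / 2) + e / 2 by field.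
  exact: ltrD xv vu.
have -> : (fun w => hsum (z ^~ w)) @^-1` U =
  \bigcup_m \bigcup_N \bigcap_(n in [set n | (N <= n)%N]) [set w | V m (Z n w)].
  apply/seteqP; split=> [w /= Uw|w [m _ [N _ /= HN]]]; last first.
    have m0 : 0 < m.+1%:R^-1 :> R by rewrite invr_gt0.
    have [N' HN'] := Zlim w _ m0.
    have [hZ [e e0 He]] := HN (maxn N N') (leq_maxl _ _).
    apply: (He _ (Hr_hsum c00 vr0 (fz w))).
    by apply: (lt_trans (HN' (maxn N N') (leq_maxr _ _))); rewrite ltrDl.
  have [_ /(_ _ Uw) [e e0 eU]] := oU.
  have [m _ Hm] := @nbhs_infty_ger R (4 / e).
  have me : m.+1%:R^-1 <= e / 4.
    have h := Hm m.+1 (leqnSn _).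
    by rewrite -[e / 4]invrK lef_pV2 ?posrE ?invr_gt0 ?divr_gt0// invf_div.
  have e40 : 0 < e / 4 by rewrite divr_gt0.
  have [N HN] := Zlim w _ e40; exists m => //; exists N => // n /= Nn.
  split; first exact: Hr_fin.
  exists (e / 4) => // v hv vZ; apply: (eU _ hv).
  have hs := Hr_hsum c00 vr0 (fz w).
  have hZ : Hr (Z n w) := @Hr_fin n (z ^~ w).
  have h := Hnorm_tri hv hZ hs; apply: (le_lt_trans h); rewrite (Hnorm_sub hZ hs).
  have h2 := HN n Nn; move: vZ h2; set A := Hnorm (v - _); set B := Hnorm (_ - Z n w) => hA hB.
  by clear -hA hB me e0; move: A B (m.+1%:R^-1) hA hB me e0 => A B x; move: e => {}e; lra.
apply: bigcupT_measurable => m; apply: bigcupT_measurable => N.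
apply: bigcap_measurableType => n Nn.
apply: (@measurable_coord_open _ _ _ n z _ (fun a => V m (\sum_(1 <= k < n.+1) a k *: eigf k))).
  by move=> k /andP[k0 _]; exact: mz.
by move=> a; exact: open_Hr_coord.
Qed.

(** The norm of [H_varrho] dominates a multiple of that of [H], so an open set of [H] cuts
    [H_varrho] in an open set. *)
Lemma rv_Hr_borel (Z : Omega -> H) : rv_Hr c0 varrho Z -> borel_H Z.
Proof.
move=> [hZ mZ] U oU; have -> : Z @^-1` U = Z @^-1` (U `&` Hr).
  by apply/seteqP; split=> [w /= Uw|w /= []//]; split => //; exact: hZ.
apply: mZ; split=> [u []//|u [Uu hu]].
have /nbhs_ballP[e /= e0 eU] := open_nbhs_nbhs (conj oU Uu).
have l0 : 0 < lamr 1 by rewrite powR_gt0 ?lam_gt0.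
exists (e * lamr 1); first by rewrite mulr_gt0.
move=> v hv vu; split=> //; apply: eU; rewrite -ball_normE /= distrC.
rewrite -(ltr_pM2r l0); apply: le_lt_trans vu.
rewrite -(@ler_pXn2r _ 2%N) ?nnegrE ?Hnorm_ge0 ?mulr_ge0 ?(ltW l0)//.
rewrite -lee_fin (Hnorm_sqr (HrB hv hu)).
rewrite mulrC exprMn EFinM parseval -ssq_Z; apply: ssq_le => k k0.
rewrite !normrM !(ger0_norm (powR_ge0 _ _)); apply: le_lamr => //; exact: ltW.
Qed.

Lemma measurable_coef (Z : Omega -> H) k : (0 < k)%N -> borel_H Z ->
  measurable_fun setT (fun w => coef k (Z w)).
Proof.
move=> k0 bZ; apply: (measurability _ (RGenOpens.measurableE R)).
move=> _ [_ [a [b ->] <-]]; rewrite setTI; apply: (bZ (coef k @^-1` `]a, b[%classic)).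
rewrite openE => u; rewrite /= in_itv/= => /andP[au ub].
apply/nbhs_ballP; exists (Num.min (coef k u - a) (b - coef k u));
  rewrite /= ?lt_min ?subr_gt0 ?au//.
move=> v; rewrite -ball_normE /= lt_min => /andP[h1 h2]; rewrite in_itv/=.
have h := sqr_coef_le (u - v) k0; rewrite coefB ler_norml in h.
by move: h => /andP[h3 h4]; apply/andP; split; lra.
Qed.
End hilbert_measurability.

Section processes.
Context {R : realType} {d : measure_display} {Omega : measurableType d}.
Variable P : probability Omega R.
Variables (T : R) (W : R -> H01 R -> Omega -> R).
Hypothesis (Ww : cylindrical_wiener P T W) (T0 : 0 < T).
Variables (c0 varrho : R).
Hypotheses (c00 : 0 < c0) (vr0 : 0 < varrho) (vr1 : varrho < 4^-1).
Local Notation H := (H01 R).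
Local Notation leb := (@lebesgue_measure R).
Local Notation wt := (wt c0 varrho).
Local Notation wexp := (wexp varrho).
Local Notation weight_mass := (weight_mass varrho).
Local Notation lamr k := (lam c0 k `^ varrho).
Variable G : set Omega.
Hypotheses (mG : measurable G) (PG : P (~` G) = 0%E) (Ggood : G `<=` good_path T W).
Local Notation Y k := (ou_mode T W G (lam c0 k) k).
Variable xi : H.

(** [limconv], [galconv] and [shiftconv] are the witnesses for the limit process, the Galerkin
    convolutions and the solutions of (iii); the last contain the initial value and have all rates
    raised by [eta]. *)
Definition limconv (t : R) (w : Omega) : H := hsum (fun k => Y k t w).
Definition galconv (n : nat) (t : R) (w : Omega) : H := \sum_(1 <= k < n.+1) Y k t w *: eigf k.
Definition shiftcoef (eta : R) (k : nat) (t : R) (w : Omega) : R :=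
  ou_mode T W G (lam c0 k + eta) k t w + expR (- ((lam c0 k + eta) * t)) * coef k xi.
Definition shiftconv (eta : R) (n : nat) (t : R) (w : Omega) : H :=
  \sum_(1 <= k < n.+1) shiftcoef eta k t w *: eigf k.

Lemma coef_expA0 t u k : (0 < k)%N -> 0 <= t ->
  coef k (expA c0 t u) = expR (- (lam c0 k * t)) * coef k u.
Proof. by move=> k0 t0; rewrite coef_expA//; congr (expR _ * _); ring. Qed.

Lemma coef_galconv n t w k : (0 < k)%N -> coef k (galconv n t w) = if (k <=
  n)%N then Y k t w else 0.
Proof. exact: coef_eigf_sum. Qed.

Lemma coef_galconvD n t w k : (0 < k)%N -> 0 <= t ->
  coef k (galconv n t w + Pn n (expA c0 t xi)) =
  if (k <= n)%N then Y k t w + expR (- (lam c0 k * t)) * coef k xi else 0.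
Proof.
move=> k0 t0; rewrite coefD coef_galconv// coef_Pn// coef_expA0//.
by case: ifP => //; rewrite addr0.
Qed.

Lemma coef_Pint n t (f : R -> H) k : (0 < k)%N ->
  coef k (Pint n t f) = if (k <= n)%N then \int[leb]_(s in `[0%R, t]) coef k (f s) else 0.
Proof.
exact: (coef_eigf_sum (fun k => \int[leb]_(s in `[0%R, t]) coef k (f s))).
Qed.

Lemma shiftconvE eta n t w : 0 <= eta -> 0 <= t ->
  shiftconv eta n t w = galconv n t w + Pn n (expA c0 t xi)
   - Pint n t (fun s => expAsub c0 eta (t - s) (eta *: (galconv n s w + Pn n (expA c0 s xi)))).
Proof.
move=> eta0 t0; apply: coef_inj => k k0.
rewrite coefB coef_galconvD// coef_Pint// coef_eigf_sum//; case: ifP => kn; last by rewrite subr0.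
have cB : continuous (coord_path T W G k w) by move=> x; apply: continuous_coord_path => //;
  exact: ltW.
rewrite /shiftcoef -(ou_resolvent cB (coord_path_le0 Ggood k w))//.
congr (_ - _); apply: eq_Rintegral => s; rewrite inE/= in_itv/= => /andP[s0 st].
rewrite coef_expA// ?subr_ge0// coefZ coef_galconvD// kn.
by congr (expR _ * _); ring.
Qed.

Lemma Hr_le r r' u : 0 <= r -> r <= r' -> Hr c0 r' u -> Hr c0 r u.
Proof.
move=> r0 rr; rewrite !HrE => h.
pose C := lam c0 1 `^ (r - r').
have hC : (ssq (fun k => (C * (lam c0 k `^ r' * coef k u))%R) < +oo)%E.
  rewrite ssq_Z; have : ssq (fun k => (lam c0 k `^ r' * coef k u)%R) \is a fin_num by rewrite
    ge0_fin_numE// ssq_ge0.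
  by move=> /fineK <-; rewrite -EFinM ltry.
apply: le_lt_trans hC; apply: ssq_le => k k0.
rewrite !normrM !(ger0_norm (powR_ge0 _ _)) mulrA ler_wpM2r//.
have l1 := @lam_gt0 R c0 1 c00 isT; have lk := lam_gt0 c00 k0.
have -> : lam c0 k `^ r = lam c0 k `^ (r - r') * lam c0 k `^ r'.
  by rewrite -powRD ?subrK//; apply/implyP => _; rewrite gt_eqF.
rewrite ler_wpM2r ?powR_ge0// /C -(opprB r' r) !powRN lef_pV2 ?posrE ?powR_gt0//.
by rewrite ge0_ler_powR ?nnegrE ?subr_ge0 ?(ltW l1) ?(ltW lk)// lam_nd.
Qed.

Hypothesis xi_dom : Hr c0 2^-1 xi.

Let vr_le : varrho <= 2^-1. Proof. by move: vr1; lra. Qed.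

Lemma xi_lty : (ssq (fun k => (lamr k * coef k xi)%R) < +oo)%E.
Proof. by rewrite -HrE; apply: Hr_le xi_dom => //; exact: ltW. Qed.

Definition xisq : R := fine (ssq (fun k => (lamr k * coef k xi)%R)).

Lemma xisqE : ssq (fun k => (lamr k * coef k xi)%R) = xisq%:E.
Proof. by rewrite fineK// ge0_fin_numE ?ssq_ge0 ?xi_lty. Qed.

Lemma xisq_ge0 : 0 <= xisq. Proof. by rewrite fine_ge0// ssq_ge0. Qed.

Lemma xisq_sum n : \sum_(1 <= k < n.+1) (lamr k * coef k xi) ^+ 2 <= xisq.
Proof.
rewrite -lee_fin -xisqE; have := @nneseries_lim_ge R (fun k => ((lamr k * coef k xi) ^+ 2)%:E)
  xpredT 1%N n.+1.
by rewrite sumEFin; apply => i _ _; rewrite lee_fin sqr_ge0.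
Qed.

Variable q : Omega -> R.
Hypothesis hq : forall w k t, (0 < k)%N -> 0 <= t <= T -> wt k * Y k t w ^+ 2 <= q w.

Lemma wbnd_Y w t : 0 <= t <= T -> wbnd c0 varrho (q w) (fun k => Y k t w).
Proof. by move=> tT k k0; exact: hq. Qed.

(** A summable bound on the squared weighted coordinates that is free of time; (a + b)^2 <= 2 a^2 +
    2 b^2 separates the noise from the initial value. *)
Definition majo w k : R := 2 * (q w / wexp k) + 2 * (lamr k * coef k xi) ^+ 2.

Lemma q_ge0 w : 0 <= q w.
Proof. by apply: wbnd_ge0 (wbnd_Y w (t := 0) _) => //; rewrite lexx ltW. Qed.

Lemma majo_ge0 w k : (0 < k)%N -> 0 <= majo w k.
Proof.
move=> k0; rewrite addr_ge0// mulr_ge0// ?sqr_ge0// divr_ge0 ?q_ge0// ltW// wexp_gt0//.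
Qed.

Lemma majo_sum w n : \sum_(1 <= k < n.+1) majo w k <= 2 * (q w * weight_mass) + 2 * xisq.
Proof.
rewrite big_split/= -!mulr_sumr lerD// ler_wpM2l// ?xisq_sum//.
by rewrite ler_wpM2l ?q_ge0// wexp_sum.
Qed.

Lemma majo_bound w k t : (0 < k)%N -> 0 <= t <= T ->
  (lamr k * (Y k t w + expR (- (lam c0 k * t)) * coef k xi)) ^+ 2 <= majo w k.
Proof.
move=> k0 tT; have h1 := wbnd_sqr k0 (wbnd_Y w tT).
have h2 : (lamr k * (expR (- (lam c0 k * t)) * coef k xi)) ^+ 2 <= (lamr k * coef k xi) ^+ 2.
  rewrite mulrCA exprMn ler_piMl ?sqr_ge0// expr_le1 ?expR_ge0//.
  by rewrite -expR0 ler_expR oppr_le0 mulr_ge0 ?(ltW (lam_gt0 c00 k0))//; case/andP: tT.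
rewrite /majo mulrDr.
set a := lamr k * Y k t w in h1 *; set b := lamr k * (expR _ * _) in h2 *.
have := sqr_ge0 (a - b); nra.
Qed.

Lemma galconv_Hnorm w n t : 0 <= t <= T ->
  Hnorm c0 varrho (galconv n t w + Pn n (expA c0 t xi)) ^+ 2 <= 2 * (q w * weight_mass) + 2 * xisq.
Proof.
move=> tT; have t0 : 0 <= t by case/andP: tT.
have -> : galconv n t w + Pn n (expA c0 t xi) = \sum_(1 <=
  k < n.+1) (Y k t w + expR (- (lam c0 k * t)) * coef k xi) *: eigf k.
  by apply: coef_inj => k k0; rewrite coef_galconvD// coef_eigf_sum.
rewrite Hnorm_fin//; apply: le_trans (majo_sum w n).
by apply: ler_sum_nat => k /andP[k0 _]; exact: majo_bound.
Qed.

(** The difference keeps only the modes above [n], and their squares are dominated by the tail of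
    [majo w], whatever the time. *)
Lemma limconv_diff w e : 0 < e -> exists N, forall n, (N <= n)%N -> forall t, 0 <= t <= T ->
  Hnorm c0 varrho ((limconv t w + expA c0 t xi) - (galconv n t w + Pn n (expA c0 t xi))) <= e.
Proof.
move=> e0; have [N HN] := tail_sum_le (fun k => @majo_ge0 w k) (majo_sum w) (exprn_gt0 2 e0).
exists N => n Nn t tT; have t0 : 0 <= t by case/andP: tT.
set D := _ - _; have fY := wbnd_lty0 c00 vr0 vr1 (wbnd_Y w tT).
have cD k : (0 < k)%N -> coef k D = if (k <=
  n)%N then 0 else Y k t w + expR (- (lam c0 k * t)) * coef k xi.
  move=> k0; rewrite /D coefB coef_galconvD// coefD coef_hsum// coef_expA0//.
  by case: ifP; rewrite ?subrr ?subr0.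
have hD m : \sum_(1 <= k < m.+1) (lamr k * coef k D) ^+ 2 <= e ^+ 2.
  apply: le_trans (HN m).
  have [mN|Nm] := leqP m N.
    rewrite (@eq_big_nat _ _ _ _ _ _ (fun=> 0)); last first.
      by move=> k /andP[k0 km]; rewrite cD// (leq_trans _ (leq_trans mN Nn))// mulr0 expr0n.
    by rewrite big1_eq big_geq// ltnS.
  rewrite (@big_cat_nat _ _ _ N.+1 1 m.+1)//=; last by rewrite ltnS ltnW.
  rewrite (@eq_big_nat _ _ _ 1 N.+1 _ (fun=> 0)); last first.
    by move=> k /andP[k0 km]; rewrite cD// (leq_trans _ Nn)// mulr0 expr0n.
  rewrite big1_eq add0r; apply: ler_sum_nat => k /andP[Nk _].
  have k0 : (0 < k)%N by exact: leq_trans Nk.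
  rewrite cD//; case: ifP => _; last exact: majo_bound.
  by rewrite mulr0 expr0n majo_ge0.
have fD : Hr c0 varrho D by rewrite HrE; apply: le_lt_trans (ltry (e ^+ 2)); exact: ssq_leB.
rewrite -(@ler_pXn2r _ 2%N) ?nnegrE ?Hnorm_ge0 ?(ltW e0)//.
by rewrite -lee_fin (Hnorm_sqr fD); exact: ssq_leB.
Qed.

Lemma limconv_esup w : limn_esup (fun n => ereal_sup
      [set (Hnorm c0 varrho ((limconv s w + expA c0 s xi)
              - (galconv n s w + Pn n (expA c0 s xi))))%:E
       | s in `[0%R, T]]) = 0%E.
Proof.
set u := fun n => _.
have u0 n : (0 <= u n)%E.
  apply: (@le_trans _ _ (Hnorm c0 varrho ((limconv 0 w + expA c0 0 xi)
              - (galconv n 0 w + Pn n (expA c0 0 xi))))%:E); first by rewrite lee_fin Hnorm_ge0.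
  by apply: ereal_sup_ubound; exists 0 => //; rewrite /= in_itv/= lexx ltW.
have ue e : 0 < e -> exists N, forall n, (N <= n)%N -> (u n <= e%:E)%E.
  move=> e0; have [N HN] := limconv_diff w e0; exists N => n Nn.
  apply: ge_ereal_sup => _ [s sT <-]; rewrite lee_fin; have : 0 <= s <= T by move: sT;
    rewrite /= in_itv.
  exact: HN.
suff : u n @[n --> \oo] --> 0%:E by move=> /cvg_limn_einf_sup [].
apply/fine_cvgP; split.
  have [N HN] := ue 1 ltr01; exists N => // n /= Nn.
  by rewrite ge0_fin_numE//; apply: le_lt_trans (HN n Nn) (ltry _).
apply/cvgrPdist_le => e e0; have [N HN] := ue e e0; exists N => // n /= Nn.
have un : u n \is a fin_num by rewrite ge0_fin_numE//; apply: le_lt_trans (HN n Nn) (ltry _).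
by rewrite sub0r normrN ger0_norm ?fine_ge0// -lee_fin fineK// HN.
Qed.
End processes.

(** * Stochastic integrals of diagonal integrands *)

Section ssq_integral.
Context {R : realType} {d : measure_display} {S : measurableType d}.
Variable mu : {measure set S -> \bar R}.

Lemma int_ssq_le (D : set S) (a : nat -> S -> R) (e : nat -> R) C : measurable D ->
  (forall k, (0 < k)%N -> measurable_fun D (a k)) ->
  (forall k, (0 < k)%N -> (\int[mu]_(x in D) (a k x ^+ 2)%:E <= (e k)%:E)%E) ->
  (forall n, \sum_(1 <= k < n.+1) e k <= C) ->
  (\int[mu]_(x in D) ssq (a ^~ x) <= C%:E)%E.
Proof.
move=> mD ma ae eC.
have ms n : measurable_fun D (fun x => (\sum_(1 <= k < n.+1) a k x ^+ 2)%:E).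
  apply/measurable_EFinP; apply: measurable_bigsum => k; rewrite mem_index_iota => /andP[k0 _].
  by apply: measurable_funX; exact: ma.
apply: (@fatou_le _ _ _ mu D (fun n x => (\sum_(1 <= k < n.+1) a k x ^+ 2)%:E)) => //.
- apply: (emeasurable_fun_cvg (fun n x => (\sum_(1 <= k < n.+1) a k x ^+ 2)%:E)) => // x Dx.
  exact: cvg_ssq.
- by move=> n x _; rewrite lee_fin sumr_ge0// => k _; exact: sqr_ge0.
- by apply: nearW => x Dx; exact: cvg_ssq.
apply: nearW => n; under eq_integral do rewrite -sumEFin big_nat.
rewrite (eq_integral (fun x => (\sum_(1 <=
  k < n.+1) ((if (0 < k)%N then a k x else 0%R) ^+ 2)%:E)%E)); last first.
  by move=> x _; rewrite -big_nat; apply: eq_big_nat => k /andP[-> _].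
rewrite ge0_integral_sum//; last 2 first.
- move=> k; apply/measurable_EFinP; apply: measurable_funX; case: (boolP (0 < k)%N) => k0;
  [exact: ma|exact: measurable_cst].
- by move=> k x _; rewrite lee_fin sqr_ge0.
apply: (@le_trans _ _ (\sum_(1 <= k < n.+1) (e k)%:E)%E).
  by rewrite !big_nat; apply: lee_sum => k /andP[k0 _]; rewrite k0; exact: ae.
by rewrite sumEFin lee_fin.
Qed.

(** The total error of the [m]-th approximation: discretisation errors of the first [m] modes plus
    the variances of the omitted ones. The latter telescope after 1 / x^2 <= 2 / (x (x + 1)). *)
Lemma mode_error_sum (A B : R) m n : 0 <= A -> 0 <= B ->
  \sum_(1 <= j < n.+1) (if (j <= m)%N then A / m.+1%:R ^+ 4 else B / j%:R ^+ 2) <=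
    (A + 2 * B) / m.+1%:R.
Proof.
move=> A0 B0; have m0 : 0 < m.+1%:R :> R by [].
have tele k : \sum_(m.+1 <= j < (m.+1 + k)%N) B / j%:R ^+ 2 <=
  2 * B / m.+1%:R - 2 * B / (m.+1 + k)%:R :> R.
  elim: k => [|k IH]; first by rewrite addn0 big_geq// subrr.
  rewrite addnS big_nat_recr ?leq_addr//=; apply: le_trans (lerD IH (lexx _)) _.
  have x0 : 0 < (m.+1 + k)%:R :> R by rewrite ltr0n.
  rewrite -[((m.+1 + k).+1)%:R]natr1; set x := (m.+1 + k)%:R in x0 *.
  have x1 : 1 <= x by rewrite /x ler1n.
  have -> : 2 * B / m.+1%:R - 2 * B / x + B / x ^+ 2 = 2 * B / m.+1%:R - 2 * B / (x + 1)
     - B * ((x - 1) / (x ^+ 2 * (x + 1))).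
    by field; rewrite !gt_eqF//= ltr_wpDl.
  by rewrite lerBlDr lerDl mulr_ge0// divr_ge0 ?subr_ge0// mulr_ge0 ?sqr_ge0//; lra.
have head k : (k <= m)%N -> \sum_(1 <= j < k.+1) (if (j <=
  m)%N then A / m.+1%:R ^+ 4 else B / j%:R ^+ 2) <= A / m.+1%:R.
  move=> km; rewrite (@eq_big_nat _ _ _ 1 k.+1 _ (fun=> A / m.+1%:R ^+ 4)); last first.
    by move=> j /andP[_ jk]; rewrite (leq_trans _ km).
  rewrite big_const_nat iter_addr_0 subSS subn0 -[X in X <= _]mulr_natr -mulrA ler_wpM2l//.
  rewrite ler_pdivrMl ?exprn_gt0//; apply: (@le_trans _ _ m.+1%:R); first by rewrite ler_nat ltnW.
  rewrite (_ : m.+1%:R ^+ 4 / m.+1%:R = m.+1%:R ^+ 3); last by field; rewrite gt_eqF.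
  by rewrite -natrX ler_nat expnS leq_pmulr// expn_gt0.
have [nm|mn] := leqP n m.
  apply: le_trans (head n nm) _; rewrite ler_wpM2r ?invr_ge0 ?(ltW m0)// lerDl mulr_ge0//.
rewrite (@big_cat_nat _ _ _ m.+1 1 n.+1)//=; last by rewrite ltnS ltnW.
rewrite mulrDl lerD ?head//.
rewrite (@eq_big_nat _ _ _ m.+1 n.+1 _ (fun j => B / j%:R ^+ 2)); last first.
  by move=> j /andP[mj _]; rewrite leqNgt mj.
have := tele (n.+1 - m.+1)%N; rewrite subnKC ?ltnS ?(ltnW mn)// => h; apply: le_trans h _.
by rewrite lerBlDr lerDl divr_ge0 ?mulr_ge0.
Qed.
End ssq_integral.

Lemma cvg_le_inv {R : realType} (u : nat -> \bar R) (C : R) :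
  (forall m, 0 <= u m)%E -> (forall m, (u m <= (C / m.+1%:R)%:E)%E) -> u m @[m --> \oo] --> 0%E.
Proof.
move=> u0 uC.
have fu m : u m \is a fin_num by rewrite ge0_fin_numE//; apply: le_lt_trans (uC m) (ltry _).
apply/fine_cvgP; split; first exact: nearW.
have h : C / m.+1%:R @[m --> \oo] --> (0 : R).
  by rewrite -(mulr0 C); apply: cvgM; [exact: cvg_cst|exact: cvg_harmonic].
apply: (squeeze_cvgr _ (cvg_cst (0 : R)) h); apply: nearW => m /=.
by rewrite fine_ge0//= -lee_fin fineK.
Qed.

Lemma norm_eigf {R : realType} k : (0 < k)%N -> `|eigf k : H01 R| = 1.
Proof.
move=> k0; apply/eqP; rewrite -sqrp_eq1// -L2_inner_norm.
by rewrite [L2_inner _ _]inner_eigf// eqxx.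
Qed.

Section convolution_error.
Context {R : realType} {d : measure_display} {Omega : measurableType d}.
Variable P : probability Omega R.
Variables (T : R) (W : R -> H01 R -> Omega -> R).
Hypothesis (Ww : cylindrical_wiener P T W) (T0 : 0 < T).
Local Notation H := (H01 R).
Local Notation leb := (@lebesgue_measure R).
Variable G : set Omega.
Hypotheses (mG : measurable G) (PG : P (~` G) = 0%E) (Ggood : G `<=` good_path T W).
Local Notation coord_path := (coord_path T W G).
Local Notation ou_mode := (ou_mode T W G).

Lemma ousumE mu k w t N : 0 <= t <= T -> G w ->
  ousum (coord_path k w) mu 0 t N = \sum_(i < N) expker mu t (part 0 t N i) *
    (W (part 0 t N i.+1) (eigf k) w - W (part 0 t N i) (eigf k) w).
Proof.
move=> /andP[t0 tT] Gw; apply: eq_bigr => i _.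
have /andP[h1 h2] := part_in t0 (ltnW (ltn_ord i)); have /andP[h3 h4] := part_in t0 (ltn_ord i).
by rewrite !BpE// ?h1 ?h3/= ?(le_trans _ tT).
Qed.

(** The difference of two Riemann sums is the Wiener integral of a difference of step functions,
    both within [mu * t / N%:R] of the kernel by its Lipschitz bound. *)
Lemma subgaussian_ousum_diff mu k t M N : (0 < k)%N -> 0 < mu -> 0 <= t <= T -> (0 < N)%N ->
  (N <= M)%N ->
  subgaussian P (fun w => ousum (coord_path k w) mu 0 t M - ousum (coord_path k w) mu 0 t N) (t *
    (2 * mu * t / N%:R) ^+ 2).
Proof.
move=> k0 mu0 tT N0 NM; have M0 : (0 < M)%N by exact: leq_trans NM.
have /andP[t0 tT'] := tT.
pose r := [seq (true, i) | i <- iota 0 M] ++ [seq (false, i) | i <- iota 0 N].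
pose L (b : bool) := if b then M else N.
pose lo (x : bool * nat) := part 0 t (L x.1) x.2.
pose hi (x : bool * nat) := part 0 t (L x.1) x.2.+1.
pose c (x : bool * nat) := (-1) ^+ (~~ x.1) * expker mu t (lo x).
pose g (x : bool * nat) : H := eigf k.
have io n : iota 0 n = index_iota 0 n by rewrite /index_iota subn0.
have sumE (F : bool * nat -> R) : \sum_(x <- r) F x = \sum_(i < M) F (true,
  nat_of_ord i) + \sum_(i < N) F (false, nat_of_ord i).
  by rewrite /r big_cat/= !big_map !io !big_mkord.
have rT x : x \in r -> [/\ 0 <= lo x, lo x <= hi x & hi x <= T].
  have key b i : (i < L b)%N -> [/\ 0 <= lo (b, i), lo (b, i) <= hi (b, i) & hi (b, i) <= T].
    move=> ib; rewrite /lo /hi/=.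
    have /andP[h1 h2] := part_in t0 (ltnW ib); have /andP[h3 h4] := part_in t0 ib.
    by split => //; [exact: part_le|exact: le_trans tT'].
  by rewrite mem_cat => /orP[] /mapP[i]; rewrite mem_iota add0n => /andP[_ ib] ->; apply: key.
apply: (@subgaussian_ae _ _ _ P (incW W r c lo hi g)).
- by apply: measurable_funB; exact: (measurable_ousum Ww (ltW T0) mG).
- apply: ae_imply (ae_G mG PG) => w Gw _; rewrite /incW sumE !ousumE//; congr (_ + _).
    by apply: eq_bigr => i _; rewrite /c/= expr0 mul1r.
  by rewrite -sumrN; apply: eq_bigr => i _; rewrite /c/= expr1 mulN1r mulNr.
apply: (subgaussian_incW Ww rT).
pose f := expker mu t.
have kE x : `|inc_ker r c lo hi g x| ^+ 2 = (stepf f 0 t M x - stepf f 0 t N x) ^+ 2.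
  have -> : inc_ker r c lo hi g x = (\sum_(i <- r) c i * \1_(`]lo i, hi i]%classic) x) *:
    (eigf k : H).
    by rewrite scaler_suml.
  rewrite sumE normrZ exprMn norm_eigf// expr1n mulr1 real_normK ?num_real//; congr (_ ^+ 2);
    rewrite /stepf; congr (_ + _).
    by apply: eq_bigr => i _; rewrite /c/= expr0 mul1r.
  by rewrite -sumrN; apply: eq_bigr => i _; rewrite /c/= expr1 mulN1r mulNr.
have bnd x : (stepf f 0 t M x - stepf f 0 t N x) ^+ 2 <= (2 * mu * t / N%:R) ^+ 2 * \1_(`]0,
  t]%classic) x.
  have lip y z : y <= z -> z <= t -> `|f y - f z| <= mu * (z - y) by exact: expker_lip.
  have h1 := stepf_dist t0 x M0 (ltW mu0) lip; have h2 := stepf_dist t0 x N0 (ltW mu0) lip.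
  rewrite subr0 in h1 h2; set I := \1__ x in h1 h2 *.
  have I0 : I = 0 \/ I = 1 by rewrite /I indicE; case: (_ \in _); [right|left].
  have MN : mu * (t / M%:R) <= mu * (t / N%:R).
    rewrite ler_wpM2l ?(ltW mu0)// ler_wpM2l// lef_pV2 ?posrE ?ltr0n// ler_nat//.
  have hh : `|stepf f 0 t M x - stepf f 0 t N x| <= 2 * mu * t / N%:R * I.
    have -> : stepf f 0 t M x - stepf f 0 t N x = (f x * I - stepf f 0 t N x) - (f x * I - stepf
      f 0 t M x) by ring.
    apply: le_trans (ler_normB _ _) _; apply: le_trans (lerD h2 h1) _.
    have -> : 2 * mu * t / N%:R = mu * (t / N%:R) + mu * (t / N%:R) by ring.
    by rewrite mulrDl lerD2l; case: I0 => ->; rewrite ?mulr0// !mulr1.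
  rewrite -(real_normK (num_real (_ - _))).
  have -> : (2 * mu * t / N%:R) ^+ 2 * I = (2 * mu * t / N%:R * I) ^+ 2.
    by rewrite [in RHS]exprMn; case: I0 => ->; rewrite ?expr0n ?expr1n.
  by rewrite ler_pXn2r ?nnegrE//; exact: le_trans hh.
apply: (@le_trans _ _ (\int[leb]_(x in `[0%R, T]) ((2 * mu * t / N%:R) ^+ 2 * \1_(`]0,
  t]%classic) x)%:E)%E).
  by apply: ge0_le_integralW => x _; rewrite lee_fin ?kE ?sqr_ge0.
have i0 (x : R) : 0 <= \1_(`]0, t]%classic) x :> R by rewrite indicE.
have s0 : 0 <= (2 * mu * t / N%:R) ^+ 2 by exact: sqr_ge0.
rewrite integral_realZ//.
rewrite integral_indic//= setIidl; last first.
  by move=> x /=; rewrite !in_itv/= => /andP[/ltW -> h]; exact: le_trans h tT'.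
rewrite lebesgue_measure_itv/= lte_fin; case: ltP => h.
  by rewrite -EFinB subr0 -EFinM mulrC.
by rewrite mule0 lee_fin mulr_ge0 ?sqr_ge0.
Qed.

(** The finer mesh tends to zero in [subgaussian_ousum_diff]; the shift by [N] keeps it the finer
    one throughout. *)
Lemma subgaussian_ousum_error mu k t N : (0 < k)%N -> 0 < mu -> 0 <= t <= T -> (0 < N)%N ->
  subgaussian P (fun w => ou_mode mu k t w - ousum (coord_path k w) mu 0 t N) (t * (2 * mu * t /
    N%:R) ^+ 2).
Proof.
move=> k0 mu0 tT N0; have /andP[t0 _] := tT.
apply: (@subgaussian_lim _ _ _ P (fun M w => ousum (coord_path k w) mu 0 t (M + N).+1 - ousum
  (coord_path k w) mu 0 t N)).
- apply: measurable_funB; first by apply: (measurable_ou_mode Ww (ltW T0) mG Ggood) => //; exact: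
  ltW.
  exact: (measurable_ousum Ww (ltW T0) mG).
- apply: nearW => w; apply: (@cvgB _ R^o); last exact: cvg_cst.
  rewrite -(ouinc0 Ggood).
  have : ousum (coord_path k w) mu 0 t n.+1 @[n --> \oo] --> ouinc (coord_path k w) mu 0 t.
    by apply: cvg_ousum => //; exact: ltW.
  by rewrite -(cvg_shiftn N).
by move=> M; apply: subgaussian_ousum_diff => //; rewrite ltnW// ltnS leq_addl.
Qed.
End convolution_error.

Section diagonal_integral.
Context {R : realType} {d : measure_display} {Omega : measurableType d}.
Variable P : probability Omega R.
Variables (T : R) (W : R -> H01 R -> Omega -> R).
Hypothesis (Ww : cylindrical_wiener P T W) (T0 : 0 < T).
Local Notation H := (H01 R).
Local Notation leb := (@lebesgue_measure R).
Variable G : set Omega.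
Hypotheses (mG : measurable G) (PG : P (~` G) = 0%E) (Ggood : G `<=` good_path T W).
Variables (c0 : R) (c00 : 0 < c0) (t : R) (tT : 0 <= t <= T).
Local Notation Y k := (ou_mode T W G (lam c0 k) k).
Variable sigma : nat -> R.
Hypothesis sigma1 : forall k, sigma k ^+ 2 <= 1.

Let t0 : 0 <= t. Proof. by case/andP: tT. Qed.
Let tleT : t <= T. Proof. by case/andP: tT. Qed.
(* The mesh [t / N m] beats the growth [m ^ 2] of the rates of the first [m] modes. *)
Let N (m : nat) : nat := (m.+1 ^ 4)%N.
Let N0 m : (0 < N m)%N. Proof. by rewrite expn_gt0. Qed.
Let f k := expker (lam c0 k) t.

(** The left-endpoint discretisation of the first [m] modes. The multiplier [sigma] is 1 for (i) and
    the indicator of [k <= n] for (ii), so one argument covers both. *)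
Definition diag_terms (m : nat) : seq (elem_term (R := R)) :=
  [seq ElemTerm (part 0 t (N m) i) (part 0 t (N m) i.+1) (eigf k)
     ((sigma k * f k (part 0 t (N m) i)) *: eigf k)
   | k <- index_iota 1 m.+1, i <- index_iota 0 (N m)].

Definition wiener_sum (m k : nat) (w : Omega) : R :=
  \sum_(i < N m) f k (part 0 t (N m) i) *
    (W (part 0 t (N m) i.+1) (eigf k) w - W (part 0 t (N m) i) (eigf k) w).

Lemma elem_val_diag m s v : elem_val (diag_terms m) s v =
  \sum_(1 <= k < m.+1) (sigma k * stepf (f k) 0 t (N m) s * coef k v) *: eigf k.
Proof.
rewrite /elem_val /diag_terms big_allpairs_dep; apply: eq_bigr => k _.
rewrite /stepf mulr_sumr mulr_suml scaler_suml big_mkord; apply: eq_bigr => i _ /=.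
by rewrite scalerA; congr (_ *: _); rewrite -/(coef k v); ring.
Qed.

Lemma elem_int_diag m w : elem_int W (diag_terms m) w =
  \sum_(1 <= k < m.+1) (sigma k * wiener_sum m k w) *: eigf k.
Proof.
rewrite /elem_int /diag_terms big_allpairs_dep; apply: eq_bigr => k _.
rewrite /wiener_sum mulr_sumr scaler_suml big_mkord; apply: eq_bigr => i _ /=.
by rewrite scalerA; congr (_ *: _); ring.
Qed.

Let cc := c0 * pi ^+ 2.
Let cc0 : 0 < cc. Proof. by rewrite mulr_gt0// exprn_gt0// pi_gt0. Qed.
Let lamE k : lam c0 k = cc * k%:R ^+ 2. Proof. by []. Qed.

Let step_small m k (c : R) : 0 <= c -> (0 < k)%N -> (k <= m)%N ->
  (c * lam c0 k / (N m)%:R) ^+ 2 <= (c * cc) ^+ 2 / m.+1%:R ^+ 4.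
Proof.
move=> c_ge0 k0 km; have m0 : 0 < m.+1%:R :> R by [].
have -> : (c * cc) ^+ 2 / m.+1%:R ^+ 4 = (c * (cc * m.+1%:R ^+ 2) / (N m)%:R) ^+ 2.
  by rewrite /N natrX; field; rewrite gt_eqF.
rewrite ler_pXn2r ?nnegrE ?divr_ge0 ?mulr_ge0 ?exprn_ge0 ?pi_ge0 ?(ltW cc0) ?(ltW c00)//.
rewrite ler_wpM2r ?invr_ge0// ler_wpM2l// lamE ler_wpM2l ?(ltW cc0)//.
by rewrite -!natrX ler_nat leq_exp2r// ltnW.
Qed.

Definition ker_err m k s : R := sigma k * (f k s - (if (k <=
  m)%N then stepf (f k) 0 t (N m) s else 0)).

Lemma measurable_ker_err m k D : measurable_fun D (ker_err m k).
Proof.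
apply: measurable_funTS; apply: measurable_funM => //; apply: measurable_funB.
  by apply: continuous_measurable_fun; exact: continuous_expker.
case: (boolP (k <= m)%N) => _; last exact: measurable_cst.
by apply: measurable_sum => i; apply: measurable_funM.
Qed.

Lemma sqr_sigma_le k (x : R) : (sigma k * x) ^+ 2 <= x ^+ 2.
Proof. by rewrite exprMn ler_piMl ?sqr_ge0. Qed.

Lemma int_ker_err m k : (0 < k)%N ->
  (\int[leb]_(s in `[0%R, t]) (ker_err m k s ^+ 2)%:E <=
    (if (k <= m)%N then (t * (t * cc) ^+ 2) / m.+1%:R ^+ 4 else (2 * cc)^-1 / k%:R ^+ 2)%:E)%E.
Proof.
move=> k0; have lk := lam_gt0 c00 k0.
case: ifP => km; last first.
  apply: (@le_trans _ _ (\int[leb]_(s in `[0%R, t]) (f k s ^+ 2)%:E)%E).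
    apply: ge0_le_integralW => s _; rewrite lee_fin ?sqr_ge0// /ker_err km subr0.
    exact: sqr_sigma_le.
  have h := Rint_expker_sqr lk t0.
  have fi : (\int[leb]_(s in `[0%R, t]) (f k s ^+ 2)%:E)%E \is a fin_num.
    apply: (integrable_fin_num (mu := leb)); first exact: measurable_itv.
    apply: continuous_itv_integrable => x.
    by apply: (cvg_comp (f k) (fun y => y ^+ 2)); [exact: continuous_expker|exact: sqr_continuous].
  rewrite -(fineK fi) lee_fin [fine _]h; apply: le_trans (ouvar_le lk _) _.
  by rewrite lamE mulrA invfM.
have mer : measurable_fun `[0%R, t]%classic (fun s => (ker_err m k s ^+ 2)%:E).
  by apply/measurable_EFinP; apply: measurable_funX; exact: measurable_ker_err.
(* The step function vanishes at 0, because its cells are open on the left, so the estimate is made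
   on ]0, t]. *)
rewrite -integral_itv_obnd_cbnd; last first.
  apply: measurable_funS mer => //; exact: subset_itv_oc_cc.
apply: (@le_trans _ _ (\int[leb]_(s in `]0%R, t]) ((t * cc) ^+ 2 / m.+1%:R ^+ 4)%:E)%E).
  apply: ge0_le_integralW => s; first by rewrite lee_fin sqr_ge0.
  rewrite /= in_itv/= => st; rewrite lee_fin /ker_err km; apply: le_trans (sqr_sigma_le _ _) _.
  apply: le_trans (step_small t0 k0 km).
  have lip y z : y <= z -> z <= t -> `|f k y - f k z| <= lam c0 k * (z - y) by exact: expker_lip.
  have := stepf_dist t0 s (N0 m) (ltW lk) lip.
  rewrite indicE mem_set /= ?in_itv//= !mulr1 subr0 => h.
  have hr : 0 <= t * lam c0 k / (N m)%:R by rewrite divr_ge0// mulr_ge0// ltW.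
  rewrite -(real_normK (num_real (_ - _))) ler_pXn2r ?nnegrE//.
  by apply: le_trans h _; rewrite mulrA (mulrC t).
rewrite integral_cst//= lebesgue_measure_itv/= lte_fin -EFinB subr0; case: ltP => h.
  by rewrite -EFinM lee_fin le_eqVlt; apply/orP; left; apply/eqP; ring.
by rewrite mule0 lee_fin divr_ge0 ?exprn_ge0// mulr_ge0 ?sqr_ge0.
Qed.

Variables (Psi : R -> H -> H) (Z : Omega -> H).
Hypothesis coef_Psi : forall s v k, 0 <= s <= t -> (0 < k)%N ->
  coef k (Psi s v) = sigma k * f k s * coef k v.
Hypothesis coef_Z : forall w k, (0 < k)%N -> coef k (Z w) = sigma k * Y k t w.
Hypothesis bZ : borel_H Z.

Lemma HS2_diag m s : 0 <= s <= t ->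
  HS2 (fun v => (Psi s v - elem_val (diag_terms m) s v)%R) = ssq (fun k => ker_err m k s).
Proof.
move=> st; rewrite /HS2 /ssq; apply: congr_lim; apply/funext => n.
apply: eq_big_nat => j /andP[j0 _]; congr EFin.
have -> : Psi s (eigf j) - elem_val (diag_terms m) s (eigf j) = ker_err m j s *: eigf j.
  apply: coef_inj => k k0; rewrite coefB coefZ coef_Psi// elem_val_diag coef_eigf_sum//.
  have cjk : coef k (eigf j) = (k == j)%:R :> R by exact: inner_eigf.
  rewrite cjk; case: eqP => [->|_]; last by rewrite !mulr0; case: ifP => _; rewrite ?mulr0 subrr.
  by rewrite /ker_err !mulr1 mulrBr; case: ifP; rewrite ?mulr0.
by rewrite normrZ exprMn norm_eigf// expr1n mulr1 real_normK ?num_real.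
Qed.

Definition path_err m k w : R := sigma k * (Y k t w - (if (k <= m)%N then wiener_sum m k w else 0)).

Lemma measurable_wiener_sum m k : measurable_fun setT (wiener_sum m k).
Proof.
apply: measurable_sum => i; apply: measurable_funM => //.
have /andP[h1 h2] := part_in t0 (ltnW (ltn_ord i)); have /andP[h3 h4] := part_in t0 (ltn_ord i).
by apply: measurable_funB; apply: (cw_meas Ww); rewrite ?h1 ?h3/= (le_trans _ tleT).
Qed.

Lemma measurable_path_err m k : (0 < k)%N -> measurable_fun setT (path_err m k).
Proof.
move=> k0; apply: measurable_funM => //; apply: measurable_funB.
  by apply: (measurable_ou_mode Ww (ltW T0) mG Ggood) => //; rewrite ltW// lam_gt0.
by case: (boolP (k <= m)%N) => _; [exact: measurable_wiener_sum|exact: measurable_cst].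
Qed.

Lemma norm_path_err m w : ((`|Z w - elem_int W (diag_terms m) w| ^+ 2)%:E = ssq (fun k =>
  path_err m k w))%E.
Proof.
rewrite parseval /ssq; apply: congr_lim; apply/funext => n.
apply: eq_big_nat => k /andP[k0 _]; congr (EFin (_ ^+ 2)).
rewrite coefB coef_Z// elem_int_diag coef_eigf_sum// /path_err.
by case: ifP => _; [rewrite -mulrBr|rewrite !subr0].
Qed.

(** [T + 1] takes the place of [t], which may be 0, because [subgaussian_moment] asks for a positive
    variance bound. *)
Let A1 : R := 4 * expR 2 * ((T + 1) * (2 * (T + 1) * cc) ^+ 2).
Let B1 : R := 4 * expR 2 * (2 * cc)^-1.

Lemma int_path_err m k : (0 < k)%N ->
  (\int[P]_w (path_err m k w ^+ 2)%:E <=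
    (if (k <= m)%N then A1 / m.+1%:R ^+ 4 else B1 / k%:R ^+ 2)%:E)%E.
Proof.
move=> k0; have lk := lam_gt0 c00 k0.
have T1 : 0 < T + 1 by have := T0; lra.
have mom X v : 0 < v -> subgaussian P X v ->
    (\int[P]_w ((sigma k * X w) ^+ 2)%:E <= (4 * expR 2 * v)%:E)%E.
  move=> v0 sX; apply: (@le_trans _ _ (\int[P]_w (X w ^+ 2)%:E)%E).
    by apply: ge0_le_integralW => w _; rewrite lee_fin ?sqr_ge0// sqr_sigma_le.
  apply: le_trans (subgaussian_moment 1 v0 sX) _; rewrite lee_fin factS fact0 mul1n expr1.
  by rewrite le_eqVlt; apply/orP; left; apply/eqP; ring.
rewrite /path_err; case: ifP => km; last first.
  under eq_integral do rewrite subr0.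
  apply: le_trans (mom _ _ _ (subgaussian_ou_mode Ww T0 mG PG Ggood k0 lk tT)) _.
    by rewrite invr_gt0 mulr_gt0.
  rewrite lee_fin /B1 lamE le_eqVlt; apply/orP; left; apply/eqP; field.
  by rewrite pnatr_eq0 -lt0n k0 gt_eqF.
pose v := (T + 1) * (2 * (T + 1) * lam c0 k / (N m)%:R) ^+ 2.
have N0R : 0 < (N m)%:R :> R by rewrite ltr0n.
have v0 : 0 < v by rewrite /v mulr_gt0// exprn_gt0// divr_gt0// mulr_gt0// mulr_gt0.
have sgE : subgaussian P (fun w => Y k t w - wiener_sum m k w) v.
  apply: (@subgaussian_ae _ _ _ P (fun w => Y k t w - ousum (coord_path T W G k w) (lam c0 k) 0 t
    (N m))).
  - apply: measurable_funB; last exact: measurable_wiener_sum.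
    by apply: (measurable_ou_mode Ww (ltW T0) mG Ggood) => //; exact: ltW.
  - by apply: ae_imply (ae_G mG PG) => w Gw _; rewrite (ousumE _ _ _ _ tT Gw).
  apply: subgaussian_le (subgaussian_ousum_error Ww T0 mG PG Ggood k0 lk tT (N0 m)).
  apply: ler_pM => //; first exact: sqr_ge0.
    by move: tleT; lra.
  have x0 : 0 <= 2 * lam c0 k * t / (N m)%:R by rewrite divr_ge0// mulr_ge0// mulr_ge0// ltW.
  have y0 : 0 <= 2 * (T + 1) * lam c0 k / (N m)%:R by rewrite divr_ge0// mulr_ge0 ?(ltW lk)//
    mulr_ge0// ltW.
  rewrite ler_pXn2r ?nnegrE//.
  rewrite ler_wpM2r ?invr_ge0// mulrAC ler_wpM2r ?(ltW lk)// ler_wpM2l//.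
  by move: tleT; lra.
apply: le_trans (mom _ _ v0 sgE) _; rewrite lee_fin /A1 -[X in _ <= X]mulrA.
apply: ler_wpM2l; first by rewrite mulr_ge0// expR_ge0.
rewrite -[X in _ <= X]mulrA /v; apply: ler_wpM2l; first exact: ltW.
by apply: step_small => //; rewrite mulr_ge0// ltW.
Qed.

Lemma stoch_integral_diag : is_stoch_integral P W t Psi Z.
Proof.
split; first exact: bZ.
exists diag_terms; split.
- move=> m; apply/all_allpairsP => k i _; rewrite mem_index_iota /= => iN.
  have /andP[h1 h2] := part_in t0 (ltnW iN); have /andP[h3 h4] := part_in t0 iN.
  by apply/and3P; split => //; exact: part_le.
- have C0 : 0 <= t * (t * cc) ^+ 2 by rewrite mulr_ge0 ?sqr_ge0.
  apply: (@cvg_le_inv _ _ (t * (t * cc) ^+ 2 + 2 * (2 * cc)^-1)) => m.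
    by apply: integral_ge0 => s _; apply: nneseries_ge0 => k _ _; rewrite lee_fin sqr_ge0.
  have -> : (\int[leb]_(s in `[0%R, t]) HS2 (fun v => (Psi s v - elem_val (diag_terms m) s v)%R) =
    \int[leb]_(s in `[0%R, t]) ssq (fun k => ker_err m k s))%E.
    by apply: eq_integral => s; rewrite inE/= in_itv/= => st; exact: HS2_diag.
  have mke k : (0 < k)%N -> measurable_fun `[0%R, t]%classic (ker_err m k) by move=> _; exact:
    measurable_ker_err.
  apply: (@int_ssq_le _ _ _ leb _ _ _ _ (measurable_itv _) mke (@int_ker_err m)).
  by move=> n; apply: mode_error_sum => //; rewrite invr_ge0 mulr_ge0// ltW.
apply: (@cvg_le_inv _ _ (A1 + 2 * B1)) => m.
  by apply: integral_ge0 => w _; rewrite lee_fin sqr_ge0.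
rewrite (eq_integral (fun w => ssq (fun k => path_err m k w))); last first.
  by move=> w _; exact: norm_path_err.
apply: (int_ssq_le measurableT _ (@int_path_err m)); first exact: measurable_path_err.
move=> n; apply: mode_error_sum.
  apply: mulr_ge0; first by rewrite mulr_ge0// expR_ge0.
  by apply: mulr_ge0; [have := T0; lra|exact: sqr_ge0].
apply: mulr_ge0; first by rewrite mulr_ge0// expR_ge0.
by rewrite invr_ge0 mulr_ge0// ltW.
Qed.
End diagonal_integral.

(** * Uniqueness of the stochastic integral *)

Section uniqueness.
Context {R : realType} {d : measure_display} {Omega : measurableType d}.
Variable P : probability Omega R.
Variables (T : R) (W : R -> H01 R -> Omega -> R).
Hypothesis (Ww : cylindrical_wiener P T W) (T0 : 0 < T).
Local Notation H := (H01 R).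
Local Notation leb := (@lebesgue_measure R).
Variables (t : R) (tT : 0 <= t <= T).

Definition good_terms (E : seq (elem_term (R := R))) :=
  all (fun i => [&& 0 <= et_lo i, et_lo i <= et_hi i & et_hi i <= t]) E.

Lemma coef_elem_val j E s (v : H) : coef j (elem_val E s v) =
  \sum_(i <- E) \1_(`]et_lo i, et_hi i]%classic) s * inner (et_left i) v * coef j (et_right i).
Proof. by rewrite /elem_val /coef /inner L2_inner_sumr; apply: eq_bigr => i _;
  rewrite L2_innerZr. Qed.

Lemma coef_elem_int j E w : coef j (elem_int W E w) =
  \sum_(i <- E) (W (et_hi i) (et_left i) w - W (et_lo i) (et_left i) w) * coef j (et_right i).
Proof. by rewrite /elem_int /coef /inner L2_inner_sumr; apply: eq_bigr => i _;
  rewrite L2_innerZr. Qed.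

Lemma measurable_coef_elem_val j E (v : H) D : measurable_fun D (fun s => coef j (elem_val E s v)).
Proof.
rewrite (funext (fun s => coef_elem_val j E s v)); apply: measurable_funTS.
elim: E => [|i E IH]; first by under eq_fun do rewrite big_nil; exact: measurable_cst.
under eq_fun do rewrite big_cons; apply: measurable_funD => //.
by apply: measurable_funM => //; apply: measurable_funM.
Qed.

Lemma measurable_coef_elem_int j E : good_terms E ->
  measurable_fun setT (fun w => coef j (elem_int W E w)).
Proof.
have /andP[t0 tleT] := tT.
move=> gE; rewrite (funext (fun w => coef_elem_int j E w)).
elim: E gE => [|i E IH] /=; first by move=> _; under eq_fun do rewrite big_nil; exact:
  measurable_cst.
move=> /andP[/and3P[h1 h2 h3] gE]; under eq_fun do rewrite big_cons; apply: measurable_funD;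
  last exact: IH.
apply: measurable_funM => //; apply: measurable_funB; apply: (cw_meas Ww).
  by rewrite (le_trans h1 h2) (le_trans h3).
by rewrite h1 (le_trans h2 (le_trans h3 tleT)).
Qed.

(** By Parseval, the squared norm of the linear functional that sends [v] to the [j]-th coordinate
    of the difference of both integrands at [v]. It is the energy density of the [j]-th coordinate
    of the difference of the elementary integrals. *)
Definition cross_ker j (E1 E2 : seq (elem_term (R := R))) s : \bar R :=
  ssq (fun k => coef j (elem_val E1 s (eigf k)) - coef j (elem_val E2 s (eigf k))).

Lemma subgaussian_elem_diff j E1 E2 (e : R) : good_terms E1 -> good_terms E2 ->
  (\int[leb]_(s in `[0%R, t]) cross_ker j E1 E2 s <= e%:E)%E ->
  subgaussian P (fun w => coef j (elem_int W E1 w) - coef j (elem_int W E2 w)) e.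
Proof.
move=> g1 g2 hker; have /andP[t0 tleT] := tT.
pose x0 := @ElemTerm R 0 0 0 0.
pose EE (b : bool) := if b then E1 else E2.
pose term (x : bool * nat) := nth x0 (EE x.1) x.2.
pose r := [seq (true, i) | i <- iota 0 (size E1)] ++ [seq (false, i) | i <- iota 0 (size E2)].
pose c (x : bool * nat) : R := (-1) ^+ (~~ x.1) * coef j (et_right (term x)).
have io n : iota 0 n = index_iota 0 n by rewrite /index_iota subn0.
have sumE (V : nmodType) (F : bool * nat -> V) (F1 F2 : elem_term -> V) :
  (forall i, F (true, i) = F1 (nth x0 E1 i)) -> (forall i, F (false, i) = F2 (nth x0 E2 i)) ->
  \sum_(x <- r) F x = \sum_(i <- E1) F1 i + \sum_(i <- E2) F2 i.
  move=> h1 h2; rewrite /r big_cat/= !big_map !io.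
  by congr (_ + _); rewrite [RHS](big_nth x0); apply: eq_bigr.
have rT x : x \in r -> [/\ 0 <= et_lo (term x), et_lo (term x) <=
  et_hi (term x) & et_hi (term x) <= t].
  have key b i : (i < size (EE b))%N -> [/\ 0 <= et_lo (term (b, i)), et_lo (term (b,
    i)) <= et_hi (term (b, i)) & et_hi (term (b, i)) <= t].
    move=> ib; have gb : good_terms (EE b) by case: (b).
    by move/(all_nthP x0) : gb => /(_ i ib) /and3P[].
  by rewrite mem_cat => /orP[] /mapP[i]; rewrite mem_iota add0n => /andP[_ ib] ->; apply: key.
have rT' x : x \in r -> [/\ 0 <= et_lo (term x), et_lo (term x) <=
  et_hi (term x) & et_hi (term x) <= T].
  by move=> /rT[h1 h2 h3]; split => //; exact: le_trans h3 tleT.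
have incE : (fun w => coef j (elem_int W E1 w) - coef j (elem_int W E2 w)) =
   incW W r c (fun x => et_lo (term x)) (fun x => et_hi (term x)) (fun x => et_left (term x)).
  apply/funext => w; rewrite !coef_elem_int /incW -sumrN.
  rewrite (sumE _ _ (fun i => (W (et_hi i) (et_left i) w - W (et_lo i) (et_left i) w) * coef j
    (et_right i))
    (fun i => - ((W (et_hi i) (et_left i) w - W (et_lo i) (et_left i) w) * coef j (et_right i))))//.
    by move=> i; rewrite /c/= expr0 mul1r mulrC.
  by move=> i; rewrite /c/= expr1 mulN1r mulNr mulrC.
rewrite incE; apply: (subgaussian_incW Ww rT').
pose K s := inc_ker r c (fun x => et_lo (term x)) (fun x => et_hi (term x)) (fun x => et_left
  (term x)) s.
have KE s : (`|K s| ^+ 2)%:E = cross_ker j E1 E2 s.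
  rewrite parseval /cross_ker; congr ssq; apply/funext => k.
  rewrite !coef_elem_val -sumrN /K /inc_ker /coef /inner L2_inner_sumr.
  rewrite (sumE _ _ (fun i => \1_(`]et_lo i, et_hi i]%classic) s * inner (et_left i) (eigf k) *
    coef j (et_right i))
    (fun i => - (\1_(`]et_lo i, et_hi i]%classic) s * inner (et_left i) (eigf k) * coef j
      (et_right i))))//.
    by move=> i; rewrite L2_innerZr L2_innerC /c/= expr0 mul1r /inner; ring.
  by move=> i; rewrite L2_innerZr L2_innerC /c/= expr1 mulN1r /inner; ring.
apply: le_trans hker.
pose g := (cross_ker j E1 E2) \_ `[0, t]%classic.
apply: (@le_trans _ _ (\int[leb]_(s in `[0%R, T]) g s)%E).
  apply: ge0_le_integralW => s sT; first by rewrite lee_fin sqr_ge0.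
  rewrite KE /g patchE; case: ifPn => // sn; rewrite -KE (_ : K s = 0) ?normr0 ?expr0n//.
  rewrite /K /inc_ker big1_seq// => x /= xr; have [h1 h2 h3] := rT x xr.
  rewrite indicE (_ : _ \in _ = false) ?mulr0 ?scale0r//.
  apply/negbTE; apply: contra sn; rewrite !mem_setE !in_itv/= => /andP[h4 h5].
  by rewrite (le_trans h1 (ltW h4)) (le_trans h5 h3).
rewrite /g -integral_mkcondr setIidr//.
by apply: subset_itv; rewrite bnd_simp.
Qed.

Lemma ssq_diff_le (a b : nat -> R) : (ssq (fun k => a k - b k)%R <= 2%:E * ssq a + 2%:E * ssq b)%E.
Proof.
rewrite /ssq -!nneseriesZl; try by move=> k _; rewrite lee_fin sqr_ge0.
rewrite -nneseriesD; try by move=> k _ _; rewrite mule_ge0 ?lee_fin ?sqr_ge0.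
apply: lee_nneseries => k _; first by rewrite lee_fin sqr_ge0.
rewrite -!EFinM -EFinD lee_fin; have := sqr_ge0 (a k + b k); nra.
Qed.

Lemma cvg_near_le (u : nat -> \bar R) e : u m @[m --> \oo] --> 0%E -> 0 < e ->
  exists N, forall m, (N <= m)%N -> (u m <= e%:E)%E.
Proof.
move=> u0 e0; have /fine_cvgP[uf] := u0.
move=> /cvgrPdist_le /(_ e e0); case: uf => N1 _ h1 [N2 _ h2].
exists (maxn N1 N2) => m; rewrite geq_max => /andP[m1 m2].
have := h2 m m2; rewrite /= sub0r normrN -{2}(fineK (h1 m m1)) lee_fin => h.
exact: le_trans (ler_norm _) h.
Qed.

(** Two elementary sequences approximating the same [Psi] have a small cross kernel, so the
    coordinates of their integrals differ by a sub-Gaussian variable of small variance. The triangle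
    inequality then makes the second moment of the difference of [Z1] and [Z2] smaller than any
    positive number. *)
Lemma stoch_integral_unique (Psi : R -> H -> H) (Z1 Z2 : Omega -> H) j : (0 < j)%N ->
  (forall k, (0 < k)%N -> measurable_fun `[0, t]%classic (fun s => coef j (Psi s (eigf k)))) ->
  is_stoch_integral P W t Psi Z1 -> is_stoch_integral P W t Psi Z2 ->
  {ae P, forall w, coef j (Z1 w) = coef j (Z2 w)}.
Proof.
move=> j0 mPsi [b1 [E1 [g1 k1 i1]]] [b2 [E2 [g2 k2 i2]]].
(* The [j]-th row of the Hilbert-Schmidt error: it lies below [HS2], and being measurable it can be
   integrated additively. *)
pose pk (E : seq elem_term) s := ssq (fun k => coef j (Psi s (eigf k)) - coef j (elem_val E s
  (eigf k))).
have mpk E : measurable_fun `[0, t]%classic (pk E).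
  apply: (emeasurable_fun_cvg (fun n s => (\sum_(1 <=
    k < n.+1) (coef j (Psi s (eigf k)) - coef j (elem_val E s (eigf k))) ^+ 2)%:E)).
    move=> n; apply/measurable_EFinP; apply: measurable_bigsum => k;
      rewrite mem_index_iota => /andP[k0 _].
    apply: measurable_funX; apply: measurable_funB; first exact: mPsi.
    exact: measurable_coef_elem_val.
  by move=> s _; exact: cvg_ssq.
have pk0 E s : (0 <= pk E s)%E by exact: ssq_ge0.
have pkle E s : (pk E s <= HS2 (fun v => (Psi s v - elem_val E s v)%R))%E.
  apply: lee_nneseries => k _; first by rewrite lee_fin sqr_ge0.
  rewrite lee_fin -coefB -(real_normK (num_real (coef j _))) ler_pXn2r ?nnegrE//.
  exact: sqr_coef_le.
have ker_le E E' (e : R) : 0 < e ->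
  (\int[leb]_(s in `[0%R, t]) HS2 (fun v => (Psi s v - elem_val E s v)%R) <= (e / 4)%:E)%E ->
  (\int[leb]_(s in `[0%R, t]) HS2 (fun v => (Psi s v - elem_val E' s v)%R) <= (e / 4)%:E)%E ->
  (\int[leb]_(s in `[0%R, t]) cross_ker j E E' s <= e%:E)%E.
  move=> e0 hE hE'.
  apply: (@le_trans _ _ (\int[leb]_(s in `[0%R, t]) (2%:E * pk E' s + 2%:E * pk E s))%E).
    apply: ge0_le_integralW => s _; first exact: ssq_ge0.
    rewrite /cross_ker; apply: le_trans (ssq_diff_le _ _).
    rewrite le_eqVlt; apply/orP; left; apply/eqP; congr ssq; apply/funext => k; ring.
  have p2 E0 s : (0 <= 2%:E * pk E0 s)%E by rewrite mule_ge0.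
  have mp2 E0 : measurable_fun `[0, t]%classic (fun s => 2%:E * pk E0 s)%E.
    by apply: measurable_funeM; exact: mpk.
  rewrite (ge0_integralD leb (measurable_itv _) (fun s _ => p2 E' s) (mp2 E') (fun s _ => p2 E s)
    (mp2 E)).
  have z2 E0 : (\int[leb]_(s in `[0%R, t]) (2%:E * pk E0 s) = 2%:E * \int[leb]_(s in `[0%R,
    t]) pk E0 s)%E.
    by apply: (ge0_integralZl leb (measurable_itv _) (mpk E0)) => // s _; exact: pk0.
  rewrite !z2.
  have b E'' : (\int[leb]_(s in `[0%R, t]) HS2 (fun v => (Psi s v - elem_val E'' s v)%R) <=
    (e / 4)%:E)%E ->
     (2%:E * \int[leb]_(s in `[0%R, t]) pk E'' s <= (e / 2)%:E)%E.
    move=> h; have -> : (e / 2)%:E = (2%:E * (e / 4)%:E)%E by rewrite -EFinM; congr EFin; field.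
    apply: lee_wpmul2l => //; apply: le_trans h.
    by apply: ge0_le_integralW.
  have -> : e%:E = ((e / 2)%:E + (e / 2)%:E)%E by rewrite -EFinD; congr EFin; field.
  by apply: leeD; exact: b.
have mZ1 := measurable_coef j0 b1; have mZ2 := measurable_coef j0 b2.
pose D w := coef j (Z1 w) - coef j (Z2 w).
have mD : measurable_fun setT D by apply: measurable_funB.
(* The constant is 3 (1 + 1 + 4 exp 2): a square of three terms, and the second moment from
   [subgaussian_moment] for the last one. *)
have small e : 0 < e -> (\int[P]_w (D w ^+ 2)%:E <= ((6 + 12 * expR 2) * e)%:E)%E.
  move=> e0; have e40 : 0 < e / 4 by rewrite divr_gt0.
  have [N1 h1] := cvg_near_le k1 e40; have [N2 h2] := cvg_near_le k2 e40.
  have [N3 h3] := cvg_near_le i1 e0; have [N4 h4] := cvg_near_le i2 e0.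
  pose m := maxn (maxn N1 N2) (maxn N3 N4).
  have [m1 m2 m3 m4] : [/\ (N1 <= m)%N, (N2 <= m)%N, (N3 <= m)%N & (N4 <= m)%N].
    by split; rewrite /m !leq_max leqnn ?orbT.
  have sD := subgaussian_elem_diff (g1 m) (g2 m) (ker_le _ _ _ e0 (h1 m m1) (h2 m m2)).
  have eD := subgaussian_moment 1 e0 sD.
  pose X1 w := coef j (Z1 w) - coef j (elem_int W (E1 m) w).
  pose X2 w := coef j (Z2 w) - coef j (elem_int W (E2 m) w).
  pose X3 w := coef j (elem_int W (E1 m) w) - coef j (elem_int W (E2 m) w).
  have mE1 := measurable_coef_elem_int j (g1 m); have mE2 := measurable_coef_elem_int j (g2 m).
  have mX1 : measurable_fun setT X1 by apply: measurable_funB.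
  have mX2 : measurable_fun setT X2 by apply: measurable_funB.
  have mX3 : measurable_fun setT X3 by apply: measurable_funB.
  have sq0 (X : Omega -> R) : forall w, 0 <= X w ^+ 2 by move=> w; exact: sqr_ge0.
  have msq (X : Omega -> R) : measurable_fun setT X ->
    measurable_fun setT (fun w => X w ^+ 2) by exact: measurable_funX.
  have bX1 : (\int[P]_w (X1 w ^+ 2)%:E <= e%:E)%E.
    apply: le_trans (h3 m m3); apply: ge0_le_integralW => w _; rewrite lee_fin ?sqr_ge0//.
    by rewrite /X1 -coefB -(real_normK (num_real (coef j _))) ler_pXn2r ?nnegrE// sqr_coef_le.
  have bX2 : (\int[P]_w (X2 w ^+ 2)%:E <= e%:E)%E.
    apply: le_trans (h4 m m4); apply: ge0_le_integralW => w _; rewrite lee_fin ?sqr_ge0//.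
    by rewrite /X2 -coefB -(real_normK (num_real (coef j _))) ler_pXn2r ?nnegrE// sqr_coef_le.
  apply: (@le_trans _ _ (\int[P]_w (3 * ((X1 w ^+ 2 + X2 w ^+ 2) + X3 w ^+ 2))%:E)%E).
    apply: ge0_le_integralW => w _; rewrite lee_fin ?sqr_ge0//.
    have -> : D w = X1 w - X2 w + X3 w by rewrite /D /X1 /X2 /X3; ring.
    have := sqr_ge0 (X1 w + X2 w); have := sqr_ge0 (X1 w - X3 w); have := sqr_ge0 (X2 w + X3 w);
      nra.
  have s12 w : 0 <= X1 w ^+ 2 + X2 w ^+ 2 by rewrite addr_ge0 ?sqr_ge0.
  have s123 w : 0 <= (X1 w ^+ 2 + X2 w ^+ 2) + X3 w ^+ 2 by rewrite addr_ge0 ?sqr_ge0.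
  have m12 : measurable_fun setT (fun w => X1 w ^+ 2 + X2 w ^+ 2) by apply: measurable_funD;
    exact: msq.
  have m123 : measurable_fun setT (fun w => (X1 w ^+ 2 + X2 w ^+ 2) + X3 w ^+ 2) by apply:
    measurable_funD => //; exact: msq.
  rewrite (integral_realZ P measurableT m123 s123)//.
  rewrite (integral_realD P measurableT m12 (msq _ mX3) s12 (sq0 X3)).
  rewrite (integral_realD P measurableT (msq _ mX1) (msq _ mX2) (sq0 X1) (sq0 X2)).
  have bX3 : (\int[P]_w (X3 w ^+ 2)%:E <= (4 * expR 2 * e)%:E)%E.
    apply: le_trans eD _; rewrite lee_fin factS fact0 mul1n expr1.
    by rewrite le_eqVlt; apply/orP; left; apply/eqP; ring.
  apply: (@le_trans _ _ (3%:E * ((e%:E + e%:E) + (4 * expR 2 * e)%:E))%E).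
    apply: lee_wpmul2l; first by rewrite lee_fin.
    exact: (leeD (leeD bX1 bX2) bX3).
  rewrite -!EFinD -EFinM lee_fin le_eqVlt; apply/orP; left; apply/eqP; ring.
have D0 : (\int[P]_w (D w ^+ 2)%:E = 0)%E.
  apply/eqP; rewrite eq_le; apply/andP; split; last by apply: integral_ge0 => w _;
    rewrite lee_fin sqr_ge0.
  apply/lee_addgt0Pr => e e0; rewrite add0e.
  have C0 : 0 < 6 + 12 * expR 2 :> R by have := expR_gt0 (2 : R); lra.
  have := small (e / (6 + 12 * expR 2)) (divr_gt0 e0 C0).
  by rewrite mulrC divfK// gt_eqF.
have : ae_eq P setT (EFin \o (fun w => D w ^+ 2)) (cst 0%E).
  apply/(ae_eq_integral_abs P measurableT).
    by apply/measurable_EFinP; exact: measurable_funX.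
  by rewrite -[RHS]D0; apply: eq_integral => w _; rewrite /= ger0_norm ?sqr_ge0.
apply: filterS => w /(_ I) /= [] /eqP; rewrite sqrf_eq0 subr_eq0 => /eqP.
by [].
Qed.
End uniqueness.

(** * The scheme *)

Section continuous_extension.
Context {R : realType}.
Local Notation H := (H01 R).
Variables (c0 : R) (c00 : 0 < c0) (alpha : R).
Variables (Hneg : completeNormedModType R) (iota : {linear H01 R -> Hneg}).
Hypothesis iota_dense : dense (range iota).

Lemma dense_range_eq (q q' : Hneg -> H) : continuous q -> continuous q' ->
  (forall v, q (iota v) = q' (iota v)) -> q = q'.
Proof.
move=> cq cq' qq; apply/funext => y; apply/eqP; rewrite -subr_eq0 -normr_eq0;
  apply/negPn/negP => n0.
have e0 : 0 < `|q y - q' y| / 2 by rewrite divr_gt0// lt_neqAle eq_sym n0 normr_ge0.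
have /cvgrPdist_lt /(_ _ e0) n1 := cq y; have /cvgrPdist_lt /(_ _ e0) n2 := cq' y.
have n3 : nbhs y [set z | `|q y - q z| < `|q y - q' y| / 2 /\ `|q' y - q' z| < `|q y - q' y| / 2].
  by apply: filterS2 n1 n2 => z ? ?; split.
have [|z [Oz [v _ vz]]] := @iota_dense (interior [set z | `|q y - q z| < `|q y - q' y| / 2 /\
  `|q' y - q' z| < `|q y - q' y| / 2]) _ (open_interior _).
  by exists y; exact: n3.
have [h1 h2] := interior_subset Oz; rewrite -vz qq in h1; rewrite -vz in h2.
have := ler_distD (q' (iota v)) (q y) (q' y); rewrite (distrC (q' (iota v))) => h3.
by move: (lt_le_trans (ltrD h1 h2) (lexx _)); rewrite -splitr ltNge h3.
Qed.

Definition diagmap (n : nat) (c : nat -> R) (u : H) : H := \sum_(1 <=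
  k < n.+1) (c k * coef k u) *: eigf k.

Lemma coef_diagmap n c u k : (0 < k)%N -> coef k (diagmap n c u) = if (k <=
  n)%N then c k * coef k u else 0.
Proof. by move=> k0; rewrite coef_eigf_sum. Qed.

Lemma diagmap_lip n c u v : `|diagmap n c u - diagmap n c v| <= (1 + \sum_(1 <=
  k < n.+1) c k ^+ 2) * `|u - v|.
Proof.
set L := \sum_(1 <= k < n.+1) c k ^+ 2; have L0 : 0 <= L by apply: sumr_ge0 => k _; exact: sqr_ge0.
rewrite -sumrB (eq_bigr (fun k => (c k * coef k (u - v)) *: (eigf k : H))); last first.
  by move=> k _; rewrite -scalerBl -mulrBr coefB.
rewrite -(@ler_pXn2r _ 2%N) ?nnegrE ?mulr_ge0 ?addr_ge0// norm_eigf_sum//.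
apply: (@le_trans _ _ (L * `|u - v| ^+ 2)).
  rewrite /L mulr_suml; apply: ler_sum_nat => k /andP[k0 _]; rewrite exprMn ler_wpM2l ?sqr_ge0//.
  by rewrite -(real_normK (num_real (coef k _))) ler_pXn2r ?nnegrE// sqr_coef_le.
by rewrite exprMn ler_wpM2r ?sqr_ge0//; nra.
Qed.

Lemma continuous_diagmap n c (q : Hneg -> H) : continuous q ->
  continuous (fun y => diagmap n c (q y)).
Proof.
move=> cq y; apply/cvgrPdist_lt => e e0.
set L := 1 + \sum_(1 <= k < n.+1) c k ^+ 2.
have L0 : 0 < L by rewrite /L ltr_pwDl// sumr_ge0// => k _; exact: sqr_ge0.
have /cvgrPdist_lt /(_ (e / L) (divr_gt0 e0 L0)) := cq y.
apply: filterS => z h; apply: le_lt_trans (diagmap_lip _ _ _ _) _.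
by rewrite -/L mulrC -ltr_pdivlMr.
Qed.

Lemma cext_spec (S : H -> H) q : continuous q -> (forall v, q (iota v) = S v) -> cext iota S = q.
Proof.
move=> cq qS; have [c1 h1] : continuous (cext iota S) /\ forall v, cext iota S (iota v) = S v.
  by apply: (@xgetPex _ (cst 0) [set q : Hneg -> H | continuous q /\ forall v,
    q (iota v) = S v]); exists q.
by apply: dense_range_eq => // v; rewrite h1 qS.
Qed.

(** Where no extension exists, [cext] is the constant 0, which is continuous as well. *)
Lemma continuous_cext (S : H -> H) : continuous (cext iota S).
Proof.
have [[q [cq qS]]|nq] := pselect (exists q : Hneg -> H, continuous q /\ forall v, q (iota v) = S v).
  by rewrite (cext_spec cq qS).
rewrite /cext xgetPN; first exact: cst_continuous.
by move=> q hq; apply: nq; exists q.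
Qed.

(** On the range of [Pn n] the semigroup is an invertible diagonal map, so the extensions of both
    operators exist together and correspond to each other; if neither exists, both sides are 0. *)
Lemma cext_diag n tau y : 0 <= tau ->
  cext iota (fun v => Pn n (expA c0 tau v)) y =
  diagmap n (fun k => expR (- (lam c0 k * tau))) (cext iota (Pn n) y).
Proof.
move=> tau0; set e := fun k => expR (- (lam c0 k * tau)).
have Pd v : Pn n (expA c0 tau v) = diagmap n e (Pn n v).
  apply: coef_inj => k k0; rewrite coef_Pn// coef_diagmap// coef_Pn//.
  by case: ifP => // _; rewrite coef_expA0.
have [[q [cq qS]]|nq] := pselect (exists q : Hneg -> H, continuous q /\ forall v,
  q (iota v) = Pn n v).
  rewrite (cext_spec cq qS) (@cext_spec _ (fun y => diagmap n e (q y)))//; first exact: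
    continuous_diagmap.
  by move=> v; rewrite qS Pd.
rewrite {2}/cext xgetPN; last by move=> q hq; apply: nq; exists q.
rewrite /cext xgetPN; last first.
  (* The inverse multipliers would turn an extension of the composition into one of [Pn n]. *)
  move=> q [cq hq]; apply: nq; exists (fun y => diagmap n (fun k => expR (lam c0 k * tau)) (q y)).
  split; first exact: continuous_diagmap.
  move=> v; rewrite hq Pd; apply: coef_inj => k k0; rewrite !coef_diagmap// !coef_Pn//.
  by case: (k <= n)%N => //; rewrite mulrA /e -expRD subrr expR0 mul1r.
by apply: coef_inj => k k0; rewrite coef_diagmap// coef0 mulr0 if_same.
Qed.

End continuous_extension.

Section scheme_measurability.
Context {R : realType} {d : measure_display} {Omega : measurableType d}.
Local Notation H := (H01 R).
Local Notation leb := (@lebesgue_measure R).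
Variables (T c0 varrho chi : R).
Hypotheses (c00 : 0 < c0) (vr0 : 0 < varrho).
Variables (Hneg : completeNormedModType R) (iota : {linear H01 R -> Hneg}).
Hypothesis iota_dense : dense (range iota).
Variables (F : H -> Hneg) (F_continuous : continuous_Hr c0 varrho F).
Variables (xi : H) (n : nat) (h : R) (h0 : 0 < h).

(** On a grid cell the truncated drift of mode [k] is this frozen value times an exponential, whose
    integral over the cell is [gweight]. *)
Definition gstep (k : nat) (u : R) (X O : R -> H) : R :=
  if Hnorm c0 varrho (X u) + Hnorm c0 varrho (O u + Pn n (expA c0 u xi)) <= `|h| `^ (- chi)
  then coef k (cext iota (Pn n) (F (X u))) else 0.

Definition gweight (t : R) (k i : nat) : R :=
  \int[leb]_(s in `[0%R, t]) (\1_(`[i%:R * h, i.+1%:R * h[%classic) s * expR (- (lam c0 k * (t -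
    s)))).

Lemma gridfloor_nat s : 0 <= s -> exists i : nat, gridfloor h s = i%:R * h /\ i%:R * h <=
  s < i.+1%:R * h.
Proof.
move=> s0; have sh : 0 <= s / h by rewrite divr_ge0// ltW.
have := floor_ge0 (s / h); rewrite sh; case E : (Num.floor (s / h)) => [i|//] _.
exists i; rewrite /gridfloor E -pmulrn; split=> //.
have /andP[h1 h2] := floor_itv (s / h); move: h1 h2; rewrite E intrD -pmulrn => h1 h2.
by rewrite -ler_pdivlMr// h1/= -ltr_pdivrMr// -natr1.
Qed.

Lemma gridfloor_eqP s (i : nat) : 0 <= s -> (i%:R * h <= s < i.+1%:R * h) ->
  gridfloor h s = i%:R * h.
Proof.
move=> s0 /andP[h1 h2]; have [i' [-> /andP[h3 h4]]] := gridfloor_nat s0.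
have : (i < i'.+1)%N by rewrite -(ltr_nat R) -(ltr_pM2r h0); exact: le_lt_trans h4.
have : (i' < i.+1)%N by rewrite -(ltr_nat R) -(ltr_pM2r h0); exact: le_lt_trans h2.
by rewrite !ltnS => a b; have -> : i = i' by apply/eqP; rewrite eqn_leq a b.
Qed.

(** Counts the grid points [i%:R * h] in [0, t], the point [t] itself included if it is one. *)
Definition nsteps (t : R) : nat := (Num.truncn (t / h)).+1.

Lemma nsteps_lt t s i : 0 <= s -> s <= t -> i%:R * h <= s -> (i < nsteps t)%N.
Proof.
move=> s0 st is_; rewrite /nsteps ltnS truncn_ge_nat.
  by rewrite ler_pdivlMr//; exact: le_trans st.
by rewrite divr_ge0 ?(le_trans s0 st)// ltW.
Qed.

Lemma nsteps_le t i : 0 <= t -> (i < nsteps t)%N -> i%:R * h <= t.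
Proof.
move=> t0; rewrite /nsteps ltnS truncn_ge_nat; last by rewrite divr_ge0// ltW.
by rewrite ler_pdivlMr.
Qed.

Definition drift_sum (t : R) (k : nat) (b : nat -> R) : R :=
  \sum_(i < nsteps t) b i * gweight t k i.

Lemma drift_sum_eq t k b b' : (forall i, (i < nsteps t)%N -> b i = b' i) ->
  drift_sum t k b = drift_sum t k b'.
Proof. by move=> bb; apply: eq_bigr => i _; rewrite (bb i (ltn_ord i)). Qed.

(** The drift is frozen on each cell and [cext_diag] splits off the semigroup, so the integral
    collapses to a finite combination of values at grid times. *)
Lemma coef_scheme t k (X O : R -> H) : 0 <= t -> (0 < k <= n)%N ->
  coef k (scheme c0 varrho chi iota F xi n h X O t) =
  expR (- (lam c0 k * t)) * coef k xi + drift_sum t k (fun i => gstep k (i%:R * h) X O) + coef k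
    (O t).
Proof.
move=> t0 /andP[k0 kn]; rewrite /scheme !coefD coef_Pn// kn coef_expA0//; congr (_ + _ + _).
rewrite coef_Pint// kn.
pose w i s := \1_(`[i%:R * h, i.+1%:R * h[%classic) s * expR (- (lam c0 k * (t - s))).
have iw0 i : leb.-integrable `[0%R, t]%classic (EFin \o w i).
  apply: (@le_integrable _ _ _ leb _ (measurable_itv _) _ (EFin \o (expker (lam c0 k) t))).
  - apply/measurable_EFinP; apply: measurable_funTS; apply: measurable_funM => //.
    by apply: continuous_measurable_fun; exact: continuous_expker.
  - move=> s _; rewrite /= lee_fin /w normrM ler_piMl// indicE; case: (_ \in _);
    rewrite ?normr1 ?normr0//.
  - by apply: continuous_itv_integrable; exact: continuous_expker.
have iw i : leb.-integrable `[0%R, t]%classic (EFin \o (fun s => gstep k (i%:R * h) X O * w i s)).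
  have := @integrableZl _ _ _ leb _ (measurable_itv _) (gstep k (i%:R * h) X O) (EFin \o w i)
    (iw0 i).
  by apply: eq_integrable => // s _.
transitivity (\int[leb]_(s in `[0%R, t]) (\sum_(i < nsteps t) gstep k (i%:R * h) X O * w i s));
  last first.
  rewrite Rintegral_sum//; apply: eq_bigr => i _.
  rewrite RintegralZl//; exact: iw0.
apply: eq_Rintegral => s; rewrite inE/= in_itv/= => /andP[s0 st].
have [i [gi is_]] := gridfloor_nat s0; rewrite gi.
have iN : (i < nsteps t)%N by apply: nsteps_lt st _ => //; case/andP: is_.
rewrite (bigD1 (Ordinal iN))//= big1 ?addr0; last first.
  move=> j /eqP ji; rewrite /w indicE (_ : _ \in _ = false) ?mul0r ?mulr0//.
  apply/negbTE; rewrite mem_setE in_itv/=; apply/negP => js; apply: ji; apply: val_inj => /=.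
  have := gridfloor_eqP s0 js; rewrite gi => /(mulIf (lt0r_neq0 h0)) /eqP;
    rewrite eqr_nat => /eqP ->//.
rewrite /w indicE mem_setE in_itv/= is_ mul1r /gstep; case: ifP => _; last by rewrite mul0r coef0.
by rewrite cext_diag ?subr_ge0// coef_diagmap// kn mulrC.
Qed.

Lemma coef_scheme_high t k (X O : R -> H) : (n < k)%N ->
  coef k (scheme c0 varrho chi iota F xi n h X O t) = coef k (O t).
Proof.
move=> nk; have k0 : (0 < k)%N by exact: leq_ltn_trans nk.
by rewrite /scheme !coefD coef_Pn// coef_Pint// leqNgt nk/= !add0r.
Qed.

Lemma scheme_congr t k (X O O' : R -> H) : 0 <= t -> (0 < k <= n)%N ->
  (forall i, (i < nsteps t)%N -> O (i%:R * h) = O' (i%:R * h)) -> O t = O' t ->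
  coef k (scheme c0 varrho chi iota F xi n h X O t) = coef k (scheme c0 varrho chi iota F xi n h
    X O' t).
Proof.
move=> t0 kn OO' Ot; rewrite (coef_scheme X O t0 kn) (coef_scheme X O' t0 kn) Ot.
have gE i : (i < nsteps t)%N -> gstep k (i%:R * h) X O = gstep k (i%:R * h) X O'.
  by move=> iN; rewrite /gstep (OO' i iN).
have dE := drift_sum_eq k gE.
by rewrite [in LHS]dE.
Qed.

Lemma rv_Pn_coef (Z : Omega -> H) : rv_Pn n Z -> forall w, Z w = \sum_(1 <=
  k < n.+1) coef k (Z w) *: eigf k.
Proof. by move=> [rZ _] w; rewrite -[LHS](Pn_id (rZ w)). Qed.

Lemma measurable_Hnorm (Z : Omega -> H) : rv_Pn n Z ->
  measurable_fun setT (fun w => Hnorm c0 varrho (Z w)).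
Proof.
move=> rZ.
have -> : (fun w => Hnorm c0 varrho (Z w)) =
    (fun w => Num.sqrt (\sum_(1 <= k < n.+1) (lam c0 k `^ varrho * coef k (Z w)) ^+ 2)).
  apply/funext => w; rewrite {1}(rv_Pn_coef rZ w) -(Hnorm_fin c0 varrho n (coef^~ (Z w))).
  by rewrite sqrtr_sqr ger0_norm// normr_ge0.
apply: measurableT_comp; first by apply: continuous_measurable_fun; exact: sqrt_continuous.
apply: measurable_bigsum => k; rewrite mem_index_iota => /andP[k0 _].
apply: measurable_funX; apply: measurable_funM => //; apply: measurable_coef => //; exact: rZ.2.
Qed.

(** [F] is continuous in the norm of [H_varrho], which on the range of [Pn n] is controlled by
    finitely many coordinates, and [cext] is continuous; preimages of intervals are therefore sets
    as in [measurable_coord_open]. *)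
Lemma measurable_ext_coef (Z : Omega -> H) (k : nat) : (0 < k)%N -> rv_Pn n Z ->
  measurable_fun setT (fun w => coef k (cext iota (Pn n) (F (Z w)))).
Proof.
move=> k0 rZ; apply: (measurability _ (RGenOpens.measurableE R)).
move=> _ [_ [a [b ->] <-]]; rewrite setTI.
pose V (x : nat -> R) := a < coef k (cext iota (Pn n) (F (\sum_(1 <= k < n.+1) x k *: eigf k))) < b.
have -> : (fun w => coef k (cext iota (Pn n) (F (Z w)))) @^-1` `]a,
  b[%classic = [set w | V (fun k => coef k (Z w))].
  by apply/seteqP; split => w; rewrite /V /= in_itv/= -(rv_Pn_coef rZ w).
apply: (@measurable_coord_open _ _ _ n (fun k w => coef k (Z w)) _ V).
  by move=> j /andP[j0 _]; apply: measurable_coef => //; exact: rZ.2.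
move=> x; rewrite /V; set u := \sum_(1 <= k < n.+1) x k *: eigf k : H => /andP[au ub].
pose g (y : Hneg) := coef k (cext iota (Pn n) y).
have r0 : 0 < Num.min (g (F u) - a) (b - g (F u)) by rewrite lt_min !subr_gt0 au.
have /cvgrPdist_lt /(_ _ r0) := @continuous_cext _ Hneg iota iota_dense (Pn n) (F u).
rewrite /= => /nbhs_normP [e /= e0 He].
have [dl dl0 Hdl] := F_continuous (@Hr_fin _ c0 varrho n x) e0.
have [dl' dl'0 Hdl'] := @small_weighted_sum _ n (fun k => lam c0 k `^ varrho) dl dl0.
exists dl' => // y hy.
set v := \sum_(1 <= k < n.+1) y k *: eigf k : H.
have Fv : `|F v - F u| < e.
  apply: Hdl; first exact: Hr_fin.
  rewrite /v /u -sumrB (eq_bigr (fun k => (y k - x k) *: (eigf k : H))); last first.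
    by move=> i _; rewrite scalerBl.
  rewrite -(@ltr_pXn2r _ 2%N) ?nnegrE ?(ltW dl0) ?normr_ge0// Hnorm_fin; exact: Hdl'.
have := He (F v); rewrite /= distrC => /(_ Fv) h1.
have := le_lt_trans (sqr_coef_le (cext iota (Pn n) (F u) - cext iota (Pn n) (F v)) k0) h1.
rewrite coefB lt_min => /andP[]; rewrite /g !ltr_norml => /andP[h2 h3] /andP[h4 h5].
move: au ub h2 h3 h4 h5; rewrite /g.
move: (coef k (cext iota (Pn n) (F u))) (coef k (cext iota (Pn n) (F v))) => A B *.
by apply/andP; split; lra.
Qed.

Lemma measurable_gstep k u (X O : R -> Omega -> H) : (0 < k)%N -> 0 <= u -> rv_Pn n (X u) ->
  rv_Pn n (O u) ->
  measurable_fun setT (fun w => gstep k u (X ^~ w) (O ^~ w)).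
Proof.
move=> k0 u0 rX rO.
have rO' : rv_Pn n (fun w => O u w + Pn n (expA c0 u xi)).
  have -> : (fun w => O u w + Pn n (expA c0 u xi)) =
      (fun w => \sum_(1 <= k < n.+1) (coef k (O u w) + coef k (Pn n (expA c0 u xi))) *: (eigf k :
        H)).
    apply/funext => w; rewrite {1}(rv_Pn_coef rO w).
    have {1}-> : Pn n (expA c0 u xi) = \sum_(1 <= k < n.+1) coef k (Pn n (expA c0 u xi)) *: eigf k.
      by apply: coef_inj => j j0; rewrite coef_eigf_sum// coef_Pn//; case: ifP.
    rewrite -big_split/=; by apply: eq_bigr => i _; rewrite scalerDl.
  apply: rv_Pn_sum => j /andP[j0 _]; apply: measurable_funD => //; apply: measurable_coef => //;
    exact: rO.2.
pose A := [set w | Hnorm c0 varrho (X u w) + Hnorm c0 varrho (O u w + Pn n (expA c0 u xi)) <=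
  `|h| `^ (- chi)].
have mA : measurable A.
  have ms : measurable_fun setT (fun w => Hnorm c0 varrho (X u w) + Hnorm c0 varrho (O u w + Pn n
    (expA c0 u xi))).
    by apply: measurable_funD; apply: measurable_Hnorm.
  have := ms measurableT `]-oo, (`|h| `^ (- chi))]%classic (measurable_itv _).
  by rewrite setTI; congr measurable; apply/seteqP; split => w /=; rewrite in_itv.
have -> : (fun w => gstep k u (X ^~ w) (O ^~ w)) = (fun w => \1_A w * coef k (cext iota (Pn n) (F
  (X u w)))).
  apply/funext => w; rewrite /gstep indicE; case: ifPn => [Aw|Aw].
    by rewrite mem_set// mul1r.
  by rewrite memNset ?mul0r//; exact/negP.
by apply: measurable_funM; [exact: measurable_indic|exact: measurable_ext_coef].
Qed.

Lemma scheme_replace (P : probability Omega R) t (X O O' : R -> Omega -> H) : 0 <= t <= T ->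
  (forall u, 0 <= u <= T -> rv_Pn n (X u)) -> (forall u, 0 <= u <= T -> rv_Pn n (O' u)) ->
  (forall u, 0 <= u <= T -> {ae P, forall w, O u w = O' u w}) ->
  prob_one P [set w | X t w = scheme c0 varrho chi iota F xi n h (X ^~ w) (O ^~ w) t] ->
  prob_one P [set w | X t w = scheme c0 varrho chi iota F xi n h (X ^~ w) (O' ^~ w) t].
Proof.
move=> tT rX rO OO [mE PE]; have /andP[t0 tleT] := tT.
set E' := [set w | _ = scheme _ _ _ _ _ _ _ _ _ (O' ^~ w) _].
have ih0 i : 0 <= i%:R * h by rewrite mulr_ge0// ltW.
have range_scheme (Xw Ow : R -> H) : range (Pn n) (Ow t) ->
    range (Pn n) (scheme c0 varrho chi iota F xi n h Xw Ow t).
  move=> rOw; apply/range_PnP => k nk; rewrite coef_scheme_high//.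
  by move/range_PnP : rOw; apply.
(* [prob_one] includes measurability of the event, which is obtained from finitely many coordinate
   equations. *)
have E'E : E' = \bigcap_(k in [set k | (0 < k <= n)%N])
   [set w | coef k (X t w) = coef k (scheme c0 varrho chi iota F xi n h (X ^~ w) (O' ^~ w) t)].
  apply/seteqP; split=> [w /= Ew k _|w /= hw]; first by rewrite /= -Ew.
  apply: coef_inj => k k0.
  have [kn|nk] := leqP k n; first by apply: hw; rewrite /= k0.
  have /range_PnP -> // := (rX t tT).1 w.
  by have /range_PnP -> // := range_scheme (X ^~ w) (O' ^~ w) ((rO t tT).1 w).
have mE' : measurable E'.
  rewrite E'E; apply: bigcap_measurableType => k /= kn; have /andP[k0 _] := kn.
  under eq_set => w do rewrite coef_scheme//.
  have m1 : measurable_fun setT (fun w => coef k (X t w)) by apply: measurable_coef => //; exact: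
    (rX t tT).2.
  have m2 : measurable_fun setT (fun w => expR (- (lam c0 k * t)) * coef k xi +
     drift_sum t k (fun i => gstep k (i%:R * h) (X ^~ w) (O' ^~ w)) + coef k (O' t w)).
    apply: measurable_funD; last by apply: measurable_coef => //; exact: (rO t tT).2.
    apply: measurable_funD => //; apply: measurable_sum => i; apply: measurable_funM => //.
    have iT : 0 <= i%:R * h <= T.
      by rewrite ih0/=; apply: le_trans tleT; apply: nsteps_le.
    by apply: measurable_gstep => //; [exact: rX|exact: rO].
  have m3 := measurable_funB m1 m2; have := m3 measurableT [set 0] (measurable_set1 0).
  rewrite setTI; congr measurable; apply/seteqP; split => w /= /eqP.
    by rewrite subr_eq0 => /eqP.
  by move/eqP => ->; rewrite subrr.
split => //.
have aeE : {ae P, forall w, X t w = scheme c0 varrho chi iota F xi n h (X ^~ w) (O ^~ w) t}.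
  exists (~` [set w | X t w = scheme c0 varrho chi iota F xi n h (X ^~ w) (O ^~ w) t]); split => //.
    exact: measurableC.
  by rewrite probability_setC// PE subee.
have aeG : {ae P, forall w, forall i, (i < nsteps t)%N -> O (i%:R * h) w = O' (i%:R * h) w}.
  apply/ae_foralln => i; have [iN|iN] := ltnP i (nsteps t); last exact: nearW.
  apply: filterS (OO (i%:R * h) _) => [w -> //|].
  by rewrite ih0/=; apply: le_trans tleT; apply: nsteps_le.
have : {ae P, forall w, E' w}.
  apply: filterS3 aeE aeG (OO t tT) => w wE wG wO; rewrite /E' /= {1}wE.
  apply: coef_inj => k k0; have [kn|nk] := leqP k n.
    have kk : (0 < k <= n)%N by rewrite k0.
    exact: (scheme_congr (X ^~ w) t0 kk wG wO).
  by rewrite (coef_scheme_high t (X ^~ w) (O ^~ w) nk) (coef_scheme_high t (X ^~ w) (O' ^~ w) nk)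
    wO.
case=> N [mN N0 EN]; apply/eqP; rewrite eq_le probability_le1//=.
rewrite -(setCK E') probability_setC; last exact: measurableC.
have -> : P (~` E') = 0%E by apply: (subset_measure0 _ mN _ N0) => //; exact: measurableC.
by rewrite sube0.
Qed.

End scheme_measurability.

(** * Exponential moments of the shifted convolutions *)

Section sine_bounds.
Context {R : realType}.

Lemma sin_lip (a b : R) : `|sin a - sin b| <= `|a - b|.
Proof.
wlog ab : a b / b <= a.
  by move=> h; have [/h//|/ltW/h] := leP b a; rewrite distrC (distrC b).
have d (x : R) : is_derive x (1 : R) (sin : R -> R) (cos x) by exact: is_derive_sin.
have := @MVT_bound R _ _ b a 1 ab d (fun x _ => cos_max x).
by rewrite mul1r (ger0_norm (_ : 0 <= a - b)) // subr_ge0.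
Qed.

(** Interpolates between the Lipschitz bound and boundedness. The exponent [2^-1] costs k^(1/2) in
    mode [k], which variances of order k^(-7/4) can afford. *)
Lemma sqr_sin_diff_le (a b : R) : (sin a - sin b) ^+ 2 <= 4 * `|a - b| `^ 2^-1.
Proof.
have u0 : 0 <= `|a - b| by [].
have h2 : (sin a - sin b) ^+ 2 <= 4.
  have := sin_max a; have := sin_max b; rewrite !ler_norml => /andP[h1 h3] /andP[h4 h5]; nra.
have [u1|u1] := leP `|a - b| 1.
  apply: (@le_trans _ _ (`|a - b| ^+ 2)).
    by rewrite -(real_normK (num_real (_ - _))) ler_pXn2r ?nnegrE// sin_lip.
  have hu : `|a - b| ^+ 2 <= `|a - b| `^ 2^-1.
    have [->|un] := eqVneq `|a - b| 0; first by rewrite expr0n powR_ge0.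
    rewrite -powR_mulrn// ger_powR ?u1 ?lt_neqAle 1?eq_sym ?un//; lra.
  by have := powR_ge0 `|a - b| 2^-1; lra.
have : `|a - b| `^ 0 <= `|a - b| `^ 2^-1 by rewrite ler_powR ?(ltW u1).
by rewrite powRr0; lra.
Qed.
End sine_bounds.

Section spatial.
Context {R : realType} {d : measure_display} {Omega : measurableType d}.
Variable P : probability Omega R.
Variables (T : R) (W : R -> H01 R -> Omega -> R).
Hypothesis (Ww : cylindrical_wiener P T W) (T0 : 0 < T).
Variable G : set Omega.
Hypotheses (mG : measurable G) (PG : P (~` G) = 0%E) (Ggood : G `<=` good_path T W).
Variables (c0 eta : R).
Hypotheses (c00 : 0 < c0) (eta0 : 0 < eta).
Local Notation ou_mode := (ou_mode T W G).

Definition rate k : R := lam c0 k + eta.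

Lemma lam_ge0 k : 0 <= lam c0 k.
Proof. by rewrite /lam mulr_ge0 ?sqr_ge0// mulr_ge0 ?sqr_ge0// ltW. Qed.

Lemma rate_pos k : 0 < rate k.
Proof. by rewrite /rate ltr_wpDl// lam_ge0. Qed.

Definition fsum n t w x : R := \sum_(1 <= k < n.+1) sinek k x * ou_mode (rate k) k t w.

Lemma continuous_fsum n t w : continuous (fsum n t w).
Proof.
move=> x; apply: cvg_bigsum => k _.
by apply: cvgM; [exact: continuous_sinek|exact: cvg_cst].
Qed.

Lemma fsum0 n t w : fsum n t w 0 = 0.
Proof. by rewrite /fsum big1// => k _; rewrite /sinek mulr0 sin0 mulr0 mul0r. Qed.

Lemma measurable_fsum n t x : 0 <= t -> measurable_fun setT (fun w => fsum n t w x).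
Proof.
move=> t0; apply: measurable_bigsum => k _; apply: measurable_funM => //.
by apply: (measurable_ou_mode Ww (ltW T0) mG Ggood) => //; rewrite ltW// rate_pos.
Qed.

(* Interpolating [lam k + eta >= lam k ^ (7/8) * eta ^ (1/8)] leaves a convergent
   series in [k] and a factor which vanishes as [eta] grows. *)
Definition spatial_const : R := 20 * pi `^ 2^-1 * (c0 * pi ^+ 2) `^ (- (7 / 8)) * eta `^ (- 8^-1).

Let cc := c0 * pi ^+ 2.
Let cc0 : 0 < cc. Proof. by rewrite mulr_gt0// exprn_gt0// pi_gt0. Qed.

Lemma rate_lower k : (0 < k)%N -> (rate k)^-1 <=
  cc `^ (- (7 / 8)) * k%:R `^ (- (7 / 4)) * eta `^ (- 8^-1).
Proof.
move=> k0; have kp : 0 < k%:R :> R by rewrite ltr0n.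
have lk : 0 < lam c0 k by rewrite /lam -/cc mulr_gt0// exprn_gt0.
have r0 := rate_pos k.
have -> : cc `^ (- (7 / 8)) * k%:R `^ (- (7 / 4)) * eta `^ (- 8^-1) = ((lam c0 k) `^ (7 / 8) *
  eta `^ 8^-1)^-1.
  rewrite invfM -!powRN /lam -/cc powRM ?(ltW cc0) ?exprn_ge0//; congr (_ * _ * _).
  rewrite -(powR_mulrn 2 (ler0n _ k)) -powRrM; congr (_ `^ _); lra.
rewrite lef_pV2 ?posrE ?mulr_gt0 ?powR_gt0//.
have -> : rate k = rate k `^ (7 / 8) * rate k `^ 8^-1.
  rewrite -powRD; last by apply/implyP => _; rewrite gt_eqF.
  by rewrite (_ : 7 / 8 + 8^-1 = 1) ?powRr1 ?ltW//; lra.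
have le1 : lam c0 k <= rate k by rewrite /rate lerDl ltW.
have le2 : eta <= rate k by rewrite /rate lerDr lam_ge0.
have p7 : 0 <= 7 / 8 :> R by lra.
have p8 : 0 <= 8^-1 :> R by lra.
by apply: ler_pM; rewrite ?powR_ge0//; apply: ge0_ler_powR; rewrite ?nnegrE ?(ltW r0) ?(ltW lk)
  ?(ltW eta0).
Qed.

Lemma subgaussian_fsum_incr n t x y : 0 <= t <= T ->
  subgaussian P (fun w => fsum n t w y - fsum n t w x) (spatial_const * `|y - x| `^ 2^-1).
Proof.
move=> /andP[t0 tT].
have := @subgaussian_ouinc _ _ _ P T W Ww (ltW T0) G mG PG Ggood n (fun k => sinek k y - sinek k
  x) rate 0 t (lexx _) t0 tT (fun k _ => rate_pos k).
have -> : (fun w => \sum_(1 <= k < n.+1) (sinek k y - sinek k x) * ouinc (coord_path T W G k w)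
  (rate k) 0 t) =
    (fun w => fsum n t w y - fsum n t w x).
  apply/funext => w; rewrite /fsum -sumrB; apply: eq_bigr => k _.
  by rewrite (ouinc0 Ggood) mulrBl.
apply: subgaussian_le.
pose D := `|y - x| `^ 2^-1; have D0 : 0 <= D by exact: powR_ge0.
pose A := 4 * pi `^ 2^-1 * cc `^ (- (7 / 8)) * eta `^ (- 8^-1).
have A0 : 0 <= A by rewrite !mulr_ge0// powR_ge0.
have each k : (0 < k)%N -> (sinek k y - sinek k x) ^+ 2 * ouvar (rate k) (t - 0) <=
  A * D * k%:R `^ (- (1 + 4^-1)).
  move=> k0; have kp : 0 < k%:R :> R by rewrite ltr0n.
  have r0 := rate_pos k; have hv := ouvar_le r0 (t - 0).
  have hs := sqr_sin_diff_le (k%:R * pi * y) (k%:R * pi * x).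
  have kD : `|k%:R * pi * y - k%:R * pi * x| `^ 2^-1 = k%:R `^ 2^-1 * pi `^ 2^-1 * D.
    rewrite -mulrBr !normrM powRM ?mulr_ge0// powRM// (ger0_norm (pi_ge0 _)) (ger0_norm (ltW kp))
      //.
  have hS : (sinek k y - sinek k x) ^+ 2 <= 8 * (k%:R `^ 2^-1 * pi `^ 2^-1 * D).
    rewrite /sinek -mulrBr exprMn sqr_sqrtr//; rewrite kD in hs; lra.
  apply: (@le_trans _ _ (8 * (k%:R `^ 2^-1 * pi `^ 2^-1 * D) * (2 * rate k)^-1)).
    by apply: ler_pM; rewrite ?sqr_ge0 ?ouvar_ge0// subr0.
  rewrite invfM.
  apply: (@le_trans _ _ (8 * (k%:R `^ 2^-1 * pi `^ 2^-1 * D) * (2^-1 * (cc `^ (- (7 / 8)) * k%:R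
    `^ (- (7 / 4)) * eta `^ (- 8^-1))))).
    rewrite ler_wpM2l// ?ler_wpM2l ?rate_lower//.
    by rewrite !mulr_ge0// ?powR_ge0.
  have -> : k%:R `^ (- (1 + 4^-1)) = k%:R `^ 2^-1 * k%:R `^ (- (7 / 4)) :> R.
    rewrite -powRD; last by apply/implyP => _; rewrite gt_eqF.
    by congr (_ `^ _); lra.
  by rewrite le_eqVlt; apply/orP; left; apply/eqP; rewrite /A; field.
apply: (@le_trans _ _ (\sum_(1 <= k < n.+1) A * D * k%:R `^ (- (1 + 4^-1)))).
  by apply: ler_sum_nat => k /andP[k0 _]; exact: each.
rewrite -mulr_sumr big_add1 big_mkord/=.
have q0 : 0 < 4^-1 :> R by lra.
(* The series of k^(-5/4) is at most 1 + 4 = 5; with the 4 in [A] this is the 20 of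
   [spatial_const]. *)
apply: (@le_trans _ _ (A * D * 5)).
  apply: ler_wpM2l; first exact: mulr_ge0.
  by apply: le_trans (pseries_le n q0) _; rewrite invrK; lra.
by rewrite /spatial_const -/cc le_eqVlt; apply/orP; left; apply/eqP; rewrite /A /D; ring.
Qed.

(** Halving the dyadic mesh multiplies the variance bound, which has order [2^-1] in the distance,
    by this factor. *)
Definition spatial_ratio : R := 2 `^ (- 2^-1).

Lemma spatial_ratio01 : 0 < spatial_ratio < 1.
Proof.
rewrite /spatial_ratio powR_gt0//= powRN invf_lt1 ?powR_gt0//.
have h : 0 < 2^-1 :> R by lra.
by have := @gt0_ltr_powR R 2^-1 h 1 2; rewrite powR1; apply; rewrite ?inE ?nnegrE// ltr1n.
Qed.

Lemma spatial_const_gt0 : 0 < spatial_const.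
Proof. by rewrite /spatial_const -/cc !mulr_gt0// powR_gt0// pi_gt0. Qed.

Lemma spatial_chain n t j : 0 <= t <= T ->
  2 * (chain_ratio spatial_ratio)^-1 ^+ (2 * j) * spatial_ratio ^+ j <= 2^-1 ->
  (\int[P]_w chainQ 1 (chain_ratio spatial_ratio) (2 * j) (fun x w => fsum n t w x) w <=
    ((1 - chain_ratio spatial_ratio)^-1 ^+ (2 * j) * (4 * j`!%:R) * (2 * expR 2 * spatial_const)
      ^+ j)%:E)%E.
Proof.
move=> tT jth; have /andP[t0 _] := tT.
have mZ x : 0 <= x <= 1 -> measurable_fun setT (fun w => fsum n t w x) by move=> _; exact:
  measurable_fsum.
apply: (subgaussian_chain ltr01 spatial_const_gt0 spatial_ratio01 jth mZ) => m i im.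
have := subgaussian_fsum_incr n (dyad 1 m i) (dyad 1 m i.+1) tT.
congr (subgaussian P _ (_ * _)); rewrite /dyad -mulrBr -mulrBl -natr1 addrAC subrr add0r !mul1r.
rewrite ger0_norm ?invr_ge0 ?exprn_ge0// /spatial_ratio -(powR_mulrn m) ?powR_ge0// -powRrM.
by rewrite -(powR_invn m (ler0n _ 2)) -powRrM; congr (_ `^ _); ring.
Qed.

End spatial.

Section exp_series.
Context {R : realType}.

(** For [y <= 1] the first summand is enough; for [y > 1] raising every power by [j0] only increases
    the series. *)
Lemma exp_series_bound (c y : R) (j0 : nat) (Q : nat -> \bar R) : 0 <= c -> 0 <= y ->
  (forall j, (y ^+ (j + j0))%:E <= Q j)%E ->
  ((expR (c * y))%:E <= (expR c)%:E + \sum_(j <oo) (c ^+ j / j`!%:R)%:E * Q j)%E.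
Proof.
move=> c_ge0 y0 yQ.
have cj j : 0 <= c ^+ j / j`!%:R by rewrite divr_ge0// exprn_ge0.
have Q0 j : (0 <= Q j)%E by apply: le_trans (yQ j); rewrite lee_fin exprn_ge0.
have S0 : (0 <= \sum_(j <oo) (c ^+ j / j`!%:R)%:E * Q j)%E.
  by apply: nneseries_ge0 => j _ _; apply: mule_ge0; rewrite ?lee_fin.
have [y1|y1] := leP y 1.
  apply: (@le_trans _ _ (expR c)%:E); last by rewrite leeDl.
  by rewrite lee_fin ler_expR ler_piMr.
apply: (@le_trans _ _ (\sum_(j <oo) (c ^+ j / j`!%:R)%:E * Q j)%E);
  last by rewrite leeDr// lee_fin expR_ge0.
have ce : (series (exp_coeff (c * y)) N)%:E @[N --> \oo] --> (expR (c * y))%:E.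
  by apply: cvg_EFin; [exact: nearW|exact: is_cvg_series_exp_coeff].
rewrite -(cvg_lim _ ce)//; apply: lime_le; first by apply/cvg_ex; eexists; exact: ce.
apply: nearW => N; rewrite /series/= -sumEFin.
apply: (@le_trans _ _ (\sum_(0 <= j < N) (c ^+ j / j`!%:R)%:E * Q j)%E); last first.
  by apply: nneseries_lim_ge => j _ _; apply: mule_ge0; rewrite ?lee_fin.
apply: lee_sum => j _; apply: (@le_trans _ _ ((c ^+ j / j`!%:R)%:E * (y ^+ (j + j0))%:E)%E);
  last by apply: lee_wpmul2l; [rewrite lee_fin|exact: yQ].
rewrite -EFinM lee_fin /exp_coeff/= exprMn mulrAC ler_wpM2l//.
by rewrite ler_weXn2l ?ltW// leq_addr.
Qed.

(** A binomial coefficient is at most a power of 2. This lets the factorial from the shifted moment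
    cancel against that of the exponential series. *)
Lemma fact_add_le (j k : nat) : ((j + k)`! <= 2 ^ (j + k) * (j`! * k`!))%N.
Proof.
rewrite -(@bin_fact (j + k) j) ?leq_addr// addKn leq_mul2r; apply/orP; right.
have := Pascal 1 1 (j + k); rewrite addn1 => ->.
rewrite (bigD1 (inord j)) //= inordK ?ltnS ?leq_addr// !exp1n !muln1.
exact: leq_addr.
Qed.
End exp_series.

Section exp_moments.
Context {R : realType} {d : measure_display} {Omega : measurableType d}.
Variable P : probability Omega R.
Variables (T : R) (W : R -> H01 R -> Omega -> R).
Hypothesis (Ww : cylindrical_wiener P T W) (T0 : 0 < T).
Variables (c0 : R) (c00 : 0 < c0).
Local Notation r := (chain_ratio (@spatial_ratio R)).

(* The power series of [exp (c * y ^+ 2)] with each power of [y] replaced by its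
   chaining bound; the shift [j0] avoids the low powers, for which the chaining
   series need not converge. *)
Definition expQ (eta c : R) (j0 : nat) (G : set Omega) (n : nat) (t : R) (w : Omega) : \bar R :=
  ((expR c)%:E + \sum_(j <oo) (c ^+ j / j`!%:R)%:E *
    chainQ 1 r (2 * (j + j0)) (fun x w => fsum T W G c0 eta n t w x) w)%E.

Let r01 : 0 < r < 1. Proof. by apply: chain_ratio_in; exact: spatial_ratio01. Qed.
Let even2 j : ~~ odd (2 * j). Proof. by rewrite oddM. Qed.

Lemma expQ_ge0 eta c j0 G n t w : 0 <= c -> (0 <= expQ eta c j0 G n t w)%E.
Proof.
move=> c_ge0; rewrite adde_ge0 ?lee_fin ?expR_ge0//; apply: nneseries_ge0 => j _ _.
by rewrite mule_ge0 ?lee_fin ?divr_ge0 ?exprn_ge0//; apply: chainQ_ge0.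
Qed.

Lemma exp_fsum_le eta c j0 G n t w x : 0 <= c -> (0 < j0)%N -> 0 <= x <= 1 ->
  ((expR (c * fsum T W G c0 eta n t w x ^+ 2))%:E <= expQ eta c j0 G n t w)%E.
Proof.
move=> c_ge0 j00 x01; apply: (@exp_series_bound _ _ _ j0) => //; first exact: sqr_ge0.
move=> j; rewrite -exprM.
have n0 : (0 < 2 * (j + j0))%N by rewrite muln_gt0/= addn_gt0 j00 orbT.
have := chain_bound ltr01 n0 (even2 (j + j0)) r01 (@continuous_fsum _ _ _ T W G c0 eta n t w) x01.
by rewrite fsum0 subr0.
Qed.

(** [eta], [j0] and [C1] come before [G]: in the end [G] is shrunk in a way that depends on [eta],
    and the bound has to survive this. *)
Lemma exp_moment (c : R) : 0 < c -> exists (eta : R) (j0 : nat) (C1 : R),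
  [/\ 0 < eta, (0 < j0)%N, 0 <= C1 &
   forall G : set Omega, measurable G -> P (~` G) = 0%E -> G `<=` good_path T W ->
   forall n t, 0 <= t <= T -> measurable_fun setT (expQ eta c j0 G n t) /\
     (\int[P]_w expQ eta c j0 G n t w <= C1%:E)%E].
Proof.
move=> cp; have c_ge0 := ltW cp; have /andP[ra rb] := r01.
pose K1 : R := 20 * pi `^ 2^-1 * (c0 * pi ^+ 2) `^ (- (7 / 8)).
have cc0 : 0 < c0 * pi ^+ 2 by rewrite mulr_gt0// exprn_gt0// pi_gt0.
have K10 : 0 < K1 by rewrite /K1 !mulr_gt0// powR_gt0// pi_gt0.
pose B0 : R := (1 - r)^-1 ^+ 2 * (2 * expR 2).
have B00 : 0 < B0 by rewrite /B0 mulr_gt0 ?exprn_gt0 ?invr_gt0 ?subr_gt0// mulr_gt0// expR_gt0.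
(* Chosen so that [eta] to the power -1/8 is [x^-1] and hence [2 * b * c = 2^-1], the ratio of the
   geometric series that bounds the expectations. *)
pose x : R := 4 * B0 * K1 * c.
have x0 : 0 < x by rewrite /x; apply: mulr_gt0 => //; apply: mulr_gt0 => //; exact: mulr_gt0.
pose eta := x ^+ 8; have eta0 : 0 < eta by rewrite exprn_gt0.
have e8 : eta `^ (- 8^-1) = x^-1.
  by rewrite /eta -powR_mulrn ?(ltW x0)// -powRrM mulrN mulfV// powR_inv1// ltW.
have [j1 Hj1] := chain_power_exists (@spatial_ratio01 R).
pose j0 := maxn 1 j1; have j00 : (0 < j0)%N by rewrite leq_maxl.
pose b := B0 * spatial_const c0 eta.
have b0 : 0 < b by rewrite mulr_gt0// spatial_const_gt0.
have bc : 2 * b * c = 2^-1.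
  rewrite /b /spatial_const e8 -/K1 /x; field; rewrite !gt_eqF//.
exists eta, j0, (expR c + 2 * (4 * j0`!%:R * (2 * b) ^+ j0)); split => //.
  by rewrite addr_ge0 ?expR_ge0// !mulr_ge0// exprn_ge0// mulr_ge0// ltW.
move=> G mG PG Gg n t tT; have /andP[t0 tT'] := tT.
have mQ j : measurable_fun setT (chainQ 1 r (2 * (j + j0)) (fun x w => fsum T W G c0 eta n t w x)).
  by apply: measurable_chainQ => // y _; exact: (measurable_fsum Ww T0 mG Gg c00 eta0).
have q0 j w : (0 <= (c ^+ j / j`!%:R)%:E * chainQ 1 r (2 * (j + j0)) (fun x w => fsum T W G c0
  eta n t w x) w)%E.
  by rewrite mule_ge0 ?lee_fin ?divr_ge0 ?exprn_ge0//; apply: chainQ_ge0.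
have mS : measurable_fun setT (fun w => \sum_(j <oo) (c ^+ j / j`!%:R)%:E *
    chainQ 1 r (2 * (j + j0)) (fun x w => fsum T W G c0 eta n t w x) w)%E.
  by apply: ge0_emeasurable_sum => [j w _ _|j _]; [exact: q0|apply: measurable_funeM; exact: mQ].
split; first by apply: emeasurable_funD.
rewrite ge0_integralD//; last by move=> w _; apply: nneseries_ge0 => j _ _; exact: q0.
rewrite integral_cst//= probability_setT mule1 EFinD leeD2l//.
rewrite integral_nneseries//; last by move=> j; apply: measurable_funeM; exact: mQ.
pose M := 4 * j0`!%:R * (2 * b) ^+ j0.
have M0 : 0 <= M by rewrite !mulr_ge0// exprn_ge0// mulr_ge0// ltW.
have each j : (\int[P]_w ((c ^+ j / j`!%:R)%:E * chainQ 1 r (2 * (j + j0)) (fun x w => fsum T W G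
  c0 eta n t w x) w)
   <= (geometric M 2^-1 j)%:E)%E.
  rewrite ge0_integralZl//; last 2 first.
  - by move=> w _; apply: chainQ_ge0.
  - by rewrite lee_fin divr_ge0 ?exprn_ge0.
  have jj : 2 * r^-1 ^+ (2 * (j + j0)) * spatial_ratio ^+ (j + j0) <= 2^-1.
    by apply: Hj1; rewrite (leq_trans _ (leq_addl _ _))// leq_maxr.
  have h := spatial_chain Ww T0 mG PG Gg c00 eta0 n tT jj.
  apply: le_trans (lee_wpmul2l _ h) _; first by rewrite lee_fin divr_ge0 ?exprn_ge0.
  rewrite -EFinM lee_fin.
  have -> : (1 - r)^-1 ^+ (2 * (j + j0)) * (4 * (j + j0)`!%:R) * (2 * expR 2 * spatial_const c0
    eta) ^+ (j + j0)
     = 4 * (j + j0)`!%:R * b ^+ (j + j0).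
    by rewrite /b /B0 exprM !exprMn; ring.
  have f0 : 0 < j`!%:R :> R by rewrite ltr0n fact_gt0.
  apply: (@le_trans _ _ (c ^+ j / j`!%:R * (4 * (2 ^+ (j + j0) * (j`!%:R * j0`!%:R)) * b ^+ (j +
    j0)))).
    rewrite ler_wpM2l ?divr_ge0 ?exprn_ge0// ler_wpM2r ?exprn_ge0 ?(ltW b0)// ler_wpM2l//.
    by rewrite -natrX -!natrM ler_nat fact_add_le.
  rewrite /geometric /= -bc /M !exprMn !exprD le_eqVlt; apply/orP; left; apply/eqP; field.
  by rewrite gt_eqF.
apply: le_trans (lee_nneseries _ (fun j _ => each j)) _.
  by move=> j _ _; apply: integral_ge0 => w _; exact: q0.
have cg : series (geometric (M : R) 2^-1) @ \oo --> (M / (1 - 2^-1) : R).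
  by apply: cvg_geometric_series; rewrite ger0_norm; lra.
have -> : 2 * (4 * j0`!%:R * (2 * b) ^+ j0) = M / (1 - 2^-1) by rewrite /M; field; lra.
apply: lime_le.
  by apply: is_cvg_nneseries => j _ _; rewrite lee_fin mulr_ge0// exprn_ge0.
apply: nearW => N; rewrite sumEFin lee_fin -(cvg_lim _ cg)//; apply: nondecreasing_cvgn_le.
  by apply: nondecreasing_series => j _ _; rewrite /= mulr_ge0// exprn_ge0.
by apply/cvg_ex; eexists; exact: cg.
Qed.

End exp_moments.

(** * Continuous representatives and the growth of phi and Phi *)

Section continuous_representative.
Context {R : realType}.
Local Notation H := (H01 R).
Local Notation mu := (mu01 R).

Lemma L2_fun_eigf_sum n (a : nat -> R) :
  {ae mu, forall x, L2_fun (\sum_(1 <= k < n.+1) a k *: eigf k :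
    H) x = \sum_(1 <= k < n.+1) a k * sinek k x}.
Proof.
elim: n => [|n IH].
  rewrite big_geq//; apply: filterS (toL2K (0 : LfunType mu (lee1n 2))) => x h.
  by rewrite big_geq//; exact: h.
set u := \sum_(1 <= k < n.+1) a k *: eigf k : H.
have hZ := toL2K (a n.+1 *: L2_fun (eigf n.+1 : H)).
have hD := toL2K (L2_fun u + L2_fun (a n.+1 *: eigf n.+1 : H)).
have : {ae mu, forall x, L2_fun (u + a n.+1 *: eigf n.+1 : H) x = L2_fun u x + a n.+1 * L2_fun
  (eigf n.+1 : H) x}.
  apply: filterS2 hZ hD => x hZ hD; apply: etrans (hD I) _.
  by rewrite /= !fctE; congr (_ + _); exact: hZ.
apply: filterS3 IH (eigfE n.+1) => x hx he h.
by rewrite big_nat_recr//= -/u h hx [RHS]big_nat_recr//=; congr (_ + _ * _); exact: he.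
Qed.

(** Functions differing at [x] would differ on an interval to the right of [x], which has positive
    measure. This pins down the representative that [crep] chooses. *)
Lemma mu01_ae_eq_continuous (f g : R -> R) :
  {in `]0, 1[%classic, continuous f} -> {in `]0, 1[%classic, continuous g} ->
  {ae mu, forall x, f x = g x} -> forall x, 0 < x < 1 -> f x = g x.
Proof.
move=> cf cg [N [mN N0 fgN]] x x01; apply/eqP/negPn/negP => fgx.
have xin : x \in (`]0, 1[%classic : set R) by rewrite inE/= in_itv.
have D0 : 0 < `|f x - g x| by rewrite normr_gt0 subr_eq0.
have cD : (fun z => f z - g z) z @[z --> x] --> f x - g x.
  by apply: (@cvgB _ R^o); [exact: cf|exact: cg].
have /cvgrPdist_lt /(_ _ D0) [e /= e0 He] := cD.
case/andP: x01 => x0 x1.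
pose b := Num.min (x + e) 1.
have xb : x < b by rewrite lt_min x1 andbT ltrDl.
have sub : `]x, b[%classic `<=` N.
  move=> z; rewrite /= in_itv/= lt_min => /andP[xz /andP[ze z1]]; apply: fgN => /= fgz.
  have hz : `|x - z| < e by rewrite distrC gtr0_norm ?subr_gt0// ltrBlDl.
  by have := He z hz; rewrite /= fgz subrr subr0 ltxx.
have : (mu `]x, b[%classic <= mu N)%E.
  have m1 : measurable (`]x, b[%classic : set R) by exact: measurable_itv.
  by apply: le_measure; rewrite ?inE.
have -> : mu `]x, b[%classic = (b - x)%:E.
  rewrite /mu01 /mrestr setIidl; last first.
    move=> z; rewrite /= !in_itv/= lt_min => /andP[xz /andP[_ ->]].
    by rewrite (lt_trans x0 xz).
  by rewrite lebesgue_measure_itv/= lte_fin xb -EFinB.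
by rewrite N0 lee_fin subr_le0 leNgt xb.
Qed.

Lemma crep_eigf_sum n (a : nat -> R) x : 0 < x < 1 ->
  crep (\sum_(1 <= k < n.+1) a k *: eigf k : H) x = \sum_(1 <= k < n.+1) a k * sinek k x.
Proof.
move=> x01; set u := (X in crep X).
pose g x := \sum_(1 <= k < n.+1) a k * sinek k x.
have cg : continuous g.
  move=> z; apply: cvg_bigsum => k _; apply: cvgM; [exact: cvg_cst|exact: continuous_sinek].
have hg : {within `]0%R, 1%R[, continuous g} /\ {ae mu, forall x, L2_fun u x = g x}.
  by split; [exact: continuous_subspaceT|exact: L2_fun_eigf_sum].
have [cf fe] : {within `]0%R, 1%R[, continuous (crep u)} /\ {ae mu, forall x,
  L2_fun u x = crep u x}.
  apply: (@xgetPex _ (cst 0) [set f : R -> R | {within `]0%R, 1%R[, continuous f} /\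
    {ae mu, forall x, L2_fun u x = f x}]); by exists g.
have hf : {in `]0, 1[%classic, continuous (crep u)}.
  by move: cf; rewrite continuous_open_subspace//; exact: interval_open.
have hg2 : {in `]0, 1[%classic, continuous g} by move=> z _; exact: cg.
have hae : {ae mu, forall x, crep u x = g x}.
  by case: hg => _; apply: filterS2 fe => z -> ->.
exact: (mu01_ae_eq_continuous hf hg2 hae x01).
Qed.

Lemma sup_image_le (g : R -> R) M : (forall x, 0 < x < 1 -> g x <= M) ->
  sup [set g x | x in `]0%R, 1%R[] <= M.
Proof.
move=> gM; apply: ge_sup.
  by exists (g 2^-1), 2^-1 => //=; rewrite in_itv/=; apply/andP; split; lra.
by move=> _ [x /= x01 <-]; apply: gM; move: x01; rewrite in_itv.
Qed.

Lemma le_sup_image (g : R -> R) M x : (forall x, 0 < x < 1 -> g x <= M) -> 0 < x < 1 ->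
  g x <= sup [set g x | x in `]0%R, 1%R[].
Proof.
move=> gM x01; apply: ub_le_sup; last by exists x => //=; rewrite in_itv.
by exists M => _ [y /= y01 <-]; apply: gM; move: y01; rewrite in_itv.
Qed.

Variables (c0 gamma : R) (phi Phi : H -> R).
Hypotheses (c00 : 0 < c0) (gamma0 : 0 < gamma).
Hypothesis phiE : forall u, Hr c0 1 u ->
    phi u = gamma + gamma * sup [set `|crep u x| ^+ 2 | x in `]0%R, 1%R[].
Hypothesis PhiE : forall u, Hr c0 1 u ->
    Phi u = gamma + gamma * sup [set `|crep u x| `^ gamma | x in `]0%R, 1%R[].

Definition sinesum n (a : nat -> R) (x : R) : R := \sum_(1 <= k < n.+1) a k * sinek k x.
Local Notation esum n a := (\sum_(1 <= k < n.+1) a k *: eigf k : H).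

Definition supsq n a : R := sup [set `|crep (esum n a) x| ^+ 2 | x in `]0%R, 1%R[].

Lemma sinesum_bounded n a : exists M, forall x, (sinesum n a x) ^+ 2 <= M.
Proof.
exists ((\sum_(1 <= k < n.+1) `|a k| * Num.sqrt 2) ^+ 2) => x.
have h : `|sinesum n a x| <= \sum_(1 <= k < n.+1) `|a k| * Num.sqrt 2.
  apply: le_trans (ler_norm_sum _ _ _) _; apply: ler_sum => k _; rewrite normrM ler_wpM2l//.
  rewrite /sinek normrM (ger0_norm (sqrtr_ge0 _)) ler_piMr// ?sqrtr_ge0//; exact: sin_max.
rewrite -(real_normK (num_real (sinesum n a x))) ler_pXn2r ?nnegrE//.
exact: le_trans h.
Qed.

Lemma crep_sqr n a x : 0 < x < 1 -> `|crep (esum n a) x| ^+ 2 = (sinesum n a x) ^+ 2.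
Proof. by move=> x01; rewrite crep_eigf_sum// real_normK ?num_real. Qed.

Lemma sqr_le_supsq n a x : 0 < x < 1 -> (sinesum n a x) ^+ 2 <= supsq n a.
Proof.
move=> x01; have [M hM] := sinesum_bounded n a.
have := @le_sup_image (fun y => `|crep (esum n a) y| ^+ 2) M x _ x01.
by rewrite crep_sqr//; apply => y y01; rewrite crep_sqr.
Qed.

Lemma supsq_le n a M : (forall x, 0 < x < 1 -> (sinesum n a x) ^+ 2 <= M) -> supsq n a <= M.
Proof. by move=> h; apply: sup_image_le => x x01; rewrite crep_sqr//; exact: h. Qed.

Lemma supsq_ge0 n a : 0 <= supsq n a.
Proof.
have h : 0 < (2^-1 : R) < 1 by apply/andP; split; lra.
exact: le_trans (sqr_ge0 _) (sqr_le_supsq n a h).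
Qed.

Lemma phi_esum n a : phi (esum n a) = gamma + gamma * supsq n a.
Proof. by rewrite phiE//; exact: Hr_fin. Qed.

Lemma phi_ge0 n a : 0 <= phi (esum n a).
Proof. by rewrite phi_esum addr_ge0 ?mulr_ge0 ?supsq_ge0// ltW. Qed.

Lemma Phi_esum n a : 0 <= Phi (esum n a) <= gamma + gamma * supsq n a `^ (gamma / 2).
Proof.
have h : 0 < (2^-1 : R) < 1 by apply/andP; split; lra.
have hb x : 0 < x < 1 -> `|crep (esum n a) x| `^ gamma <= supsq n a `^ (gamma / 2).
  move=> x01; have -> : `|crep (esum n a) x| `^ gamma = ((sinesum n a x) ^+ 2) `^ (gamma / 2).
    rewrite -crep_sqr// -powR_mulrn// -powRrM; congr (_ `^ _); lra.
  rewrite ge0_ler_powR ?nnegrE ?sqr_ge0 ?supsq_ge0 ?sqr_le_supsq//.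
  by rewrite divr_ge0// ltW.
rewrite PhiE; last exact: Hr_fin.
apply/andP; split.
  rewrite addr_ge0 ?(ltW gamma0)// mulr_ge0 ?(ltW gamma0)//.
  exact: le_trans (powR_ge0 _ _) (le_sup_image hb h).
by rewrite lerD2l ler_wpM2l ?(ltW gamma0)//; apply: sup_image_le.
Qed.

(** [Phi] grows polynomially in the sup norm and [phi] quadratically, so a power of [Phi] is
    absorbed by the exponential that has to be integrated anyway. *)
Lemma Phi_le_exp (kappa p : R) : 0 < kappa -> 0 < p -> exists2 C2 : R, 0 <= C2 &
  forall n a, `|Phi (esum n a)| `^ p <= C2 * expR (kappa * phi (esum n a)).
Proof.
(* An integer above the exponent of [supsq] in the [p]-th power of [Phi]; the term of order [N] of
   the exponential series then dominates that power. *)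
move=> k0 p0; pose N := (Num.truncn (gamma / 2 * p)).+1.
have gp0 : 0 <= gamma / 2 * p by rewrite mulr_ge0 ?divr_ge0// ltW.
have Ngp : gamma / 2 * p <= N%:R by rewrite ltW// truncnS_gt.
have kg : 0 < kappa * gamma by rewrite mulr_gt0.
have g2 : 0 <= 2 * gamma by rewrite mulr_ge0// ltW.
exists ((2 * gamma) `^ p * (N`!%:R / (kappa * gamma) ^+ N)).
  by rewrite mulr_ge0 ?powR_ge0// divr_ge0// exprn_ge0// ltW.
move=> n a; have /andP[P0 Ple] := Phi_esum n a.
pose y := 1 + supsq n a; have s0 := supsq_ge0 n a.
have y1 : 1 <= y by rewrite /y lerDl.
have y0 : 0 <= y by exact: le_trans y1.
have g20 : 0 <= gamma / 2 by rewrite divr_ge0// ltW.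
have hy : 1 <= y `^ (gamma / 2).
  by have := ler_powR y1 g20; rewrite powRr0.
have hs : supsq n a `^ (gamma / 2) <= y `^ (gamma / 2).
  by rewrite ge0_ler_powR ?nnegrE// /y lerDr.
have P2 : Phi (esum n a) <= 2 * gamma * y `^ (gamma / 2).
  apply: le_trans Ple _; have h1 := ler_wpM2l (ltW gamma0) hs;
    have h2 := ler_wpM2l (ltW gamma0) hy; lra.
rewrite ger0_norm//.
apply: (@le_trans _ _ ((2 * gamma * y `^ (gamma / 2)) `^ p)).
  by rewrite ge0_ler_powR ?nnegrE ?(ltW p0)// mulr_ge0// powR_ge0.
rewrite powRM ?powR_ge0// -mulrA ler_wpM2l ?powR_ge0// -powRrM.
apply: (@le_trans _ _ (y ^+ N)); first by rewrite -powR_mulrn// ler_powR.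
have h := @exp_ge_pow R (kappa * gamma * y) N (mulr_ge0 (ltW kg) y0).
rewrite phi_esum (_ : kappa * (gamma + gamma * supsq n a) = kappa * gamma * y);
  last by rewrite /y; ring.
have f0 : 0 < N`!%:R :> R by rewrite ltr0n fact_gt0.
rewrite mulrAC ler_pdivlMr ?exprn_gt0// -exprMn mulrC.
by move: h; rewrite ler_pdivrMr// [expR _ * _]mulrC.
Qed.

(** A single [psi] bounds the exponential at every [x], so its logarithm bounds the squared sup
    norm. The factor 2 in the exponent pays for separating [a] from [b]. *)
Lemma exp_phi_le (kappa X1 : R) (n : nat) (a b : nat -> R) (psi : \bar R) : 0 < kappa -> 0 <= X1 ->
  (forall x, 0 < x < 1 -> (sinesum n b x) ^+ 2 <= X1) ->
  (forall x, 0 < x < 1 -> ((expR (2 * (kappa * gamma) * (sinesum n a x) ^+ 2))%:E <= psi)%E) ->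
  ((expR (kappa * phi (esum n (fun k => a k + b k)%R)))%:E <=
    (expR (kappa * gamma * (1 + 2 * X1)))%:E * psi)%E.
Proof.
move=> k0 X10 hb ha; have kg : 0 < kappa * gamma by rewrite mulr_gt0.
have h2 : 0 < (2^-1 : R) < 1 by apply/andP; split; lra.
have p0 := ha _ h2.
case: psi ha p0 => [s| |] ha p0; last by move: p0; rewrite leeNy_eq.
  2: by rewrite gt0_muley ?leey// lte_fin expR_gt0.
have s0 : 0 < s by apply: lt_le_trans (expR_gt0 _) _; rewrite -lee_fin; exact: p0.
have c2 : 0 < 2 * (kappa * gamma) by rewrite mulr_gt0.
pose M := ln s / (2 * (kappa * gamma)).
have aM x : 0 < x < 1 -> (sinesum n a x) ^+ 2 <= M.
  move=> /ha; rewrite lee_fin => h; rewrite ler_pdivlMr// mulrC -ler_expR lnK//.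
have sM : supsq n (fun k => a k + b k) <= 2 * M + 2 * X1.
  apply: supsq_le => x x01.
  have -> : sinesum n (fun k => a k + b k) x = sinesum n a x + sinesum n b x.
    by rewrite /sinesum -big_split/=; apply: eq_bigr => k _; rewrite mulrDl.
  have := aM x x01; have := hb x x01; have := sqr_ge0 (sinesum n a x - sinesum n b x); nra.
rewrite -EFinM lee_fin phi_esum.
have -> : s = expR (2 * (kappa * gamma) * M) by rewrite /M mulrC divfK ?gt_eqF// lnK.
rewrite -expRD ler_expR.
have := ler_wpM2l (ltW kg) sM; lra.
Qed.

End continuous_representative.

(** * Functions that are constant on the cells of the time grid *)

Section grid_steps.
Context {R : realType}.
Local Notation leb := (@lebesgue_measure R).
Variables (T h : R) (T0 : 0 < T) (h0 : 0 < h).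
Local Notation N := (nsteps h T).

Definition gind (i : nat) (u : R) : R := \1_(`[i%:R * h, i.+1%:R * h[%classic) u.
(** The length of the part of the [i]-th cell inside [0, T]; the last cell may be cut off. *)
Definition glen (i : nat) : R := \int[leb]_(u in `[0%R, T]) gind i u.

Lemma gind_ge0 i u : 0 <= gind i u. Proof. by rewrite /gind indicE. Qed.

Lemma measurable_gind i D : measurable_fun D (gind i).
Proof. by apply: measurable_funTS; exact: measurable_indic. Qed.

Lemma int_gind i : (\int[leb]_(u in `[0%R, T]) (gind i u)%:E = (glen i)%:E)%E.
Proof.
rewrite /glen /Rintegral fineK// integral_indic//= ge0_fin_numE ?measure_ge0//.
apply: (@le_lt_trans _ _ (leb `[0%R, T]%classic)).
  by apply: le_measure; rewrite ?inE//; exact: measurableI.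
by rewrite lebesgue_measure_itv/= lte_fin T0 -EFinB ltry.
Qed.

Lemma glen_ge0 i : 0 <= glen i.
Proof. by apply: Rintegral_ge0 => u _; exact: gind_ge0. Qed.

Lemma gridfloor_step u : 0 <= u <= T -> exists i : 'I_N,
  gridfloor h u = i%:R * h /\ forall j : 'I_N, gind j u = (j == i)%:R.
Proof.
move=> /andP[u0 uT]; have [i [gi /andP[i1 i2]]] := gridfloor_nat h0 u0.
have iN : (i < N)%N by exact: (nsteps_lt h0 u0 uT i1).
exists (Ordinal iN); split => // j; rewrite /gind indicE mem_setE in_itv/=.
have [->|ji] := eqVneq j (Ordinal iN); first by rewrite /= i1 i2.
case: (boolP (j%:R * h <= u < j.+1%:R * h)) => //= ju.
have := gridfloor_eqP h0 u0 ju; rewrite gi => /(mulIf (lt0r_neq0 h0)) /eqP.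
by rewrite eqr_nat => /eqP ij; case/eqP: ji; apply: val_inj.
Qed.

Lemma sum_gind u : 0 <= u <= T -> \sum_(i < N) gind i u = 1.
Proof.
move=> /gridfloor_step [i [_ gi]]; rewrite (bigD1 i)//= gi eqxx big1 ?addr0// => j /negbTE ji.
by rewrite gi ji.
Qed.

Lemma step_value (f : R -> R) u : 0 <= u <= T ->
  f (gridfloor h u) = \sum_(i < N) gind i u * f (i%:R * h).
Proof.
move=> /gridfloor_step [i [-> gi]]; rewrite (bigD1 i)//= gi eqxx mul1r big1 ?addr0// => j /negbTE
  ji.
by rewrite gi ji mul0r.
Qed.

Lemma int_gind_sum (g : nat -> \bar R) : (forall i, 0 <= g i)%E ->
  (\int[leb]_(u in `[0%R, T]) (\sum_(i < N) (gind i u)%:E * g i) = \sum_(i < N) (glen i)%:E * g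
    i)%E.
Proof.
move=> g0.
have mg i : measurable_fun `[0%R, T]%classic (fun u => (gind i u)%:E).
  by apply/measurable_EFinP; exact: measurable_gind.
have mgg (i : 'I_N) : measurable_fun `[0%R, T]%classic (fun u => (gind i u)%:E * g i)%E.
  by apply: emeasurable_funM => //; exact: measurable_cst.
rewrite ge0_integral_sum//; last by move=> i u _; rewrite mule_ge0 ?lee_fin ?gind_ge0.
apply: eq_bigr => i _.
have gi0 (u : R) : (`[0%R, T]%classic : set R) u -> (0 <= (gind i u)%:E)%E by move=> _;
  rewrite lee_fin gind_ge0.
by rewrite (ge0_integralZr leb (measurable_itv _) (mg i) gi0 (g0 i)) int_gind.
Qed.

Lemma sum_glen : \sum_(i < N) glen i = T.
Proof.
have := int_gind_sum (fun=> @lee01 R).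
under eq_integral do under eq_bigr do rewrite mule1.
under [X in _ = X -> _]eq_bigr do rewrite mule1.
have -> : (\int[leb]_(u in `[0%R, T]) (\sum_(i < N) (gind i u)%:E) = \int[leb]_(u in `[0%R,
  T]) 1%:E)%E.
  apply: eq_integral => u; rewrite inE/= in_itv/= => uT.
  by rewrite sumEFin sum_gind.
rewrite integral_cst//= mul1e lebesgue_measure_itv/= lte_fin T0 -EFinB subr0 sumEFin.
by move=> [].
Qed.

Lemma int_gridfloor (f : R -> R) : (forall i : 'I_N, 0 <= f (i%:R * h)) ->
  (\int[leb]_(u in `[0%R, T]) (f (gridfloor h u))%:E = (\sum_(i < N) glen i * f (i%:R * h)%R)%:E)%E.
Proof.
move=> f0; pose g i := if pselect (i < N)%N then (f (i%:R * h))%:E else 0%E.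
have gE (i : 'I_N) : g i = (f (i%:R * h))%:E by rewrite /g; case: pselect => //; rewrite ltn_ord.
have g0 i : (0 <= g i)%E.
  rewrite /g; case: pselect => // iN; rewrite lee_fin; exact: (f0 (Ordinal iN)).
have := int_gind_sum g0; under [X in _ = X -> _]eq_bigr do rewrite gE.
rewrite -sumEFin => <-; apply: eq_integral => u; rewrite inE/= in_itv/= => uT.
by rewrite (step_value f uT) -sumEFin; apply: eq_bigr => i _; rewrite gE EFinM.
Qed.

Lemma le_int_gridfloor (f : R -> R) s : 0 <= s -> (forall i : 'I_N, 0 <= f (i%:R * h)) ->
  (\int[leb]_(u in `[s, T]) (f (gridfloor h u))%:E <= (\sum_(i < N) glen i * f (i%:R * h)%R)%:E)%E.
Proof.
move=> s0 f0; rewrite -int_gridfloor//.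
have sub : `[s, T]%classic `<=` (`[0%R, T]%classic : set R) by apply: subset_itv; rewrite bnd_simp.
have fp u : 0 <= u <= T -> 0 <= f (gridfloor h u).
  by move=> uT; rewrite (step_value f uT) sumr_ge0// => i _; rewrite mulr_ge0 ?gind_ge0.
have mf : measurable_fun `[0%R, T]%classic (fun u => (f (gridfloor h u))%:E).
  apply: (eq_measurable_fun (fun u => (\sum_(i < N) gind i u * f (i%:R * h)%R)%:E)).
    by move=> u; rewrite inE/= in_itv/= => uT; rewrite (step_value f uT).
  apply/measurable_EFinP; apply: measurable_sum => i; apply: measurable_funM => //.
  exact: measurable_gind.
have fp' (u : R) : (`[0%R, T]%classic : set R) u -> (0 <= (f (gridfloor h u))%:E)%E.
  by rewrite /= in_itv/= => uT; rewrite lee_fin fp.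
exact: (ge0_subset_integral leb (measurable_itv _) (measurable_itv _) mf fp' sub).
Qed.

(** Jensen for the probability weights [glen i / T], by the tangent of the exponential at the mean.
    It replaces the exponential of a time integral by exponentials at single grid times, whose
    expectations are bounded. *)
Lemma jensen_exp (x : nat -> R) : expR (\sum_(i < N) glen i * x i) <=
  \sum_(i < N) glen i / T * expR (T * x i).
Proof.
pose m := \sum_(i < N) glen i * x i.
have each i : glen i / T * (expR m * (1 + (T * x i - m))) <= glen i / T * expR (T * x i).
  rewrite ler_wpM2l ?divr_ge0 ?glen_ge0 ?(ltW T0)//.
  have -> : expR (T * x i) = expR m * expR (T * x i - m) by rewrite -expRD; congr expR; ring.
  by rewrite ler_wpM2l ?expR_ge0// expR_ge1Dx.
apply: (@le_trans _ _ (\sum_(i < N) glen i / T * (expR m * (1 + (T * x i - m))))); last first.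
  by apply: ler_sum => i _; exact: each.
have -> : \sum_(i < N) glen i / T * (expR m * (1 + (T * x i - m))) =
   expR m * (\sum_(i < N) glen i / T * (1 - m) + \sum_(i < N) glen i * x i).
  rewrite mulrDr !mulr_sumr -big_split/=; by apply: eq_bigr => i _; field; rewrite gt_eqF.
rewrite -mulr_suml -mulr_suml sum_glen divff ?gt_eqF// mul1r -/m.
by rewrite subrK mulr1.
Qed.
End grid_steps.

(** Trades a real exponent for the integer power [j] for which the moment of [q] is known to be
    finite. *)
Lemma powR_affine_le {R : realType} (C a : R) (j : nat) : 0 <= C -> 0 <= a -> a <= j%:R ->
  exists2 C' : R, 0 <= C' & forall x, 0 <= x -> (C * (1 + x)) `^ a <= C' * (1 + x ^+ j).
Proof.
move=> C0 a0 aj; exists (C `^ a * 2 ^+ j); first by rewrite mulr_ge0 ?powR_ge0// exprn_ge0.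
move=> x x0; have x1 : 1 <= 1 + x by lra.
rewrite powRM//; last by lra.
rewrite -mulrA ler_wpM2l ?powR_ge0//.
apply: (@le_trans _ _ ((1 + x) ^+ j)).
  by rewrite -powR_mulrn ?ler_powR//; lra.
have [xle|xge] := leP x 1.
  apply: (@le_trans _ _ (2 ^+ j)); first by rewrite lerXn2r ?nnegrE//; lra.
  by rewrite ler_peMr ?exprn_ge0// lerDl exprn_ge0.
apply: (@le_trans _ _ ((2 * x) ^+ j)); first by rewrite lerXn2r ?nnegrE//; lra.
by rewrite exprMn ler_wpM2l ?exprn_ge0// lerDr.
Qed.

Section xi_bound.
Context {R : realType}.
Variables (c0 : R) (c00 : 0 < c0) (xi : H01 R) (xi_dom : Hr c0 2^-1 xi).

Lemma xi_sine_bound : exists2 X1 : R, 0 <= X1 & forall n (b : nat -> R) x,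
  (forall k, (0 < k)%N -> `|b k| <= `|coef k xi|) -> sinesum n b x ^+ 2 <= X1.
Proof.
pose l k := lam c0 k `^ 2^-1.
have lE k : (0 < k)%N -> l k ^+ 2 = lam c0 k.
  move=> k0; rewrite -powR_mulrn ?powR_ge0// -powRrM mulVf// powRr1// ltW// lam_gt0//.
pose S := fine (ssq (fun k => (l k * coef k xi)%R)).
have SE : ssq (fun k => (l k * coef k xi)%R) = S%:E.
  by rewrite fineK// ge0_fin_numE ?ssq_ge0//; move: xi_dom; rewrite HrE.
have Ssum n : \sum_(1 <= k < n.+1) (l k * coef k xi) ^+ 2 <= S.
  rewrite -lee_fin -SE; have := @nneseries_lim_ge R (fun k => ((l k * coef k xi) ^+ 2)%:E) xpredT
    1%N n.+1.
  by rewrite sumEFin; apply => i _ _; rewrite lee_fin sqr_ge0.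
have cc0 : 0 < c0 * pi ^+ 2 by rewrite mulr_gt0// exprn_gt0// pi_gt0.
have Lsum n : \sum_(1 <= k < n.+1) (lam c0 k)^-1 <= (c0 * pi ^+ 2)^-1 * 2.
  have -> : \sum_(1 <= k < n.+1) (lam c0 k)^-1 = (c0 * pi ^+ 2)^-1 * \sum_(k < n) k.+1%:R `^ (-
    (1 + 1)).
    rewrite big_add1 big_mkord/= mulr_sumr; apply: eq_bigr => k _.
    by rewrite /lam invfM -[1 + 1]/(2%:R) powR_invn.
  rewrite ler_wpM2l ?invr_ge0 ?(ltW cc0)//.
  by have := @pseries_le R 1 n ltr01; rewrite invr1.
pose B := S + (c0 * pi ^+ 2)^-1 * 2.
exists ((Num.sqrt 2 * B) ^+ 2); first exact: sqr_ge0.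
move=> n b x hb.
have h : `|sinesum n b x| <= Num.sqrt 2 * B.
  apply: le_trans (ler_norm_sum _ _ _) _.
  apply: (@le_trans _ _ (\sum_(1 <= k < n.+1) Num.sqrt 2 * ((l k * coef k xi) ^+ 2 + (lam c0
    k)^-1))).
    apply: ler_sum_nat => k /andP[k0 _]; rewrite normrM mulrC.
    have hs : `|sinek k x| <= Num.sqrt 2 by rewrite /sinek normrM (ger0_norm (sqrtr_ge0 _))
      ler_piMr// ?sqrtr_ge0//; exact: sin_max.
    apply: ler_pM => //; apply: le_trans (hb k k0) _.
    have lk : 0 < l k by rewrite powR_gt0// lam_gt0.
    rewrite -(lE k k0) -(real_normK (num_real (l k * _))) normrM (ger0_norm (ltW lk)).
    rewrite -exprVn.
    have hz : `|coef k xi| = (l k * `|coef k xi|) * (l k)^-1 by field; rewrite gt_eqF.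
    rewrite {1}hz; move: (l k * _) ((l k)^-1) => u v.
    by have := sqr_ge0 (u - v); have := sqr_ge0 (u + v); nra.
  rewrite -mulr_sumr ler_wpM2l ?sqrtr_ge0// big_split/= /B.
  by apply: lerD.
rewrite -(real_normK (num_real (sinesum n b x))) ler_pXn2r ?nnegrE//; exact: le_trans h.
Qed.
End xi_bound.

Lemma le_sum4 {R : realDomainType} (x y z : R) : 0 <= x -> 0 <= y -> 0 <= z ->
  [/\ 1 <= 1 + x + y + z, x <= 1 + x + y + z, y <= 1 + x + y + z & z <= 1 + x + y + z].
Proof. by move=> x0 y0 z0; split; lra. Qed.

Lemma mulr_le_sqrD {R : realFieldType} (x y : R) : 0 <= x -> x * y <= x * x + y ^+ 2.
Proof. by move=> x0; have := sqr_ge0 (x - y); have := sqr_ge0 (x + y); nra. Qed.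

Lemma sqr_sum4_le {R : realFieldType} (a b c e f : R) : b ^+ 2 <= e -> c ^+ 2 <= f ->
  (1 + a + b + c) ^+ 2 <= 4 * (1 + e + f) + 4 * a ^+ 2.
Proof.
move=> hb hc.
have := sqr_ge0 (1 - a); have := sqr_ge0 (1 - b); have := sqr_ge0 (1 - c).
by have := sqr_ge0 (a - b); have := sqr_ge0 (a - c); have := sqr_ge0 (b - c); nra.
Qed.

Lemma powR_sqrC {R : realType} (x a : R) : 0 <= x -> (x `^ a) ^+ 2 = (x ^+ 2) `^ a.
Proof.
move=> x0; rewrite -(powR_mulrn 2 (powR_ge0 x a)) -(powR_mulrn 2 x0).
by rewrite -(powRrM x) -(powRrM x) mulrC.
Qed.

Lemma powR_half_sqr {R : realType} (x a : R) : (x `^ (a / 2)) ^+ 2 = x `^ a.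
Proof.
rewrite -(powR_mulrn 2 (powR_ge0 x _)) -(powRrM x); congr (_ `^ _); by field.
Qed.

Lemma EFin_muleCA {R : realDomainType} (a b : R) (x y : \bar R) :
  (x * ((a * b)%:E * y) = a%:E * (x * (b%:E * y)))%E.
Proof. by rewrite EFinM -(muleA a%:E) muleCA. Qed.

(** * The moment bounds of (vi), uniform in dimension and step size *)

Section moment_bounds.
Context {R : realType} {d : measure_display} {Omega : measurableType d}.
Variable P : probability Omega R.
Variables (T : R) (W : R -> H01 R -> Omega -> R).
Hypothesis (T0 : 0 < T).
Variables (c0 varrho gamma vartheta p : R).
Hypotheses (c00 : 0 < c0) (vr0 : 0 < varrho) (vr1 : varrho < 4^-1) (gamma0 : 0 < gamma)
  (vartheta0 : 0 < vartheta) (p0 : 0 < p).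
Local Notation leb := (@lebesgue_measure R).
Local Notation H := (H01 R).
Local Notation lamr k := (lam c0 k `^ varrho).
Variables (phi Phi : H -> R).
Hypothesis phiE : forall u, Hr c0 1 u ->
    phi u = gamma + gamma * sup [set `|crep u x| ^+ 2 | x in `]0%R, 1%R[].
Hypothesis PhiE : forall u, Hr c0 1 u ->
    Phi u = gamma + gamma * sup [set `|crep u x| `^ gamma | x in `]0%R, 1%R[].
Variables (xi : H) (xi_dom : Hr c0 2^-1 xi).
(** [T] comes from Jensen and 2 from separating the exponential from the maximum; [expQ] carries
    another 2, which separates the noise from the initial value. *)
Let kappa : R := 2 * T * p.
Variables (eta : R) (j0 : nat) (C1 : R) (G : set Omega).
Hypotheses (eta0 : 0 < eta) (j00 : (0 < j0)%N).
Local Notation expQ := (expQ T W c0 eta (2 * (kappa * gamma)) j0 G).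
Hypothesis Hexp : forall n t, 0 <= t <= T -> measurable_fun setT (expQ n t) /\
     (\int[P]_w expQ n t w <= C1%:E)%E.
Variables (q1 q2 : Omega -> R) (j1 j2 : nat).
Hypotheses (mq1 : measurable_fun setT q1) (mq2 : measurable_fun setT q2).
Hypotheses (q1_fin : (\int[P]_w (q1 w ^+ j1)%:E < +oo)%E) (q2_fin :
  (\int[P]_w (q2 w ^+ j2)%:E < +oo)%E).
Hypotheses (j1_ge : 2 * (p * (1 + vartheta)) <= j1%:R) (j2_ge : p <= j2%:R).
Hypothesis hq1 : forall w k t, (0 < k)%N -> 0 <= t <= T ->
  wt c0 varrho k * ou_mode T W G (lam c0 k) k t w ^+ 2 <= q1 w.
Hypothesis hq2 : forall w k t, (0 < k)%N -> 0 <= t <= T ->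
  wt c0 varrho k * ou_mode T W G (lam c0 k + eta) k t w ^+ 2 <= q2 w.
Local Notation OO n t w := (shiftconv T W c0 G xi eta n t w).
Local Notation gc n t w := (galconv T W c0 G n t w).

Let kappa0 : 0 < kappa. Proof. by rewrite /kappa !mulr_gt0. Qed.

Lemma q1_ge0 w : 0 <= q1 w.
Proof. exact: (q_ge0 T0 c00 hq1). Qed.

Lemma q2_ge0 w : 0 <= q2 w.
Proof.
have h : 0 <= (0 : R) <= T by rewrite lexx ltW.
by apply: le_trans (hq2 w (k := 1) isT h); rewrite mulr_ge0 ?sqr_ge0// ltW// wt_gt0.
Qed.

Lemma shiftcoef_decay k t : (0 < k)%N -> 0 <= t ->
  `|expR (- ((lam c0 k + eta) * t)) * coef k xi| <= `|coef k xi|.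
Proof.
move=> k0 t0; rewrite normrM ler_piMl// ger0_norm ?expR_ge0// -expR0 ler_expR oppr_le0 mulr_ge0//.
by rewrite addr_ge0 ?(ltW eta0)// ltW// lam_gt0.
Qed.

Lemma exp_phi_bound : exists2 CX : R, 0 <= CX & forall n t w, 0 <= t <= T ->
  ((expR (kappa * phi (OO n t w)))%:E <= CX%:E * expQ n t w)%E.
Proof.
have [X1 X10 hX1] := xi_sine_bound c00 xi_dom.
exists (expR (kappa * gamma * (1 + 2 * X1))); first exact: expR_ge0.
move=> n t w tT; have t0 : 0 <= t by case/andP: tT.
apply: (@exp_phi_le _ _ _ _ gamma0 phiE _ _ n (fun k => ou_mode T W G (lam c0 k + eta) k t w)
  (fun k => expR (- ((lam c0 k + eta) * t)) * coef k xi)) => //.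
  by move=> x _; apply: hX1 => k k0; exact: shiftcoef_decay.
move=> x /andP[x0 x1]; have x01 : 0 <= x <= 1 by rewrite !ltW.
have c_ge0 : 0 <= 2 * (kappa * gamma) by rewrite !mulr_ge0// ltW.
have := @exp_fsum_le _ _ _ T W c0 eta _ j0 G n t w x c_ge0 j00 x01.
rewrite (_ : fsum T W G c0 eta n t w x = sinesum n (fun k => ou_mode T W G (lam c0 k + eta) k t
  w) x)//.
by apply: eq_bigr => k _; rewrite mulrC.
Qed.

(** Passing from the norm of [H_varrho], which [q2] controls, to that of [H] costs a power of the
    smallest eigenvalue. *)
Lemma shiftconv_norm : exists2 C3 : R, 0 <= C3 & forall n t w, 0 <= t <= T ->
  `|OO n t w| ^+ 2 <= C3 * (1 + q2 w).
Proof.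
have X0 := xisq_ge0 c0 varrho xi; have B0 := weight_mass_gt0 vr1.
have l1 : 0 < lamr 1 by rewrite powR_gt0 ?lam_gt0.
exists (lamr 1 ^- 2 * (2 * weight_mass varrho + 2 * xisq c0 varrho xi)).
  by rewrite mulr_ge0 ?invr_ge0 ?exprn_ge0 ?(ltW l1)// addr_ge0 ?mulr_ge0// ltW.
move=> n t w tT; have t0 : 0 <= t by case/andP: tT.
pose a k := shiftcoef T W c0 G xi eta k t w.
have := ssq_lamr c00 (fun k => if (k <= n)%N then a k else 0) (ltW vr0).
have -> : ssq (fun k => if (k <= n)%N then a k else 0) = (`|OO n t w| ^+ 2)%:E.
  rewrite parseval /ssq; apply: congr_lim; apply/funext => M.
  by apply: eq_big_nat => k /andP[k0 _]; rewrite coef_eigf_sum.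
move=> h; rewrite -lee_fin; apply: le_trans h _.
rewrite -mulrA EFinM; apply: lee_wpmul2l; first by rewrite lee_fin invr_ge0 exprn_ge0// ltW.
apply: ssq_leB => M.
apply: (@le_trans _ _ (\sum_(1 <= k < M.+1) (2 * (q2 w / wexp varrho k) + 2 * (lamr k * coef k
  xi) ^+ 2))).
  apply: ler_sum_nat => k /andP[k0 _].
  have wb : wbnd c0 varrho (q2 w) (fun k => ou_mode T W G (lam c0 k + eta) k t w) by move=> i i0;
    exact: hq2.
  have h1 := wbnd_sqr k0 wb.
  have w0 : 0 <= q2 w / wexp varrho k by rewrite divr_ge0 ?q2_ge0// ltW// wexp_gt0.
  case: ifP => _; last by rewrite mulr0 expr0n/= addr_ge0// mulr_ge0// sqr_ge0.
  have h2 : (lamr k * (expR (- ((lam c0 k + eta) * t)) * coef k xi)) ^+ 2 <=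
    (lamr k * coef k xi) ^+ 2.
    rewrite -(real_normK (num_real (lamr k * (_ * _)))) -(real_normK (num_real (lamr k * coef k
      xi))).
    by rewrite ler_pXn2r ?nnegrE// !(normrM (lamr k)) ler_wpM2l// shiftcoef_decay.
  rewrite /a /shiftcoef mulrDr.
  set u := lamr k * ou_mode _ _ _ _ _ _ _ in h1 *; set v := lamr k * (expR _ * _) in h2 *.
  by have := sqr_ge0 (u - v); nra.
rewrite big_split/= -!mulr_sumr.
have hs1 := wexp_sum vr1 M; have hs2 := xisq_sum c00 vr0 vr1 xi_dom M.
have h3 : q2 w * \sum_(1 <= k < M.+1) (wexp varrho k)^-1 <=
  q2 w * weight_mass varrho by rewrite ler_wpM2l ?q2_ge0.
have h4 : 0 <= q2 w * xisq c0 varrho xi by rewrite mulr_ge0 ?q2_ge0.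
by nra.
Qed.

Lemma galconv_pow : exists2 C5 : R, 0 <= C5 & forall n t w, 0 <= t <= T ->
  Hnorm c0 varrho (gc n t w + Pn n (expA c0 t xi)) `^ (2 * p + 2 * p * vartheta) <=
    (C5 * (1 + q1 w)) `^ (p * (1 + vartheta)).
Proof.
have X0 := xisq_ge0 c0 varrho xi; have B0 := weight_mass_gt0 vr1.
exists (2 * weight_mass varrho + 2 * xisq c0 varrho xi); first by rewrite addr_ge0 ?mulr_ge0// ltW.
move=> n t w tT; have h := galconv_Hnorm T0 c00 vr0 vr1 xi_dom hq1 w n tT.
set x := Hnorm _ _ _ in h *; have x0 : 0 <= x by exact: normr_ge0.
have -> : x `^ (2 * p + 2 * p * vartheta) = (x ^+ 2) `^ (p * (1 + vartheta)).
  by rewrite -powR_mulrn// -powRrM; congr (_ `^ _); ring.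
have q0 := q1_ge0 w.
rewrite ge0_ler_powR ?nnegrE ?sqr_ge0//.
- by rewrite mulr_ge0// ?ltW// addr_gt0.
- by rewrite mulr_ge0 ?addr_ge0 ?mulr_ge0// ltW.
- by apply: le_trans h _; have := mulr_ge0 q0 X0; nra.
Qed.

Definition moment_const (q : Omega -> R) (j : nat) : R := fine (\int[P]_w (q w ^+ j)%:E).

Lemma int_affine_pow (q : Omega -> R) (j : nat) (C : R) : measurable_fun setT q -> (forall w,
  0 <= q w) ->
  (\int[P]_w (q w ^+ j)%:E < +oo)%E -> 0 <= C ->
  (\int[P]_w (C * (1 + q w ^+ j))%:E = (C * (1 + moment_const q j))%:E)%E.
Proof.
move=> mq qq0 qf C0.
have mqj : measurable_fun setT (fun w => q w ^+ j) by exact: measurable_funX.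
have q0j w : 0 <= q w ^+ j by rewrite exprn_ge0.
rewrite (integral_realZ P measurableT)//.
- have m1 : measurable_fun setT (fun _ : Omega => 1 : R) by exact: measurable_cst.
  rewrite (integral_realD P measurableT m1 mqj)//.
  rewrite integral_cst//= probability_setT mule1 EFinM EFinD fineK//.
  by rewrite ge0_fin_numE//; apply: integral_ge0 => w _; rewrite lee_fin.
- exact: measurable_funD.
- by move=> w; rewrite addr_ge0.
Qed.

Lemma norm_moment_bound : exists K : R, forall n t, 0 <= t <= T ->
  (\int[P]_w (`|OO n t w| `^ p)%:E <= K%:E)%E.
Proof.
have [C3 C30 hC3] := shiftconv_norm.
have p20 : 0 <= p / 2 by rewrite divr_ge0// ltW.
have pj : p / 2 <= j2%:R by move: j2_ge p0; lra.
have [C4 C40 hC4] := powR_affine_le C30 p20 pj.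
exists (C4 * (1 + moment_const q2 j2)) => n t tT.
rewrite -(int_affine_pow mq2 q2_ge0 q2_fin C40); apply: ge0_le_integralW => w _.
  by rewrite lee_fin powR_ge0.
rewrite lee_fin; apply: le_trans (hC4 _ (q2_ge0 w)).
have -> : `|OO n t w| `^ p = (`|OO n t w| ^+ 2) `^ (p / 2).
  by rewrite -powR_mulrn// -powRrM; congr (_ `^ _); lra.
by rewrite ge0_ler_powR ?nnegrE ?sqr_ge0// ?mulr_ge0 ?addr_ge0 ?q2_ge0//; exact: hC3.
Qed.

(** For each path the integral is bounded by a part linear in [S], the sum of exponential bounds at
    grid times, and a part [Rm] polynomial in [q1] and [q2]. The expectation of [S] is bounded
    independently of [n] and [h] because the cell lengths add up to [T]. *)
Lemma exponential_moment_bound : exists K : R, forall n h, 0 < h ->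
  (\int[P]_w \int[leb]_(s in `[0%R, T])
          (expeR (\int[leb]_(u in `[s, T])
                    (p * phi (OO n (gridfloor h u) w))%:E)
           * Order.max 1
               (Order.max (`|Phi (OO n (gridfloor h s) w)| `^ (p / 2))%:E
               (Order.max (`|OO n s w| `^ p)%:E
                 (\int[leb]_(u in `[0%R, T])
                    (Hnorm c0 varrho (gc n u w + Pn n (expA c0 u xi))
                       `^ (2 * p + 2 * p * vartheta))%:E)))) <= K%:E)%E.
Proof.
have [CX CX0 hCX] := exp_phi_bound.
have [C2 C20 hC2] := Phi_le_exp gamma0 phiE PhiE kappa0 p0.
have [C3 C30 hC3] := shiftconv_norm.
have [C5 C50 hC5] := galconv_pow.
have [C4 C40 hC4] := powR_affine_le C30 (ltW p0) j2_ge.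
have pv0 : 0 <= 2 * (p * (1 + vartheta)) by rewrite !mulr_ge0// ?addr_ge0// ltW.
have [C6 C60 hC6] := powR_affine_le C50 pv0 j1_ge.
(* Bounds the last entry of the maximum; by the choice of [j1] its square has finite expectation. *)
pose D w := T * (C5 * (1 + q1 w)) `^ (p * (1 + vartheta)).
have D0 w : 0 <= D w by rewrite mulr_ge0 ?powR_ge0// ltW.
have D2 w : D w ^+ 2 <= T ^+ 2 * C6 * (1 + q1 w ^+ j1).
  rewrite /D exprMn -mulrA ler_wpM2l ?sqr_ge0//.
  have -> : ((C5 * (1 + q1 w)) `^ (p * (1 + vartheta))) ^+ 2 = (C5 * (1 + q1 w)) `^ (2 * (p * (1
    + vartheta))).
    by rewrite -powR_mulrn ?powR_ge0// -powRrM; congr (_ `^ _); rewrite mulrC.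
  exact: hC6 (q1_ge0 w).
(* The polynomial part after squaring a sum of four terms, which explains the factor 4. *)
pose Rm w := 4 * (1 + C4 * (1 + q2 w ^+ j2) + T ^+ 2 * C6 * (1 + q1 w ^+ j1)).
have q1j w : 0 <= q1 w ^+ j1 by rewrite exprn_ge0// q1_ge0.
have q2j w : 0 <= q2 w ^+ j2 by rewrite exprn_ge0// q2_ge0.
have TC60 : 0 <= T ^+ 2 * C6 by rewrite mulr_ge0 ?sqr_ge0.
have Rm0 w : 0 <= Rm w.
  by rewrite /Rm mulr_ge0// addr_ge0// ?addr_ge0// mulr_ge0// addr_ge0.
pose KR := 4 * (1 + C4 * (1 + moment_const q2 j2) + T ^+ 2 * C6 * (1 + moment_const q1 j1)).
exists ((1 + 4 * C2) * (T * (CX * C1)) + T * KR) => n h h0.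
set N := nsteps h T.
have ihT (i : 'I_N) : 0 <= i%:R * h <= T.
  have hi : i%:R * h <= T := nsteps_le h0 (ltW T0) (ltn_ord i).
  by rewrite hi mulr_ge0// ltW.
pose Q i w := (CX%:E * expQ n (i%:R * h)%R w)%E.
have eQ0 i w : (0 <= expQ n (i%:R * h)%R w)%E.
  by apply: expQ_ge0; rewrite !mulr_ge0// ltW.
have Q0 i w : (0 <= Q i w)%E by rewrite mule_ge0.
have phi0 t w : 0 <= phi (OO n t w) by exact: (phi_ge0 gamma0 phiE).
pose S w := (\sum_(i < N) (glen T h i)%:E * Q i w)%E.
have S0 w : (0 <= S w)%E.
  by apply: sume_ge0 => i _; rewrite mule_ge0// lee_fin glen_ge0.
pose M w := ((1 + 4 * C2)%:E * S w + (T * Rm w)%:E)%E.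
apply: (@le_trans _ _ (\int[P]_w M w)%E).
  apply: ge0_le_integralW => w _.
    apply: integral_ge0 => s _; rewrite mule_ge0 ?expeR_ge0//.
    by rewrite le_max lee01.
  pose B := (T^-1%:E * S w + (Rm w)%:E)%E.
  have B0 : (0 <= B)%E by rewrite adde_ge0 ?lee_fin// mule_ge0// lee_fin invr_ge0 ltW.
  apply: (@le_trans _ _ (\int[leb]_(s in `[0%R, T]) (B + \sum_(i < N) (gind h i s)%:E * ((4 *
    C2)%:E * Q i w)))%E).
    apply: ge0_le_integralW => s; rewrite /= in_itv/= => sT.
      by rewrite mule_ge0 ?expeR_ge0// le_max lee01.
    have s0 : 0 <= s by case/andP: sT.
    (* As [phi] is nonnegative on these values, the integral from [s] is at most the full grid sum,
       which no longer depends on [s]. *)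
    pose A := \sum_(i < N) glen T h i * (p * phi (OO n (i%:R * h) w)).
    have hA : (expeR (\int[leb]_(u in `[s, T]) (p * phi (OO n (gridfloor h u) w))%:E) <=
      (expR A)%:E)%E.
      rewrite -[leRHS]/(expeR A%:E) lee_expeR.
      apply: (le_int_gridfloor T0 h0 (f := fun u => p * phi (OO n u w)) s0) => i.
      by rewrite mulr_ge0 ?(ltW p0).
    (* A sum of four nonnegative terms takes the place of the maximum. *)
    pose m := 1 + `|Phi (OO n (gridfloor h s) w)| `^ (p / 2) + `|OO n s w| `^ p + D w.
    have m1 := powR_ge0 `|Phi (OO n (gridfloor h s) w)| (p / 2).
    have m2 := powR_ge0 `|OO n s w| p.
    have hm : (Order.max 1 (Order.max (`|Phi (OO n (gridfloor h s) w)| `^ (p / 2))%:E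
               (Order.max (`|OO n s w| `^ p)%:E
                 (\int[leb]_(u in `[0%R, T])
                    (Hnorm c0 varrho (gc n u w + Pn n (expA c0 u xi))
                       `^ (2 * p + 2 * p * vartheta))%:E))) <= m%:E)%E.
      have Dw := D0 w.
      have [l1 l2 l3 l4] := le_sum4 m1 m2 Dw.
      rewrite !ge_max !lee_fin l1 l2 l3/=.
      apply: (@le_trans _ _ (D w)%:E); last by rewrite lee_fin.
      apply: (@le_trans _ _ (\int[leb]_(u in `[0%R, T]) ((C5 * (1 + q1 w)) `^ (p * (1 +
        vartheta)))%:E)%E).
        apply: ge0_le_integralW => u; first by rewrite lee_fin powR_ge0.
        by rewrite /= in_itv/= => uT; rewrite lee_fin; exact: hC5.
      by rewrite integral_cst//= lebesgue_measure_itv/= lte_fin T0 -EFinB subr0 -EFinM mulrC.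
    have m0 : 0 <= m by rewrite /m addr_ge0// addr_ge0// addr_ge0.
    apply: (@le_trans _ _ ((expR A)%:E * m%:E)%E).
      apply: lee_pmul => //; first exact: expeR_ge0.
      by rewrite le_max lee01.
    rewrite -EFinM.
    (* The inequality x y <= x^2 + y^2 separates the exponential from the polynomial factor. *)
    apply: (@le_trans _ _ (expR (2 * A) + m ^+ 2)%:E).
      rewrite lee_fin (_ : 2 * A = A + A); last by ring.
      by rewrite expRD mulr_le_sqrD// expR_ge0.
    have h2A : ((expR (2 * A))%:E <= T^-1%:E * S w)%E.
      have -> : 2 * A = \sum_(i < N) glen T h i * (2 * p * phi (OO n (i%:R * h) w)).
        by rewrite /A mulr_sumr; apply: eq_bigr => i _; ring.
      have hj := jensen_exp T0 h0 (fun i => 2 * p * phi (OO n (i%:R * h) w)).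
      apply: (@le_trans _ _ (\sum_(i < N) glen T h i / T * expR (T * (2 * p * phi (OO n (i%:R *
        h) w))))%:E).
        by rewrite lee_fin.
      rewrite /S ge0_sume_distrr; last by move=> i _; rewrite mule_ge0// lee_fin glen_ge0.
      rewrite -sumEFin; apply: lee_sum => i _.
      rewrite muleA -EFinM (mulrC T^-1) EFinM; apply: lee_wpmul2l.
        by rewrite lee_fin mulr_ge0 ?invr_ge0 ?glen_ge0// ltW.
      have -> : T * (2 * p * phi (OO n (i%:R * h) w)) = kappa * phi (OO n (i%:R * h) w) by
        rewrite /kappa; ring.
      exact: hCX.
    (* At the grid time below [s] the power of [Phi] is absorbed by the exponential with the same
       [kappa]; [gind] selects the cell of [s]. *)
    have hPhi : ((`|Phi (OO n (gridfloor h s) w)| `^ p)%:E <=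
      \sum_(i < N) (gind h i s)%:E * (C2%:E * Q i w))%E.
      rewrite (step_value h0 (fun u => `|Phi (OO n u w)| `^ p) sT) -sumEFin.
      apply: lee_sum => i _; rewrite EFinM; apply: lee_wpmul2l; first by rewrite lee_fin gind_ge0.
      apply: (@le_trans _ _ (C2 * expR (kappa * phi (OO n (i%:R * h) w)))%:E);
        first by rewrite lee_fin; exact: hC2.
      by rewrite EFinM; apply: lee_wpmul2l; [rewrite lee_fin|exact: hCX].
    have hO : `|OO n s w| `^ p ^+ 2 <= C4 * (1 + q2 w ^+ j2).
      apply: le_trans (hC4 _ (q2_ge0 w)).
      rewrite powR_sqrC//.
      rewrite ge0_ler_powR ?nnegrE ?(ltW p0) ?sqr_ge0// ?mulr_ge0 ?addr_ge0 ?q2_ge0//; exact: hC3.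
    have hP2 : (`|Phi (OO n (gridfloor h s) w)| `^ (p / 2)) ^+ 2 = `|Phi (OO n (gridfloor h s)
      w)| `^ p.
      exact: powR_half_sqr.
    have hm2 : m ^+ 2 <= Rm w + 4 * `|Phi (OO n (gridfloor h s) w)| `^ p.
      by rewrite /m /Rm -hP2; apply: sqr_sum4_le hO (D2 w).
    rewrite EFinD /B -addeA; apply: leeD => //.
    apply: (@le_trans _ _ ((Rm w)%:E + (4 * `|Phi (OO n (gridfloor h s) w)| `^ p)%:E)%E);
      first by rewrite -EFinD lee_fin.
    apply: leeD => //; rewrite EFinM.
    have -> : (\sum_(i < N) (gind h i s)%:E * ((4 * C2)%:E * Q i w) = 4%:E * \sum_(i < N) (gind h
      i s)%:E * (C2%:E * Q i w))%E.
      rewrite ge0_sume_distrr; last by move=> i _; rewrite mule_ge0 ?lee_fin ?gind_ge0// mule_ge0.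
      by apply: eq_bigr => i _; rewrite EFin_muleCA.
    by apply: lee_wpmul2l.
  have g0 i : (0 <= (4 * C2)%:E * Q i w)%E by rewrite mule_ge0// lee_fin mulr_ge0.
  have mB : measurable_fun (`[0%R, T]%classic : set R) (fun=> B) by exact: measurable_cst.
  have mS : measurable_fun (`[0%R, T]%classic : set R) (fun s => \sum_(i < N) (gind h i s)%:E *
    ((4 * C2)%:E * Q i w))%E.
    apply: emeasurable_sum => i; apply: emeasurable_funM; last exact: measurable_cst.
    by apply/measurable_EFinP; exact: measurable_gind.
  have s0 (s : R) : (`[0%R, T]%classic : set R) s -> (0 <=
    \sum_(i < N) (gind h i s)%:E * ((4 * C2)%:E * Q i w))%E.
    by move=> _; apply: sume_ge0 => i _; rewrite mule_ge0// lee_fin gind_ge0.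
  rewrite (ge0_integralD leb (measurable_itv _) (fun s _ => B0) mB s0 mS).
  rewrite (int_gind_sum h T0 g0) integral_cst//= lebesgue_measure_itv/= lte_fin T0 -EFinB subr0.
  have -> : (\sum_(i < N) (glen T h i)%:E * ((4 * C2)%:E * Q i w) = (4 * C2)%:E * S w)%E.
    rewrite /S ge0_sume_distrr; last by move=> i _; rewrite mule_ge0// lee_fin glen_ge0.
    by apply: eq_bigr => i _; rewrite muleCA.
  have TS : (0 <= T^-1%:E * S w)%E by rewrite mule_ge0// lee_fin invr_ge0 ltW.
  rewrite /B /M ge0_muleDl ?lee_fin// muleAC -EFinM mulVf ?gt_eqF// mul1e.
  rewrite EFinD ge0_muleDl ?lee_fin ?mulr_ge0// mul1e -EFinM (mulrC (Rm w)).
  by rewrite addeAC.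
have mQ (i : 'I_N) : measurable_fun setT (Q i) by apply: measurable_funeM; exact:
  (Hexp n (ihT i)).1.
have mS : measurable_fun setT S.
  by apply: emeasurable_sum => i; apply: measurable_funeM; exact: mQ.
have mqj1 : measurable_fun setT (fun w => q1 w ^+ j1) by exact: measurable_funX.
have mqj2 : measurable_fun setT (fun w => q2 w ^+ j2) by exact: measurable_funX.
have mR : measurable_fun setT Rm.
  by apply: measurable_funM => //; do ?apply: measurable_funD => //; apply:
    measurable_funM => //; apply: measurable_funD.
have CC0 : 0 <= 1 + 4 * C2 by rewrite addr_ge0// mulr_ge0.
have IS : (\int[P]_w S w <= (T * (CX * C1))%:E)%E.
  rewrite /S ge0_integral_sum//; last 2 first.
  - by move=> i; apply: measurable_funeM; exact: mQ.
  - by move=> i w _; rewrite mule_ge0// lee_fin glen_ge0.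
  have -> : T * (CX * C1) = \sum_(i < N) glen T h i * (CX * C1) by rewrite -mulr_suml (sum_glen
    T0 h0).
  rewrite -sumEFin; apply: lee_sum => i _.
  have gi0 : (0 <= (glen T h i)%:E)%E by rewrite lee_fin glen_ge0.
  rewrite (ge0_integralZl P measurableT (mQ i) (fun w _ => Q0 i w) gi0) EFinM; apply:
    lee_wpmul2l => //.
  have [mE iE] := Hexp n (ihT i).
  rewrite (ge0_integralZl P measurableT mE (fun w _ => eQ0 i w)) ?lee_fin// EFinM.
  by apply: lee_wpmul2l; rewrite ?lee_fin.
have IR : (\int[P]_w (Rm w)%:E = KR%:E)%E.
  rewrite /Rm (integral_realZ P measurableT)//; last 2 first.
  - by do ?apply: measurable_funD => //; apply: measurable_funM => //; apply: measurable_funD.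
  - by move=> w; rewrite addr_ge0// ?addr_ge0// mulr_ge0// addr_ge0.
  rewrite (integral_realD P measurableT)//; last 4 first.
  - by do ?apply: measurable_funD => //; apply: measurable_funM => //; apply: measurable_funD.
  - by apply: measurable_funM => //; apply: measurable_funD.
  - by move=> w; rewrite addr_ge0// mulr_ge0// addr_ge0.
  - by move=> w; rewrite mulr_ge0// addr_ge0.
  rewrite (integral_realD P measurableT)//; last 2 first.
  - by apply: measurable_funM => //; apply: measurable_funD.
  - by move=> w; rewrite mulr_ge0// addr_ge0.
  rewrite (int_affine_pow mq2 q2_ge0 q2_fin C40) (int_affine_pow mq1 q1_ge0 q1_fin TC60).
  by rewrite integral_cst//= probability_setT mule1.
rewrite /M ge0_integralD//; last 4 first.
- by move=> w _; rewrite mule_ge0// lee_fin.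
- exact: measurable_funeM.
- by move=> w _; rewrite lee_fin mulr_ge0// ltW.
- by apply/measurable_EFinP; apply: measurable_funM.
rewrite (ge0_integralZl P measurableT mS (fun w _ => S0 w)) ?lee_fin//.
rewrite (integral_realZ P measurableT mR Rm0 (ltW T0)) IR (EFinD ((1 + 4 * C2) * _)); apply: leeD.
  by rewrite (EFinM (1 + 4 * C2)); apply: lee_wpmul2l; rewrite ?lee_fin.
by rewrite EFinM.
Qed.
End moment_bounds.

(** * Properties of the constructed processes *)

Section convolution_properties.
Context {R : realType} {d : measure_display} {Omega : measurableType d}.
Variables (P : probability Omega R) (T : R) (W : R -> H01 R -> Omega -> R).
Hypotheses (Ww : cylindrical_wiener P T W) (T0 : 0 < T).
Variables (G : set Omega).
Hypotheses (mG : measurable G) (PG : P (~` G) = 0%E) (Ggood : G `<=` good_path T W).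
Variables (c0 varrho : R).
Hypotheses (c00 : 0 < c0) (vr0 : 0 < varrho) (vr1 : varrho < 4^-1).
Variables (q : Omega -> R).
Hypothesis hq : forall w k t, (0 < k)%N -> 0 <= t <= T ->
  wt c0 varrho k * ou_mode T W G (lam c0 k) k t w ^+ 2 <= q w.
Local Notation Y k t w := (ou_mode T W G (lam c0 k) k t w).

Let mY k t : (0 < k)%N -> 0 <= t -> measurable_fun setT (ou_mode T W G (lam c0 k) k t).
Proof. by move=> k0 t0; apply: (measurable_ou_mode Ww (ltW T0) mG Ggood k _ t0);
  rewrite ltW// lam_gt0. Qed.

Let wY w t : 0 <= t <= T -> wbnd c0 varrho (q w) (fun k => Y k t w).
Proof. by move=> tT k k0; exact: hq. Qed.

Lemma limconv_rv t : 0 <= t <= T -> rv_Hr c0 varrho (limconv T W c0 G t).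
Proof.
move=> tT; have t0 : 0 <= t by case/andP: tT.
apply: (rv_Hr_lim c00 vr0 (z := fun k w => Y k t w)) => [k k0|w]; first exact: mY.
exact: (wbnd_lty c00 vr1 (wY w tT)).
Qed.

Lemma limconv_path w : continuous_path (Hnorm c0 varrho) T (limconv T W c0 G ^~ w).
Proof.
apply: (path_continuous c00 vr0 vr1 T0 (y := fun k t => Y k t w) (C := q w)).
  by move=> k; apply: continuous_ou_mode => //; exact: ltW.
exact: wY.
Qed.

Lemma galconv_rv n t : 0 <= t -> rv_Pn n (galconv T W c0 G n t).
Proof.
by move=> t0; apply: (rv_Pn_sum (z := fun k w => Y k t w)) => k /andP[k0 _]; exact: mY.
Qed.

Lemma galconv_path n w : continuous_path Num.norm T (galconv T W c0 G n ^~ w).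
Proof.
apply: (fin_path_continuous (y := fun k t => Y k t w)) => k.
by apply: continuous_ou_mode => //; exact: ltW.
Qed.

Lemma shiftconv_rv xi eta n t : 0 <= eta -> 0 <= t -> rv_Pn n (shiftconv T W c0 G xi eta n t).
Proof.
move=> eta0 t0; apply: (rv_Pn_sum (z := fun k w => shiftcoef T W c0 G xi eta k t w)) => k
  /andP[k0 _].
apply: measurable_funD; last exact: measurable_cst.
by apply: (measurable_ou_mode Ww (ltW T0) mG Ggood k _ t0); rewrite addr_ge0// ltW// lam_gt0.
Qed.

Lemma shiftconv_path xi eta n w : continuous_path Num.norm T (shiftconv T W c0 G xi eta n ^~ w).
Proof.
apply: (fin_path_continuous (y := fun k t => shiftcoef T W c0 G xi eta k t w)) => k t.
apply: cvgD; first by apply: continuous_ou_mode => //; exact: ltW.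
apply: cvgM; last exact: cvg_cst.
apply: (@continuous_comp _ _ _ (fun s => - ((lam c0 k + eta) * s)) expR); last exact:
  continuous_expR.
by apply: cvgN; apply: cvgM; [exact: cvg_cst|exact: cvg_id].
Qed.

Lemma limconv_stoch_integral t : 0 <= t <= T ->
  is_stoch_integral P W t (fun s v => expA c0 (t - s) v) (limconv T W c0 G t).
Proof.
move=> tT; apply: (stoch_integral_diag Ww T0 mG PG Ggood c00 tT (sigma :=
  fun=> 1)) => [k|s v k /andP[s0 st] k0|w k k0|].
- by rewrite expr1n.
- by rewrite coef_expA0 ?subr_ge0// mul1r /expker; congr (expR _ * _); ring.
- by rewrite mul1r coef_hsum//; exact: (wbnd_lty0 c00 vr0 vr1 (wY w tT)).
- exact: (rv_Hr_borel c00 vr0 (limconv_rv tT)).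
Qed.

Lemma galconv_stoch_integral n t : 0 <= t <= T ->
  is_stoch_integral P W t (fun s v => Pn n (expA c0 (t - s) v)) (galconv T W c0 G n t).
Proof.
move=> tT; have t0 : 0 <= t by case/andP: tT.
apply: (stoch_integral_diag Ww T0 mG PG Ggood c00 tT (sigma := fun k => (k <=
  n)%N%:R)) => [k|s v k /andP[s0 st] k0|w k k0|].
- by case: (k <= n)%N; rewrite /= ?expr1n ?expr0n.
- rewrite coef_Pn// coef_expA0 ?subr_ge0//; case: (k <= n)%N; rewrite ?mul0r// mul1r /expker.
  by congr (expR _ * _); ring.
- by rewrite coef_galconv//; case: (k <= n)%N; rewrite ?mul0r ?mul1r.
- exact: (galconv_rv n t0).2.
Qed.

(** Each coordinate agrees almost surely by [stoch_integral_unique], and countably many coordinates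
    determine the element. *)
Lemma galconv_unique n t (Z : Omega -> H01 R) : 0 <= t <= T -> rv_Pn n Z ->
  is_stoch_integral P W t (fun s v => Pn n (expA c0 (t - s) v)) Z ->
  {ae P, forall w, Z w = galconv T W c0 G n t w}.
Proof.
move=> tT [rZ _] ZI.
have h j : {ae P, forall w, (0 < j)%N -> coef j (Z w) = coef j (galconv T W c0 G n t w)}.
  case: j => [|j]; first by apply: nearW.
  have mPsi k : (0 < k)%N -> measurable_fun (`[0%R, t]%classic : set R)
      (fun s => coef j.+1 (Pn n (expA c0 (t - s) (eigf k)))).
    move=> k0; apply: (@eq_measurable_fun _ _ _ _ _ (fun s : R =>
      if (j.+1 <= n)%N then expR (- (lam c0 j.+1 * (t - s))) * coef j.+1 (eigf k) else 0)).
      move=> s; rewrite inE/= in_itv/= => /andP[s0 st].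
      by rewrite coef_Pn// coef_expA0// subr_ge0.
    case: (j.+1 <= n)%N; last exact: measurable_cst.
    apply: measurable_funM; last exact: measurable_cst.
    apply: measurable_funTS; apply: continuous_measurable_fun => s.
    apply: (@continuous_comp _ _ _ (fun s => - (lam c0 j.+1 * (t - s))) expR); last exact:
      continuous_expR.
    apply: cvgN; apply: cvgM; first exact: cvg_cst.
    by apply: cvgB; [exact: cvg_cst|exact: cvg_id].
  have := stoch_integral_unique Ww tT (ltn0Sn j) mPsi ZI (galconv_stoch_integral n tT).
  by apply: filterS => w ->.
by have := ae_foralln h; apply: filterS => w hw; apply: coef_inj.
Qed.

End convolution_properties.

(** * Choice of the constants and of the set of full measure *)

Theorem proposition5p6
  (R : realType)
  (T c0 gamma theta vartheta alpha varphi rho varrho chi : R)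
  (T_gt0 : 0 < T) (c0_gt0 : 0 < c0) (gamma_gt0 : 0 < gamma)
  (theta_gt0 : 0 < theta) (vartheta_gt0 : 0 < vartheta)
  (alpha_range : 0 <= alpha <= 2^-1)
  (varphi_range : 0 <= varphi < 1)
  (rho_range : 0 <= rho < 4^-1)
  (varrho_range : rho < varrho < 4^-1)
  (chi_range : 0 < chi <= (varrho - rho) / (1 + vartheta))
  (Hneg : completeNormedModType R) (iota : {linear H01 R -> Hneg})
  (Hneg_completion : is_completion c0 alpha iota)
  (xi : H01 R) (xi_dom : Hr c0 2^-1 xi)
  (F : H01 R -> Hneg) (F_continuous : continuous_Hr c0 varrho F)
  (h : nat -> R) (h_range : forall n, (0 < n)%N -> 0 < h n <= T)
  (h_limsup : limn_esup (fun m => (h m)%:E) = 0%E)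
  (phi Phi : H01 R -> R)
  (phiE : forall u, Hr c0 1 u ->
    phi u = gamma + gamma * sup [set `|crep u x| ^+ 2 | x in `]0%R, 1%R[])
  (PhiE : forall u, Hr c0 1 u ->
    Phi u = gamma + gamma * sup [set `|crep u x| `^ gamma | x in `]0%R, 1%R[])
  (F_coercive : forall n v w, (0 < n)%N ->
    range (Pn n) v -> range (Pn n) w ->
    inner v (cext iota (Pn n) (F (v + w)))
      <= phi w * `|v| ^+ 2 + varphi * Hnorm c0 2^-1 v ^+ 2 + Phi w)
  (F_lipschitz : forall n v w, (0 < n)%N ->
    range (Pn n) v -> range (Pn n) w ->
    `|F v - F w|
      <= theta * (1 + Hnorm c0 rho v `^ vartheta + Hnorm c0 rho w `^ vartheta)
         * Hnorm c0 rho (v - w))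
  (d : measure_display) (Omega : measurableType d) (P : probability Omega R)
  (W : R -> H01 R -> Omega -> R) (W_wiener : cylindrical_wiener P T W)
  (X O : nat -> R -> Omega -> H01 R)
  (X_process : forall n t, (0 < n)%N -> 0 <= t <= T -> rv_Pn n (X n t))
  (O_process : forall n t, (0 < n)%N -> 0 <= t <= T -> rv_Pn n (O n t))
  (O_convolution : forall n t, (0 < n)%N -> 0 <= t <= T ->
    is_stoch_integral P W t (fun s v => Pn n (expA c0 (t - s) v)) (O n t))
  (X_scheme : forall n t, (0 < n)%N -> 0 <= t <= T ->
    prob_one P [set w | X n t w =
      scheme c0 varrho chi iota F xi n (h n) (X n ^~ w) (O n ^~ w) t])
  (p : R) (p_gt0 : 0 < p) :
  exists (eta : R) (O' : R -> Omega -> H01 R)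
         (Otilde OO : nat -> R -> Omega -> H01 R),
    0 <= eta /\
    (forall t, 0 <= t <= T -> rv_Hr c0 varrho (O' t)) /\
    (forall w, continuous_path (Hnorm c0 varrho) T (O' ^~ w)) /\
    (forall n, (0 < n)%N ->
      (forall t, 0 <= t <= T -> rv_Pn n (Otilde n t) /\ rv_Pn n (OO n t)) /\
      (forall w, continuous_path Num.norm T (Otilde n ^~ w) /\
                 continuous_path Num.norm T (OO n ^~ w))) /\
    (* (i) *)
    (forall t, 0 <= t <= T ->
      is_stoch_integral P W t (fun s v => expA c0 (t - s) v) (O' t)) /\
    (* (ii) *)
    (forall n t, (0 < n)%N -> 0 <= t <= T ->
      is_stoch_integral P W t (fun s v => Pn n (expA c0 (t - s) v))
        (Otilde n t)) /\
    (* (iii) *)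
    (forall n t w, (0 < n)%N -> 0 <= t <= T ->
      OO n t w = Otilde n t w + Pn n (expA c0 t xi)
        - Pint n t (fun s => expAsub c0 eta (t - s)
            (eta *: (Otilde n s w + Pn n (expA c0 s xi))))) /\
    (* (iv) *)
    prob_one P [set w | limn_esup (fun n => ereal_sup
      [set (Hnorm c0 varrho ((O' s w + expA c0 s xi)
              - (Otilde n s w + Pn n (expA c0 s xi))))%:E
       | s in `[0%R, T]]) = 0%E] /\
    (* (v) *)
    (forall n t, (0 < n)%N -> 0 <= t <= T ->
      prob_one P [set w | X n t w =
        scheme c0 varrho chi iota F xi n (h n) (X n ^~ w) (Otilde n ^~ w) t]) /\
    (* (vi) *)
    (ereal_sup [set
       (\int[P]_w \int[lebesgue_measure]_(s in `[0%R, T])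
          (expeR (\int[lebesgue_measure]_(u in `[s, T])
                    (p * phi (OO n (gridfloor (h n) u) w))%:E)
           * Order.max 1
               (Order.max (`|Phi (OO n (gridfloor (h n) s) w)| `^ (p / 2))%:E
               (Order.max (`|OO n s w| `^ p)%:E
                 (\int[lebesgue_measure]_(u in `[0%R, T])
                    (Hnorm c0 varrho (Otilde n u w + Pn n (expA c0 u xi))
                       `^ (2 * p + 2 * p * vartheta))%:E)))))%E
       | n in [set n : nat | (0 < n)%N]]
     + ereal_sup [set (\int[P]_w (`|OO ns.1 ns.2 w| `^ p)%:E)%E
         | ns in [set n : nat | (0 < n)%N] `*` `[0%R, T]]
     < +oo)%E.

Proof.
have [rho0 _] := andP rho_range; have [rhov vr1] := andP varrho_range.
have vr0 : 0 < varrho by exact: le_lt_trans rhov.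
(* The same [kappa] as in the moment bounds; the outer 2 below separates the noise from the initial
   value. *)
pose kappa := 2 * T * p.
have c_gt0 : 0 < 2 * (kappa * gamma) by rewrite mulr_gt0// mulr_gt0// mulr_gt0// mulr_gt0.
have [eta [j0 [C1 [eta0 j00 C10 Hexp]]]] := exp_moment W_wiener T_gt0 c0_gt0 c_gt0.
have [G0 [mG0 PG0 G0good]] := good_path_exists W_wiener.
have [J1 hJ1] : exists J : nat, 2 * (p * (1 + vartheta)) <= J%:R.
  by exists (Num.bound (2 * (p * (1 + vartheta)))); rewrite ltW// archi_boundP// mulr_ge0// mulr_ge0 ?ltW// addr_gt0.
have [J2 hJ2] : exists J : nat, p <= J%:R.
  by exists (Num.bound p); rewrite ltW// archi_boundP// ltW.
(* Two successive shrinkings: on [G1] the modes of rate [lam c0 k] are bounded by [q1], and on [G]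
   inside [G1] those of the raised rates by [q2]; the first bound persists on the smaller set. *)
have [j1 [G1 [q1 [jJ1 [mG1 PG1 G10] [mq1 q1p q1_fin] hq1]]]] :=
  regular_set W_wiener T_gt0 c0_gt0 vr0 vr1 J1 mG0 PG0 G0good (fun k _ => lexx (lam c0 k)).
have lm k : (0 < k)%N -> lam c0 k <= lam c0 k + eta by move=> _; rewrite lerDl ltW.
have [j2 [G [q2 [jJ2 [mG PG G21] [mq2 q2p q2_fin] hq2]]]] :=
  regular_set W_wiener T_gt0 c0_gt0 vr0 vr1 J2 mG1 PG1 (subset_trans G10 G0good) lm.
have Ggood : G `<=` good_path T W by apply: subset_trans G0good; exact: subset_trans G10.
have hq1G w k t : (0 < k)%N -> 0 <= t <= T -> wt c0 varrho k * ou_mode T W G (lam c0 k) k t w ^+ 2 <= q1 w.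
  by move=> k0 tT; exact: hq1.
have hq2G w k t : (0 < k)%N -> 0 <= t <= T -> wt c0 varrho k * ou_mode T W G (lam c0 k + eta) k t w ^+ 2 <= q2 w.
  by move=> k0 tT; exact: hq2.
have hj1 : 2 * (p * (1 + vartheta)) <= j1%:R by apply: le_trans hJ1 _; rewrite ler_nat.
have hj2 : p <= j2%:R by apply: le_trans hJ2 _; rewrite ler_nat.
have [K1 hK1] := exponential_moment_bound T_gt0 c0_gt0 vr0 vr1 gamma_gt0 vartheta_gt0 p_gt0 phiE PhiE
  xi_dom eta0 j00 (Hexp G mG PG Ggood) mq1 mq2 q1_fin q2_fin hj1 hj2 hq1G hq2G.
have [K2 hK2] := norm_moment_bound (P := P) T_gt0 c0_gt0 vr0 vr1 p_gt0 xi_dom eta0 mq2 q2_fin hj2 hq2G.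
have eta_ge0 := ltW eta0.
exists eta, (limconv T W c0 G), (galconv T W c0 G), (shiftconv T W c0 G xi eta).
split; first exact: eta_ge0.
split; first by move=> t tT; exact: (limconv_rv W_wiener T_gt0 mG Ggood c0_gt0 vr0 vr1 hq1G tT).
split; first by move=> w; exact: (limconv_path T_gt0 Ggood c0_gt0 vr0 vr1 hq1G w).
split.
  move=> n n0; split=> [t /andP[t0 _]|w].
    split; first exact: (galconv_rv W_wiener T_gt0 mG Ggood c0_gt0 n t0).
    exact: (shiftconv_rv W_wiener T_gt0 mG Ggood c0_gt0 xi n eta_ge0 t0).
  by split; [exact: galconv_path|exact: shiftconv_path].
split; first by move=> t tT; exact: (limconv_stoch_integral W_wiener T_gt0 mG PG Ggood c0_gt0 vr0 vr1 hq1G tT).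
split; first by move=> n t n0 tT; exact: (galconv_stoch_integral W_wiener T_gt0 mG PG Ggood c0_gt0 n tT).
split; first by move=> n t w n0 /andP[t0 _]; exact: (shiftconvE T_gt0 c0_gt0 Ggood xi n w eta_ge0 t0).
split.
  (* The convergence holds for every [w], since the modes vanish off [G]; the event is the whole
     space. *)
  have -> : [set w | limn_esup (fun n => ereal_sup
      [set (Hnorm c0 varrho ((limconv T W c0 G s w + expA c0 s xi)
              - (galconv T W c0 G n s w + Pn n (expA c0 s xi))))%:E
       | s in `[0%R, T]]) = 0%E] = setT.
    by apply/seteqP; split=> // w _; exact: (limconv_esup T_gt0 c0_gt0 vr0 vr1 xi_dom hq1G w).
  by split; [exact: measurableT|exact: probability_setT].
split.
  move=> n t n0 tT; have h0 : 0 < h n by have /andP[] := h_range n n0.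
  apply: (scheme_replace c0_gt0 Hneg_completion.2 F_continuous h0 tT (O := O n)) => [u uT|u uT|u uT|].
  - exact: X_process.
  - by case/andP: uT => u0 _; exact: (galconv_rv W_wiener T_gt0 mG Ggood c0_gt0 n u0).
  - apply: (galconv_unique W_wiener T_gt0 mG PG Ggood c0_gt0 uT); first exact: O_process.
    exact: O_convolution.
  - exact: X_scheme.
apply: (@le_lt_trans _ _ (K1%:E + K2%:E)%E); last exact: ltry.
apply: leeD.
  by apply: ge_ereal_sup => _ [n /= n0 <-]; apply: hK1; have /andP[] := h_range n n0.
apply: ge_ereal_sup => _ [[n s] [n0 sT] <-]; apply: hK2.
by move: sT; rewrite /= in_itv.
Qed.
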